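(* Let $0<\alpha<1$, $0<\varepsilon<1$, $\epsilon=\varepsilon$, and $q\in\{1,2\}$. Consider the errors-in-variables model of the context, set $\tau=n^{-1/2}\Phi^{-1}(1-\alpha/(2p))$, $\lambda_u=1/4$, $\lambda_t=1/\{4H_n\}$, let $\hat\beta$ be the self-normalized conic estimator with these parameters, and let $\hat\beta_{\widehat T}$ be its thresholded version. Suppose that Conditions A and B hold, that $$\kappa_q(s,3)\,s^{1/q}\ \ge\ 8s\Big\{(1+\tau)b_\epsilon+\tau h_\epsilon+C'(1+m_2^{1/2})\sqrt{\log(2p^2/\varepsilon)/n}\Big\}$$ where $C'>0$ is a (suitable) constant that depends only on $\sigma_w$ and $\sigma_\xi$, that the probability that the design matrix $X$ belongs to $$\Omega_X:=\Big\{X:\ \kappa_q(s,3)\ge c_1\,s^{-1/q},\ \max_{1\le j\le p}\tfrac1n\sum_{i=1}^nx_{ij}^4\le C_1\Big\}$$ tends to $1$ as $n\to\infty$ (for $X$ deterministic as in Condition A(i), this means $X\in\Omega_X$ for all large $n$), and that $b_\epsilon\le C_1\sqrt{\log(2p/\epsilon)/n}$, where $c_1,C_1>0$ are constants not depending on $n$. Suppose moreover that $s^{1/q}\sqrt{\log(2pn/\alpha)/n}=o(1)$ and that there exist constants $0<c_2<C_2<\infty$ such that, for any $1\le j\le p$, $$c_2(1+\|\beta_0\|_2)^2\le\frac1n\sum_{i=1}^n\mathrm E\big[\{z_{ij}(\xi_i-w_i^T\beta_0)+\Gamma_{jj}\beta_{0j}\}^2\big]\le C_2(1+\|\beta_0\|_2)^2.$$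 Then there are constants $C>0$ and $c'\ge1$ such that, for $n$ sufficiently large, with probability at least $1-\alpha-11\varepsilon-o(1)$, $$\|\hat\beta_{\widehat T}\|_0\le Cs\qquad\text{and}\qquad\|\hat\beta_{\widehat T}-\beta_0\|_q\le C(1+\|\beta_0\|_2)\,s^{1/q}\sqrt{\frac{\log(c'p/\alpha)}{n}}.$$
   Context: Model. For $i=1,\dots,n$: $y_i=x_i^T\beta_0+\xi_i$ and $z_i=x_i+w_i$, where $y_i\in\mathbb R$ and $z_i\in\mathbb R^p$ are observed, $x_i\in\mathbb R^p$ is not observed, $\beta_0\in\mathbb R^p$ is unknown, and $(y_i,z_i)$ are independent across $i$. $\Gamma=\frac1n\sum_{i=1}^n\mathrm E[w_iw_i^T]$ is diagonal. Asymptotic convention: $p$, $s\ge1$ and all model quantities may depend on $n$, and results are stated as $n\to\infty$ with $\varepsilon$ a fixed number; ''constants'' do not depend on $n,p,s,\beta_0$. Notation. $\|\cdot\|_q$ is the $\ell_q$-norm and $\|\cdot\|_0$ the number of non-zero components of a vector; for a matrix $\|A\|_\infty=\max_{i,j}|a_{ij}|$; $A_{j\cdot}$ is the $j$-th row of $A$; $\theta_J$ is $\theta$ with the components outside $J$ set to zero; $\Phi$ is the standard normal c.d.f. A centered random variable $\zeta$ is zero-mean subgaussian with variance parameter $\sigma^2$ if $\mathrm E[\exp(t\zeta)]\le\exp(t^2\sigma^2/2)$ for all $t\in\mathbb R$; a random vector $w$ is zero-mean subgaussian with variance parameter $\sigma^2$ if every $v^Tw$ with $\|v\|_2=1$ is.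 Estimator of $\Gamma$. $\hat\Gamma$ is a given (random) estimator of $\Gamma$ and $b_\epsilon$ is a number such that, for any $n$, $\mathrm P(\|\hat\Gamma-\Gamma\|_\infty>b_\epsilon)\le\epsilon$. Self-normalized conic estimator. For positive $\lambda_t,\lambda_u,\tau$, $(\hat\beta,\hat t,\hat u)$ is a solution of: minimize $\|\beta\|_1+\lambda_t\|t\|_\infty+\lambda_u\|u\|_\infty$ over $\beta,t,u\in\mathbb R^p$ subject to, for all $j\le p$, $$\Big|\tfrac1n\sum_{i=1}^nz_{ij}(y_i-z_i^T\beta)+\hat\Gamma_{jj}\beta_j\Big|\le\tau t_j+(1+\tau)b_\epsilon u_j,\qquad \Big\{\tfrac1n\sum_{i=1}^n\{z_{ij}(y_i-z_i^T\beta)+\hat\Gamma_{jj}\beta_j\}^2\Big\}^{1/2}\le t_j,\qquad|\beta_j|\le u_j.$$ Thresholded estimator. $\hat\beta_{\widehat T}$ is the restriction of $\hat\beta$ to $$\widehat T=\Big\{j\in\{1,\dots,p\}:\ |\hat\beta_j|>\tau\,\frac{\big\{\frac1n\sum_{i=1}^n\{z_{ij}(y_i-z_i^T\hat\beta)+\hat\Gamma_{jj}\hat\beta_j\}^2\big\}^{1/2}}{\frac1n\sum_{i=1}^nz_{ij}^2}\Big\}.$$ Further quantities. $m_2=\max_{1\le j\le p}\frac1n\sum_{i=1}^nx_{ij}^2$. $H_n=\max_{1\le j\le p}\big\|\frac1n\sum_{i=1}^n(z_{ij}z_i^T-\hat\Gamma_{j\cdot})^T(z_{ij}z_i^T-\hat\Gamma_{j\cdot})\big\|_\infty^{1/2}$,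 and $h_\epsilon$ is its $(1-\epsilon)$-quantile, so $\mathrm P(H_n>h_\epsilon)\le\epsilon$. With $\Psi=\frac1nX^TX$ and $C_J(u)=\{\Delta\in\mathbb R^p:\|\Delta_{J^c}\|_1\le u\|\Delta_J\|_1\}$ for $J\subseteq\{1,\dots,p\}$, $u\ge0$, the $\ell_q$-sensitivity is $$\kappa_q(s,u)=\min_{J:|J|\le s}\Big(\min_{\Delta\in C_J(u):\|\Delta\|_q=1}\|\Psi\Delta\|_\infty\Big).$$ Condition A. (i) The $n\times p$ matrix $X=[x_1;\dots;x_n]^T$ is deterministic and $\|\beta_0\|_0\le s$. (ii) $\xi_1,\dots,\xi_n$ are independent zero-mean subgaussian with variance parameter $\sigma_\xi^2\le C_0$. (iii) $w_1,\dots,w_n$ are independent zero-mean subgaussian random vectors with variance parameter $\sigma_w^2\le C_0$, with $\mathrm E[w_{ij}w_{ik}]=0$ for all $1\le j<k\le p$ and all $i$; and $(w_i)_{i=1}^n$ is independent of $(\xi_i)_{i=1}^n$. Here $C_0$ is a positive constant. Condition B. Let $U_{ij}=z_{ij}(\xi_i-w_i^T\beta_0)+\mathrm E[w_{ij}^2]\beta_{0j}$, $\mathcal U_{jk}=\{\frac1n\sum_{i=1}^n\mathrm E[|U_{ij}|^k]\}^{1/k}$, $\Delta_j=|\beta_{0j}|\max_{1\le i\le n}|\mathrm E[w_{ij}^2]-\Gamma_{jj}|$. (i) $\hat\Gamma$ is diagonal and $b_\epsilon$ satisfies $\mathrm P(\|\hat\Gamma-\Gamma\|_\infty>b_\epsilon)\le\epsilon$.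 Moreover, for some sequence $\ell_n\ge2$ tending to infinity: (ii) $\max_{1\le j\le p}\{\mathcal U_{j3}/\mathcal U_{j2}\}\,\Phi^{-1}(1-\alpha/(2pn))\le n^{1/6}/\ell_n$; (iii) $\max_{j:\Delta_j>0}\{n^{-1/6}(\Delta_j/\mathcal U_{j2})\}\,\Phi^{-1}(1-\alpha/(2pn))\le1/\ell_n$, and $n\ge4\log(2pn/\alpha)$. (The ratios presuppose $\mathcal U_{j2}>0$, and $\lambda_t=1/\{4H_n\}$ presupposes $H_n>0$.) *)

(* Defs.v *)
From HB Require Import structures.
From mathcomp Require Export all_boot all_order all_algebra.
From mathcomp Require Export all_classical all_reals all_analysis.
Export numFieldNormedType.Exports.

Set Implicit Arguments.
Unset Strict Implicit.
Unset Printing Implicit Defensive.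

Import Order.TTheory GRing.Theory Num.Theory.

Local Open Scope classical_set_scope.
Local Open Scope ring_scope.

(* Throughout, [`|A|] on a matrix or a vector is the MathComp-Analysis matrix
   norm, i.e. the maximal absolute value of the entries.  Maxima over indices are
   [\big[Num.max/0]]: the entries are always nonnegative. *)

Section vectors.
Context {R : realType}.

Definition avg (n : nat) (F : 'I_n -> R) : R := n%:R^-1 * \sum_(i < n) F i.

Definition lnorm (q : nat) (p : nat) (v : 'cV[R]_p) : R :=
  (\sum_(j < p) `|v j 0| ^+ q) `^ q%:R^-1.

Definition supp (p : nat) (v : 'cV[R]_p) : {set 'I_p} := [set j | v j 0 != 0].

Definition l0norm (p : nat) (v : 'cV[R]_p) : nat := #|supp v|.

Definition restr (p : nat) (J : {set 'I_p}) (v : 'cV[R]_p) : 'cV[R]_p :=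
  \col_j (if j \in J then v j 0 else 0).

Definition gram (n p : nat) (X : 'M[R]_(n, p)) : 'M[R]_p :=
  n%:R^-1 *: (X^T *m X).

Definition cone (p : nat) (J : {set 'I_p}) (u : R) : set 'cV[R]_p :=
  [set D | lnorm 1 (restr (~: J) D) <= u * lnorm 1 (restr J D)].

(* The two nested minima are taken as one infimum over all pairs (J, D).  The
   inner minimum over an empty set (as for J = set0, where the cone is reduced
   to 0) is +oo and must not contribute, whereas [inf set0 = 0]. *)
Definition kappa (q s : nat) (u : R) (n p : nat) (X : 'M[R]_(n, p)) : R :=
  inf [set `|gram X *m D| | D in
        [set D : 'cV[R]_p | lnorm q D = 1 /\
           exists J : {set 'I_p}, (#|J| <= s)%N /\ cone J u D]].

Definition Omega_X (q s : nat) (c1 C1 : R) (n p : nat) : set 'M[R]_(n, p) :=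
  [set X | c1 * s%:R `^ (- q%:R^-1) <= kappa q s 3 X /\
           \big[Num.max/0]_(j < p) avg (fun i : 'I_n => X i j ^+ 4) <= C1].

(* Used both for the standard normal c.d.f., which is continuous and strictly
   increasing, so that [Phi_inv] inverts it on ]0, 1[, and for the quantile of
   [Hn]. *)
Definition quantile (F : R -> \bar R) (u : R) : R :=
  inf [set x | (u%:E <= F x)%E].

Definition Phi (x : R) : \bar R := normal_prob (0 : R) 1 `]-oo, x].

Definition Phi_inv : R -> R := quantile Phi.

Definition conic_residual (n p : nat) (y : 'cV[R]_n) (Z : 'M[R]_(n, p))
    (Gh : 'M[R]_p) (beta : 'cV[R]_p) (i : 'I_n) (j : 'I_p) : R :=
  Z i j * (y i 0 - (row i Z *m beta) 0 0) + Gh j j * beta j 0.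

Definition conic_feasible (n p : nat) (y : 'cV[R]_n) (Z : 'M[R]_(n, p))
    (Gh : 'M[R]_p) (tau b : R) (beta t u : 'cV[R]_p) : Prop :=
  forall j : 'I_p,
  [/\ `|avg (fun i => Z i j * (y i 0 - (row i Z *m beta) 0 0))
          + Gh j j * beta j 0| <= tau * t j 0 + (1 + tau) * b * u j 0,
      Num.sqrt (avg (fun i => conic_residual y Z Gh beta i j ^+ 2)) <= t j 0
    & `|beta j 0| <= u j 0].

Definition conic_objective (p : nat) (lambda_t lambda_u : R)
    (beta t u : 'cV[R]_p) : R :=
  lnorm 1 beta + lambda_t * `|t| + lambda_u * `|u|.

Definition conic_solution (n p : nat) (y : 'cV[R]_n) (Z : 'M[R]_(n, p))
    (Gh : 'M[R]_p) (tau b lambda_t lambda_u : R) (beta t u : 'cV[R]_p) : Prop :=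
  conic_feasible y Z Gh tau b beta t u /\
  forall beta' t' u' : 'cV[R]_p, conic_feasible y Z Gh tau b beta' t' u' ->
    conic_objective lambda_t lambda_u beta t u <=
    conic_objective lambda_t lambda_u beta' t' u'.

(* A column j with z_ij = 0 for all i has threshold 0 here (x / 0 = 0). *)
Definition That (n p : nat) (y : 'cV[R]_n) (Z : 'M[R]_(n, p)) (Gh : 'M[R]_p)
    (tau : R) (beta : 'cV[R]_p) : {set 'I_p} :=
  [set j | tau * (Num.sqrt (avg (fun i => conic_residual y Z Gh beta i j ^+ 2))
                  / avg (fun i => Z i j ^+ 2)) < `|beta j 0|].

Definition thresholded (n p : nat) (y : 'cV[R]_n) (Z : 'M[R]_(n, p))
    (Gh : 'M[R]_p) (tau : R) (beta : 'cV[R]_p) : 'cV[R]_p :=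
  restr (That y Z Gh tau beta) beta.

(* [(_)^T *m _] is the p x p outer product of a row vector with itself. *)
Definition Hstat (n p : nat) (Z : 'M[R]_(n, p)) (Gh : 'M[R]_p) : R :=
  \big[Num.max/0]_(j < p)
    Num.sqrt `|n%:R^-1 *: \sum_(i < n)
                 ((Z i j *: row i Z - row j Gh)^T
                    *m (Z i j *: row i Z - row j Gh))|.

Definition tau (n p : nat) (alpha : R) : R :=
  (Num.sqrt n%:R)^-1 * Phi_inv (1 - alpha / (2 * p%:R)).

End vectors.

Section independence.
Context {d : measure_display} {T : measurableType d} {R : realType}.

Definition sigma_gen (I : Type) (Y : I -> T -> R) : set (set T) :=
  <<s \bigcup_i preimage_set_system setT (Y i) measurable >>.

Definition independent (P : probability T R) (I : finType)
    (F : I -> set (set T)) : Prop :=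
  forall (J : {set I}) (E : I -> set T), (forall i, i \in J -> F i (E i)) ->
    P (\bigcap_(i in [set` J]) E i) = (\prod_(i in J) fine (P (E i)))%:E.

(* The variance parameter is sigma ^+ 2. *)
Definition subgaussian (P : probability T R) (sigma : R) (Y : T -> R) : Prop :=
  ('E_P[Y] = 0)%E /\
  forall t : R, ('M_P Y t <= (expR (t ^+ 2 * sigma ^+ 2 / 2))%:E)%E.

Definition subgaussian_vec (P : probability T R) (sigma : R) (p : nat)
    (W : 'I_p -> T -> R) : Prop :=
  forall v : 'cV[R]_p, lnorm 2 v = 1 ->
    subgaussian P sigma (fun om => \sum_(j < p) v j 0 * W j om).

End independence.

(* One sample size of the errors-in-variables model.  The observations are
   determined by the fields (see [y_at] and [z_at] below). *)
Record eiv_model (R : realType) (n p : nat) := EivModel {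
  disp : measure_display ;
  sample : measurableType disp ;
  Pr : probability sample R ;
  design : 'M[R]_(n, p) ;
  beta0 : 'cV[R]_p ;
  xi : 'I_n -> {RV Pr >-> R} ;
  w : 'I_n -> 'I_p -> {RV Pr >-> R} ;
  Gammahat : 'I_p -> 'I_p -> {RV Pr >-> R}
}.

Section model.
Context {R : realType} {n p : nat} (M : eiv_model R n p).

Definition Ex (Y : sample M -> R) : R := fine ('E_(Pr M)[Y])%E.

Definition vec_at (Y : 'I_p -> {RV (Pr M) >-> R}) (om : sample M) : 'cV[R]_p :=
  \col_j Y j om.

Definition y_at (om : sample M) : 'cV[R]_n :=
  \col_i ((row i (design M) *m beta0 M) 0 0 + xi M i om).

Definition z_at (om : sample M) : 'M[R]_(n, p) :=
  \matrix_(i, j) (design M i j + w M i j om).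

Definition Gh_at (om : sample M) : 'M[R]_p :=
  \matrix_(j, k) Gammahat M j k om.

Definition Gamma : 'M[R]_p :=
  \matrix_(j, k) avg (fun i : 'I_n => Ex (fun om => w M i j om * w M i k om)).

Definition noise (i : 'I_n) (om : sample M) : R :=
  xi M i om - \sum_(j < p) w M i j om * beta0 M j 0.

Definition m2 : R :=
  \big[Num.max/0]_(j < p) avg (fun i : 'I_n => design M i j ^+ 2).

Definition Hn (om : sample M) : R := Hstat (z_at om) (Gh_at om).

Definition h_quantile (eps : R) : R :=
  quantile (fun x => Pr M [set om | Hn om <= x]) (1 - eps).

(* The observation (y_i, z_i) as a family of p + 1 real functions. *)
Definition obs (i : 'I_n) (j : option 'I_p) (om : sample M) : R :=
  if j is Some k then z_at om i k else y_at om i 0.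

Definition eiv_assumptions : Prop :=
  independent (Pr M) (fun i : 'I_n => sigma_gen (obs i)) /\
  is_diag_mx Gamma.

Definition conditionA (s : nat) (C0 sigma_xi sigma_w : R) : Prop :=
  [/\ (l0norm (beta0 M) <= s)%N,
      [/\ independent (Pr M)
            (fun i : 'I_n => sigma_gen (fun _ : unit => xi M i : _ -> R)),
          forall i, subgaussian (Pr M) sigma_xi (xi M i)
        & 0 <= sigma_xi /\ sigma_xi ^+ 2 <= C0],
      [/\ independent (Pr M) (fun i : 'I_n => sigma_gen (w M i)),
          forall i, subgaussian_vec (Pr M) sigma_w (w M i),
          0 <= sigma_w /\ sigma_w ^+ 2 <= C0
        & forall i (j k : 'I_p), (j < k)%N ->
            ('E_(Pr M)[(fun om => w M i j om * w M i k om)%R] = 0)%E]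
    & independent (Pr M) (fun b : bool =>
        if b then sigma_gen (fun ij : 'I_n * 'I_p => w M ij.1 ij.2 : _ -> R)
        else sigma_gen (fun i : 'I_n => xi M i : _ -> R))].

Definition U_ (i : 'I_n) (j : 'I_p) (om : sample M) : R :=
  z_at om i j * noise i om + Ex (fun o => w M i j o ^+ 2) * beta0 M j 0.

Definition Umom (j : 'I_p) (k : nat) : R :=
  avg (fun i => Ex (fun om => `|U_ i j om| ^+ k)) `^ k%:R^-1.

Definition Delta (j : 'I_p) : R :=
  `|beta0 M j 0| *
  \big[Num.max/0]_(i < n) `|Ex (fun om => w M i j om ^+ 2) - Gamma j j|.

Definition conditionB (alpha eps b ell : R) : Prop :=
  let r := Phi_inv (1 - alpha / (2 * p%:R * n%:R)) in
  [/\ (forall om, is_diag_mx (Gh_at om)) /\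
        (Pr M [set om | (b < `|Gh_at om - Gamma|)%R] <= eps%:E)%E,
      (forall j, 0 < Umom j 2) /\ 2 <= ell,
      (\big[Num.max/0]_(j < p) (Umom j 3 / Umom j 2)) * r
        <= n%:R `^ (6^-1) / ell,
      \big[Num.max/0]_(j < p | 0 < Delta j)
          (n%:R `^ (- 6^-1) * (Delta j / Umom j 2)) * r <= ell^-1
    & 4 * ln (2 * p%:R * n%:R / alpha) <= n%:R].

(* The programme has lambda_t = 1 / (4 Hn), which needs Hn > 0; nothing is asked
   of the estimator on the null set where Hn = 0. *)
Definition is_conic_estimator (alpha b : R)
    (betahat that uhat : 'I_p -> {RV (Pr M) >-> R}) : Prop :=
  {ae Pr M, forall om, 0 < Hn om} /\
  forall om, 0 < Hn om ->
    conic_solution (y_at om) (z_at om) (Gh_at om) (tau n p alpha) b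
      (4 * Hn om)^-1 (4^-1) (vec_at betahat om) (vec_at that om)
      (vec_at uhat om).

Definition beta_thr (alpha : R) (betahat : 'I_p -> {RV (Pr M) >-> R})
    (om : sample M) : 'cV[R]_p :=
  thresholded (y_at om) (z_at om) (Gh_at om) (tau n p alpha) (vec_at betahat om).

Definition moment_condition (c2 C2 : R) : Prop :=
  forall j : 'I_p,
    c2 * (1 + lnorm 2 (beta0 M)) ^+ 2
      <= avg (fun i => Ex (fun om =>
           (z_at om i j * noise i om + Gamma j j * beta0 M j 0) ^+ 2))
      <= C2 * (1 + lnorm 2 (beta0 M)) ^+ 2.

End model.

(* Main.v *)
(** The heart of the matter is a moderate deviation bound for self-normalized
    sums: if [X_1, ..., X_n] are independent and centered with variances adding up
    to 1 and [x^3 * sum E|X_i|^3] is small, then [P(sum X_i > x sqrt(sum X_i^2))]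
    is at most [(1 + e)] times the normal tail at [x].  It is proved by truncating
    the quadratic minorant of the event and comparing with the Gaussian by a
    Lindeberg swap against a logistic test function, while the part of the event
    where [sum X_i^2] is far from 1 is removed by Chernoff bounds.  Applied to the
    scores at [beta0] it shows that [beta0] is feasible for the conic programme
    with probability [1 - alpha - eps].

    On that event, minimality puts the error in the cone of aperture 3, and the
    lower bound on the sensitivity absorbs the errors in the Gram matrix, which
    gives the rate of the conic estimator.  The thresholds are of the order
    [tau * (1 + |beta0|_2)]: the upper bound comes from fourth moments, the lower
    bound from the truncated second moment of the scores, since the prediction
    error is of smaller order.  Comparing the error with the thresholds bounds both
    the number of false positives and the error of the thresholded estimator.  The
    exceptional probabilities add up to [alpha + 9 eps], so no vanishing term is
    needed.  *)

From HB Require Import structures.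
Require Import Defs.
From mathcomp Require Import ring lra measurable_realfun ftc.
Import Order.TTheory GRing.Theory Num.Theory.
Local Open Scope classical_set_scope.
Local Open Scope ring_scope.

Set Implicit Arguments.
Unset Strict Implicit.
Unset Printing Implicit Defensive.

(** * Expectations of real random variables *)

(** The tail bound must be accurate relative to a tail of order [alpha / p]: after a union over
    [2 p] events an additive error in the swap would be worthless. The logistic function is chosen
    because its first three derivatives are bounded by the function itself and a shift by [y] costs
    a factor at most [expR |y|]; Taylor remainders are then multiples of the smoothed test function,
    and each swap costs a factor close to 1. Only the sum of the scores at [beta0] is centered, as
    [Gamma] averages variances that may differ between observations; hence the tail bound assumes
    just a vanishing sum of means. Three inputs are not given directly. The normal quantile stays
    away from 0 because the claim is void when [alpha >= 1 - 11 eps]. The columns of [Z] are bounded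
    below because otherwise the scores could not have the variance that the moment condition
    prescribes. The Chernoff bounds want [ln (p n / eps)] to be a small multiple of [n^(1/3)]: as
    [Umom j 2 <= Umom j 3], Condition B(ii) bounds the quantile by [n^(1/6) / ell], and the square
    of a normal quantile controls the logarithm. *)

Lemma meas_sum d (T : measurableType d) (R : realType) (I : Type) (r : seq I)
  (Q : pred I) (F : I -> T -> R) :
  (forall i, Q i -> measurable_fun setT (F i)) ->
  measurable_fun setT (fun w => \sum_(i <- r | Q i) F i w).
Proof.
move=> mF; elim: r => [|i r IH].
  rewrite (_ : (fun _ => _) = cst 0)//.
  by apply/funext => w; rewrite big_nil.
case Qi : (Q i).
  rewrite (_ : (fun _ => _) = (fun w => F i w + \sum_(j <- r | Q j) F j w)).
    by apply: measurable_funD => //; exact: mF.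
  by apply/funext => w; rewrite big_cons Qi.
rewrite (_ : (fun _ => _) = (fun w => \sum_(j <- r | Q j) F j w))//.
by apply/funext => w; rewrite big_cons Qi.
Qed.

Lemma meas_le d (T : measurableType d) (R : realType) (f g : T -> R) :
  measurable_fun setT f -> measurable_fun setT g -> measurable [set w | f w <= g w].
Proof.
by move=> mf mg; rewrite -[X in measurable X]setTI; exact: measurable_fun_le.
Qed.

Lemma meas_lt d (T : measurableType d) (R : realType) (f g : T -> R) :
  measurable_fun setT f -> measurable_fun setT g -> measurable [set w | f w < g w].
Proof.
move=> mf mg; rewrite (_ : [set w | f w < g w] = ~` [set w | g w <= f w]).
  by apply: measurableC; exact: meas_le.
by apply/seteqP; split=> w /=; rewrite ltNge => /negP.
Qed.

Section expectation.
Context {d : measure_display} {T : measurableType d} {R : realType}.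
Variable P : probability T R.
Implicit Types f g : T -> R.

(** [fine] sends an infinite integral to 0, so the value is meaningful only together with [Intg]. *)
Definition EX f : R := fine (\int[P]_w (f w)%:E)%E.
Definition Intg f := P.-integrable setT (EFin \o f).

Lemma Intg_meas f : Intg f -> measurable_fun setT f.
Proof. by move=> /integrableP[/measurable_EFinP]. Qed.

Lemma EX_fin f : Intg f -> (\int[P]_w (f w)%:E)%E = (EX f)%:E.
Proof. by move=> If; rewrite /EX fineK//; apply: integrable_fin_num. Qed.

Lemma eq_EX f g : f =1 g -> EX f = EX g.
Proof. by move=> /funext ->. Qed.

Lemma eq_Intg f g : f =1 g -> Intg f -> Intg g.
Proof. by move=> /funext ->. Qed.

Lemma Intg_cst (c : R) : Intg (fun=> c).
Proof. exact: finite_measure_integrable_cst. Qed.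

Lemma IntgD f g : Intg f -> Intg g -> Intg (fun w => f w + g w).
Proof. by move=> If Ig; apply: (integrableD measurableT If Ig). Qed.

Lemma IntgZ (k : R) f : Intg f -> Intg (fun w => k * f w).
Proof. by move=> If; apply: (@integrableZl _ _ _ P setT measurableT k (EFin \o f)). Qed.

Lemma IntgN f : Intg f -> Intg (fun w => - f w).
Proof. by move=> If; apply: (eq_Intg _ (IntgZ (-1) If)) => w; rewrite mulN1r. Qed.

Lemma IntgB f g : Intg f -> Intg g -> Intg (fun w => f w - g w).
Proof. by move=> If Ig; apply: IntgD => //; apply: IntgN. Qed.

Lemma IntgZr (k : R) f : Intg f -> Intg (fun w => f w * k).
Proof. by move=> If; apply: (eq_Intg _ (IntgZ k If)) => w; rewrite mulrC. Qed.

Lemma Intg_dom f g : measurable_fun setT f -> (forall w, `|f w| <= g w) ->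
  Intg g -> Intg f.
Proof.
move=> mf fg Ig; apply: (le_integrable _ _ _ Ig) => //; first exact/measurable_EFinP.
move=> w _ /=; rewrite lee_fin (le_trans (fg w))// ger0_norm//.
exact: le_trans (fg w).
Qed.

Lemma Intg_norm f : Intg f -> Intg (fun w => `|f w|).
Proof.
move=> If; apply: (@integrable_norm _ _ _ P setT f) => //.
Qed.

Lemma Intg_sum (I : Type) (r : seq I) (Q : pred I) (F : I -> T -> R) :
  (forall i, Q i -> Intg (F i)) -> Intg (fun w => \sum_(i <- r | Q i) F i w).
Proof.
move=> IF; elim: r => [|i r IH].
  by apply: (eq_Intg _ (Intg_cst 0)) => w; rewrite big_nil.
case Qi : (Q i).
  by apply: (eq_Intg _ (IntgD (IF i Qi) IH)) => w; rewrite big_cons Qi.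
by apply: (eq_Intg _ IH) => w; rewrite big_cons Qi.
Qed.

Lemma EX_cst (c : R) : EX (fun=> c) = c.
Proof.
rewrite /EX; have -> : (\int[P]_w (c)%:E = c%:E * P setT)%E.
  by rewrite (integral_cst P measurableT c%:E).
by rewrite probability_setT mule1.
Qed.

Lemma EXD f g : Intg f -> Intg g -> EX (fun w => f w + g w) = EX f + EX g.
Proof.
by move=> If Ig; apply: (RintegralD measurableT If Ig).
Qed.

Lemma EXZ (k : R) f : Intg f -> EX (fun w => k * f w) = k * EX f.
Proof. by move=> If; have := RintegralZl k measurableT If. Qed.

Lemma EXZr (k : R) f : Intg f -> EX (fun w => f w * k) = EX f * k.
Proof.
by move=> If; rewrite mulrC -EXZ//; apply: eq_EX => w; rewrite mulrC.
Qed.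

Lemma EXN f : Intg f -> EX (fun w => - f w) = - EX f.
Proof.
by move=> If; rewrite -mulN1r -EXZ//; apply: eq_EX => w; rewrite mulN1r.
Qed.

Lemma EXB f g : Intg f -> Intg g -> EX (fun w => f w - g w) = EX f - EX g.
Proof. by move=> If Ig; rewrite EXD ?EXN//; apply: IntgN. Qed.

Lemma EX_sum (I : Type) (r : seq I) (Q : pred I) (F : I -> T -> R) :
  (forall i, Q i -> Intg (F i)) ->
  EX (fun w => \sum_(i <- r | Q i) F i w) = \sum_(i <- r | Q i) EX (F i).
Proof.
move=> IF; elim: r => [|i r IH].
  by rewrite big_nil -[RHS](EX_cst 0); apply: eq_EX => w; rewrite big_nil.
rewrite big_cons; case Qi : (Q i).
  rewrite -IH -EXD; [|exact: IF|exact: Intg_sum].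
  by apply: eq_EX => w; rewrite big_cons Qi.
by rewrite -IH; apply: eq_EX => w; rewrite big_cons Qi.
Qed.

Lemma EX_le f g : Intg f -> Intg g -> (forall w, f w <= g w) -> EX f <= EX g.
Proof.
move=> If Ig fg; apply: (@le_Rintegral _ _ _ P setT) => //.
Qed.

Lemma EX_ge0 f : (forall w, 0 <= f w) -> 0 <= EX f.
Proof. by move=> f0; apply: Rintegral_ge0. Qed.

Lemma EX_norm f : Intg f -> `|EX f| <= EX (fun w => `|f w|).
Proof. by move=> If; apply: le_normr_Rintegral. Qed.

(** Exponential moment bounds arrive as extended-real integrals of nonnegative functions; this turns
    a finite one into integrability and a real inequality at once. *)
Lemma Intg_ge0 f (c : R) : measurable_fun setT f -> (forall w, 0 <= f w) ->
  ((\int[P]_w (f w)%:E <= c%:E)%E -> Intg f /\ EX f <= c).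
Proof.
move=> mf f0 fc; have If : Intg f.
  apply/integrableP; split; first exact/measurable_EFinP.
  rewrite (@le_lt_trans _ _ c%:E) ?ltry//.
  rewrite (eq_integral (fun w => (f w)%:E))// => w _ /=.
  by rewrite ger0_norm.
by split=> //; rewrite -lee_fin -EX_fin.
Qed.

Lemma Intg_bdd f (c : R) : measurable_fun setT f -> (forall w, `|f w| <= c) -> Intg f.
Proof. by move=> mf fc; apply: (Intg_dom mf fc); apply: Intg_cst. Qed.

Lemma Intg_ind (A : set T) : measurable A -> Intg (\1_A : T -> R).
Proof.
move=> mA; apply: (@Intg_bdd _ 1); first exact: measurable_indic.
by move=> w; rewrite indicE; case: (_ \in _); rewrite ?normr1 ?normr0.
Qed.

Lemma EX_ind (A : set T) : measurable A -> P A = (EX (\1_A : T -> R))%:E.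
Proof.
move=> mA; rewrite -EX_fin; last exact: Intg_ind.
by rewrite integral_indic// setIT.
Qed.

Lemma prob_le_EX (A : set T) f : measurable A -> Intg f -> (forall w, 0 <= f w) ->
  (forall w, A w -> 1 <= f w) -> (P A <= (EX f)%:E)%E.
Proof.
move=> mA If f0 f1; rewrite EX_ind// lee_fin; apply: EX_le => //; first exact: Intg_ind.
move=> w; rewrite indicE; have [|] := boolP (w \in A) => //.
by rewrite inE => /f1.
Qed.

Lemma prob_le_int (A : set T) f : measurable A -> measurable_fun setT f ->
  (forall w, 0 <= f w) ->
  (forall w, A w -> 1 <= f w) -> (P A <= \int[P]_w (f w)%:E)%E.
Proof.
move=> mA mf f0 f1.
have -> : P A = (\int[P]_w (\1_A w)%:E)%E by rewrite integral_indic// setIT.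
apply: ge0_le_integral => //.
- exact/measurable_EFinP.
- exact/measurable_EFinP.
- move=> w _; rewrite lee_fin indicE; have [|] := boolP (w \in A) => //.
  by rewrite inE => /f1.
Qed.

End expectation.

(** * Independence *)

Section decoupling.
Context {d : measure_display} {T : measurableType d} {R : realType}.
Variable P : probability T R.
Implicit Types f g : T -> R.

Definition indep2 f g := forall A B : set R, measurable A -> measurable B ->
  (P (f @^-1` A `&` g @^-1` B) = P (f @^-1` A) * P (g @^-1` B))%E.

Lemma meas_preimage f (A : set R) : measurable_fun setT f -> measurable A ->
  measurable (f @^-1` A).
Proof. by move=> mf mA; rewrite -[_ @^-1` _]setTI; exact: mf. Qed.

(** Both sides are finite measures in [C]: the law of the pair restricted to [D], and the law of the
    pair scaled by [P D]. They agree on rectangles, an intersection-stable family generating the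
    product sigma-algebra. *)
Lemma indep2_cond f g (D : set T) (C : set (R * R)) :
  measurable_fun setT f -> measurable_fun setT g -> measurable D ->
  (forall A B : set R, measurable A -> measurable B ->
    (P (f @^-1` A `&` g @^-1` B `&` D) =
     P (f @^-1` A `&` g @^-1` B) * P D)%E) ->
  measurable C ->
  (P ((fun w => (f w, g w)) @^-1` C `&` D) =
   P ((fun w => (f w, g w)) @^-1` C) * P D)%E.
Proof.
move=> mf mg mD rect mC.
have mfg : measurable_fun setT (fun w => (f w, g w)) by exact: measurable_fun_pair.
pose X : {mfun T >-> (R * R)%type} := HB.pack (fun w => (f w, g w))
  (isMeasurableFun.Build _ _ _ _ _ mfg).
have PDfin : P D \is a fin_num by exact: fin_num_measure.
have c0 : 0 <= fine (P D) by rewrite fine_ge0.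
pose m1 : {measure set (R * R) -> \bar R} := pushforward (mrestr P mD) X.
pose m2 : {measure set (R * R) -> \bar R} := mscale (NngNum c0) (pushforward P X).
have := @measure_unique _ _ (R * R)%type
   [set A `*` B | A in measurable & B in measurable] (fun=> setT)
   (measurable_prod_measurableType _ _) _ _ _ (m1 mfg) (m2 mfg) _ _ C mC.
rewrite /m1 /m2 /= /mscale /= /pushforward /mrestr /= fineK// => ->.
- by rewrite muleC.
- move=> _ _ [A mA [B mB <-]] [A' mA' [B' mB' <-]].
  exists (A `&` A'); first exact: measurableI.
  by exists (B `&` B'); [exact: measurableI|rewrite setXI].
- by move=> _; exists setT => //; exists setT => //; rewrite setXTT.
- by rewrite bigcup_const//; exists 0%N.
- move=> _ [A mA [B mB <-]].
  rewrite muleC -rect//.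
- move=> _; rewrite (@le_lt_trans _ _ 1%E) ?ltry// probability_le1//.
  by apply: measurableI => //; rewrite preimage_setT.
Qed.

(** Fubini for the joint law, which is a product by independence. Writing it with two integrals over
    the same [P] lets later arguments freeze one variable without leaving the sample space. *)
Lemma decouple f g (h : R * R -> \bar R) :
  measurable_fun setT f -> measurable_fun setT g -> indep2 f g ->
  measurable_fun setT h -> (forall z, 0 <= h z)%E ->
  (\int[P]_w h (f w, g w) = \int[P]_v \int[P]_w h (f v, g w))%E.
Proof.
move=> mf mg ind mh h0.
have mfg : measurable_fun setT (fun w => (f w, g w)) by exact: measurable_fun_pair.
pose X : {mfun T >-> (R * R)%type} := HB.pack (fun w => (f w, g w))
  (isMeasurableFun.Build _ _ _ _ _ mfg).
pose f' : {mfun T >-> R} := HB.pack f (isMeasurableFun.Build _ _ _ _ _ mf).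
pose g' : {mfun T >-> R} := HB.pack g (isMeasurableFun.Build _ _ _ _ _ mg).
pose Pf := distribution P f'; pose Pg := distribution P g'.
have E C : measurable C -> (Pf \x Pg)%E C = pushforward P X C.
  apply: product_measure_unique => A B mA mB.
  by rewrite /pushforward -ind.
transitivity (\int[pushforward P X]_z h z)%E.
  by rewrite ge0_integral_pushforward// preimage_setT.
rewrite (@eq_measure_integral _ _ _ _ (Pf \x Pg)%E); last first.
  by move=> A mA _; rewrite /= -E.
rewrite fubini_tonelli1//=.
have mF : measurable_fun setT (fubini_F Pg h).
  exact: measurable_fun_fubini_tonelli_F.
rewrite ge0_integral_distribution//; last first.
  by move=> x; apply: integral_ge0.
apply: eq_integral => v _ /=; rewrite /fubini_F ge0_integral_distribution//.
by apply: measurableT_comp => //; exact: measurable_pair1.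
Qed.

End decoupling.

Section independent_sums.
Context {d : measure_display} {T : measurableType d} {R : realType}.
Variables (P : probability T R) (n : nat).
Variables (F : 'I_n -> set (set T)) (Y : 'I_n -> T -> R).
Hypothesis FM : forall i E, F i E -> measurable E.
Hypothesis FY : forall i (B : set R), measurable B -> F i (Y i @^-1` B).
Hypothesis indF : independent P F.

Definition psum (k : nat) (w : T) : R := \sum_(i < n | (i < k)%N) Y i w.

Lemma indep_meas i : measurable_fun setT (Y i).
Proof. by move=> _ B mB; rewrite setTI; apply/FM/FY. Qed.

Lemma psum_meas k : measurable_fun setT (psum k).
Proof.
by apply: meas_sum => i _; exact: indep_meas.
Qed.

Lemma psumS (i : 'I_n) w : psum i.+1 w = psum i w + Y i w.
Proof.
rewrite /psum (bigD1 i) ?ltnS//= addrC; congr (_ + _).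
apply: eq_bigl => j; rewrite ltnS [in RHS]ltn_neqAle.
by rewrite andbC -val_eqE.
Qed.

Lemma psum_full w : psum n w = \sum_(i < n) Y i w.
Proof. by apply: eq_bigl => i; rewrite ltn_ord. Qed.

Lemma bigcap_meas (J : {set 'I_n}) (E : 'I_n -> set T) :
  (forall i, i \in J -> F i (E i)) -> measurable (\bigcap_(i in [set` J]) E i).
Proof.
by move=> FE; apply: fin_bigcap_measurable => // i /FE; exact: FM.
Qed.

(** The events have indices [k <= i], outside the partial sum, so that induction on [k] can trade a
    summand for an event: for [psum k + Y k] it suffices by [indep2_cond] to test rectangles, and
    these fall under the hypothesis for [J] enlarged by the index [k]. *)
Lemma psum_indep k (J : {set 'I_n}) (E : 'I_n -> set T) (A : set R) :
  (forall i, i \in J -> (k <= i)%N /\ F i (E i)) -> measurable A ->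
  (P (psum k @^-1` A `&` \bigcap_(i in [set` J]) E i) =
   P (psum k @^-1` A) * P (\bigcap_(i in [set` J]) E i))%E.
Proof.
elim: k => [|k IH] in J E A *.
  move=> FE mA; have -> : psum 0 = cst 0.
    by apply/funext => w; rewrite /psum big_pred0.
  rewrite preimage_cst; case: ifP => _.
    by rewrite setTI probability_setT mul1e.
  by rewrite set0I measure0 mul0e.
move=> FE mA.
have [nk|kn] := leqP n k.
  have -> : psum k.+1 = psum k.
    apply/funext => w; apply: eq_bigl => i.
    by rewrite !(leq_trans (ltn_ord i))// leqW.
  by apply: IH => // i /FE[ki ?]; split=> //; exact: ltnW.
pose i0 := Ordinal kn.
have -> : psum k.+1 = (fun w => psum k w + Y i0 w).
  by apply/funext => w; rewrite (psumS i0).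
have i0J : i0 \notin J.
  by apply/negP => /FE[] /=; rewrite ltnn.
have mD : measurable (\bigcap_(i in [set` J]) E i).
  by apply: bigcap_meas => i /FE[].
have mC : measurable [set z : R * R | A (z.1 + z.2)].
  have mp : measurable_fun setT (fun z : R * R => z.1 + z.2).
    by apply: measurable_funD; [exact: measurable_fst|exact: measurable_snd].
  by have := mp measurableT _ mA; rewrite setTI.
apply: (indep2_cond (psum_meas k) (indep_meas i0) mD _ mC) => A' B mA' mB.
pose E' i := if i == i0 then Y i0 @^-1` B else E i.
have E'J : \bigcap_(i in [set` J]) E' i = \bigcap_(i in [set` J]) E i.
  apply: eq_bigcapr => i /= iJ; rewrite /E'; case: eqP => // e.
  by move: i0J; rewrite -e; move: iJ => /= ->.
have FE'J i : i \in J -> (k <= i)%N /\ F i (E' i).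
  move=> iJ; have [ki Fi] := FE _ iJ; split; first exact: ltnW.
  rewrite /E'; case: eqP => // e.
  by move: i0J; rewrite -e iJ.
have FE'1 i : i \in [set i0]%SET -> (k <= i)%N /\ F i (E' i).
  by rewrite inE => /eqP ->; split=> //; rewrite /E' eqxx; exact: FY.
have FE'U i : i \in (i0 |: J)%SET -> (k <= i)%N /\ F i (E' i).
  by rewrite inE => /orP[/FE'1|/FE'J].
have capU : \bigcap_(i in [set` (i0 |: J)%SET]) E' i =
    Y i0 @^-1` B `&` \bigcap_(i in [set` J]) E i.
  rewrite -E'J; apply/seteqP; split=> w /= H.
    split; first by have := H i0; rewrite /= !inE eqxx /= /E' eqxx; apply.
    by move=> i /= iJ; apply: H => /=; rewrite !inE iJ orbT.
  move=> i /=; rewrite !inE => /orP[/eqP ->|iJ]; first by rewrite /E' eqxx; case: H.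
  by case: H => _; apply.
have cap1 : \bigcap_(i in [set` [set i0]%SET]) E' i = Y i0 @^-1` B.
  apply/seteqP; split=> w /= H.
    by have := H i0; rewrite /= inE eqxx /E' eqxx; apply.
  by move=> i /=; rewrite inE => /eqP ->; rewrite /E' eqxx.
have PU : P (\bigcap_(i in [set` (i0 |: J)%SET]) E' i) =
    (P (Y i0 @^-1` B) * P (\bigcap_(i in [set` J]) E i))%E.
  rewrite indF; last by move=> i /FE'U[].
  rewrite big_setU1//= EFinM fineK; last first.
    by apply: fin_num_measure; rewrite /E' eqxx; apply/FM/FY.
  by rewrite {1}/E' eqxx -E'J indF// => i /FE'J[].
have := IH _ _ A' FE'U mA'; rewrite capU setIA => ->.
have := IH _ _ A' FE'1 mA'; rewrite cap1 => ->.
by rewrite -capU PU muleA.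
Qed.

Lemma psum_indep2 (i : 'I_n) : indep2 P (psum i) (Y i).
Proof.
move=> A B mA mB.
have -> : Y i @^-1` B = \bigcap_(j in [set` [set i]%SET]) (Y i @^-1` B).
  apply/seteqP; split=> w /= H; first by move=> j _.
  by have := H i; rewrite /= inE eqxx; apply.
apply: psum_indep => // j; rewrite inE => /eqP ->; split=> //; exact: FY.
Qed.

(** Extended integrals spare any prior integrability of the exponentials; independence peels off one
    factor at a time. *)
Lemma expR_psum (c : 'I_n -> R) k :
  (forall i, (\int[P]_w (expR (Y i w))%:E <= (expR (c i))%:E)%E) ->
  (\int[P]_w (expR (psum k w))%:E <= (expR (\sum_(i < n | (i < k)%N) c i))%:E)%E.
Proof.
move=> Yc; elim: k => [|k IH].
  rewrite big_pred0// expR0.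
  rewrite (eq_integral (cst 1%E)); last first.
    by move=> w _; rewrite /psum big_pred0// expR0.
  have -> : (\int[P]_w (cst 1%E w) = 1%E * P setT)%E.
    exact: (integral_cst P measurableT 1%E).
  by rewrite probability_setT mule1.
have [nk|kn] := leqP n k.
  have E (i : 'I_n) : (i < k.+1)%N = (i < k)%N.
    by rewrite !(leq_trans (ltn_ord i))// leqW.
  under eq_integral do rewrite /psum (eq_bigl _ _ E).
  by rewrite (eq_bigl _ _ E).
pose i := Ordinal kn.
have mh : measurable_fun setT (fun z : R * R => (expR (z.1 + z.2))%:E).
  apply/measurable_EFinP; apply: measurableT_comp => //.
  by apply: measurable_funD; [exact: measurable_fst|exact: measurable_snd].
under eq_integral do rewrite (psumS i).
have h0 (z : R * R) : (0 <= (expR (z.1 + z.2))%:E)%E by rewrite lee_fin expR_ge0.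
rewrite (decouple (psum_meas i) (indep_meas i) (psum_indep2 i) mh h0) /=.
have -> : \sum_(j < n | (j < k.+1)%N) c j = \sum_(j < n | (j < k)%N) c j + c i.
  rewrite (bigD1 i) ?ltnS//= addrC; congr (_ + _).
  apply: eq_bigl => j; rewrite ltnS [in RHS]ltn_neqAle.
  by rewrite andbC -val_eqE.
have mexp k' : measurable_fun setT (fun w => (expR (psum k' w))%:E).
  by apply/measurable_EFinP; apply: measurableT_comp => //; exact: psum_meas.
have mY i' : measurable_fun setT (fun w => (expR (Y i' w))%:E).
  by apply/measurable_EFinP; apply: measurableT_comp => //; exact: indep_meas.
rewrite expRD EFinM.
apply: (@le_trans _ _ (\int[P]_v ((expR (psum k v))%:E * (expR (c i))%:E))%E).
  apply: ge0_le_integral => //.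
  - by move=> v _; apply: integral_ge0 => w _; rewrite lee_fin expR_ge0.
  - apply: (eq_measurable_fun (fun v => (expR (psum k v))%:E *
      \int[P]_w (expR (Y i w))%:E)%E).
      move=> v _; rewrite -ge0_integralZl ?lee_fin ?expR_ge0//.
      by apply: eq_integral => w _; rewrite -EFinM -expRD.
    exact: emeasurable_funM.
  - exact: emeasurable_funM.
  - move=> v _; rewrite (eq_integral (fun w => (expR (psum k v))%:E * (expR (Y i w))%:E)%E); last first.
      by move=> w _; rewrite -EFinM -expRD.
    rewrite ge0_integralZl ?lee_fin ?expR_ge0//.
    by rewrite lee_pmul2l// lte_fin expR_gt0.
rewrite ge0_integralZr ?lee_fin ?expR_ge0//.
by rewrite lee_pmul2r// lte_fin expR_gt0.
Qed.

Lemma chernoff_sum (c : 'I_n -> R) (t : R) :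
  (forall i, (\int[P]_w (expR (Y i w))%:E <= (expR (c i))%:E)%E) ->
  (P [set w | (t <= \sum_(i < n) Y i w)%R] <= (expR (\sum_(i < n) c i - t))%:E)%E.
Proof.
move=> Yc.
have mS : measurable_fun setT (fun w => \sum_(i < n) Y i w).
  by apply: meas_sum => i _; exact: indep_meas.
have mA : measurable [set w | t <= \sum_(i < n) Y i w].
  by rewrite -[X in measurable X]setTI; apply: measurable_fun_le.
have mE : measurable_fun setT (fun w => expR (\sum_(i < n) Y i w)).
  exact: measurableT_comp.
apply: (@le_trans _ _ (\int[P]_w (expR (\sum_(i < n) Y i w) * expR (- t))%:E)%E).
  apply: prob_le_int => //.
  - exact: measurable_funM.
  - by move=> w /= tw; rewrite -expRD -[leLHS]expR0 ler_expR subr_ge0.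
under eq_integral do rewrite EFinM.
rewrite ge0_integralZr ?lee_fin ?expR_ge0//; last exact/measurable_EFinP.
rewrite expRD EFinM lee_pmul2r ?lte_fin ?expR_gt0//.
under eq_integral do rewrite -psum_full.
apply: le_trans (expR_psum n Yc) _.
by rewrite (eq_bigl xpredT c)// => i; rewrite ltn_ord.
Qed.

End independent_sums.

(** * Taylor bounds and the standard normal law *)

Section taylor.
Context {R : realType}.
Implicit Types f : R -> R.

Section derivative_rules.
Variables (f g : R -> R) (x a b : R).
Hypotheses (df : is_derive x 1 f a) (dg : is_derive x 1 g b).

Lemma drv_eq (c : R) : a = c -> is_derive x 1 f c. Proof. by move=> <-. Qed.
Lemma drvD : is_derive x 1 (fun y => f y + g y) (a + b).
Proof. exact: (is_deriveD df dg). Qed.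
Lemma drvB : is_derive x 1 (fun y => f y - g y) (a - b).
Proof. exact: (is_deriveB df dg). Qed.
Lemma drvM : is_derive x 1 (fun y => f y * g y) (f x * b + g x * a).
Proof. exact: (is_deriveM df dg). Qed.
Lemma drvN : is_derive x 1 (fun y => - f y) (- a).
Proof. exact: (is_deriveN df). Qed.
Lemma drv_comp (h : R -> R) (c : R) : is_derive (f x) 1 h c -> is_derive x 1 (fun y => h (f y)) (c * a).
Proof. by move=> dh; exact: (is_derive1_comp dh df). Qed.
End derivative_rules.

Lemma drv_cst (c x : R) : is_derive x 1 (fun=> c) 0.
Proof. exact: is_derive_cst. Qed.
Lemma drv_id (x : R) : is_derive x 1 (fun y : R => y) 1.
Proof. exact: is_derive_id. Qed.

Lemma mean_value_bound f f' (a y M : R) :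
  (forall x : R, is_derive x 1 f (f' x)) ->
  (forall x, `|x - a| <= `|y| -> `|f' x| <= M) ->
  `|f (a + y) - f a| <= M * `|y|.
Proof.
move=> df bf.
have cf (b c : R) : {within `[b, c], continuous f}.
  apply: continuous_subspaceT => x; apply/differentiable_continuous.
  by apply/derivable1_diffP; have [] := df x.
have [y0|y0|->] := ltgtP y 0; last by rewrite addr0 subrr !normr0 mulr0.
- have lt : a + y < a by rewrite gtrDl.
  have [x xay E] := MVT_segment (ltW lt) (fun x _ => df x) (cf _ _).
  move: xay; rewrite in_itv/= => /andP[x1 x2].
  rewrite distrC E normrM opprD addNKr normrN ler_wpM2r// bf//.
  by rewrite ler0_norm ?subr_le0// ltr0_norm//; lra.
- have lt : a < a + y by rewrite ltrDl.
  have [x xay E] := MVT_segment (ltW lt) (fun x _ => df x) (cf _ _).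
  move: xay; rewrite in_itv/= => /andP[x1 x2].
  rewrite E normrM addrC addKr ler_wpM2r// bf//.
  by rewrite ger0_norm ?subr_ge0// gtr0_norm//; lra.
Qed.

(** The mean value bound is applied in turn to [f2], to [f1] minus its linear part and to [f] minus
    its quadratic part. The sharp factor [1/6] is lost, which only affects constants. *)
Lemma taylor3 f f1 f2 f3 (s y M : R) :
  (forall x : R, is_derive x 1 f (f1 x)) ->
  (forall x : R, is_derive x 1 f1 (f2 x)) ->
  (forall x : R, is_derive x 1 f2 (f3 x)) ->
  (forall x, `|x - s| <= `|y| -> `|f3 x| <= M) ->
  `|f (s + y) - f s - f1 s * y - f2 s * y ^+ 2 / 2| <= M * `|y| ^+ 3.
Proof.
move=> d1 d2 d3 b3.
have h2 x : `|x - s| <= `|y| -> `|f2 x - f2 s| <= M * `|y|.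
  move=> xy; have M0 : 0 <= M by apply: le_trans (b3 _ xy).
  rewrite (_ : x = s + (x - s)); last by rewrite addrC subrK.
  apply: (le_trans (mean_value_bound d3 (M := M) _)).
    by move=> z zx; apply: b3; exact: le_trans xy.
  by rewrite ler_wpM2l// (_ : s + (x - s) - s = x - s)//; ring.
have h1 x : `|x - s| <= `|y| -> `|f1 x - f1 s - f2 s * (x - s)| <= M * `|y| ^+ 2.
  move=> xy; have M0 : 0 <= M by apply: le_trans (b3 _ xy).
  pose g x := f1 x - f2 s * x.
  have dg (x' : R) : is_derive x' 1 g (f2 x' - f2 s).
    by apply: (drv_eq (drvB (d2 x') (drvM (drv_cst (f2 s) x') (drv_id x')))); ring.
  have := @mean_value_bound g _ s (x - s) (M * `|y|) dg.
  rewrite (_ : s + (x - s) = x); last by ring.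
  rewrite (_ : g x - g s = f1 x - f1 s - f2 s * (x - s)); last by rewrite /g; ring.
  move=> h; apply: (le_trans (h _)).
    by move=> z zx; apply: h2; exact: le_trans xy.
  rewrite expr2 mulrA ler_wpM2l// mulr_ge0//.
pose g x := f x - f1 s * x - f2 s * ((x - s) * (x - s) * 2^-1).
have dg (x : R) : is_derive x 1 g (f1 x - f1 s - f2 s * (x - s)).
  have db := drvB (drv_id x) (drv_cst s x).
  have dq := drvM (drvM db db) (drv_cst 2^-1 x).
  apply: (drv_eq (drvB (drvB (d1 x) (drvM (drv_cst (f1 s) x) (drv_id x)))
    (drvM (drv_cst (f2 s) x) dq))).
  by field.
have := @mean_value_bound g _ s y (M * `|y| ^+ 2) dg.
rewrite (_ : g (s + y) - g s = f (s + y) - f s - f1 s * y - f2 s * y ^+ 2 / 2); last first.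
  by rewrite /g; field.
move=> h; rewrite [leRHS](_ : _ = M * `|y| ^+ 2 * `|y|); last by ring.
by apply: h => x xy; exact: h1.
Qed.

Lemma expR_taylor3 (y : R) :
  `|expR y - 1 - y - y ^+ 2 / 2| <= expR `|y| * `|y| ^+ 3.
Proof.
have d (x : R) := is_derive_expR x.
have := @taylor3 expR expR expR expR 0 y (expR `|y|) d d d.
rewrite add0r expR0 !mul1r; apply=> x; rewrite subr0 => xy.
by rewrite ger0_norm ?expR_ge0// ler_expR (le_trans (ler_norm x)).
Qed.

Definition logistic (x : R) : R := (1 + expR (- x))^-1.

Lemma logistic_den (x : R) : 0 < 1 + expR (- x).
Proof. by rewrite ltr_wpDr ?expR_ge0. Qed.

Lemma logistic_gt0 (x : R) : 0 < logistic x.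
Proof. by rewrite invr_gt0 logistic_den. Qed.

Lemma logistic_lt1 (x : R) : logistic x < 1.
Proof. by rewrite invf_lt1 ?logistic_den// ltrDl expR_gt0. Qed.

Lemma logistic_le_expR (x : R) : logistic x <= expR x.
Proof.
rewrite -[expR x]opprK -[x in leRHS]opprK expRN opprK lef_pV2 ?posrE ?expR_gt0 ?logistic_den//.
by rewrite lerDr.
Qed.

Lemma logistic_homo : {homo logistic : x y / x <= y}.
Proof.
move=> x y xy; rewrite lef_pV2 ?posrE ?logistic_den//.
by rewrite lerD2l ler_expR lerN2.
Qed.

(** A Harnack-type inequality: through it the third-order remainder becomes a multiple of the value
    at the base point instead of a supremum over a segment. *)
Lemma logistic_shift (x y : R) : logistic (x + y) <= expR `|y| * logistic x.
Proof.
have E0 := logistic_den x; have E1 := logistic_den (x + y).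
rewrite /logistic ler_pdivlMr// mulrC ler_pdivrMr// mulrDr mulr1 -expRD.
apply: lerD; first by rewrite -expR0 ler_expR.
by rewrite ler_expR; have := ler_norm y; lra.
Qed.

(** The derivatives are written as polynomials in [logistic] through [h' = h (1 - h)], a form from
    which the bounds by [logistic] itself can be read off. *)
Definition logistic1 (x : R) := logistic x * (1 - logistic x).
Definition logistic2 (x : R) := logistic1 x * (1 - 2 * logistic x).
Definition logistic3 (x : R) :=
  logistic1 x * (1 - 6 * logistic x + 6 * (logistic x * logistic x)).

Lemma is_derive_logistic (x : R) : is_derive x 1 logistic (logistic1 x).
Proof.
have h := drvD (drv_cst 1 x)
  (drv_comp (drvN (drv_id x)) (is_derive_expR (- x))).
apply: (drv_eq (is_deriveV (f := fun y => 1 + expR (- y)) _ h)).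
  by rewrite gt_eqF// logistic_den.
rewrite /logistic1 /logistic /GRing.scale/=; field.
by rewrite gt_eqF// logistic_den.
Qed.

Lemma is_derive_logistic1 (x : R) : is_derive x 1 logistic1 (logistic2 x).
Proof.
have h := is_derive_logistic x.
apply: (drv_eq (drvM h (drvB (drv_cst 1 x) h))).
by rewrite /logistic2 /logistic1; ring.
Qed.

Lemma is_derive_logistic2 (x : R) : is_derive x 1 logistic2 (logistic3 x).
Proof.
have h := is_derive_logistic x.
apply: (drv_eq (drvM (is_derive_logistic1 x)
  (drvB (drv_cst 1 x) (drvM (drv_cst 2 x) h)))).
by rewrite /logistic3 /logistic2 /logistic1; ring.
Qed.

Lemma logistic1_bound (x : R) : 0 <= logistic1 x <= logistic x.
Proof.
have l0 := logistic_gt0 x; have l1 := logistic_lt1 x.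
rewrite /logistic1; nra.
Qed.

Lemma logistic2_bound (x : R) : `|logistic2 x| <= logistic x.
Proof.
have l0 := logistic_gt0 x; have l1 := logistic_lt1 x.
have /andP[h0 h1] := logistic1_bound x.
rewrite /logistic2 normrM (ger0_norm h0) (le_trans _ h1)// ler_piMr//.
by rewrite ler_norml; apply/andP; split; lra.
Qed.

Lemma logistic3_bound (x : R) : `|logistic3 x| <= logistic x.
Proof.
have l0 := logistic_gt0 x; have l1 := logistic_lt1 x.
have /andP[h0 h1] := logistic1_bound x.
rewrite /logistic3 normrM (ger0_norm h0) (le_trans _ h1)// ler_piMr//.
by rewrite ler_norml; apply/andP; split; nra.
Qed.

Lemma logistic_taylor3 (u y : R) :
  `|logistic (u + y) - logistic u - logistic1 u * y - logistic2 u * y ^+ 2 / 2|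
    <= logistic u * expR `|y| * `|y| ^+ 3.
Proof.
apply: (taylor3 is_derive_logistic is_derive_logistic1 is_derive_logistic2).
move=> x xy; rewrite (le_trans (logistic3_bound x))// mulrC.
rewrite (_ : x = u + (x - u)); last by ring.
by rewrite (le_trans (logistic_shift _ _))// ler_wpM2r ?ler_expR// ltW// logistic_gt0.
Qed.

Lemma continuous_of_derive (f : R -> R) f' :
  (forall x : R, is_derive x 1 f (f' x)) -> continuous f.
Proof.
move=> df x; apply/differentiable_continuous.
by apply/derivable1_diffP; have [] := df x.
Qed.

End taylor.

(** * The standard normal law: density, exponential moments, mean and variance *)

Section gauss.
Context {R : realType}.
Notation mu := (@lebesgue_measure R).
Notation phi := (normal_pdf (0 : R) 1).
Definition gamma : probability (measurableTypeR R) R := normal_prob (0 : R) 1.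

Lemma phiE (x : R) : phi x = normal_peak 1 * expR (- x ^+ 2 / 2).
Proof.
rewrite normal_pdfE ?oner_eq0//; congr (_ * _).
by rewrite /normal_fun subr0 expr1n.
Qed.

Lemma phi_gt0 (x : R) : 0 < phi x.
Proof. by rewrite phiE mulr_gt0 ?expR_gt0// normal_peak_gt0// oner_eq0. Qed.

Lemma measurable_phi : measurable_fun setT (phi : R -> R).
Proof. exact: measurable_normal_pdf. Qed.

Lemma continuous_phi : continuous (phi : R -> R).
Proof. by apply: continuous_normal_pdf; rewrite oner_eq0. Qed.

(** The Radon-Nikodym derivative of [gamma] agrees almost everywhere with [phi], since both have the
    same integral over every measurable set. *)
Lemma gauss_density (f : R -> \bar R) : measurable_fun setT f ->
  (forall x, 0 <= f x)%E ->
  (\int[gamma]_x f x = \int[mu]_x (f x * (phi x)%:E))%E.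
Proof.
move=> mf f0.
have dom : gamma `<< mu by exact: normal_prob_dominates.
rewrite -(@Radon_Nikodym_SigmaFinite.change_of_variables _ _ _ _ mu dom)//.
have If := Radon_Nikodym_SigmaFinite.f_integrable dom.
apply: ae_eq_integral => //.
- by apply: emeasurable_funM => //; exact: measurable_int If.
- by apply: emeasurable_funM => //; apply/measurable_EFinP; exact: measurable_phi.
- apply: ae_eqe_mul2l; apply: integral_ae_eq => //.
    by apply/measurable_EFinP; exact: measurable_phi.
  by move=> E _ mE; rewrite -Radon_Nikodym_SigmaFinite.f_integral.
Qed.

Lemma affine_substitution (G : R -> R) (k m : R) : 0 < k -> continuous G ->
  (forall x, 0 <= G x) ->
  (\int[mu]_x (G x)%:E = \int[mu]_x (G (k * x + m) * k)%:E)%E.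
Proof.
move=> k0 cG G0.
have dF (x : R) : is_derive x 1 (fun x : R => k * x + m) k.
  by apply: (drv_eq (drvD (drvM (drv_cst k x) (drv_id x)) (drv_cst m x))); ring.
have F'E : derive1 (fun x : R => k * x + m) = cst k.
  by apply/funext => x; rewrite derive1E (derive_val (df := k)).
rewrite (@increasing_ge0_integration_by_substitutionT _ (fun x => k * x + m))//.
- by apply: eq_integral => x _; rewrite /= F'E.
- by move=> x y xy; rewrite ltrD2r ltr_pM2l.
- by rewrite F'E; exact: cst_continuous.
- by rewrite F'E; exact: is_cvg_cst.
- by rewrite F'E; exact: is_cvg_cst.
- rewrite (_ : (fun x => k * x + m) = (fun x => (x + m / k) * k)); last first.
    by apply/funext => x; field; rewrite gt_eqF.
  by apply/gt0_cvgMlNy => //; exact: cvg_addrr_Ny.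
- rewrite (_ : (fun x => k * x + m) = (fun x => (x + m / k) * k)); last first.
    by apply/funext => x; field; rewrite gt_eqF.
  by apply/gt0_cvgMly => //; exact: cvg_addrr.
Qed.

Lemma cont_meas (f : R -> R) : continuous f -> measurable_fun setT f.
Proof. exact: continuous_measurable_fun. Qed.

Lemma gauss_mgf (t : R) :
  (\int[gamma]_x (expR (t * x))%:E = (expR (t ^+ 2 / 2))%:E)%E.
Proof.
rewrite (@gauss_density (fun x => (expR (t * x))%:E)).
- have E (x : R) : expR (t * x) * phi x = phi (1 * x + - t) * expR (t ^+ 2 / 2).
    by rewrite !phiE [LHS]mulrCA -[RHS]mulrA -!expRD; congr (_ * expR _); field.
  under eq_integral do rewrite -EFinM E EFinM.
  rewrite ge0_integralZr ?lee_fin ?expR_ge0//.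
  + rewrite (_ : (\int[mu]_x (phi (1 * x - t))%:E)%E = 1%E) ?mul1e//.
    rewrite -[RHS](@integral_normal_pdf R 0 1).
    rewrite (@affine_substitution phi 1 (- t))//; last 2 first.
    * exact: continuous_phi.
    * by move=> x; rewrite ltW// phi_gt0.
    by apply: eq_integral => x _; rewrite mulr1.
  + apply/measurable_EFinP; apply: measurableT_comp; first exact: measurable_phi.
    by apply: measurable_funD => //; exact: measurable_funM.
  + by move=> x _; rewrite lee_fin ltW// phi_gt0.
- apply/measurable_EFinP; apply: measurableT_comp => //; exact: measurable_funM.
- by move=> x; rewrite lee_fin expR_ge0.
Qed.

Lemma gauss_expR (t : R) :
  Intg gamma (fun x => expR (t * x)) /\ EX gamma (fun x => expR (t * x)) = expR (t ^+ 2 / 2).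
Proof.
have mf : measurable_fun (setT : set (measurableTypeR R)) (fun x => expR (t * x)).
  by apply: measurableT_comp => //; exact: measurable_funM.
have f0 x : 0 <= expR (t * x) by rewrite expR_ge0.
have le : (\int[gamma]_x (expR (t * x))%:E <= (expR (t ^+ 2 / 2))%:E)%E by rewrite gauss_mgf.
have [I _] := Intg_ge0 mf f0 le.
split=> //; apply: EFin_inj; rewrite -EX_fin//.
exact: gauss_mgf.
Qed.


Lemma measR (f : R -> R) : measurable_fun (setT : set R) f ->
  measurable_fun (setT : set (measurableTypeR R)) f.
Proof. by []. Qed.

Lemma pow_le_expR (n : nat) (a : R) : 0 <= a -> a ^+ n <= n`!%:R * expR a.
Proof.
move=> a0; case: n => [|n].
  by rewrite expr0 mul1r -expR0 ler_expR.
have f0 : 0 < n.+1`!%:R :> R by rewrite ltr0n fact_gt0.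
rewrite mulrC -ler_pdivrMr// (le_trans _ (expR_ge1Dxn n a0))//.
by rewrite lerDr.
Qed.

Lemma expR_norm_le (a : R) : expR `|a| <= expR a + expR (- a).
Proof.
have [a0|a0] := leP 0 a; first by rewrite ger0_norm// lerDl expR_ge0.
by rewrite ltr0_norm// lerDr expR_ge0.
Qed.

(** An integrable majorant for all Gaussian integrands below: it dominates [|x|], [x^2] and
    [|x|^3 expR |x|], hence Taylor remainders uniformly in step sizes at most 1. *)
Definition gweight (x : R) := 6 * (expR (2 * x) + expR (- 2 * x)).

Lemma gweight_Intg : Intg gamma gweight.
Proof.
apply: IntgZ; apply: IntgD; [exact: (gauss_expR 2).1|exact: (gauss_expR (- 2)).1].
Qed.

Lemma cube_expR_le_gweight (x : R) : `|x| ^+ 3 * expR `|x| <= gweight x.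
Proof.
apply: (@le_trans _ _ (6 * expR `|x| * expR `|x|)).
  by rewrite ler_wpM2r ?expR_ge0// pow_le_expR.
rewrite /gweight -mulrA -expRD ler_pM2l// -{1 2}[`|x|]mul1r -mulrDl.
rewrite (_ : (1 + 1) * `|x| = `|2 * x|); last by rewrite normrM ger0_norm.
by rewrite mulNr expR_norm_le.
Qed.

Lemma gweight_ge0 x : 0 <= gweight x.
Proof. by rewrite (le_trans _ (cube_expR_le_gweight x))// mulr_ge0 ?expR_ge0// exprn_ge0. Qed.

Lemma Intg_gauss_dom (f : R -> R) (C : R) : measurable_fun (setT : set R) f ->
  (forall x, `|f x| <= C * gweight x) -> Intg gamma f.
Proof. by move=> mf fC; apply: (@Intg_dom _ _ _ gamma f (fun x => C * gweight x)) => //;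
  apply: IntgZ gweight_Intg. Qed.

(** Moments are read off from exponential moments as limits of difference quotients; this is the
    limit [a -> 0]. *)
Lemma small_eq0 (z C : R) : (forall a, 0 < a <= 1 -> `|z| <= C * a) -> z = 0.
Proof.
move=> h; apply/eqP; rewrite -normr_le0; apply/ler_addgt0Pr => e e0; rewrite add0r.
have C0 : 0 <= C by have := h 1; rewrite ltr01 lexx => /(_ isT); rewrite mulr1; apply: le_trans.
have C1 : 0 < C + 1 by rewrite ltr_wpDl.
pose a := Num.min 1 (e / (C + 1)).
have a0 : 0 < a by rewrite lt_min ltr01 divr_gt0.
have a1 : a <= 1 by rewrite ge_min lexx.
have ae : a <= e / (C + 1) by rewrite ge_min lexx orbT.
apply: (le_trans (h a _)); first by rewrite a0.
apply: (@le_trans _ _ ((C + 1) * a)); first by rewrite ler_wpM2r ?lerDl// ltW.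
by move: ae; rewrite ler_pdivlMr// mulrC.
Qed.

Lemma lin_le_gweight (x : R) : `|x| <= gweight x.
Proof.
rewrite (le_trans (pow_le_expR 1 (normr_ge0 x)))// mul1r.
rewrite (le_trans (expR_norm_le x))// /gweight.
have e1 : expR x <= 1 + expR (2 * x).
  by rewrite (_ : 2 * x = x + x) ?expRD; [have := expR_ge0 x; nra|ring].
have e2 : expR (- x) <= 1 + expR (- 2 * x).
  by rewrite (_ : - 2 * x = - x - x) ?expRD; [have := expR_ge0 (- x); nra|ring].
have e3 : 2 <= expR (2 * x) + expR (- 2 * x).
  by have := expR_ge1Dx (2 * x); have := expR_ge1Dx (- 2 * x); lra.
lra.
Qed.

Lemma sqr_le_gweight (x : R) : x ^+ 2 <= gweight x.
Proof.
have := pow_le_expR 2 (normr_ge0 (x)); rewrite real_normK ?num_real//.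
move=> /le_trans; apply.
rewrite (_ : (2`!)%:R = 2 :> R)//.
have h : expR `|x| <= 1 / 2 + expR (2 * `|x|).
  by rewrite (_ : 2 * `|x| = `|x| + `|x|) ?expRD; [have := expR_ge0 `|x|; nra|ring].
have h2 : expR (2 * `|x|) <= expR (2 * x) + expR (- 2 * x).
  rewrite (_ : 2 * `|x| = `|2 * x|); last by rewrite normrM ger0_norm.
  by rewrite mulNr expR_norm_le.
have e3 : 2 <= expR (2 * x) + expR (- 2 * x).
  by have := expR_ge1Dx (2 * x); have := expR_ge1Dx (- 2 * x); lra.
rewrite /gweight; lra.
Qed.

(** The odd part of the exponential moments: [2 a x] and [expR (a x) - expR (- a x)] differ by at
    most [2 a^3] times [gweight], and the second has expectation 0 by symmetry of the moments in
    [a]. *)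
Lemma gauss_mean : Intg gamma (fun x => x) /\ EX gamma (fun x => x) = 0.
Proof.
have I1 : Intg gamma (fun x => x).
  apply: (@Intg_gauss_dom _ 1) => // x; rewrite mul1r; exact: lin_le_gweight.
split=> //; apply: (@small_eq0 _ (2 * EX gamma gweight)) => a /andP[a0 a1].
have [Ip Ep] := gauss_expR a; have [In En] := gauss_expR (- a).
have IW := gweight_Intg.
have W0 : 0 <= EX gamma gweight by apply: EX_ge0 => x; exact: gweight_ge0.
have pw (x : R) : `|2 * a * x - (expR (a * x) - expR (- a * x))| <= 2 * a ^+ 3 * gweight x.
  have t1 := expR_taylor3 (a * x); have t2 := expR_taylor3 (- a * x).
  have e1 : `|a * x| = a * `|x| by rewrite normrM gtr0_norm.
  have e2 : `|- a * x| = a * `|x| by rewrite mulNr normrN.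
  have le : expR (a * `|x|) * (a * `|x|) ^+ 3 <= a ^+ 3 * gweight x.
    rewrite exprMn mulrCA ler_wpM2l ?exprn_ge0 ?(ltW a0)//.
    rewrite (le_trans _ (cube_expR_le_gweight x))// mulrC ler_wpM2l ?exprn_ge0//.
    by rewrite ler_expR ler_piMl.
  move: t1 t2; rewrite e1 e2 => t1 t2.
  have := le_trans t1 le; have := le_trans t2 le.
  rewrite !ler_norml => /andP[? ?] /andP[? ?]; apply/andP; split; nra.
have Id : Intg gamma (fun x => expR (a * x) - expR (- a * x)) by exact: IntgB.
have I2 : Intg gamma (fun x => 2 * a * x) by exact: IntgZ.
have := le_trans (EX_norm (IntgB I2 Id)) (EX_le (Intg_norm (IntgB I2 Id)) (IntgZ (2 * a ^+ 3) IW) pw).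
rewrite EXB// EXB// Ep En sqrrN subrr subr0 EXZ// EXZ// normrM (@ger0_norm _ (2 * a)) ?mulr_ge0 ?(ltW a0)//.
set W := EX gamma gweight in W0 *; set m := EX _ _ => h.
have : 2 * a * `|m| <= 2 * a * (a ^+ 2 * W) by rewrite (le_trans h)// le_eqVlt; apply/orP; left; apply/eqP; ring.
rewrite ler_pM2l ?mulr_gt0// => /le_trans; apply.
rewrite mulrC (_ : 2 * W * a = W * (2 * a)); last by ring.
rewrite ler_wpM2l// expr2; nra.
Qed.

(** The even part: [expR (a x) + expR (- a x) - 2] is [a^2 x^2] up to [O(a^3)] times [gweight], and
    its expectation [2 expR (a^2 / 2) - 2] is [a^2] up to [O(a^3)]. *)
Lemma gauss_var : Intg gamma (fun x => x ^+ 2) /\ EX gamma (fun x => x ^+ 2) = 1.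
Proof.
have I1 : Intg gamma (fun x => x ^+ 2).
  apply: (@Intg_gauss_dom _ 1) => [|x]; first exact: measurable_funX.
  by rewrite mul1r ger0_norm ?sqr_ge0//; exact: sqr_le_gweight.
split=> //; apply/eqP; rewrite -subr_eq0; apply/eqP.
apply: (@small_eq0 _ (2 * EX gamma gweight + (1 + 2 * expR 1))) => a /andP[a0 a1].
have [Ip Ep] := gauss_expR a; have [In En] := gauss_expR (- a).
have IW := gweight_Intg.
have W0 : 0 <= EX gamma gweight by apply: EX_ge0 => x; exact: gweight_ge0.
have pw (x : R) : `|a ^+ 2 * x ^+ 2 - (expR (a * x) + expR (- a * x) - 2)| <= 2 * a ^+ 3 * gweight x.
  have t1 := expR_taylor3 (a * x); have t2 := expR_taylor3 (- a * x).
  have e1 : `|a * x| = a * `|x| by rewrite normrM gtr0_norm.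
  have e2 : `|- a * x| = a * `|x| by rewrite mulNr normrN.
  have le : expR (a * `|x|) * (a * `|x|) ^+ 3 <= a ^+ 3 * gweight x.
    rewrite exprMn mulrCA ler_wpM2l ?exprn_ge0 ?(ltW a0)//.
    rewrite (le_trans _ (cube_expR_le_gweight x))// mulrC ler_wpM2l ?exprn_ge0//.
    by rewrite ler_expR ler_piMl.
  move: t1 t2; rewrite e1 e2 => t1 t2.
  have := le_trans t1 le; have := le_trans t2 le.
  rewrite !ler_norml => /andP[? ?] /andP[? ?]; apply/andP; split; nra.
have Id : Intg gamma (fun x => expR (a * x) + expR (- a * x) - 2).
  by apply: IntgB; [exact: IntgD|exact: Intg_cst].
have I2 : Intg gamma (fun x => a ^+ 2 * x ^+ 2) by exact: IntgZ.
have := le_trans (EX_norm (IntgB I2 Id)) (EX_le (Intg_norm (IntgB I2 Id)) (IntgZ (2 * a ^+ 3) IW) pw).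
rewrite EXB// EXZ// EXB; [|exact: IntgD|exact: Intg_cst].
rewrite EXD// EX_cst Ep En sqrrN EXZ//.
set W := EX gamma gweight in W0 *; set m := EX _ _ => h.
have a20 : 0 < a ^+ 2 by rewrite exprn_gt0.
have t := expR_taylor3 (a ^+ 2 / 2).
have h2 : `|expR (a ^+ 2 / 2) + expR (a ^+ 2 / 2) - 2 - a ^+ 2| <= (1 + 2 * expR 1) * a ^+ 3.
  have y0 : 0 <= a ^+ 2 / 2 by rewrite divr_ge0 ?sqr_ge0.
  have y1 : a ^+ 2 / 2 <= 1 by nra.
  have e1 : expR `|a ^+ 2 / 2| * `|a ^+ 2 / 2| ^+ 3 <= expR 1 * a ^+ 3.
    rewrite ger0_norm// ler_pM ?expR_ge0 ?exprn_ge0// ?ler_expR// lerXn2r ?nnegrE// ?(ltW a0)//; nra.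
  have y3 : (a ^+ 2 / 2) ^+ 2 <= a ^+ 3.
    by rewrite [leRHS]exprS (_ : (a ^+ 2 / 2) ^+ 2 = (a ^+ 2 / 4) * a ^+ 2); [nra|field].
  have := le_trans t e1; have y4 := sqr_ge0 (a ^+ 2 / 2).
  have a30 : 0 <= a ^+ 3 by rewrite exprn_ge0// ltW.
  rewrite !ler_norml => /andP[? ?]; apply/andP; split; lra.
rewrite -(@ler_pM2l _ (a ^+ 2))// -[X in X * `|_|]ger0_norm ?(ltW a20)// -normrM.
rewrite (_ : a ^+ 2 * (m - 1) = (a ^+ 2 * m - (expR (a ^+ 2 / 2) + expR (a ^+ 2 / 2) - 2)) +
  (expR (a ^+ 2 / 2) + expR (a ^+ 2 / 2) - 2 - a ^+ 2)); last by ring.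
rewrite (le_trans (ler_normD _ _))// (le_trans (lerD h h2))//.
by rewrite le_eqVlt; apply/orP; left; apply/eqP; ring.
Qed.

End gauss.

(** * Stability of the normal law under convolution *)

Section semigroup.
Context {R : realType}.
Notation mu := (@lebesgue_measure R).
Notation phi := (normal_pdf (0 : R) 1).
Notation gamma := (@gamma R).

(** The points [(x, (c u - a x) / b)] and [(u, (c x - a u) / b)] have the same Euclidean norm. On
    the left the second coordinate [y] solves [a x + b y = c u], so this is the rotation invariance
    of the Gaussian plane. *)
Lemma phi_rotate (a b c x u : R) : b != 0 -> a ^+ 2 + b ^+ 2 = c ^+ 2 ->
  phi x * phi ((c * u - a * x) / b) = phi u * phi ((c * x - a * u) / b).
Proof.
move=> b0 abc; rewrite !phiE mulrACA [RHS]mulrACA -!expRD; congr (_ * expR _).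
apply/eqP; rewrite -subr_eq0; apply/eqP.
rewrite [LHS](_ : _ =
   (u ^+ 2 - x ^+ 2) * (a ^+ 2 + b ^+ 2 - c ^+ 2) / b ^+ 2 / 2); last by field.
by rewrite abc subrr mulr0 !mul0r.
Qed.

Lemma int_phi_affine (k m : R) : 0 < k ->
  (\int[mu]_x (phi (k * x + m) * k)%:E = 1)%E.
Proof.
move=> k0; rewrite -affine_substitution//; first exact: integral_normal_pdf.
- exact: continuous_phi.
- by move=> x; rewrite ltW// phi_gt0.
Qed.

(** Substitute for [y] the variable [u] with [a x + b y = c u], exchange the integrals and rotate:
    the inner integral over [x] is that of an affinely rescaled density, equal to 1. The
    substitution divides by [b], whence the separate case [b = 0]. *)
Lemma gauss_convolution (h : R -> R) (s a b c : R) :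
  continuous h -> (forall x, 0 <= h x) -> 0 <= a -> 0 <= b -> 0 <= c ->
  a ^+ 2 + b ^+ 2 = c ^+ 2 ->
  (\int[gamma]_x \int[gamma]_y (h (s + a * x + b * y))%:E =
   \int[gamma]_z (h (s + c * z))%:E)%E.
Proof.
move=> ch h0 a0 b0 c0 abc.
have cst1 (r : R) : (\int[gamma]_x r%:E = r%:E)%E.
  have -> : (\int[gamma]_w r%:E = r%:E * gamma setT)%E.
    exact: (integral_cst gamma measurableT r%:E).
  by rewrite probability_setT mule1.
have [bz|bn] := eqVneq b 0.
  have -> : c = a.
    by apply/eqP; rewrite -(@eqrXn2 _ 2)// -abc bz expr0n addr0.
  by apply: eq_integral => x _; rewrite bz; under eq_integral do rewrite mul0r addr0.
have b1 : 0 < b by rewrite lt_neqAle eq_sym bn.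
have c1 : 0 < c.
  rewrite lt_neqAle c0 andbT eq_sym; apply/eqP => cz.
  move: abc; rewrite cz expr0n/= => /eqP; rewrite paddr_eq0 ?sqr_ge0//.
  by rewrite [b ^+ 2 == 0]sqrf_eq0 (negbTE bn) andbF.
have mh := cont_meas ch.
have m0 : measurable_fun (setT : set R) (fun x : R => x) by [].
have maff (p q : R) : measurable_fun (setT : set R) (fun x : R => p + q * x).
  by apply: measurable_funD => //; exact: measurable_funM.
have kb : 0 < c / b by rewrite divr_gt0.
have caff (p q : R) : continuous (fun x : R => p + q * x).
  apply: (@continuous_of_derive _ _ (fun=> q)) => x.
  by apply: (drv_eq (drvD (drv_cst p x) (drvM (drv_cst q x) (drv_id x)))); ring.
have chaff (p q : R) : continuous (fun x : R => h (p + q * x)).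
  by move=> x; apply: (@continuous_comp _ _ _ (fun x => p + q * x) h); [exact: caff|exact: ch].
have kb0 := ltW kb.
have phi0 (x : R) : 0 <= phi x by rewrite ltW// phi_gt0.
pose K (z : R * R) : \bar R :=
  (h (s + c * z.2) * (c / b) * (phi z.1 * phi ((c * z.2 - a * z.1) / b)))%:E.
have m1 : measurable_fun setT (fun z : R * R => z.1) by exact: measurable_fst.
have m2 : measurable_fun setT (fun z : R * R => z.2) by exact: measurable_snd.
have mphi := @measurable_phi R.
have mK : measurable_fun setT K.
  apply/measurable_EFinP; apply: measurable_funM.
    apply: measurable_funM => //; apply: (measurableT_comp mh).
    by apply: measurable_funD => //; exact: measurable_funM.
  apply: measurable_funM; first exact: (measurableT_comp mphi).
  apply: (measurableT_comp mphi); apply: measurable_funM => //.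
  by apply: measurable_funB; exact: measurable_funM.
have K0 z : (0 <= K z)%E.
  by rewrite lee_fin !mulr_ge0 ?invr_ge0//.
have inner (x : R) : ((\int[gamma]_y (h (s + a * x + b * y))%:E) * (phi x)%:E =
    \int[mu]_u K (x, u))%E.
  rewrite gauss_density//; last 2 first.
  - apply/measurable_EFinP; apply: (measurableT_comp mh); exact: maff.
  - by move=> y; rewrite lee_fin.
  under eq_integral do rewrite -EFinM.
  rewrite (@affine_substitution _ (fun y => h (s + a * x + b * y) * phi y) (c / b) (- (a * x / b)))//.
  + rewrite -ge0_integralZr ?lee_fin ?(ltW (phi_gt0 _))//.
    * apply: eq_integral => u _; rewrite -EFinM /K/=; congr (_%:E).
      have -> : b * (c / b * u + - (a * x / b)) = c * u - a * x by field.
      have -> : c / b * u + - (a * x / b) = (c * u - a * x) / b by field.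
      have -> : s + a * x + (c * u - a * x) = s + c * u by ring.
      by ring.
    * apply/measurable_EFinP; apply: measurable_funM => //; apply: measurable_funM => //.
      + apply: (measurableT_comp mh); apply: measurable_funD => //.
        by apply: measurable_funM => //; apply: measurable_funD => //; exact: measurable_funM.
      + by apply: (measurableT_comp mphi); apply: measurable_funD => //; exact: measurable_funM.
    * by move=> y _; rewrite lee_fin !mulr_ge0 ?invr_ge0//.
  + by move=> y; apply: continuousM; [exact: chaff|exact: continuous_phi].
  + by move=> y; rewrite mulr_ge0//.
have mH : measurable_fun (setT : set R) (fun x => \int[gamma]_y (h (s + a * x + b * y))%:E)%E.
  apply: (@measurable_fun_fubini_tonelli_F _ _ R (measurableTypeR R) R gamma
    (fun z => (h (s + a * z.1 + b * z.2))%:E)) => [|z].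
    apply/measurable_EFinP; apply: (measurableT_comp mh).
    apply: measurable_funD; last exact: measurable_funM.
    by apply: measurable_funD => //; exact: measurable_funM.
  by rewrite lee_fin.
rewrite gauss_density//; last by move=> x; apply: integral_ge0 => y _; rewrite lee_fin.
under eq_integral do rewrite inner.
rewrite (@fubini_tonelli _ _ _ _ _ mu mu K mK K0) gauss_density//; last 2 first.
- by apply/measurable_EFinP; apply: (measurableT_comp mh); exact: maff.
- by move=> z; rewrite lee_fin.
apply: eq_integral => u _; rewrite -EFinM.
transitivity (\int[mu]_x ((h (s + c * u) * phi u)%:E *
   (phi (c / b * x + - (a * u / b)) * (c / b))%:E))%E.
  apply: eq_integral => x _; rewrite /K/= -EFinM; congr (_%:E).
  rewrite (phi_rotate x u bn abc) (_ : c / b * x + - (a * u / b) = (c * x - a * u) / b).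
    by ring.
  by field.
rewrite ge0_integralZl//.
- by rewrite int_phi_affine// mule1.
- apply/measurable_EFinP; apply: measurable_funM => //.
  by apply: (measurableT_comp mphi); apply: measurable_funD => //; exact: measurable_funM.
- by move=> x _; rewrite lee_fin mulr_ge0.
- by rewrite lee_fin mulr_ge0.
Qed.

End semigroup.

(** * The normal tail and its logistic smoothing *)

Section gauss_tail.
Context {R : realType}.
Notation mu := (@lebesgue_measure R).
Notation phi := (normal_pdf (0 : R) 1).
Notation gamma := (@gamma R).

Definition tail (x : R) : R := fine (gamma `]x, +oo[%classic).

Lemma phi_anti (x y : R) : 0 <= x -> x <= y -> phi y <= phi x.
Proof.
move=> x0 xy; rewrite !phiE ler_wpM2l ?normal_peak_ge0// ler_expR.
by rewrite ler_pM2r// lerN2 lerXn2r// nnegrE (le_trans x0).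
Qed.

Lemma gammaE (A : set R) : (gamma A = \int[mu]_(x in A) (phi x)%:E)%E.
Proof. by []. Qed.

Lemma tailE (x : R) : gamma `]x, +oo[%classic = (tail x)%:E.
Proof. by rewrite /tail fineK// fin_num_measure. Qed.

Lemma tail_anti (x y : R) : x <= y -> tail y <= tail x.
Proof.
move=> xy; rewrite -lee_fin -!tailE; apply: le_measure; rewrite ?inE//.
by move=> z /=; rewrite !in_itv/= !andbT; apply: le_lt_trans.
Qed.

Lemma mphiT (A : set R) : measurable_fun A (fun x => (phi x)%:E).
Proof. by apply: measurable_funTS; apply/measurable_EFinP; exact: measurable_phi. Qed.

(** The density on []x, x + e]] is at least its value at the right end. With [e = x^-1] this is
    Mills's lower bound up to a constant. *)
Lemma tail_lower (x e : R) : 0 <= x -> 0 < e -> e * phi (x + e) <= tail x.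
Proof.
move=> x0 e0; rewrite -lee_fin -tailE.
apply: (@le_trans _ _ (gamma `]x, (x + e)]%classic)); last first.
  apply: le_measure; rewrite ?inE//.
  by move=> z /=; rewrite !in_itv/= andbT => /andP[].
rewrite gammaE.
apply: (@le_trans _ _ (\int[mu]_(z in `]x, (x + e)%R]) (phi (x + e)%R)%:E)%E).
  rewrite integral_cst//= lebesgue_measure_itv/= lte_fin ltrDl e0.
  by rewrite -EFinB -EFinM lee_fin [x + e]addrC addrK mulrC.
apply: ge0_le_integral => //.
- by move=> z _; rewrite lee_fin ltW// phi_gt0.
- exact: mphiT.
- move=> z /=; rewrite in_itv/= => /andP[xz ze]; rewrite lee_fin.
  by apply: phi_anti => //; rewrite (le_trans x0)// ltW.
Qed.

Lemma tail_gt0 (x : R) : 0 <= x -> 0 < tail x.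
Proof.
by move=> x0; rewrite (lt_le_trans _ (tail_lower x0 ltr01))// mul1r phi_gt0.
Qed.

Lemma tail_local (a x : R) : 0 <= a -> a <= x -> tail a <= tail x + (x - a) * phi a.
Proof.
move=> a0 ax; rewrite -lee_fin EFinD -!tailE.
rewrite (_ : `]a, +oo[%classic = `]a, x] `|` `]x, +oo[); last first.
  apply/seteqP; split=> z /=; rewrite !in_itv/= !andbT.
    by case: (leP z x) => [zx ->|xz az]; [left|right].
  by case=> [/andP[]//|]; apply: le_lt_trans.
apply: (le_trans (measureU2 _ _ _)) => //.
rewrite addeC; apply: leeD => //.
suff: (\int[mu]_(z in `]a, x]) (phi z)%:E <= ((x - a)%R * phi a)%:E)%E by [].
apply: (@le_trans _ _ (\int[mu]_(z in `]a, x]) (phi a)%:E)%E).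
  apply: ge0_le_integral => //.
  - by move=> z _; rewrite lee_fin ltW// phi_gt0.
  - exact: mphiT.
  - move=> z /=; rewrite in_itv/= => /andP[xz ze]; rewrite lee_fin.
    by apply: phi_anti => //; exact: ltW.
rewrite integral_cst//= lebesgue_measure_itv/= lte_fin; case: ifP => h.
  by rewrite -EFinB -EFinM lee_fin mulrC.
by rewrite mule0 lee_fin mulr_ge0 ?subr_ge0// ltW// phi_gt0.
Qed.

Lemma tail_upper (x : R) : 0 <= x -> tail x <= expR (- x ^+ 2 / 2).
Proof.
move=> x0; have [I E] := gauss_expR x.
have m : measurable (`]x, +oo[ : set R) by [].
have := @prob_le_EX _ _ _ gamma `]x, +oo[%classic (fun z => expR (- x ^+ 2) * expR (x * z)) m.
rewrite tailE lee_fin EXZ// E -expRD (_ : - x ^+ 2 + x ^+ 2 / 2 = - x ^+ 2 / 2); last by field.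
apply; first exact: IntgZ.
  by move=> z; rewrite mulr_ge0 ?expR_ge0.
move=> z /=; rewrite in_itv/= andbT => xz.
by rewrite -expRD -[leLHS]expR0 ler_expR addrC subr_ge0 expr2 ler_wpM2l// ltW.
Qed.

Lemma Phi_tail (x : R) : Phi x = (1 - tail x)%:E.
Proof.
rewrite EFinB -tailE (_ : Phi x = gamma `]-oo, x]%classic)//.
rewrite -(@probability_setT _ _ _ gamma) (_ : setT = `]-oo, x] `|` `]x, +oo[ :> set R); last first.
  apply/seteqP; split=> // z _ /=; rewrite !in_itv/= andbT.
  by case: (leP z x); [left|right].
rewrite measureU//; last first.
  apply/seteqP; split=> z //= []; rewrite !in_itv/= andbT => zx.
  by rewrite ltNge zx.
by rewrite addeK// fin_num_measure.
Qed.

Lemma int_expR_Ny (a c : R) : 0 < c ->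
  (\int[mu]_(x in `]-oo, a]) (expR (c * (x - a)))%:E = (c^-1)%:E)%E.
Proof.
move=> c0.
have dlin (x : R) : is_derive x 1 (fun x : R => c * (- x - a)) (- c).
  by apply: (drv_eq (drvM (drv_cst c x) (drvB (drvN (drv_id x)) (drv_cst a x)))); ring.
have dE (x : R) : is_derive x 1 (fun x : R => expR (c * (- x - a)))
    (expR (c * (- x - a)) * - c).
  exact: (drv_comp (dlin x) (is_derive_expR _)).
have dF (x : R) : is_derive x 1 (fun x : R => - (c^-1 * expR (c * (- x - a))))
    (expR (c * (- x - a))).
  apply: (drv_eq (drvN (drvM (drv_cst c^-1 x) (drv_comp (dlin x) (is_derive_expR _))))).
  by rewrite mulr0 addr0; field; rewrite gt_eqF.
have dG (x : R) : is_derive x 1 (fun x : R => expR (c * (x - a))) (c * expR (c * (x - a))).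
  apply: (drv_eq (drv_comp (drvM (drv_cst c x) (drvB (drv_id x) (drv_cst a x))) (is_derive_expR _))).
  by ring.
have := @ge0_integration_by_substitutionNy R (fun x => expR (c * (x - a))) (- a).
rewrite opprK => ->.
- rewrite (@ge0_continuous_FTC2y _ _ (fun x : R => - (c^-1 * expR (c * (- x - a)))) (- a) 0).
  + by rewrite -EFinB (_ : c * (- - a - a) = 0); [rewrite expR0 mulr1 sub0r opprK|ring].
  + by move=> x _; rewrite expR_ge0.
  + by apply: continuous_subspaceT; exact: (continuous_of_derive dE).
  + rewrite -oppr0; apply: cvgN; rewrite -(mulr0 c^-1); apply: cvgM; first exact: cvg_cst.
    rewrite (_ : (fun x => expR (c * (- x - a))) =
       (fun y => expR (- y)) \o (fun x => (x + a) * c)); last first.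
      by apply/funext => x /=; congr expR; ring.
    apply: cvg_comp; last exact: cvgr_expR.
    by apply/gt0_cvgMly => //; exact: cvg_addrr.
  + by move=> x _; have [] := dF x.
  + apply: cvg_at_right_filter; exact: (continuous_of_derive dF).
  + by move=> x _; rewrite derive1E; exact: derive_val.
- by apply: continuous_subspaceT; exact: (continuous_of_derive dG).
- by move=> x _; rewrite expR_ge0.
Qed.

(** The exponent on the right is the tangent at [a] of the concave function [- g^2 / 2]. *)
Lemma phi_le_expR (a g : R) : phi g <= phi a * expR (a * (a - g)).
Proof.
rewrite !phiE -mulrA -expRD ler_wpM2l ?normal_peak_ge0// ler_expR.
by have := sqr_ge0 (a - g); rewrite !expr2; lra.
Qed.

(** Above [a] the logistic is at most 1, which gives the tail. Below [a], [logistic_le_expR] and the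
    tangent bound for [phi] leave [phi a * expR ((k - a) * (g - a))], integrable because [a < k],
    with integral [phi a / (k - a)]. *)
Lemma gauss_logistic (k a : R) : 0 <= a -> a < k ->
  (\int[gamma]_g (logistic (k * (g - a)))%:E <= (tail a + phi a / (k - a))%:E)%E.
Proof.
move=> a0 ak; have c0 : 0 < k - a by rewrite subr_gt0.
have mlin (q : R) : measurable_fun (setT : set R) (fun g : R => q * (g - a)).
  by apply: measurable_funM => //; exact: measurable_funB.
have ml : measurable_fun (setT : set R) (fun g => logistic (k * (g - a))).
  apply: (measurableT_comp (cont_meas _)) => //.
  exact: (continuous_of_derive is_derive_logistic).
have mphi := @measurable_phi R.
have phi0 (x : R) : 0 <= phi x by rewrite ltW// phi_gt0.
rewrite gauss_density//; last 2 first.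
- exact/measurable_EFinP.
- by move=> x; rewrite lee_fin ltW// logistic_gt0.
have mlp : measurable_fun (setT : set R) (fun x => (logistic (k * (x - a)) * phi x)%:E).
  by apply/measurable_EFinP; exact: measurable_funM.
under eq_integral do rewrite -EFinM.
rewrite -(setUv (`]-oo, a]%classic : set R)) setCitvl ge0_integral_setU//=; last 3 first.
- by rewrite -setCitvl setUv.
- by move=> x _; rewrite lee_fin mulr_ge0// ltW// logistic_gt0.
- by rewrite -setCitvl; apply/disj_setPCl.
rewrite addeC EFinD; apply: leeD.
- rewrite -tailE gammaE; apply: ge0_le_integral => //.
  + by move=> x _; rewrite lee_fin mulr_ge0// ltW// logistic_gt0.
  + exact: measurable_funTS.
  + exact: mphiT.
  + by move=> x _; rewrite lee_fin ler_piMl// ltW// logistic_lt1.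
- apply: (@le_trans _ _ (\int[mu]_(x in `]-oo, a]) ((phi a)%:E * (expR ((k - a) * (x - a)))%:E))%E).
    apply: ge0_le_integral => //.
    + by move=> x _; rewrite lee_fin mulr_ge0// ltW// logistic_gt0.
    + exact: measurable_funTS.
    + apply: measurable_funTS; apply/measurable_EFinP; apply: measurable_funM => //.
      apply: (measurableT_comp (@measurable_expR R)); exact: mlin.
    + move=> x _; rewrite -EFinM lee_fin.
      apply: (@le_trans _ _ (expR (k * (x - a)) * (phi a * expR (a * (a - x))))).
        by rewrite ler_pM ?logistic_le_expR ?phi_le_expR// ltW// logistic_gt0.
      rewrite mulrCA -expRD ler_wpM2l// ler_expR.
      by rewrite le_eqVlt; apply/orP; left; apply/eqP; ring.
  rewrite ge0_integralZl ?lee_fin//.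
  + by rewrite int_expR_Ny// -EFinM.
  + apply: measurable_funTS; apply/measurable_EFinP.
    apply: (measurableT_comp (@measurable_expR R)); exact: mlin.
Qed.

End gauss_tail.

(** * A Lindeberg comparison *)

Lemma remainder_ub (R : realType) (a b c d r r' : R) :
  a - b - c - d <= r -> r <= r' -> a <= b + c + d + r'.
Proof. lra. Qed.

Lemma remainder_lb (R : realType) (a b c d r r' : R) :
  - r <= a - b - c - d -> r <= r' -> b + c + d - r' <= a.
Proof. lra. Qed.

Section heat.
Context {R : realType}.
Notation gamma := (@gamma R).
Variables (k c : R).
Hypothesis k0 : 0 < k.

(** The logistic step of slope [k] at [c], smoothed by a Gaussian of variance [t]: a solution of the
    heat equation in which [t] records the variance swapped in so far. [heat1] and [heat2] play the
    part of its first two derivatives in [s]. *)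
Definition heat (t s : R) : R :=
  EX gamma (fun g => logistic (k * (s + Num.sqrt t * g - c))).
Definition heat1 (t s : R) : R :=
  EX gamma (fun g => k * logistic1 (k * (s + Num.sqrt t * g - c))).
Definition heat2 (t s : R) : R :=
  EX gamma (fun g => k ^+ 2 * logistic2 (k * (s + Num.sqrt t * g - c))).

Lemma meas_aff (p q r u : R) :
  measurable_fun (setT : set R) (fun g : R => p * (q + r * g - u)).
Proof.
apply: measurable_funM => //; apply: measurable_funB => //.
by apply: measurable_funD => //; exact: measurable_funM.
Qed.

Lemma meas_logistic : measurable_fun (setT : set R) (@logistic R).
Proof. by apply: cont_meas; exact: (continuous_of_derive is_derive_logistic). Qed.

Lemma meas_logistic1 : measurable_fun (setT : set R) (@logistic1 R).
Proof. by apply: cont_meas; exact: (continuous_of_derive is_derive_logistic1). Qed.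

Lemma meas_logistic2 : measurable_fun (setT : set R) (@logistic2 R).
Proof. by apply: cont_meas; exact: (continuous_of_derive is_derive_logistic2). Qed.

Lemma Intg_heat t s : Intg gamma (fun g => logistic (k * (s + Num.sqrt t * g - c))).
Proof.
apply: (@Intg_bdd _ _ _ _ _ 1); first exact: (measurableT_comp meas_logistic (meas_aff _ _ _ _)).
by move=> g; rewrite ger0_norm ?(ltW (logistic_gt0 _))// ltW// logistic_lt1.
Qed.

Lemma Intg_heat1 t s : Intg gamma (fun g => k * logistic1 (k * (s + Num.sqrt t * g - c))).
Proof.
apply: IntgZ; apply: (@Intg_bdd _ _ _ _ _ 1).
  exact: (measurableT_comp meas_logistic1 (meas_aff _ _ _ _)).
move=> g; have /andP[h0 h1] := logistic1_bound (k * (s + Num.sqrt t * g - c)).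
by rewrite ger0_norm// (le_trans h1)// ltW// logistic_lt1.
Qed.

Lemma Intg_heat2 t s : Intg gamma (fun g => k ^+ 2 * logistic2 (k * (s + Num.sqrt t * g - c))).
Proof.
apply: IntgZ; apply: (@Intg_bdd _ _ _ _ _ 1).
  exact: (measurableT_comp meas_logistic2 (meas_aff _ _ _ _)).
by move=> g; rewrite (le_trans (logistic2_bound _))// ltW// logistic_lt1.
Qed.

Lemma heat_ge0 t s : 0 <= heat t s.
Proof. by apply: EX_ge0 => g; rewrite ltW// logistic_gt0. Qed.

Lemma heat_le1 t s : heat t s <= 1.
Proof.
rewrite -[leRHS](EX_cst gamma 1); apply: EX_le => [||g]; [exact: Intg_heat|exact: Intg_cst|].
by rewrite ltW// logistic_lt1.
Qed.

Lemma heat2_bound t s : `|heat2 t s| <= k ^+ 2 * heat t s.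
Proof.
rewrite (le_trans (EX_norm (Intg_heat2 t s)))// -EXZ; last exact: Intg_heat.
apply: EX_le; [exact/Intg_norm/Intg_heat2|exact/IntgZ/Intg_heat|move=> g].
by rewrite normrM ger0_norm ?sqr_ge0// ler_wpM2l ?sqr_ge0// logistic2_bound.
Qed.

Lemma heat_taylor t s y :
  `|heat t (s + y) - heat t s - heat1 t s * y - heat2 t s * (y ^+ 2 / 2)|
  <= heat t s * (expR (k * `|y|) * (k * `|y|) ^+ 3).
Proof.
have I0 := Intg_heat t s; have I0' := Intg_heat t (s + y).
have I1 := Intg_heat1 t s; have I2 := Intg_heat2 t s.
have IA := IntgB I0' I0; have IB := IntgB IA (IntgZr y I1).
have IC := IntgB IB (IntgZr (y ^+ 2 / 2) I2).
rewrite /heat /heat1 /heat2 -EXZr// -EXZr// -EXB// -EXB//; last exact: IntgZr.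
rewrite -EXB//; last exact: IntgZr.
rewrite -EXZr//; apply: (le_trans (EX_norm IC)).
apply: EX_le => [||g]; [exact: Intg_norm|exact: IntgZr|].
have := logistic_taylor3 (k * (s + Num.sqrt t * g - c)) (k * y).
rewrite (_ : k * (s + Num.sqrt t * g - c) + k * y = k * (s + y + Num.sqrt t * g - c)); last by ring.
rewrite normrM (gtr0_norm k0) => h.
rewrite [leRHS]mulrA; apply: le_trans h.
by rewrite le_eqVlt; apply/orP; left; apply/eqP; congr `|_|; field.
Qed.

Lemma heat_lipschitz t s y : `|heat t (s + y) - heat t s| <= k * `|y|.
Proof.
have I0 := Intg_heat t s; have I0' := Intg_heat t (s + y).
rewrite /heat -EXB//; apply: (le_trans (EX_norm (IntgB I0' I0))).
rewrite -[leRHS](EX_cst gamma); apply: EX_le => [||g]; [exact/Intg_norm/IntgB|exact: Intg_cst|].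
have h := @mean_value_bound R (@logistic R) (@logistic1 R) (k * (s + Num.sqrt t * g - c)) (k * y) 1
  is_derive_logistic.
rewrite (_ : k * (s + y + Num.sqrt t * g - c) = k * (s + Num.sqrt t * g - c) + k * y); last by ring.
apply: (le_trans (h _)) => [x _|].
  have /andP[h0 h1] := logistic1_bound x.
  by rewrite ger0_norm// (le_trans h1)// ltW// logistic_lt1.
by rewrite mul1r normrM (gtr0_norm k0).
Qed.

Lemma heat_continuous t : continuous (heat t).
Proof.
move=> s; apply/cvgrPdist_le => e e0.
near=> z; rewrite distrC (_ : z = s + (z - s)); last by rewrite addrC subrK.
apply: (le_trans (heat_lipschitz _ _ _)).
rewrite mulrC -ler_pdivlMr// distrC.
near: z; apply: cvgr_dist_le; [exact: cvg_id|exact: divr_gt0].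
Unshelve. all: by end_near. Qed.

Lemma heat_meas t : measurable_fun (setT : set R) (heat t).
Proof. by apply: cont_meas; exact: heat_continuous. Qed.

Lemma Intg_heat_comp d (T : measurableType d) (P : probability T R) (Y : T -> R) t :
  measurable_fun setT Y -> Intg P (fun w => heat t (Y w)).
Proof.
move=> mY; apply: (@Intg_bdd _ _ _ _ _ 1); first exact: (measurableT_comp (heat_meas t)).
by move=> w; rewrite ger0_norm ?heat_ge0// heat_le1.
Qed.

Lemma heat_int t s : (\int[gamma]_g (logistic (k * (s + Num.sqrt t * g - c)))%:E =
  (heat t s)%:E)%E.
Proof. by rewrite EX_fin//; exact: Intg_heat. Qed.

(** Variances of independent Gaussians add, so swapping in one more Gaussian amounts to increasing
    the time. *)
Lemma heat_semigroup t t' s : 0 <= t -> 0 <= t' ->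
  EX gamma (fun g => heat t (s + Num.sqrt t' * g)) = heat (t + t') s.
Proof.
move=> t0 t'0.
have maff : measurable_fun (setT : set R) (fun g : R => s + Num.sqrt t' * g).
  by apply: measurable_funD => //; exact: measurable_funM.
have mI : Intg gamma (fun g => heat t (s + Num.sqrt t' * g)).
  exact: Intg_heat_comp.
have E1 := EX_fin mI; have E2 := heat_int (t + t') s.
apply: EFin_inj; apply: (etrans (esym E1)); apply: (etrans _ E2).
have cl : continuous (fun z : R => logistic (k * (z - c))).
  have dl (z : R) : is_derive z 1 (fun z : R => k * (z - c)) k.
    by apply: (drv_eq (drvM (drv_cst k z) (drvB (drv_id z) (drv_cst c z)))); ring.
  exact: (continuous_of_derive (fun z => drv_comp (dl z) (is_derive_logistic _))).
rewrite -(@gauss_convolution R (fun z => logistic (k * (z - c))) s (Num.sqrt t')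
  (Num.sqrt t) (Num.sqrt (t + t')))//; last 2 first.
- by move=> z; rewrite ltW// logistic_gt0.
- by rewrite !sqr_sqrtr ?addr_ge0// addrC.
by apply: eq_integral => x _; rewrite -heat_int.
Qed.

Definition gW : R := EX gamma (@gweight R).

Lemma gW_ge0 : 0 <= gW.
Proof. by apply: EX_ge0 => x; exact: gweight_ge0. Qed.

(** The Gaussian half of the swap, one-sided like the comparison itself. Mean 0 and variance 1
    identify the terms of order one and two; [k * Num.sqrt v <= 1] lets [gweight] dominate the
    remainder. *)
Lemma heat_gauss_lower t v s : 0 <= t -> 0 <= v -> k * Num.sqrt v <= 1 ->
  heat t s + heat2 t s * (v / 2) - heat t s * (gW * (k * Num.sqrt v) ^+ 3)
  <= heat (t + v) s.
Proof.
move=> t0 v0 kv; rewrite -heat_semigroup//.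
set sg := Num.sqrt v in kv *.
have sg0 : 0 <= sg by exact: sqrtr_ge0.
have [Im Em] := @gauss_mean R; have [Iv Ev] := @gauss_var R.
have IW := @gweight_Intg R.
have E : heat t s + heat2 t s * (v / 2) - heat t s * (gW * (k * sg) ^+ 3) =
   EX gamma (fun g => heat t s + heat1 t s * sg * g + heat2 t s * (v / 2) * g ^+ 2 -
     heat t s * (k * sg) ^+ 3 * gweight g).
  rewrite EXB; [|by repeat apply: IntgD; [exact: Intg_cst|exact: IntgZ|exact: IntgZ]|exact: IntgZ].
  rewrite EXD; [|by apply: IntgD; [exact: Intg_cst|exact: IntgZ]|exact: IntgZ].
  rewrite EXD; [|exact: Intg_cst|exact: IntgZ].
  rewrite EX_cst (@EXZ _ _ _ gamma _ (fun g => g))// Em.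
  rewrite (@EXZ _ _ _ gamma _ (fun g => g ^+ 2))// Ev.
  by rewrite (@EXZ _ _ _ gamma _ (@gweight R))// -/gW; ring.
rewrite E; apply: EX_le.
- apply: IntgB; last exact: IntgZ.
  by repeat apply: IntgD; [exact: Intg_cst|exact: IntgZ|exact: IntgZ].
- apply: Intg_heat_comp; apply: (@measR R).
  by apply: measurable_funD => //; exact: measurable_funM.
move=> g; have := heat_taylor t s (sg * g).
rewrite ler_norml => /andP[h _].
have e1 : k * `|sg * g| = (k * sg) * `|g| by rewrite normrM ger0_norm// mulrA.
have ks0 : 0 <= k * sg by rewrite mulr_ge0// ltW.
have h2 : heat t s * (expR (k * `|sg * g|) * (k * `|sg * g|) ^+ 3) <=
   heat t s * (k * sg) ^+ 3 * gweight g.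
  rewrite e1 -[leRHS]mulrA ler_wpM2l ?heat_ge0// exprMn mulrCA ler_wpM2l ?exprn_ge0//.
  rewrite (le_trans _ (cube_expR_le_gweight g))// mulrC ler_wpM2l ?exprn_ge0//.
  by rewrite ler_expR ler_piMl.
have e2 : (sg * g) ^+ 2 = v * g ^+ 2 by rewrite exprMn sqr_sqrtr.
rewrite e2 in h; apply: le_trans (remainder_lb h h2).
by rewrite le_eqVlt; apply/orP; left; apply/eqP; ring.
Qed.

End heat.

(** * Replacing one bounded summand by a Gaussian *)

Lemma swap_arith1 (R : realType) (x W : R) : 0 <= x -> 0 <= W ->
  2 * (1 + W) * x <= 1 -> x ^+ 2 / 2 + W * x ^+ 3 <= 1 / 2.
Proof.
move=> x0 W0 h; have Wx : 0 <= W * x by exact: mulr_ge0.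
have x1 : x <= 1 / 2 by lra.
have Wx1 : W * x <= 1 / 2 by lra.
have x2 : x ^+ 2 <= 1 / 2 by rewrite expr2; nra.
rewrite (_ : W * x ^+ 3 = W * x * x ^+ 2); last by ring.
have := sqr_ge0 x; set y := x ^+ 2 in x2 *; set z := W * x in Wx Wx1 *; nra.
Qed.

Lemma swap_arith2 (R : realType) (H H' a q g : R) : 0 <= H -> q + g <= 1 / 2 ->
  - (q * H) <= a -> H + a - H * g <= H' -> H <= 2 * H'.
Proof. by move=> H0 qg; have := ler_wpM2r H0 qg; lra. Qed.

Lemma swap_arith3 (R : realType) (H H' q : R) : 0 <= q -> H <= 2 * H' ->
  H' + H * q <= (1 + 2 * q) * H'.
Proof. by move=> q0 h; have := ler_wpM2r q0 h; lra. Qed.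

Lemma swap_arith4 (R : realType) (H W k sg r : R) : 0 <= H -> 0 <= W -> 0 <= k ->
  sg ^+ 3 <= r -> H * (W * (k * sg) ^+ 3) <= H * (W * k ^+ 3 * r).
Proof.
move=> H0 W0 k0 h; rewrite ler_wpM2l// exprMn mulrA ler_wpM2l//.
by rewrite mulr_ge0// exprn_ge0.
Qed.

Lemma swap_arith5 (R : realType) (E H H' a x W k r g : R) :
  E <= H + a + H * (x * k) * r -> H + a - H * g <= H' ->
  H * g <= H * (W * k * r) -> E <= H' + H * ((x + W) * k * r).
Proof. by move=> h1 h2 h3; lra. Qed.

Section swap.
Context {R : realType}.
Variables (k c : R).
Hypothesis k0 : 0 < k.
Context {d : measure_display} {T : measurableType d} (P : probability T R).
Local Notation heat := (heat k c).
Local Notation gW := (@gW R).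

(* Lyapunov's inequality between second and third moments, through
   3 a y^2 <= 2 |y|^3 + a^3 *)
Lemma sqrt_var_le (Y : T -> R) : Intg P (fun w => `|Y w| ^+ 3) ->
  Intg P (fun w => Y w ^+ 2) ->
  Num.sqrt (EX P (fun w => Y w ^+ 2)) ^+ 3 <= EX P (fun w => `|Y w| ^+ 3).
Proof.
move=> I3 I2; set v := EX P _; set a := Num.sqrt v.
have v0 : 0 <= v by apply: EX_ge0 => w; exact: sqr_ge0.
have a0 : 0 <= a by exact: sqrtr_ge0.
have va : v = a ^+ 2 by rewrite sqr_sqrtr.
have := @EX_le _ _ _ P (fun w => 3 * a * Y w ^+ 2) (fun w => 2 * `|Y w| ^+ 3 + a ^+ 3).
rewrite EXZ// EXD; [|exact: IntgZ|exact: Intg_cst].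
rewrite EXZ// EX_cst -/v => h; have {}h : 3 * a * v <= 2 * EX P (fun w => `|Y w| ^+ 3) + a ^+ 3.
  apply: h; [exact: IntgZ|by apply: IntgD; [exact: IntgZ|exact: Intg_cst]|move=> w].
  rewrite -(@real_normK _ (Y w)) ?num_real//; have y0 := normr_ge0 (Y w).
  set y := `|Y w| in y0 *.
  have : 0 <= (y - a) ^+ 2 * (2 * y + a) by rewrite mulr_ge0 ?sqr_ge0// addr_ge0// mulr_ge0.
  rewrite !exprS expr0; lra.
rewrite va !exprS expr0 in h *; lra.
Qed.

(** The expansions for [Y] and for a Gaussian of equal variance share the terms of order zero and
    two, and both first-order terms vanish. The difference is a multiple of [heat t s], hence of the
    target [heat (t + v) s], and is written as an exponential so that the costs of successive swaps
    multiply. *)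
Lemma heat_swap (Y : T -> R) (t s m : R) : measurable_fun setT Y -> 0 <= t ->
  (forall w, `|Y w| <= m) -> EX P Y = 0 ->
  2 * (1 + gW) * (k * Num.sqrt (EX P (fun w => Y w ^+ 2))) <= 1 ->
  EX P (fun w => heat t (s + Y w)) <=
  expR (2 * (expR (k * m) + gW) * k ^+ 3 * EX P (fun w => `|Y w| ^+ 3)) *
  heat (t + EX P (fun w => Y w ^+ 2)) s.
Proof.
move=> mY t0 Ym EY.
have I1 : Intg P Y by exact: Intg_bdd Ym.
have I2 : Intg P (fun w => Y w ^+ 2).
  apply: (@Intg_bdd _ _ _ _ _ (m ^+ 2)) => [|w]; first exact: measurable_funX.
  by rewrite normrX lerXn2r ?nnegrE// (le_trans _ (Ym w)).
have I3 : Intg P (fun w => `|Y w| ^+ 3).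
  apply: (@Intg_bdd _ _ _ _ _ (m ^+ 3)) => [|w].
    by apply: measurable_funX; exact: (measurableT_comp _ mY).
  by rewrite ger0_norm ?exprn_ge0// lerXn2r ?nnegrE// (le_trans _ (Ym w)).
have I2' : Intg P (fun w => Y w ^+ 2 / 2) by exact: IntgZr.
have sv := sqrt_var_le I3 I2.
have v0 : 0 <= EX P (fun w => Y w ^+ 2) by apply: EX_ge0 => w; exact: sqr_ge0.
set v := EX P (fun w => Y w ^+ 2) in sv v0 *; set r3 := EX P (fun w => `|Y w| ^+ 3) in sv *.
set sg := Num.sqrt v in sv * => hs.
have sg0 : 0 <= sg by exact: sqrtr_ge0.
have W0 := gW_ge0 (R := R).
have ks0 : 0 <= k * sg by rewrite mulr_ge0// ltW.
have ks1 : k * sg <= 1.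
  have := mulr_ge0 W0 ks0; move: hs ks0; clear; lra.
have H0 := heat_ge0 k c t s.
have mH : measurable_fun setT (fun w => s + Y w) by exact: measurable_funD.
have up : EX P (fun w => heat t (s + Y w)) <=
   heat t s + heat2 k c t s * (v / 2) + heat t s * (expR (k * m) * k ^+ 3) * r3.
  have -> : heat t s + heat2 k c t s * (v / 2) + heat t s * (expR (k * m) * k ^+ 3) * r3 =
    EX P (fun w => heat t s + heat1 k c t s * Y w + heat2 k c t s * (Y w ^+ 2 / 2) +
       heat t s * (expR (k * m) * k ^+ 3) * `|Y w| ^+ 3).
    rewrite EXD; [|by repeat apply: IntgD; [exact: Intg_cst|exact: IntgZ|exact: IntgZ]|exact: IntgZ].
    rewrite EXD; [|by apply: IntgD; [exact: Intg_cst|exact: IntgZ]|exact: IntgZ].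
    rewrite EXD; [|exact: Intg_cst|exact: IntgZ].
    rewrite EX_cst (@EXZ _ _ _ P _ Y)// EY (@EXZ _ _ _ P _ (fun w => Y w ^+ 2 / 2))//.
    rewrite (@EXZr _ _ _ P _ (fun w => Y w ^+ 2))// (@EXZ _ _ _ P _ (fun w => `|Y w| ^+ 3))//.
    by rewrite mulr0 addr0.
  apply: EX_le; first exact: Intg_heat_comp.
    apply: IntgD; last exact: IntgZ.
    by repeat apply: IntgD; [exact: Intg_cst|exact: IntgZ|exact: IntgZ].
  move=> w; have := heat_taylor c k0 t s (Y w).
  rewrite ler_norml => /andP[_ h].
  have h2 : heat t s * (expR (k * `|Y w|) * (k * `|Y w|) ^+ 3) <=
     heat t s * (expR (k * m) * k ^+ 3) * `|Y w| ^+ 3.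
    rewrite -[leRHS]mulrA ler_wpM2l// exprMn mulrA ler_wpM2r ?exprn_ge0//.
    rewrite ler_wpM2r ?exprn_ge0 ?(ltW k0)// ler_expR ler_wpM2l ?(ltW k0)//.
  exact: remainder_ub h h2.
have lo := heat_gauss_lower c k0 s t0 v0 ks1.
have h2 := heat2_bound k c t s.
(* The smallness hypothesis bounds the relative loss from the second-order term and the Gaussian
   remainder by [1/2] in total. *)
have H1 : heat t s <= 2 * heat (t + v) s.
  have va : v = sg ^+ 2 by rewrite sqr_sqrtr.
  have h3 : `|heat2 k c t s * (v / 2)| <= (k * sg) ^+ 2 / 2 * heat t s.
    rewrite normrM (@ger0_norm _ (v / 2)) ?divr_ge0// exprMn -va.
    rewrite (_ : k ^+ 2 * v / 2 * heat t s = (k ^+ 2 * heat t s) * (v / 2)); last by ring.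
    by rewrite ler_wpM2r// divr_ge0.
  have h4 := swap_arith1 ks0 W0 hs.
  move: h3; rewrite ler_norml => /andP[h3 _].
  exact: swap_arith2 H0 h4 h3 lo.
have r0 : 0 <= r3 by apply: EX_ge0 => w; rewrite exprn_ge0.
have H2 := heat_ge0 k c (t + v) s.
have e0 := expR_ge0 (k * m).
have k3 : 0 <= k ^+ 3 by rewrite exprn_ge0// ltW.
set H := heat t s in H0 H1 up lo *; set H' := heat (t + v) s in H1 H2 lo *.
have step : EX P (fun w => heat t (s + Y w)) <= H' + H * ((expR (k * m) + gW) * k ^+ 3 * r3).
  exact: swap_arith5 up lo (swap_arith4 H0 W0 (ltW k0) sv).
apply: (le_trans step).
have q0 : 0 <= (expR (k * m) + gW) * k ^+ 3 * r3 := mulr_ge0 (mulr_ge0 (addr_ge0 e0 W0) k3) r0.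
apply: (@le_trans _ _ ((1 + 2 * (expR (k * m) + gW) * k ^+ 3 * r3) * H')).
  rewrite (_ : 2 * (expR (k * m) + gW) * k ^+ 3 * r3 =
     2 * ((expR (k * m) + gW) * k ^+ 3 * r3)); last by ring.
  exact: swap_arith3.
by rewrite ler_wpM2r// expR_ge1Dx.
Qed.

End swap.

(** * Swapping all summands *)

Section lindeberg.
Context {R : realType}.
Variables (k c m : R).
Hypothesis k0 : 0 < k.
Context {d : measure_display} {T : measurableType d} (P : probability T R) (n : nat).
Variables (F : 'I_n -> set (set T)) (Y : 'I_n -> T -> R).
Hypothesis FM : forall i E, F i E -> measurable E.
Hypothesis FY : forall i (B : set R), measurable B -> F i (Y i @^-1` B).
Hypothesis indF : independent P F.
Hypothesis Ym : forall i w, `|Y i w| <= m.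
Hypothesis EY : forall i, EX P (Y i) = 0.
Local Notation gW := (@gW R).
Let v i := EX P (fun w => Y i w ^+ 2).
Let e i := 2 * (expR (k * m) + gW) * k ^+ 3 * EX P (fun w => `|Y i w| ^+ 3).
Hypothesis smallv : forall i, 2 * (1 + gW) * (k * Num.sqrt (v i)) <= 1.

Lemma big_ltS (f : 'I_n -> R) (i : 'I_n) :
  \sum_(j < n | (j < i.+1)%N) f j = \sum_(j < n | (j < i)%N) f j + f i.
Proof.
rewrite (bigD1 i) ?ltnS//= addrC; congr (_ + _).
by apply: eq_bigl => j; rewrite ltnS [in RHS]ltn_neqAle andbC -val_eqE.
Qed.

(** The time is generalized in the induction: the last summand of the prefix is swapped first, with
    the shorter prefix frozen by [decouple], and the hypothesis is then used at time [t + v i]. *)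
Lemma lindeberg_prefix (j : nat) (t : R) : 0 <= t ->
  EX P (fun w => heat k c t (psum Y j w)) <=
  expR (\sum_(i < n | (i < j)%N) e i) * heat k c (t + \sum_(i < n | (i < j)%N) v i) 0.
Proof.
elim: j => [|j IH] in t * => t0.
  rewrite !big_pred0// expR0 mul1r addr0 -[leRHS](EX_cst P).
  by rewrite le_eqVlt; apply/orP; left; apply/eqP; apply: eq_EX => w; rewrite /psum big_pred0.
have [nj|jn] := leqP n j.
  have E (i : 'I_n) : (i < j.+1)%N = (i < j)%N.
    by rewrite !(leq_trans (ltn_ord i))// leqW.
  rewrite !(eq_bigl _ _ E); apply: le_trans (IH _ t0).
  by rewrite le_eqVlt; apply/orP; left; apply/eqP; apply: eq_EX => w; rewrite /psum (eq_bigl _ _ E).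
pose i := Ordinal jn.
have mS := psum_meas FM FY i; have mY := indep_meas FM FY i.
have v0 : 0 <= v i by apply: EX_ge0 => w; exact: sqr_ge0.
have tv : 0 <= t + v i by exact: addr_ge0.
rewrite !(big_ltS _ i) expRD.
have IH' := IH _ tv.
have ms : measurable_fun setT (psum Y j.+1) by exact: (psum_meas FM FY).
have step : EX P (fun w => heat k c t (psum Y j.+1 w)) <=
    expR (e i) * EX P (fun w => heat k c (t + v i) (psum Y j w)).
  have mh : measurable_fun setT (fun z : R * R => (heat k c t (z.1 + z.2))%:E).
    apply/measurable_EFinP; apply: (measurableT_comp (heat_meas _ k0 _)).
    by apply: measurable_funD; [exact: measurable_fst|exact: measurable_snd].
  have h0 z : (0 <= (heat k c t (z.1 + z.2))%:E)%E by rewrite lee_fin heat_ge0.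
  have I1 := Intg_heat_comp c k0 P t ms.
  have I2 := Intg_heat_comp c k0 P (t + v i) mS.
  have D := decouple mS mY (psum_indep2 FM FY indF i) mh h0.
  have E : (\int[P]_w (heat k c t (psum Y j.+1 w))%:E =
      \int[P]_w (heat k c t (psum Y i w + Y i w))%:E)%E.
    by apply: eq_integral => w _; congr ((heat k c t _)%:E); rewrite -psumS.
  have {D E} := etrans E D; rewrite /= (EX_fin I1) => E.
  rewrite -lee_fin {}E EFinM -(EX_fin I2).
  rewrite -ge0_integralZl ?lee_fin ?expR_ge0//; last 2 first.
  - by apply/measurable_EFinP; exact: Intg_meas I2.
  - by move=> w _; rewrite lee_fin heat_ge0.
  have swap s : (\int[P]_w (heat k c t (s + Y i w))%:E <=
      (expR (e i))%:E * (heat k c (t + v i) s)%:E)%E.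
    have I : Intg P (fun w => heat k c t (s + Y i w)).
      by apply: (Intg_heat_comp c k0); exact: measurable_funD.
    have H := @heat_swap R k c k0 d T P (Y i) t s m mY t0 (Ym i) (EY i) (smallv i).
    by rewrite (EX_fin I) -EFinM lee_fin; exact: H.
  apply: ge0_le_integral => //.
  - by move=> s _; apply: integral_ge0 => w _; rewrite lee_fin heat_ge0.
  - have mK : measurable_fun setT (fun z : R * T => (heat k c t (z.1 + Y i z.2))%:E).
      apply/measurable_EFinP; apply: (measurableT_comp (heat_meas c k0 t)).
      apply: measurable_funD; first exact: measurable_fst.
      exact: (measurableT_comp mY measurable_snd).
    have K0 z : (0 <= (heat k c t (z.1 + Y i z.2))%:E)%E by rewrite lee_fin heat_ge0.
    exact: (measurableT_comp (measurable_fun_fubini_tonelli_F _ mK K0) mS).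
  - apply: emeasurable_funM => //; apply/measurable_EFinP; exact: Intg_meas I2.
apply: (@le_trans _ _ _ _ _ step).
have -> : t + (\sum_(j < n | (j < i)%N) v j + v i) =
   t + v i + \sum_(j < n | (j < i)%N) v j by rewrite addrCA addrC.
rewrite [_ * expR (e i)]mulrC -mulrA; apply: ler_wpM2l; first exact: expR_ge0.
exact: IH'.
Qed.

End lindeberg.

(** * Self-normalized sums *)

Section exponential_inequalities.
Context {R : realType}.
Implicit Types u l t : R.

Lemma norm_pow2 u : u ^+ 2 = `|u| ^+ 2.
Proof. by rewrite real_normK// num_real. Qed.

Lemma expR1_lt3 : expR 1 < 3 :> R.
Proof.
have h : expR (1 / 6) <= 6 / 5 :> R.
  have h5 : 5 / 6 <= expR (- (1 / 6)) :> R by apply: le_trans (expR_ge1Dx _); lra.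
  rewrite -[1 / 6]opprK expRN (_ : 6 / 5 = (5 / 6)^-1); last by field.
  by rewrite lef_pV2// ?posrE ?expR_gt0//; lra.
have -> : 1 = 6%:R * (1 / 6) :> R by field.
rewrite expRM_natl; apply: (@le_lt_trans _ _ ((6 / 5) ^+ 6)).
  by rewrite lerXn2r ?nnegrE ?expR_ge0//; lra.
by rewrite !exprS expr0; lra.
Qed.

Definition cA : R := 20 * expR 3.

Lemma expR3_ge : 4 <= expR (3 : R).
Proof. by have := expR_ge1Dx (3 : R); lra. Qed.

(** The range of [l] contains the two values used later, [3/2] and [1/8]. For [|u| <= 1] this is
    Taylor's formula. For larger [u] the exponent is at most [1 / (4 l) <= 2], thanks to [1/8 <= l],
    and the cubic term alone absorbs everything. *)
Lemma expR_linquad l u : 1 / 8 <= l -> l <= 3 / 2 ->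
  expR (u - l * u ^+ 2) <= 1 + u + (1 / 2 - l) * u ^+ 2 + cA * `|u| ^+ 3.
Proof.
move=> l1 l2; set w := u - l * u ^+ 2; have e3 := expR3_ge.
have u0 := normr_ge0 u.
have /andP[un1 un2] : - `|u| <= u <= `|u| by rewrite -ler_norml.
have [uu|uu] := leP `|u| 1.
  have wu : `|w| <= 5 / 2 * `|u|.
    rewrite /w norm_pow2 (le_trans (ler_normB _ _))// normrM normrX normr_id.
    rewrite (@ger0_norm _ l); last by lra.
    set y := `|u| in u0 uu *; nra.
  have w3 : `|w| ^+ 3 <= 16 * `|u| ^+ 3.
    apply: (@le_trans _ _ ((5 / 2 * `|u|) ^+ 3)).
      by rewrite lerXn2r// nnegrE mulr_ge0.
    by rewrite exprMn ler_wpM2r ?exprn_ge0// !exprS expr0; lra.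
  have ew : expR `|w| <= expR 3 by rewrite ler_expR (le_trans wu)//; lra.
  have := expR_taylor3 w; rewrite ler_norml => /andP[_ h].
  have h2 : expR `|w| * `|w| ^+ 3 <= expR 3 * (16 * `|u| ^+ 3).
    by rewrite ler_pM ?expR_ge0 ?exprn_ge0.
  have h3 : w ^+ 2 / 2 <= u ^+ 2 / 2 + 3 * `|u| ^+ 3.
    have -> : w ^+ 2 = u ^+ 2 - 2 * l * u ^+ 3 + l ^+ 2 * u ^+ 4 by rewrite /w; ring.
    have a1 : - u ^+ 3 <= `|u| ^+ 3 by rewrite -normrX -normrN ler_norm.
    have a2 : u ^+ 4 <= `|u| ^+ 3.
      rewrite (_ : u ^+ 4 = `|u| ^+ 3 * `|u|); last by rewrite -exprSr -normrX ger0_norm// (exprM u 2 2) sqr_ge0.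
      by rewrite ler_piMr// exprn_ge0.
    have b0 : 0 <= `|u| ^+ 3 by exact: exprn_ge0.
    have a3 : l ^+ 2 <= 9 / 4 by rewrite expr2; nra.
    have a4 : l ^+ 2 * u ^+ 4 <= 9 / 4 * `|u| ^+ 3.
      by rewrite ler_pM ?sqr_ge0// (exprM u 2 2) sqr_ge0.
    have a5 : - (2 * l * u ^+ 3) <= 3 * `|u| ^+ 3.
      rewrite -mulrN (@le_trans _ _ (2 * l * `|u| ^+ 3))// ?ler_wpM2l ?ler_wpM2r//; lra.
    lra.
  have b0 : 0 <= `|u| ^+ 3 by exact: exprn_ge0.
  have h4 : 3 * `|u| ^+ 3 <= expR 3 * `|u| ^+ 3 by rewrite ler_wpM2r//; lra.
  rewrite /cA.
  move: h h2 h3 h4; rewrite /w; set z := `|u| ^+ 3; set q := u ^+ 2.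
  have z0 : 0 <= expR 3 * z by rewrite mulr_ge0// ?expR_ge0.
  have -> : 20 * expR 3 * z = 20 * (expR 3 * z) by ring.
  have -> : expR 3 * (16 * z) = 16 * (expR 3 * z) by ring.
  set ww := w ^+ 2; lra.
have w2 : w <= 2.
  have : 0 <= l * (u - (2 * l)^-1) ^+ 2 by rewrite mulr_ge0 ?sqr_ge0//; lra.
  have -> : l * (u - (2 * l)^-1) ^+ 2 = - w + (4 * l)^-1.
    by rewrite /w; field; rewrite gt_eqF//; lra.
  have : (4 * l)^-1 <= 2 by rewrite invf_ple ?posrE; lra.
  lra.
have ew : expR w <= expR 3 by rewrite ler_expR; lra.
apply: (le_trans ew).
have b1 : 1 <= `|u| ^+ 3 by rewrite exprn_ege1// ltW.
have b2 : `|u| <= `|u| ^+ 3 by rewrite -[X in X <= _]expr1 ler_eXn2l// ltW.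
have b3 : u ^+ 2 <= `|u| ^+ 3 by rewrite norm_pow2 ler_eXn2l// ltW.
have b4 : - u ^+ 2 <= (1 / 2 - l) * u ^+ 2.
  by rewrite -mulN1r ler_wpM2r ?sqr_ge0//; lra.
rewrite /cA; set z := `|u| ^+ 3 in b1 b2 b3 *; set q := u ^+ 2 in b3 b4 *.
have : expR 3 <= expR 3 * z by rewrite ler_peMr// expR_ge0.
have : 4 * z <= expR 3 * z by rewrite ler_wpM2r//; lra.
have -> : 20 * expR 3 * z = 20 * (expR 3 * z) by ring.
set q' := (1 / 2 - l) * q in b4 *; lra.
Qed.

(** For a norm far above [x] the sum is split at [|u| = 1/8]: [truncU] keeps the small summands,
    while the sum of [bigU] is 8 times the number of large ones. *)
Definition truncU u : R := if `|u| <= 1 / 8 then u else 0.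
Definition bigU u : R := if `|u| <= 1 / 8 then 0 else 8.

Lemma expR_truncU u :
  expR (truncU u) <= 1 + u + u ^+ 2 + 64 * `|u| ^+ 3.
Proof.
have u0 := normr_ge0 u; have u3 : 0 <= `|u| ^+ 3 by exact: exprn_ge0.
have /andP[un1 un2] : - `|u| <= u <= `|u| by rewrite -ler_norml.
rewrite /truncU; case: ifPn => [uu|].
  have := expR_taylor3 u; rewrite ler_norml => /andP[_ h].
  have e2 : expR `|u| <= 4.
    apply: (@le_trans _ _ (expR 1)); first by rewrite ler_expR; lra.
    apply: (@le_trans _ _ 3); last by lra.
    exact: ltW expR1_lt3.
  have : expR `|u| * `|u| ^+ 3 <= 4 * `|u| ^+ 3 by rewrite ler_wpM2r.
  have := sqr_ge0 u; lra.
rewrite -ltNge => uu; rewrite expR0.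
have : `|u| <= 64 * `|u| ^+ 3.
  have : 1 <= 64 * `|u| ^+ 2 by rewrite expr2; nra.
  rewrite !exprS expr0; set y := `|u| in u0 uu *; nra.
have := sqr_ge0 u; lra.
Qed.

Definition cB : R := 8 ^+ 3 * expR 8.

Lemma cB_ge0 : 0 <= cB.
Proof. by apply: mulr_ge0; [exact/exprn_ge0/ler0n|exact: expR_ge0]. Qed.

Lemma expR_bigU u : expR (bigU u) <= 1 + cB * `|u| ^+ 3.
Proof.
have u0 := normr_ge0 u; have u3 : 0 <= `|u| ^+ 3 by exact: exprn_ge0.
have e8 := expR_ge0 (8 : R).
rewrite /bigU; case: ifPn => [uu|].
  by rewrite expR0 lerDl; apply: mulr_ge0 => //; exact: cB_ge0.
rewrite -ltNge => uu.
have h : 1 <= (8 * `|u|) ^+ 3 by rewrite exprn_ege1//; lra.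
rewrite /cB mulrAC -exprMn; apply: (@le_trans _ _ ((8 * `|u|) ^+ 3 * expR 8)).
  exact: ler_peMl.
by rewrite lerDr.
Qed.

Lemma expR_negquad t u : 0 <= t ->
  expR (- (t ^+ 2 * u ^+ 2)) <= 1 - t ^+ 2 * u ^+ 2 + 4 * t ^+ 3 * `|u| ^+ 3.
Proof.
move=> t0; have u0 := normr_ge0 u.
rewrite (norm_pow2 u) -exprMn -[4 * t ^+ 3 * _]mulrA -exprMn; set z := t * `|u|.
have z0 : 0 <= z by exact: mulr_ge0.
have [zz|zz] := leP z 1; last first.
  have h : z ^+ 2 <= z ^+ 3 by rewrite ler_eXn2l// ltW.
  have h2 : expR (- z ^+ 2) <= 1 by rewrite -expR0 ler_expR oppr_le0 sqr_ge0.
  have := exprn_ge0 3 z0. lra.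
have := expR_taylor3 (- z ^+ 2); rewrite ler_norml => /andP[_].
rewrite normrN (ger0_norm (sqr_ge0 z)).
have z21 : z ^+ 2 <= 1 by rewrite exprn_ile1.
have e : expR (z ^+ 2) <= 3.
  apply: (@le_trans _ _ (expR 1)); first by rewrite ler_expR.
  exact: ltW expR1_lt3.
have b : (z ^+ 2) ^+ 3 <= z ^+ 3.
  by rewrite -exprM ler_wiXn2l.
have b2 : (- z ^+ 2) ^+ 2 <= z ^+ 3 by rewrite sqrrN -exprM ler_wiXn2l.
have b3 : expR (z ^+ 2) * (z ^+ 2) ^+ 3 <= 3 * z ^+ 3.
  by rewrite ler_pM ?expR_ge0 ?exprn_ge0.
have b4 : 0 <= z ^+ 3 by exact: exprn_ge0.
set p := (- z ^+ 2) ^+ 2 in b2 *; set q := expR (z ^+ 2) * _ in b3 *; set z3 := z ^+ 3 in b2 b3 b4 *; lra.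
Qed.

(** A bounded substitute for [t^2 u^2], for upper deviations of the sum of squares. Summands beyond
    the cut are handled as a separate rare event. *)
Definition truncQ t u : R := if t * `|u| <= 1 then t ^+ 2 * u ^+ 2 else 0.

Lemma expR_truncQ t u : 0 <= t ->
  expR (truncQ t u) <= 1 + t ^+ 2 * u ^+ 2 + 4 * t ^+ 3 * `|u| ^+ 3.
Proof.
move=> t0; have u0 := normr_ge0 u.
rewrite /truncQ (norm_pow2 u) -exprMn -[4 * t ^+ 3 * _]mulrA -exprMn; set z := t * `|u|.
have z0 : 0 <= z by exact: mulr_ge0.
have b4 : 0 <= z ^+ 3 by exact: exprn_ge0.
case: ifPn => [zz|_]; last first.
  by rewrite expR0; have := sqr_ge0 z; lra.
have := expR_taylor3 (z ^+ 2); rewrite ler_norml => /andP[_].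
rewrite (ger0_norm (sqr_ge0 z)).
have z21 : z ^+ 2 <= 1 by rewrite exprn_ile1.
have e : expR (z ^+ 2) <= 3.
  apply: (@le_trans _ _ (expR 1)); first by rewrite ler_expR.
  exact: ltW expR1_lt3.
have b : (z ^+ 2) ^+ 3 <= z ^+ 3 by rewrite -exprM ler_wiXn2l.
have b2 : (z ^+ 2) ^+ 2 <= z ^+ 3 by rewrite -exprM ler_wiXn2l.
have b3 : expR (z ^+ 2) * (z ^+ 2) ^+ 3 <= 3 * z ^+ 3.
  by rewrite ler_pM ?expR_ge0 ?exprn_ge0.
set p := (z ^+ 2) ^+ 2 in b2 *; set q := expR (z ^+ 2) * _ in b3 *; set z3 := z ^+ 3 in b2 b3 b4 *; lra.
Qed.

End exponential_inequalities.

(** * Chernoff and Markov bounds from third moments *)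

Section exp_sum.
Context {R : realType} {d : measure_display} {T : measurableType d}.
Variables (P : probability T R) (n : nat).
Variables (F : 'I_n -> set (set T)) (U : 'I_n -> T -> R).
Hypothesis FM : forall i E, F i E -> measurable E.
Hypothesis FU : forall i (B : set R), measurable B -> F i (U i @^-1` B).
Hypothesis indF : independent P F.
Hypothesis I3 : forall i, Intg P (fun w => `|U i w| ^+ 3).

Lemma meas_comp_preimage (g : R -> R) : measurable_fun setT g ->
  forall i (B : set R), measurable B -> F i ((g \o U i) @^-1` B).
Proof.
move=> mg i B mB; rewrite comp_preimage; apply: FU.
by have := mg measurableT _ mB; rewrite setTI.
Qed.

Lemma Intg_U1 i : Intg P (U i).
Proof.
apply: (@Intg_dom _ _ _ P _ (fun w => 1 + `|U i w| ^+ 3)); first exact: (indep_meas FM FU).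
  move=> w; set y := `|U i w|; have y0 : 0 <= y by exact: normr_ge0.
  have [y1|y1] := leP y 1; first by rewrite (le_trans y1)// lerDl exprn_ge0.
  have := ltW y1; rewrite -(ler_pXn2r (n := 2))// ?nnegrE// expr1n => y2.
  by rewrite exprS (le_trans _ (_ : y * y ^+ 2 <= _)) ?ler_peMr// lerDr.
by apply: IntgD; [exact: Intg_cst|exact: I3].
Qed.

Lemma Intg_U2 i : Intg P (fun w => U i w ^+ 2).
Proof.
apply: (@Intg_dom _ _ _ P _ (fun w => 1 + `|U i w| ^+ 3)).
- by apply: measurable_funX; exact: (indep_meas FM FU).
- move=> w; rewrite norm_pow2 normrX normr_id; set y := `|U i w|; have y0 : 0 <= y by exact: normr_ge0.
  have [y1|y1] := leP y 1.
    by rewrite (@le_trans _ _ 1)// ?exprn_ile1// lerDl exprn_ge0.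
  by rewrite (@le_trans _ _ (y ^+ 3))// ?lerDr// ler_eXn2l.
- by apply: IntgD; [exact: Intg_cst|exact: I3].
Qed.

Variable x : R.
Hypothesis EU1 : \sum_(i < n) EX P (U i) = 0.
Hypothesis EU2 : \sum_(i < n) EX P (fun w => U i w ^+ 2) = x ^+ 2.
Let Lam := \sum_(i < n) EX P (fun w => `|U i w| ^+ 3).

(** A pointwise cubic bound on [expR (g u)] integrates to a Chernoff bound. The slope [a] disappears
    because the means add up to 0, and [b] meets the total variance [x^2]. *)
Lemma exp_sum (g : R -> R) (a b C thr : R) : measurable_fun setT g ->
  (forall u, expR (g u) <= 1 + a * u + b * u ^+ 2 + C * `|u| ^+ 3) ->
  (P [set w | (thr <= \sum_(i < n) g (U i w))%R] <=
     (expR (b * x ^+ 2 + C * Lam - thr))%:E)%E.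
Proof.
move=> mg hg.
pose c i := a * EX P (U i) + b * EX P (fun w => U i w ^+ 2) + C * EX P (fun w => `|U i w| ^+ 3).
have sc : \sum_(i < n) c i = b * x ^+ 2 + C * Lam.
  by rewrite !big_split/= -!mulr_sumr EU1 EU2 mulr0 add0r.
rewrite -sc; apply: (@chernoff_sum _ _ _ P n F (fun i => g \o U i) FM (meas_comp_preimage mg) indF c) => i.
have mU := indep_meas FM FU i.
have I1 := Intg_U1 i; have I2 := Intg_U2 i.
have Ib : Intg P (fun w => 1 + a * U i w + b * U i w ^+ 2 + C * `|U i w| ^+ 3).
  apply: IntgD; [apply: IntgD; [apply: IntgD; [exact: Intg_cst|exact: IntgZ]|exact: IntgZ]|exact: IntgZ].
have Eb : EX P (fun w => 1 + a * U i w + b * U i w ^+ 2 + C * `|U i w| ^+ 3) = 1 + c i.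
  rewrite EXD; [|apply: IntgD; [apply: IntgD; [exact: Intg_cst|exact: IntgZ]|exact: IntgZ]|exact: IntgZ].
  rewrite EXD; [|apply: IntgD; [exact: Intg_cst|exact: IntgZ]|exact: IntgZ].
  rewrite EXD; [|exact: Intg_cst|exact: IntgZ].
  rewrite EX_cst (@EXZ _ _ _ P _ (U i))// (@EXZ _ _ _ P _ (fun w => U i w ^+ 2))//.
  by rewrite (@EXZ _ _ _ P _ (fun w => `|U i w| ^+ 3))// /c -!addrA.
have Ig : Intg P (fun w => expR (g (U i w))).
  apply: (Intg_dom _ _ Ib) => [|w]; last by rewrite ger0_norm ?expR_ge0.
  exact: (measurableT_comp (@measurable_expR R) (measurableT_comp mg mU)).
rewrite (EX_fin Ig) lee_fin (le_trans _ (expR_ge1Dx _))// -Eb.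
exact: EX_le.
Qed.

Lemma prob_exists_big (a : R) : 0 < a ->
  (P [set w | exists i, (a < `|U i w|)%R] <= (a ^- 3 * Lam)%:E)%E.
Proof.
move=> a0; have mU := indep_meas FM FU.
have E : [set w | exists i, (a < `|U i w|)] = \bigcup_(i in [set: 'I_n]) [set w | a < `|U i w|].
  by apply/seteqP; split=> w /= [i] => [h|_ h]; exists i.
have m1 i : measurable [set w | a < `|U i w|].
  apply: meas_lt => //.
  exact: (measurableT_comp _ (mU i)).
have mE : measurable [set w | exists i, a < `|U i w|].
  by rewrite E; apply: fin_bigcup_measurable.
have IL : Intg P (fun w => a ^- 3 * \sum_(i < n) `|U i w| ^+ 3).
  by apply: IntgZ; apply: Intg_sum => i _; exact: I3.
have -> : a ^- 3 * Lam = EX P (fun w => a ^- 3 * \sum_(i < n) `|U i w| ^+ 3).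
  rewrite (@EXZ _ _ _ P _ (fun w => \sum_(i < n) `|U i w| ^+ 3)).
    by rewrite EX_sum.
  by apply: Intg_sum => i _; exact: I3.
apply: prob_le_EX => //.
- move=> w; apply: mulr_ge0; first by rewrite invr_ge0 exprn_ge0// ltW.
  by apply: sumr_ge0 => i _; exact: exprn_ge0.
- move=> w [i h]; rewrite mulrC ler_pdivlMr ?exprn_gt0// mul1r (bigD1 i)//=.
  apply: (@le_trans _ _ (`|U i w| ^+ 3)).
    by rewrite lerXn2r ?nnegrE// ltW.
  by rewrite lerDl; apply: sumr_ge0 => j _; exact: exprn_ge0.
Qed.

End exp_sum.

Lemma prob_subU d (T : measurableType d) (R : realType) (P : probability T R)
  (E A B : set T) (a b : R) :
  measurable E -> measurable A -> measurable B -> E `<=` A `|` B ->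
  (P A <= a%:E)%E -> (P B <= b%:E)%E -> (P E <= (a + b)%:E)%E.
Proof.
move=> mE mA mB EAB Pa Pb; rewrite EFinD.
apply: le_trans (leeD Pa Pb); apply: le_trans (measureU2 _ mA mB).
by apply: le_measure => //; rewrite inE//; exact: measurableU.
Qed.

(** * The truncated quadratic minorant *)

Section truncation.
Context {R : realType}.
Implicit Types u : R.

(** The cut [- 3/2] is the value of [u - u^2 / 2] at [u = -1], so truncation acts only where
    [|u| > 1] and is paid for by third moments; the result is bounded, as the swap requires. *)
Definition tau3 u : R := Num.max (u - u ^+ 2 / 2) (- (3 / 2)).

Lemma tau3_ge u : u - u ^+ 2 / 2 <= tau3 u.
Proof. by rewrite le_max lexx. Qed.

Lemma tau3_cases u : (`|u| <= 1 /\ tau3 u = u - u ^+ 2 / 2) \/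
  (1 <= `|u| /\ - (3 / 2) <= tau3 u <= 1 / 2).
Proof.
have sq : u - u ^+ 2 / 2 <= 1 / 2 by have := sqr_ge0 (u - 1); rewrite !expr2; lra.
have [h|h] := leP `|u| 1.
  left; split=> //; apply/max_idPl; move: h; rewrite ler_norml => /andP[h1 h2].
  by rewrite expr2; nra.
right; split; first exact: ltW.
by rewrite /tau3 le_max lexx orbT/= ge_max sq/=; lra.
Qed.

Lemma pow3_ge1 u : 1 <= `|u| -> [/\ 1 <= `|u| ^+ 3, `|u| <= `|u| ^+ 3 & u ^+ 2 <= `|u| ^+ 3].
Proof.
move=> h; split; first exact: exprn_ege1.
  by rewrite -[X in X <= _]expr1 ler_weXn2l.
by rewrite norm_pow2 ler_weXn2l.
Qed.

Lemma tau3_bound u : `|tau3 u| <= 3 / 2.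
Proof.
rewrite ler_norml; have [[h ->]|[_ /andP[h1 h2]]] := tau3_cases u; last by apply/andP; split; lra.
move: h; rewrite ler_norml => /andP[h1 h2]; rewrite expr2; apply/andP; split; nra.
Qed.

Lemma tau3_lin u : `|tau3 u| <= 3 / 2 * `|u|.
Proof.
have [[h ->]|[h _]] := tau3_cases u; last by rewrite (le_trans (tau3_bound u))//; lra.
rewrite (le_trans (ler_normB _ _))// norm_pow2 normrM normrX normr_id.
rewrite (@ger0_norm _ 2^-1) ?invr_ge0//.
by have := normr_ge0 u; set y := `|u| in h *; nra.
Qed.

Lemma tau3_ub u : tau3 u <= u - u ^+ 2 / 2 + `|u| ^+ 3 * 3.
Proof.
have u3 : 0 <= `|u| ^+ 3 by exact: exprn_ge0.
have [[_ ->]|[h /andP[_ h2]]] := tau3_cases u; first by lra.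
have [a1 a2 a3] := pow3_ge1 h; have := ler_norm (- u); rewrite normrN; lra.
Qed.

Lemma tau3_sqr u : tau3 u ^+ 2 <= u ^+ 2 + 3 * `|u| ^+ 3.
Proof.
have u3 : 0 <= `|u| ^+ 3 by exact: exprn_ge0.
have [[h ->]|[h _]] := tau3_cases u; last first.
  have [a1 _ _] := pow3_ge1 h; have b := tau3_bound u.
  rewrite norm_pow2 (@le_trans _ _ ((3 / 2) ^+ 2)) ?lerXn2r ?nnegrE//.
  by have := sqr_ge0 u; rewrite !expr2; lra.
have -> : (u - u ^+ 2 / 2) ^+ 2 = u ^+ 2 - u ^+ 3 + u ^+ 4 / 4 by field.
have a1 : - u ^+ 3 <= `|u| ^+ 3 by rewrite -normrX -normrN ler_norm.
have a2 : u ^+ 4 <= `|u| ^+ 3.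
  rewrite (_ : u ^+ 4 = `|u| ^+ 3 * `|u|); last by rewrite -exprSr -normrX ger0_norm// (exprM u 2 2) sqr_ge0.
  by rewrite ler_piMr// exprn_ge0.
lra.
Qed.

Lemma tau3_meas : measurable_fun (setT : set R) tau3.
Proof.
apply: measurable_maxr => //; apply: measurable_funB => //.
by apply: measurable_funM => //; exact: measurable_funX.
Qed.

End truncation.

(** * Decomposition of the event by the Euclidean norm of the summands *)

Section deviations.
Context {R : realType} {n : nat}.
Variables (u : 'I_n -> R) (x del : R).
Let s := \sum_(i < n) u i.
Let r := Num.sqrt (\sum_(i < n) u i ^+ 2).
Hypotheses (x0 : 0 < x) (del0 : 0 < del) (delx : del <= x) (sr : x * r < s).

Lemma sqr_r : \sum_(i < n) u i ^+ 2 = r ^+ 2.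
Proof. by rewrite sqr_sqrtr// sumr_ge0// => i _; exact: sqr_ge0. Qed.

Lemma r_ge0 : 0 <= r. Proof. exact: sqrtr_ge0. Qed.

Lemma sum_linquad (l : R) : \sum_(i < n) (u i - l * u i ^+ 2) = s - l * r ^+ 2.
Proof. by rewrite big_split/= sumrN -mulr_sumr sqr_r. Qed.

(** As [s > x r], the sum exceeds [x r - 3/2 r^2]. By [exp_sum] with [l = 3/2] the resulting
    exponent is [- x^2 / 2 - x del / 2] up to a multiple of the third moments, better than the
    normal tail by [x del / 2]. *)
Lemma dev_low : r < x - del ->
  - (x ^+ 2 / 2) + x * del / 2 <= \sum_(i < n) (u i - 3 / 2 * u i ^+ 2).
Proof.
have := r_ge0; rewrite sum_linquad; move: sr x0 del0; rewrite !expr2; nra.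
Qed.

(** The same on the other side of [x] with [l = 1/8]: up to [5 x] the concave function
    [x r - r^2 / 8] stays above its value at [x], and the exponent becomes
    [- x^2 / 2 - x del / 4]. *)
Lemma dev_mid : x + del < r -> r <= 5 * x ->
  7 / 8 * x ^+ 2 + x * del / 4 <= \sum_(i < n) (u i - 1 / 8 * u i ^+ 2).
Proof.
have := r_ge0; rewrite sum_linquad; move: sr x0 del0; rewrite !expr2; nra.
Qed.

(** If few summands exceed [1/8], their total is controlled by [u <= mu / 2 * u^2 + 1 / (2 mu)] with
    [mu = x / (2 r)]. Each of the two terms costs at most a quarter of [x r]; the half that remains
    exceeds [5/2 x^2] and comes from the small summands. *)
Lemma dev_high : 5 * x < r ->
  5 / 2 * x ^+ 2 <= \sum_(i < n) truncU (u i) \/ 2 * x ^+ 2 <= \sum_(i < n) bigU (u i).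
Proof.
move=> r5; have r0 : 0 < r by apply: lt_trans r5; rewrite mulr_gt0.
have [h|h] := leP (2 * x ^+ 2) (\sum_(i < n) bigU (u i)); [by right|left].
pose mu := x / (2 * r).
have mu0 : 0 < mu by rewrite divr_gt0// mulr_gt0.
have pw i : u i - truncU (u i) <= mu / 2 * u i ^+ 2 + (16 * mu)^-1 * bigU (u i).
  rewrite /truncU /bigU; case: ifP => _.
    by rewrite subrr mulr0 addr0 mulr_ge0 ?sqr_ge0// divr_ge0// ltW.
  rewrite subr0 -subr_ge0.
  have -> : mu / 2 * u i ^+ 2 + (16 * mu)^-1 * 8 - u i = mu / 2 * (u i - mu^-1) ^+ 2.
    by field; rewrite gt_eqF.
  by rewrite mulr_ge0 ?sqr_ge0// divr_ge0// ltW.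
have : \sum_(i < n) (u i - truncU (u i)) <=
    \sum_(i < n) (mu / 2 * u i ^+ 2 + (16 * mu)^-1 * bigU (u i)).
  by apply: ler_sum => i _; exact: pw.
rewrite [X in _ <= X -> _]big_split/= -!mulr_sumr sqr_r big_split/= sumrN -/s.
set A := \sum_(i < n) truncU _; set B := \sum_(i < n) bigU _ in h *.
have e1 : mu / 2 * r ^+ 2 = x * r / 4 by rewrite /mu; field; rewrite gt_eqF.
have e2 : (16 * mu)^-1 * B <= x * r / 4.
  have -> : (16 * mu)^-1 * B = r / (8 * x) * B by rewrite /mu; field; rewrite !gt_eqF.
  apply: (@le_trans _ _ (r / (8 * x) * (2 * x ^+ 2))).
    by rewrite ler_wpM2l ?(ltW h)// divr_ge0// ?(ltW r0)// mulr_ge0// ltW.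
  by rewrite le_eqVlt; apply/orP; left; apply/eqP; field; rewrite gt_eqF.
rewrite e1; move: e2 sr r5 x0; set q := _ * B; rewrite expr2; nra.
Qed.

(** Completing the square: [x r - r^2 / 2 = x^2 / 2 - (r - x)^2 / 2]. *)
Lemma dev_center : x - del <= r <= x + del ->
  x ^+ 2 / 2 - del ^+ 2 / 2 < \sum_(i < n) tau3 (u i).
Proof.
move=> /andP[h1 h2]; apply: (@lt_le_trans _ _ (s - 1 / 2 * r ^+ 2)).
  have h3 : (r - x) ^+ 2 <= del ^+ 2.
    have : 0 <= (del - (r - x)) * (del + (r - x)) by apply: mulr_ge0; lra.
    by rewrite !expr2; lra.
  by move: h3 sr; rewrite !expr2; lra.
rewrite -sum_linquad; apply: ler_sum => i _; have := tau3_ge (u i); lra.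
Qed.

Lemma dev_low_sq : r < x - del -> x * del - x ^+ 2 <= \sum_(i < n) (- u i ^+ 2).
Proof.
move=> h; have := r_ge0; rewrite sumrN sqr_r; move: h x0 del0 delx; rewrite !expr2; nra.
Qed.

Lemma dev_high_sq (t : R) : 0 < t -> x + del < r ->
  t ^+ 2 * (x ^+ 2 + x * del) <= \sum_(i < n) truncQ t (u i) \/ exists i, t^-1 < `|u i|.
Proof.
move=> t0 h; have [[i hi]|hN] := pselect (exists i, t^-1 < `|u i|); [by right; exists i|left].
have -> : \sum_(i < n) truncQ t (u i) = t ^+ 2 * r ^+ 2.
  rewrite -sqr_r mulr_sumr; apply: eq_bigr => i _; rewrite /truncQ ifT// leNgt; apply/negP => hi.
  by apply: hN; exists i; rewrite -(ltr_pM2l t0) mulfV ?gt_eqF.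
rewrite ler_wpM2l ?sqr_ge0//; move: h x0 del0 delx; rewrite !expr2; nra.
Qed.

End deviations.

(** * Moments of the truncated and recentered summands *)

Section self_normalized.
Context {R : realType} {d : measure_display} {T : measurableType d}.
Variables (P : probability T R) (n : nat).
Variables (F : 'I_n -> set (set T)) (U : 'I_n -> T -> R).
Hypothesis FM : forall i E, F i E -> measurable E.
Hypothesis FU : forall i (B : set R), measurable B -> F i (U i @^-1` B).
Hypothesis indF : independent P F.
Hypothesis I3 : forall i, Intg P (fun w => `|U i w| ^+ 3).
Variable x : R.
Hypothesis x0 : 0 < x.
Hypothesis EU1 : \sum_(i < n) EX P (U i) = 0.
Hypothesis EU2 : \sum_(i < n) EX P (fun w => U i w ^+ 2) = x ^+ 2.
Variable Lam : R.
Hypothesis LamE : Lam = \sum_(i < n) EX P (fun w => `|U i w| ^+ 3).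
Notation phi := (normal_pdf (0 : R) 1).

Definition tauY i w := tau3 (U i w) - EX P (fun v => tau3 (U i v)).

Lemma Lam_ge0 : 0 <= Lam.
Proof.
by rewrite LamE; apply: sumr_ge0 => i _; apply: EX_ge0 => w; exact: exprn_ge0.
Qed.

Lemma mtau i : measurable_fun setT (fun w => tau3 (U i w)).
Proof. exact: (measurableT_comp tau3_meas (indep_meas FM FU i)). Qed.

Lemma Intg_tau i : Intg P (fun w => tau3 (U i w)).
Proof.
by apply: (@Intg_bdd _ _ _ _ _ (3 / 2)) => [|w]; [exact: mtau|exact: tau3_bound].
Qed.

Lemma Etau_bound i : `|EX P (fun w => tau3 (U i w))| <= 3 / 2.
Proof.
apply: (le_trans (EX_norm (Intg_tau i))); rewrite -[leRHS](EX_cst P).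
apply: EX_le => [||w]; [exact/Intg_norm/Intg_tau|exact: Intg_cst|exact: tau3_bound].
Qed.

Lemma tauY_bound i w : `|tauY i w| <= 3.
Proof.
rewrite (le_trans (ler_normB _ _))//.
by have := tau3_bound (U i w); have := Etau_bound i; move=> h1 h2; apply: (le_trans (lerD h2 h1)); lra.
Qed.

Lemma tauY_mean i : EX P (tauY i) = 0.
Proof. by rewrite EXB ?EX_cst ?subrr//; [exact: Intg_tau|exact: Intg_cst]. Qed.

(** Up to multiples of [Lam], the sum of the [tau3 (U i)] has mean at most [- x^2 / 2] and, by
    [sum_var_tauY], variance at most [x^2]. The level [x^2 / 2] thus lies [x] standard deviations
    above the mean, which is where [tail x] comes from. *)
Lemma sum_Etau : \sum_(i < n) EX P (fun w => tau3 (U i w)) <= - (x ^+ 2 / 2) + Lam * 3.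
Proof.
have -> : - (x ^+ 2 / 2) + Lam * 3 = \sum_(i < n) (EX P (U i) - EX P (fun w => U i w ^+ 2) / 2 +
    EX P (fun w => `|U i w| ^+ 3) * 3).
  by rewrite !big_split/= sumrN -!mulr_suml EU1 EU2 -LamE sub0r.
apply: ler_sum => i _.
have I1 := Intg_U1 FM FU I3 i; have I2 := Intg_U2 FM FU I3 i.
rewrite -EXZr// -EXZr// -EXB//; last exact: IntgZr.
rewrite -EXD; [|by apply: IntgB => //; exact: IntgZr|exact: IntgZr].
apply: EX_le => [||w]; first exact: Intg_tau.
  by apply: IntgD; [apply: IntgB => //; exact: IntgZr|exact: IntgZr].
exact: tau3_ub.
Qed.

Lemma Intg_tau2 i : Intg P (fun w => tau3 (U i w) ^+ 2).
Proof.
apply: (@Intg_bdd _ _ _ _ _ ((3 / 2) ^+ 2)) => [|w].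
  by apply: measurable_funX; exact: mtau.
by rewrite normrX lerXn2r ?nnegrE// tau3_bound.
Qed.

Lemma Intg_tau3 i : Intg P (fun w => `|tau3 (U i w)| ^+ 3).
Proof.
apply: (@Intg_bdd _ _ _ _ _ ((3 / 2) ^+ 3)) => [|w].
  by apply: measurable_funX; exact: (measurableT_comp _ (mtau i)).
by rewrite normrX normr_id lerXn2r ?nnegrE// tau3_bound.
Qed.

Lemma sum_var_tauY : \sum_(i < n) EX P (fun w => tauY i w ^+ 2) <= x ^+ 2 + 3 * Lam.
Proof.
have -> : x ^+ 2 + 3 * Lam = \sum_(i < n) (EX P (fun w => U i w ^+ 2) +
    3 * EX P (fun w => `|U i w| ^+ 3)).
  by rewrite big_split/= EU2 -mulr_sumr -LamE.
apply: ler_sum => i _; have I2 := Intg_U2 FM FU I3 i.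
set m := EX P (fun v => tau3 (U i v)).
have -> : EX P (fun w => tauY i w ^+ 2) = EX P (fun w => tau3 (U i w) ^+ 2) - m ^+ 2.
  have -> : EX P (fun w => tauY i w ^+ 2) =
     EX P (fun w => tau3 (U i w) ^+ 2 - 2 * m * tau3 (U i w) + m ^+ 2).
    by apply: eq_EX => w; rewrite /tauY -/m; ring.
  have It := Intg_tau i; have It2 := Intg_tau2 i.
  rewrite EXD; [|by apply: IntgB => //; exact: IntgZ|exact: Intg_cst].
  rewrite EXB//; last exact: IntgZ.
  by rewrite EX_cst EXZ// -/m; ring.
apply: (@le_trans _ _ (EX P (fun w => tau3 (U i w) ^+ 2))).
  by rewrite gerBl sqr_ge0.
rewrite -EXZ// -EXD//; last exact: IntgZ.
apply: EX_le => [||w]; [exact: Intg_tau2|by apply: IntgD => //; exact: IntgZ|exact: tau3_sqr].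
Qed.

Lemma cube_sum_le (a b : R) : 0 <= a -> 0 <= b -> (a + b) ^+ 3 <= 4 * (a ^+ 3 + b ^+ 3).
Proof.
move=> a0 b0; rewrite -subr_ge0.
have -> : 4 * (a ^+ 3 + b ^+ 3) - (a + b) ^+ 3 = 3 * ((a + b) * (a - b) ^+ 2) by ring.
by rewrite mulr_ge0// mulr_ge0 ?addr_ge0 ?sqr_ge0.
Qed.

(** [27 = 8 * (3/2)^3]: recentering costs a factor 8 by convexity of the cube, and
    [|tau3 u| <= 3/2 |u|]. *)
Lemma cube_tauY i : EX P (fun w => `|tauY i w| ^+ 3) <= 27 * EX P (fun w => `|U i w| ^+ 3).
Proof.
have It := Intg_norm (Intg_tau i); have It3 := Intg_tau3 i.
have Iy : Intg P (fun w => `|tauY i w| ^+ 3).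
  apply: (@Intg_bdd _ _ _ _ _ (3 ^+ 3)) => [|w].
    apply: measurable_funX; apply: measurableT_comp => //.
    by apply: measurable_funB => //; exact: mtau.
  by rewrite normrX normr_id lerXn2r ?nnegrE// tauY_bound.
set a := EX P (fun w => `|tau3 (U i w)|); set b := EX P (fun w => `|tau3 (U i w)| ^+ 3).
have a0 : 0 <= a by apply: EX_ge0.
have m_a : `|EX P (fun w => tau3 (U i w))| <= a by apply: EX_norm; exact: Intg_tau.
have ab : a ^+ 3 <= b.
  have h : 3 * a ^+ 2 * a - 2 * a ^+ 3 <= b.
    rewrite /a -EXZ// -/a -[X in _ - X](EX_cst P) -EXB; [|exact: IntgZ|exact: Intg_cst].
    apply: EX_le => [||w]; [by apply: IntgB; [exact: IntgZ|exact: Intg_cst]|exact: It3|].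
    set y := `|_|; have y0 : 0 <= y by exact: normr_ge0.
    rewrite -subr_ge0 (_ : _ - _ = (y - a) ^+ 2 * (y + 2 * a)); last by ring.
    by rewrite mulr_ge0 ?sqr_ge0// addr_ge0// mulr_ge0.
  by apply: le_trans h; rewrite le_eqVlt; apply/orP; left; apply/eqP; ring.
have b1 : b <= (3 / 2) ^+ 3 * EX P (fun w => `|U i w| ^+ 3).
  rewrite -EXZ//; apply: EX_le => [||w]; [exact: It3|exact: IntgZ|].
  by rewrite -exprMn lerXn2r ?nnegrE ?mulr_ge0// tau3_lin.
have y1 : EX P (fun w => `|tauY i w| ^+ 3) <= 4 * (b + a ^+ 3).
  have -> : 4 * (b + a ^+ 3) = EX P (fun w => 4 * (`|tau3 (U i w)| ^+ 3 + a ^+ 3)).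
    rewrite (@EXZ _ _ _ P _ (fun w => `|tau3 (U i w)| ^+ 3 + a ^+ 3)).
      by rewrite EXD ?EX_cst//; exact: Intg_cst.
    by apply: IntgD => //; exact: Intg_cst.
  apply: EX_le => [||w]; [exact: Iy|by apply: IntgZ; apply: IntgD => //; exact: Intg_cst|].
  apply: (@le_trans _ _ ((`|tau3 (U i w)| + a) ^+ 3)).
    rewrite lerXn2r ?nnegrE ?addr_ge0// (le_trans (ler_normB _ _))// lerD2l//.
  by apply: cube_sum_le.
apply: (le_trans y1); apply: (@le_trans _ _ (8 * b)); first by move: ab; lra.
apply: (le_trans (ler_wpM2l _ b1)) => //.
by rewrite le_eqVlt; apply/orP; left; apply/eqP; field.
Qed.

End self_normalized.

(** The variance is known only through its bound [v1]. Enlarging it increases the argument of the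
    logistic when [g >= 0]. When [g < 0] that argument is at most [- lam c], so the value is below
    [expR (- (lam * c))], which is added to the bound. *)
Lemma heat_le_tail (R : realType) (lam c v v1 : R) :
  0 < lam -> 0 <= c -> 0 < v1 -> v <= v1 -> c < lam * v1 ->
  heat lam c v 0 <= tail (c / Num.sqrt v1) +
    normal_pdf (0 : R) 1 (c / Num.sqrt v1) / (lam * Num.sqrt v1 - c / Num.sqrt v1) + expR (- (lam * c)).
Proof.
move=> l0 c0 v10 vv cl; set r := Num.sqrt v1; set a := c / r.
have r0 : 0 < r by rewrite sqrtr_gt0.
have rr : v1 = r ^+ 2 by rewrite sqr_sqrtr// ltW.
have a0 : 0 <= a by rewrite divr_ge0// ltW.
have ak : a < lam * r by rewrite ltr_pdivrMr// -mulrA -expr2 -rr.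
have mG : measurable_fun (setT : set R) (fun g : R => logistic (lam * r * (g - a))).
  apply: (measurableT_comp (@meas_logistic R)); apply: measurable_funM => //.
  exact: measurable_funB.
have G0 (g : R) : 0 <= logistic (lam * r * (g - a)) by rewrite ltW// logistic_gt0.
have [I1 E1] := @Intg_ge0 _ _ _ (@gamma R) (fun g : R => logistic (lam * r * (g - a)))
  (tail a + normal_pdf (0 : R) 1 a / (lam * r - a)) mG G0 (gauss_logistic a0 ak).
have E2 : EX (@gamma R) (fun g : R => logistic (lam * r * (g - a)) + expR (- (lam * c))) <=
   tail a + normal_pdf (0 : R) 1 a / (lam * r - a) + expR (- (lam * c)).
  by rewrite EXD ?EX_cst ?lerD2r//; exact: Intg_cst.
apply: le_trans E2; apply: EX_le => [||g].
- exact: Intg_heat.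
- by apply: IntgD => //; exact: Intg_cst.
rewrite add0r.
have ra : lam * r * (g - a) = lam * (r * g - c) by rewrite /a; field; rewrite gt_eqF.
have [g0|g0] := leP 0 g.
  apply: (@le_trans _ _ (logistic (lam * r * (g - a)))); last by rewrite lerDl expR_ge0.
  apply: logistic_homo; rewrite ra ler_pM2l// lerD2r ler_wpM2r//.
  by rewrite ler_sqrt// ltW.
apply: (@le_trans _ _ (expR (- (lam * c)))); last by rewrite lerDr.
apply: le_trans (logistic_le_expR _) _; rewrite ler_expR -mulrN ler_pM2l//.
by rewrite gerDr mulr_ge0_le0 ?sqrtr_ge0// ltW.
Qed.

(** * Assembling the tail bound, for large and for bounded x *)

Section self_normalized2.
Context {R : realType} {d : measure_display} {T : measurableType d}.
Variables (P : probability T R) (n : nat).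
Variables (F : 'I_n -> set (set T)) (U : 'I_n -> T -> R).
Hypothesis FM : forall i E, F i E -> measurable E.
Hypothesis FU : forall i (B : set R), measurable B -> F i (U i @^-1` B).
Hypothesis indF : independent P F.
Hypothesis I3 : forall i, Intg P (fun w => `|U i w| ^+ 3).
Variable x : R.
Hypothesis x0 : 0 < x.
Hypothesis EU1 : \sum_(i < n) EX P (U i) = 0.
Hypothesis EU2 : \sum_(i < n) EX P (fun w => U i w ^+ 2) = x ^+ 2.
Variable Lam : R.
Hypothesis LamE : Lam = \sum_(i < n) EX P (fun w => `|U i w| ^+ 3).
Notation phi := (normal_pdf (0 : R) 1).
Notation gW := (@gW R).

Let mU i : measurable_fun setT (U i) := indep_meas FM FU i.

Lemma meas_sum_comp (g : R -> R) : measurable_fun setT g ->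
  measurable_fun setT (fun w => \sum_(i < n) g (U i w)).
Proof. by move=> mg; apply: meas_sum => i _; exact: (measurableT_comp mg (mU i)). Qed.

Lemma meas_ge_sum (g : R -> R) (t : R) : measurable_fun setT g ->
  measurable [set w | t <= \sum_(i < n) g (U i w)].
Proof. by move=> mg; apply: meas_le => //; exact: meas_sum_comp. Qed.

Lemma cube_root_small (a K b : R) : 0 <= a -> 0 <= K -> a ^+ 3 <= b -> K ^+ 3 * b <= 1 -> K * a <= 1.
Proof.
move=> a0 K0 ab Kb.
have h : (K * a) ^+ 3 <= 1.
  by rewrite exprMn (le_trans _ Kb)// ler_wpM2l// exprn_ge0.
have [//|h1] := leP (K * a) 1.
by move: h h1; set y := K * a; rewrite !exprS expr0; nra.
Qed.

(** Markov's inequality for the logistic placed at [c], a distance [u0] below the recentered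
    threshold [x^2 - e1 - 3 Lam]: on the event the logistic is at least [logistic (lam * u0)]. Its
    expectation is compared with the Gaussian one, and [heat_le_tail] concludes. *)
Lemma part1 (lam u0 e1 r a : R) : 0 < lam -> 0 <= u0 -> 0 <= e1 ->
  (2 * (1 + gW) * lam) ^+ 3 * (27 * Lam) <= 1 ->
  0 <= x ^+ 2 - e1 - 3 * Lam - u0 ->
  x ^+ 2 - e1 - 3 * Lam - u0 < lam * (x ^+ 2 + 3 * Lam) ->
  r = Num.sqrt (x ^+ 2 + 3 * Lam) ->
  a = (x ^+ 2 - e1 - 3 * Lam - u0) / r ->
  (P [set w | (x ^+ 2 / 2 - e1 <= \sum_(i < n) tau3 (U i w))%R] <=
   (expR (2 * (expR (lam * 3) + gW) * lam ^+ 3 * (27 * Lam)) *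
    (tail a + phi a / (lam * r - a) + expR (- (lam * (x ^+ 2 - e1 - 3 * Lam - u0)))) /
    logistic (lam * u0))%:E)%E.
Proof.
move=> l0 u00 e10 small c0 cl rE aE.
set c := x ^+ 2 - e1 - 3 * Lam - u0 in c0 cl aE *.
have L0 : 0 <= Lam by exact: (Lam_ge0 LamE).
pose Y := tauY P U.
have FY i (B : set R) : measurable B -> F i (Y i @^-1` B).
  move=> mB; apply: (meas_comp_preimage FU (g := fun z => tau3 z - EX P (fun v => tau3 (U i v)))) => //.
  by apply: measurable_funB => //; exact: tau3_meas.
have Ym i w : `|Y i w| <= 3 by exact: (tauY_bound P FM FU).
have EY i : EX P (Y i) = 0 by exact: (tauY_mean P FM FU).
have c3 i : EX P (fun w => `|Y i w| ^+ 3) <= 27 * EX P (fun w => `|U i w| ^+ 3).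
  exact: (cube_tauY FM FU I3).
have Iy2 i : Intg P (fun w => Y i w ^+ 2).
  apply: (@Intg_bdd _ _ _ _ _ (3 ^+ 2)) => [|w].
    apply: measurable_funX; apply: measurable_funB => //.
    exact: (measurableT_comp tau3_meas (mU i)).
  by rewrite normrX lerXn2r ?nnegrE.
have Iy3 i : Intg P (fun w => `|Y i w| ^+ 3).
  apply: (@Intg_bdd _ _ _ _ _ (3 ^+ 3)) => [|w].
    apply: measurable_funX; apply: measurableT_comp => //; apply: measurable_funB => //.
    exact: (measurableT_comp tau3_meas (mU i)).
  by rewrite normrX normr_id lerXn2r ?nnegrE.
have W0 : 0 <= gW by exact: gW_ge0.
have U3 i : EX P (fun w => `|U i w| ^+ 3) <= Lam.
  rewrite LamE (bigD1 i)//= lerDl; apply: sumr_ge0 => j _.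
  by apply: EX_ge0 => w; exact: exprn_ge0.
(* Lyapunov's inequality turns the smallness of the third moments into that of each standard
   deviation, as the swap demands. *)
have smallv i : 2 * (1 + gW) * (lam * Num.sqrt (EX P (fun w => Y i w ^+ 2))) <= 1.
  rewrite mulrA; apply: (@cube_root_small _ _ (27 * Lam)) => //.
  - by rewrite mulr_ge0 ?(ltW l0)// mulr_ge0// addr_ge0.
  - apply: (le_trans (sqrt_var_le (Iy3 i) (Iy2 i))); apply: (le_trans (c3 i)).
    by rewrite ler_wpM2l.
have H := @lindeberg_prefix R lam c 3 l0 _ _ P n F Y FM FY indF Ym EY smallv n 0 (lexx 0).
have allE (f : 'I_n -> R) : \sum_(i < n | (i < n)%N) f i = \sum_(i < n) f i.
  by apply: eq_bigl => i; rewrite ltn_ord.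
rewrite !allE add0r in H.
have hv : heat lam c (\sum_(i < n) EX P (fun w => Y i w ^+ 2)) 0 <=
    tail a + phi a / (lam * r - a) + expR (- (lam * c)).
  rewrite aE rE; apply: heat_le_tail => //; last exact: (sum_var_tauY FM FU I3 EU2 LamE).
  by rewrite ltr_wpDr ?mulr_ge0// exprn_gt0.
have he : \sum_(i < n) (2 * (expR (lam * 3) + gW) * lam ^+ 3 * EX P (fun w => `|Y i w| ^+ 3)) <=
    2 * (expR (lam * 3) + gW) * lam ^+ 3 * (27 * Lam).
  rewrite -mulr_sumr; apply: ler_wpM2l.
    by rewrite mulr_ge0 ?exprn_ge0 ?(ltW l0)// mulr_ge0// addr_ge0 ?expR_ge0.
  by rewrite LamE mulr_sumr; apply: ler_sum => i _; exact: c3.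
have l1 := logistic_gt0 (lam * u0).
have mS : measurable_fun setT (psum Y n) by exact: (psum_meas FM FY).
have Ih := Intg_heat_comp c l0 P 0 mS.
have mA : measurable [set w | x ^+ 2 / 2 - e1 <= \sum_(i < n) tau3 (U i w)].
  by apply: meas_ge_sum; exact: tau3_meas.
apply: (@le_trans _ _ (EX P (fun w => heat lam c 0 (psum Y n w) * (logistic (lam * u0))^-1))%:E).
  apply: prob_le_EX => //.
  - exact: IntgZr.
  - by move=> w; rewrite mulr_ge0 ?heat_ge0// invr_ge0 ltW.
  - move=> w /= hw; rewrite ler_pdivlMr// mul1r.
    have -> : heat lam c 0 (psum Y n w) = logistic (lam * (psum Y n w - c)).
      rewrite /heat -[RHS](EX_cst (@gamma R)); apply: eq_EX => g.
      by rewrite sqrtr0 mul0r addr0.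
    apply: logistic_homo; rewrite ler_pM2l// psum_full.
    have -> : \sum_(i < n) Y i w = \sum_(i < n) tau3 (U i w) -
        \sum_(i < n) EX P (fun v => tau3 (U i v)) by rewrite -sumrB.
    have := sum_Etau FM FU I3 EU1 EU2 LamE; rewrite /c.
    by move: hw; set A := \sum_(i < n) tau3 _; set B := \sum_(i < n) EX _ _; lra.
rewrite lee_fin (@EXZr _ _ _ P _ (fun w => heat lam c 0 (psum Y n w)))//.
apply: ler_wpM2r; first by rewrite invr_ge0 ltW.
apply: (le_trans H); apply: ler_pM => //.
- exact: heat_ge0.
- by rewrite ler_expR.
Qed.

Hypothesis L1A : cA * Lam <= 1.
Hypothesis L1B : cB * Lam <= 1.
Let E := [set w | x * Num.sqrt (\sum_(i < n) U i w ^+ 2) < \sum_(i < n) U i w].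

Lemma measE : measurable E.
Proof.
apply: meas_lt; last by apply: (meas_sum_comp (g := id)).
apply: measurable_funM => //.
apply: (measurableT_comp (cont_meas (@sqrt_continuous R))).
by apply: (meas_sum_comp (g := fun u => u ^+ 2)); exact: measurable_funX.
Qed.

Lemma measq (l : R) : measurable_fun (setT : set R) (fun u : R => l * u ^+ 2).
Proof. by apply: measurable_funM => //; exact: measurable_funX. Qed.

Lemma meas_truncU : measurable_fun (setT : set R) (@truncU R).
Proof.
apply: measurable_fun_ifT => //; apply: (measurable_fun_bool true).
rewrite setTI; apply: (@meas_le _ (measurableTypeR R) R) => //.
Qed.

Lemma meas_bigU : measurable_fun (setT : set R) (@bigU R).
Proof.
apply: measurable_fun_ifT => //; apply: (measurable_fun_bool true).
rewrite setTI; apply: (@meas_le _ (measurableTypeR R) R) => //.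
Qed.

Lemma meas_truncQ t : measurable_fun (setT : set R) (@truncQ R t).
Proof.
apply: measurable_fun_ifT => //; last exact: measq.
apply: (measurable_fun_bool true).
rewrite setTI; apply: (@meas_le _ (measurableTypeR R) R) => //.
by apply: measurable_funM => //; exact: measurableT_comp.
Qed.

Lemma prob_expR_le (A : set T) (a b : R) : (P A <= (expR a)%:E)%E -> a <= b -> (P A <= (expR b)%:E)%E.
Proof. by move=> h ab; apply: (le_trans h); rewrite lee_fin ler_expR. Qed.

Let A0 (e1 : R) := [set w | x ^+ 2 / 2 - e1 <= \sum_(i < n) tau3 (U i w)].

(** The zones next to [x] beat [expR (- x^2 / 2)] only by the factor [expR (- x del / 4)], while the
    normal tail is smaller than this exponential by about [1 / x]; the bound is therefore useful for
    large [x]. *)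
Lemma large_x (del p0 : R) : 0 < del -> del <= x ->
  (P (A0 (del ^+ 2 / 2)) <= p0%:E)%E ->
  (P E <= (p0 + (2 * expR (1 - x ^+ 2 / 2 - x * del / 4) + 2 * expR (1 - x ^+ 2)))%:E)%E.
Proof.
move=> del0 delx h0; have LamE' := LamE; have L0 := Lam_ge0 LamE.
pose B1 := [set w | - (x ^+ 2 / 2) + x * del / 2 <= \sum_(i < n) (U i w - 3 / 2 * U i w ^+ 2)].
pose B2 := [set w | 7 / 8 * x ^+ 2 + x * del / 4 <= \sum_(i < n) (U i w - 1 / 8 * U i w ^+ 2)].
pose B3 := [set w | 5 / 2 * x ^+ 2 <= \sum_(i < n) truncU (U i w)].
pose B4 := [set w | 2 * x ^+ 2 <= \sum_(i < n) bigU (U i w)].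
have mlq (l : R) : measurable_fun (setT : set R) (fun u : R => u - l * u ^+ 2).
  by apply: measurable_funB => //; exact: measq.
have mA0 : measurable (A0 (del ^+ 2 / 2)) by apply: meas_ge_sum; exact: tau3_meas.
have mB1 : measurable B1 by apply: meas_ge_sum (mlq _).
have mB2 : measurable B2 by apply: meas_ge_sum (mlq _).
have mB3 : measurable B3 by apply: meas_ge_sum meas_truncU.
have mB4 : measurable B4 by apply: meas_ge_sum meas_bigU.
have xd0 : 0 < x * del by exact: mulr_gt0.
have x20 : 0 < x ^+ 2 by exact: exprn_gt0.
have P1 : (P B1 <= (expR (1 - x ^+ 2 / 2 - x * del / 4))%:E)%E.
  have H (u : R) : expR (u - 3 / 2 * u ^+ 2) <= 1 + 1 * u + - 1 * u ^+ 2 + cA * `|u| ^+ 3.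
    have h := @expR_linquad R (3 / 2) u; rewrite [1 * u]mul1r.
    have -> : - 1 = 1 / 2 - 3 / 2 :> R by field.
    by apply: h; lra.
  apply: (prob_expR_le (exp_sum FM FU indF I3 EU1 EU2 _ (mlq _) H)).
  by rewrite -LamE; move: L1A xd0; set q := cA * Lam; set y := x * del; lra.
have P2 : (P B2 <= (expR (1 - x ^+ 2 / 2 - x * del / 4))%:E)%E.
  have H (u : R) : expR (u - 1 / 8 * u ^+ 2) <= 1 + 1 * u + 3 / 8 * u ^+ 2 + cA * `|u| ^+ 3.
    have h := @expR_linquad R (1 / 8) u; rewrite [1 * u]mul1r.
    have -> : 3 / 8 = 1 / 2 - 1 / 8 :> R by field.
    by apply: h; lra.
  apply: (prob_expR_le (exp_sum FM FU indF I3 EU1 EU2 _ (mlq _) H)).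
  by rewrite -LamE; move: L1A xd0; set q := cA * Lam; set y := x * del; lra.
have L64 : 64 * Lam <= 1.
  apply: le_trans L1A; rewrite ler_wpM2r// /cA; have := expR3_ge (R := R); lra.
have P3 : (P B3 <= (expR (1 - x ^+ 2))%:E)%E.
  have H (u : R) : expR (truncU u) <= 1 + 1 * u + 1 * u ^+ 2 + 64 * `|u| ^+ 3.
    by rewrite !mul1r expR_truncU.
  apply: (prob_expR_le (exp_sum FM FU indF I3 EU1 EU2 _ meas_truncU H)).
  by rewrite -LamE; move: L64; set q := 64 * Lam; lra.
have P4 : (P B4 <= (expR (1 - x ^+ 2))%:E)%E.
  have H (u : R) : expR (bigU u) <= 1 + 0 * u + 0 * u ^+ 2 + cB * `|u| ^+ 3.
    by rewrite !mul0r !addr0 expR_bigU.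
  apply: (prob_expR_le (exp_sum FM FU indF I3 EU1 EU2 _ meas_bigU H)).
  by rewrite -LamE; move: L1B; set q := cB * Lam; lra.
have P34 := prob_subU (measurableU _ _ mB3 mB4) mB3 mB4 (@subset_refl _ _) P3 P4.
have P12 := prob_subU (measurableU _ _ mB1 mB2) mB1 mB2 (@subset_refl _ _) P1 P2.
have mB12 := measurableU _ _ mB1 mB2; have mB34 := measurableU _ _ mB3 mB4.
have PB := prob_subU (measurableU _ _ mB12 mB34) mB12 mB34 (@subset_refl _ _) P12 P34.
have := prob_subU measE mA0 (measurableU _ _ mB12 mB34) _ h0 PB.
have -> : expR (1 - x ^+ 2 / 2 - x * del / 4) + expR (1 - x ^+ 2 / 2 - x * del / 4) +
  (expR (1 - x ^+ 2) + expR (1 - x ^+ 2)) =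
  2 * expR (1 - x ^+ 2 / 2 - x * del / 4) + 2 * expR (1 - x ^+ 2) by ring.
apply => w Ew; pose r := Num.sqrt (\sum_(i < n) U i w ^+ 2).
have [h1|h1] := ltP r (x - del).
  by right; left; left; exact: (dev_low x0 del0 Ew h1).
have [h2|h2] := leP r (x + del).
  by left; apply: ltW; apply: (dev_center Ew); rewrite -/r h1.
have [h3|h3] := leP r (5 * x).
  by right; left; right; exact: (dev_mid x0 del0 Ew h2 h3).
by right; right; have [h|h] := dev_high x0 Ew h3; [left|right].
Qed.

(** For bounded [x] the gain [expR (- x del / 4)] is not small. Instead [\sum U^2] is shown to
    concentrate at [x^2] when [Lam] is small; the free scale [t] makes the probability of a
    deviation as small as desired. *)
Lemma small_x (del p0 t : R) : 0 < del -> del <= x -> 0 < t -> 4 * t ^+ 3 * Lam <= 1 ->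
  (P (A0 (del ^+ 2 / 2)) <= p0%:E)%E ->
  (P E <= (p0 + (2 * expR (1 - t ^+ 2 * (x * del)) + t ^+ 3 * Lam))%:E)%E.
Proof.
move=> del0 delx t0 tL h0; have L0 := Lam_ge0 LamE.
pose B1 := [set w | t ^+ 2 * (x * del - x ^+ 2) <= \sum_(i < n) (- t ^+ 2 * U i w ^+ 2)].
pose B2 := [set w | t ^+ 2 * (x ^+ 2 + x * del) <= \sum_(i < n) truncQ t (U i w)].
pose B3 := [set w | exists i, t^-1 < `|U i w|].
have mA0 : measurable (A0 (del ^+ 2 / 2)) by apply: meas_ge_sum; exact: tau3_meas.
have mB1 : measurable B1 by apply: meas_ge_sum (measq _).
have mB2 : measurable B2 by apply: meas_ge_sum (meas_truncQ t).
have mB3 : measurable B3.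
  have -> : B3 = \bigcup_(i in [set: 'I_n]) [set w | t^-1 < `|U i w|].
    by apply/seteqP; split=> w /= [i] => [h|_ h]; exists i.
  apply: fin_bigcup_measurable => // i _; apply: meas_lt => //.
  exact: (measurableT_comp _ (mU i)).
have P1 : (P B1 <= (expR (1 - t ^+ 2 * (x * del)))%:E)%E.
  have H (u : R) : expR (- t ^+ 2 * u ^+ 2) <= 1 + 0 * u + - t ^+ 2 * u ^+ 2 + 4 * t ^+ 3 * `|u| ^+ 3.
    by rewrite mul0r addr0 mulNr expR_negquad// ltW.
  apply: (prob_expR_le (exp_sum FM FU indF I3 EU1 EU2 _ (measq _) H)).
  rewrite -LamE; move: tL; set q := 4 * _ * Lam.
  by rewrite mulrBr mulNr; set y := t ^+ 2 * x ^+ 2; set z := t ^+ 2 * (x * del); lra.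
have P2 : (P B2 <= (expR (1 - t ^+ 2 * (x * del)))%:E)%E.
  have H (u : R) : expR (truncQ t u) <= 1 + 0 * u + t ^+ 2 * u ^+ 2 + 4 * t ^+ 3 * `|u| ^+ 3.
    by rewrite mul0r addr0 expR_truncQ// ltW.
  apply: (prob_expR_le (exp_sum FM FU indF I3 EU1 EU2 _ (meas_truncQ t) H)).
  rewrite -LamE; move: tL; set q := 4 * _ * Lam.
  by rewrite mulrDr; set y := t ^+ 2 * x ^+ 2; set z := t ^+ 2 * (x * del); lra.
have P3 : (P B3 <= (t ^+ 3 * Lam)%:E)%E.
  have ti0 : 0 < t^-1 by rewrite invr_gt0.
  have := prob_exists_big FM FU I3 ti0; rewrite -LamE.
  by rewrite exprVn invrK.
have mB12 := measurableU _ _ mB1 mB2.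
have P12 := prob_subU mB12 mB1 mB2 (@subset_refl _ _) P1 P2.
have PB := prob_subU (measurableU _ _ mB12 mB3) mB12 mB3 (@subset_refl _ _) P12 P3.
have := prob_subU measE mA0 (measurableU _ _ mB12 mB3) _ h0 PB.
have -> : expR (1 - t ^+ 2 * (x * del)) + expR (1 - t ^+ 2 * (x * del)) =
  2 * expR (1 - t ^+ 2 * (x * del)) by ring.
apply => w Ew; pose r := Num.sqrt (\sum_(i < n) U i w ^+ 2).
have [h1|h1] := ltP r (x - del).
  right; left; left; rewrite /B1/=.
  have -> : \sum_(i < n) - t ^+ 2 * U i w ^+ 2 = t ^+ 2 * \sum_(i < n) - U i w ^+ 2.
    by rewrite mulr_sumr; apply: eq_bigr => i _; rewrite mulNr mulrN.
  by rewrite ler_wpM2l ?sqr_ge0//; exact: (dev_low_sq x0 del0 delx h1).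
have [h2|h2] := leP r (x + del).
  by left; apply: ltW; apply: (dev_center Ew); rewrite -/r h1.
by right; have [h|h] := dev_high_sq x0 del0 delx t0 h2; [left; right|right].
Qed.

End self_normalized2.

(** * Choice of the constants against the normal tail *)

Section arithmetic.
Context {R : realType}.
Notation phi := (normal_pdf (0 : R) 1).

Lemma expRN_le_inv (z : R) : 0 < z -> expR (- z) <= z^-1.
Proof.
move=> z0; rewrite expRN lef_pV2 ?posrE ?expR_gt0//.
by have := expR_ge1Dx z; lra.
Qed.

Lemma expRN_le_inv2 (z : R) : 0 < z -> expR (- z) <= 2 / z ^+ 2.
Proof.
move=> z0; rewrite -[2 / z ^+ 2]invrK invf_div expRN lef_pV2 ?posrE ?expR_gt0 ?divr_gt0 ?exprn_gt0//.
have := @expR_ge1Dxn R z 1 (ltW z0); rewrite (_ : (2`!)%:R = 2 :> R)//; lra.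
Qed.

Lemma expR_small (y z : R) : y <= z -> 0 <= z -> z <= 1 / 2 -> expR y <= 1 + 2 * z.
Proof.
move=> yz z0 z1; apply: (@le_trans _ _ (expR z)); first by rewrite ler_expR.
have h : 1 - z <= expR (- z) by have := expR_ge1Dx (- z); lra.
rewrite -[z in leLHS]opprK expRN invf_ple ?posrE ?expR_gt0//; last by lra.
apply: le_trans h; rewrite invf_ple ?posrE; [|lra|lra].
rewrite -[leLHS]mul1r ler_pdivrMr; last by lra.
by nra.
Qed.

Variable x0 : R.
Hypothesis x00 : 0 < x0.
(** The ratio of [phi x] to [phi (x + x^-1)] is [expR (1 + (2 x^2)^-1)]; this is its largest value
    for [x >= x0]. *)
Definition C0 : R := expR (1 + (2 * x0 ^+ 2)^-1).
Lemma C0_gt0 : 0 < C0. Proof. exact: expR_gt0. Qed.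

Lemma phi_le_tail (x : R) : x0 <= x -> phi x <= C0 * x * tail x.
Proof.
move=> xx; have x1 : 0 < x by exact: lt_le_trans xx.
have xi0 : 0 < x^-1 by rewrite invr_gt0.
have h := tail_lower (ltW x1) xi0.
have E : phi x = phi (x + x^-1) * expR (1 + (2 * x ^+ 2)^-1).
  rewrite !phiE -mulrA -expRD; congr (_ * expR _); field; rewrite gt_eqF//.
have hx : expR (1 + (2 * x ^+ 2)^-1) <= C0.
  rewrite ler_expR lerD2l lef_pV2 ?posrE ?mulr_gt0 ?exprn_gt0// ler_pM2l// lerXn2r// nnegrE ltW//.
rewrite E; apply: (@le_trans _ _ (phi (x + x^-1) * C0)).
  by rewrite ler_wpM2l// ltW// phi_gt0.
rewrite mulrC -mulrA ler_pM2l ?C0_gt0//.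
by rewrite -ler_pdivrMl.
Qed.

Notation peak := (normal_peak (1 : R)).
Lemma peak_gt0 : 0 < peak. Proof. by rewrite normal_peak_gt0// oner_eq0. Qed.

Lemma expR_le_tail (x : R) : x0 <= x -> expR (- x ^+ 2 / 2) <= C0 / peak * x * tail x.
Proof.
move=> xx; have := phi_le_tail xx; rewrite phiE => h.
by rewrite (_ : C0 / peak * x * tail x = (C0 * x * tail x) / peak) ?ler_pdivlMr ?peak_gt0// 1?mulrC//; ring.
Qed.

(** In [5 C0 expR 4], four parts come from moving the tail back from [a] to [x] and one from the
    finite slope of the logistic. The last summand accounts for [expR (- (lam * c))]. *)
Definition C1 : R := 5 * C0 * expR 4 + 2 * C0 / (peak * x0).

Lemma C1_gt0 : 0 < C1.
Proof.
have c0 := C0_gt0; have e4 := expR_gt0 (4 : R); have pk := peak_gt0.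
by rewrite addr_gt0// ?divr_gt0 ?mulr_gt0.
Qed.

(** The slope [1 + z^-2] makes the logistic steep at scale [z], and [a = c / r] is within [4 z / x]
    of [x]. Since [phi x / x <= C0 * tail x], a displacement of order [z / x] changes the tail by a
    factor [1 + O(z)]. *)
Lemma part1_arith (x z L c r a lam : R) : x0 <= x -> 0 < z -> z <= 1 / 2 -> 0 <= L ->
  3 * L <= z -> 8 * z <= x0 ^+ 2 -> lam = 1 + z ^- 2 ->
  c = x ^+ 2 - z ^+ 2 / 2 - 3 * L - z -> r = Num.sqrt (x ^+ 2 + 3 * L) -> a = c / r ->
  [/\ 0 <= c, c < lam * (x ^+ 2 + 3 * L) &
  tail a + phi a / (lam * r - a) + expR (- (lam * c)) <= tail x * (1 + C1 * z)].
Proof.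
move=> xx z0 z1 L0 Lz zx lamE cE rE aE.
have x1 : 0 < x by exact: lt_le_trans xx.
have x2 : x0 ^+ 2 <= x ^+ 2 by rewrite lerXn2r// nnegrE ltW.
have z2 : z ^+ 2 <= z / 2 by rewrite expr2; nra.
have z20 : 0 < z ^+ 2 by rewrite exprn_gt0.
have c1 : x ^+ 2 - 3 * z <= c by rewrite cE; lra.
have c2 : c <= x ^+ 2 by rewrite cE; lra.
have c3 : x ^+ 2 / 2 <= c by lra.
have c0 : 0 <= c by apply: le_trans c3; rewrite divr_ge0// sqr_ge0.
have zi0 : 0 < z ^- 2 by rewrite invr_gt0.
have lam1 : 1 < lam by rewrite lamE ltrDl.
have r0 : 0 < r by rewrite rE sqrtr_gt0 ltr_wpDr ?mulr_ge0// exprn_gt0.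
have rr : r ^+ 2 = x ^+ 2 + 3 * L.
  by rewrite rE sqr_sqrtr// addr_ge0 ?sqr_ge0// mulr_ge0.
have rx : x <= r by rewrite -(@ler_pXn2r _ 2)// ?nnegrE ?(ltW x1) ?(ltW r0)// rr lerDl mulr_ge0.
have rx2 : r <= x + z / x.
  rewrite -(@ler_pXn2r _ 2)// ?nnegrE ?(ltW r0) ?addr_ge0 ?divr_ge0 ?(ltW x1) ?(ltW z0)// rr.
  have -> : (x + z / x) ^+ 2 = x ^+ 2 + 2 * z + (z / x) ^+ 2 by field; rewrite gt_eqF.
  by have := sqr_ge0 (z / x); lra.
have a0 : 0 <= a by rewrite aE divr_ge0// ltW.
have ax : a <= x by rewrite aE ler_pdivrMr// (le_trans c2)// expr2 ler_wpM2l// ltW.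
have xa : x - a <= 4 * z / x.
  rewrite lerBlDr -lerBlDl aE ler_pdivlMr//.
  have q0 : 0 <= x - 4 * z / x.
    by rewrite subr_ge0 ler_pdivrMr// -expr2; lra.
  apply: (le_trans (ler_wpM2l q0 rx2)).
  have -> : (x - 4 * z / x) * (x + z / x) = x ^+ 2 - 3 * z - 4 * (z / x) ^+ 2.
    by field; rewrite gt_eqF.
  by have := sqr_ge0 (z / x); lra.
split=> //.
  rewrite -rr (le_lt_trans c2)// (@lt_le_trans _ _ (lam * x ^+ 2))//.
    by rewrite ltr_pMl// exprn_gt0.
  by rewrite ler_wpM2l ?(ltW (lt_trans ltr01 lam1))// lerXn2r// nnegrE ltW.
have t0 := tail_gt0 (ltW x1).
have pe : phi a <= phi x * expR 4.
  apply: (le_trans (phi_le_expR x a)); rewrite ler_wpM2l ?(ltW (phi_gt0 x))// ler_expR.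
  apply: (le_trans (ler_wpM2l (ltW x1) xa)).
  rewrite (_ : x * (4 * z / x) = 4 * z); last by field; rewrite gt_eqF.
  by lra.
have px : phi x / x <= C0 * tail x.
  by rewrite ler_pdivrMr//; have := phi_le_tail xx; rewrite mulrAC.
have p0 : 0 < phi x := phi_gt0 x.
have b1 : tail a <= tail x + 4 * z * expR 4 * (C0 * tail x).
  apply: (le_trans (tail_local a0 ax)); rewrite lerD2l.
  apply: (@le_trans _ _ (4 * z / x * (phi x * expR 4))).
    by rewrite ler_pM ?subr_ge0// ltW// phi_gt0.
  rewrite (_ : 4 * z / x * (phi x * expR 4) = 4 * z * expR 4 * (phi x / x)); last by field; rewrite gt_eqF.
  by rewrite ler_wpM2l// mulr_ge0 ?expR_ge0// mulr_ge0// ltW.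
have b2 : phi a / (lam * r - a) <= z * expR 4 * (C0 * tail x).
  have k0 : x / z ^+ 2 <= lam * r - a.
    have : lam * x <= lam * r by rewrite ler_wpM2l// ltW// (lt_trans ltr01).
    by rewrite lamE mulrDl mul1r [z ^- 2 * x]mulrC; lra.
  have k1 : 0 < x / z ^+ 2 by rewrite divr_gt0.
  apply: (@le_trans _ _ (phi x * expR 4 / (x / z ^+ 2))).
    apply: ler_pM => //; first by rewrite ltW// phi_gt0.
      by rewrite invr_ge0 (le_trans _ k0)// ltW.
    by rewrite lef_pV2 ?posrE// (lt_le_trans k1).
  rewrite (_ : _ / _ = z ^+ 2 * expR 4 * (phi x / x)); last by field; rewrite !gt_eqF.
  apply: ler_pM => //; [by rewrite mulr_ge0 ?expR_ge0 ?sqr_ge0|by rewrite divr_ge0 ?ltW|].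
  by rewrite ler_wpM2r ?expR_ge0//; lra.
have b3 : expR (- (lam * c)) <= 2 * C0 / (peak * x0) * z * tail x.
  apply: (@le_trans _ _ (expR (- x ^+ 2 / 2) * expR (- (x ^+ 2 / (2 * z ^+ 2))))).
    rewrite -expRD ler_expR lamE mulrDl mul1r opprD.
    apply: lerD; first by lra.
    rewrite lerN2 (_ : x ^+ 2 / (2 * z ^+ 2) = z ^- 2 * (x ^+ 2 / 2)); last by field; rewrite gt_eqF.
    by rewrite ler_wpM2l// ltW.
  have i1 : expR (- (x ^+ 2 / (2 * z ^+ 2))) <= (2 * z ^+ 2) / x ^+ 2.
    by rewrite -[leRHS]invf_div; apply: expRN_le_inv; rewrite divr_gt0 ?mulr_gt0// exprn_gt0.
  apply: (@le_trans _ _ (C0 / peak * x * tail x * ((2 * z ^+ 2) / x ^+ 2))).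
    by apply: ler_pM; rewrite ?expR_ge0//; exact: expR_le_tail.
  have pk := peak_gt0.
  rewrite (_ : C0 / peak * x * tail x * ((2 * z ^+ 2) / x ^+ 2) =
    2 * C0 / peak * z ^+ 2 * tail x * x^-1); last by field; rewrite !gt_eqF.
  rewrite (_ : 2 * C0 / (peak * x0) * z * tail x =
    2 * C0 / peak * z * tail x * x0^-1); last by field; rewrite !gt_eqF.
  have q0 : 0 <= 2 * C0 / peak by rewrite divr_ge0 ?mulr_ge0 ?ltW// C0_gt0.
  apply: ler_pM; rewrite ?invr_ge0 ?(ltW x1)//.
  - by rewrite mulr_ge0 ?(ltW t0)// mulr_ge0 ?(ltW z20).
  - by rewrite ler_wpM2r ?(ltW t0)// ler_wpM2l//; lra.
  - by rewrite lef_pV2 ?posrE.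
apply: (le_trans (lerD (lerD b1 b2) b3)).
by rewrite /C1 le_eqVlt; apply/orP; left; apply/eqP; ring.
Qed.


(** [408 = 2 * 204] and [204 = 2 * 3 * 32 + 2 * 3 * 2]: the 3 bounds [expR 1], the 32 comes from
    [expR (- v) <= 2 / v^2] at [v = x z / 4], the last 2 from [expR (- v) <= 1 / v] at
    [v = x^2 / 2]. *)
Lemma part2_large_arith (x z T e : R) : x0 <= x -> 0 < z -> z <= 1 / 2 -> 0 < e -> T <= x ->
  T = 408 * C0 / (peak * z ^+ 2 * e) ->
  2 * expR (1 - x ^+ 2 / 2 - x * z / 4) + 2 * expR (1 - x ^+ 2) <= e / 2 * tail x.
Proof.
move=> xx z0 z1 e0 Tx TE.
have x1 : 0 < x by exact: lt_le_trans xx.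
have t0 := tail_gt0 (ltW x1); have pk := peak_gt0; have c0 := C0_gt0.
have z20 : 0 < z ^+ 2 by rewrite exprn_gt0.
have x20 : 0 < x ^+ 2 by rewrite exprn_gt0.
have h := expR_le_tail xx; set E := expR (- x ^+ 2 / 2) in h.
have E0 : 0 <= E by exact: expR_ge0.
have e3 : expR 1 <= 3 :> R by rewrite ltW// expR1_lt3.
have a1 : expR (1 - x ^+ 2 / 2 - x * z / 4) <= 3 * E * (32 / (x ^+ 2 * z ^+ 2)).
  rewrite (_ : 1 - x ^+ 2 / 2 - x * z / 4 = 1 + (- x ^+ 2 / 2) + - (x * z / 4)); last by field.
  rewrite !expRD; apply: ler_pM; rewrite ?mulr_ge0 ?expR_ge0//; first by rewrite ler_wpM2r.
  apply: (le_trans (expRN_le_inv2 _)); first by rewrite divr_gt0// mulr_gt0.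
  by rewrite le_eqVlt; apply/orP; left; apply/eqP; field; rewrite !gt_eqF.
have a2 : expR (1 - x ^+ 2) <= 3 * E * (2 / (x ^+ 2 * z ^+ 2)).
  rewrite (_ : 1 - x ^+ 2 = 1 + (- x ^+ 2 / 2) + - (x ^+ 2 / 2)); last by field.
  rewrite !expRD; apply: ler_pM; rewrite ?mulr_ge0 ?expR_ge0//; first by rewrite ler_wpM2r.
  apply: (le_trans (expRN_le_inv _)); first by rewrite divr_gt0.
  rewrite invf_div ler_wpM2l// lef_pV2 ?posrE// ?mulr_gt0// ler_piMr ?(ltW x20)//.
  by rewrite expr2; nra.
have s0 : 2 * expR (1 - x ^+ 2 / 2 - x * z / 4) + 2 * expR (1 - x ^+ 2) <=
    204 * E / (x ^+ 2 * z ^+ 2).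
  apply: (@le_trans _ _ (2 * (3 * E * (32 / (x ^+ 2 * z ^+ 2))) + 2 * (3 * E * (2 / (x ^+ 2 * z ^+ 2))))).
    by move: a1 a2; set q1 := expR _; set q2 := expR _; lra.
  by rewrite le_eqVlt; apply/orP; left; apply/eqP; field; rewrite !gt_eqF.
apply: (le_trans s0).
apply: (@le_trans _ _ (204 * (C0 / peak * x * tail x) / (x ^+ 2 * z ^+ 2))).
  apply: ler_wpM2r; first by rewrite invr_ge0; apply: mulr_ge0; exact: ltW.
  exact: ler_wpM2l.
rewrite (_ : 204 * (C0 / peak * x * tail x) / (x ^+ 2 * z ^+ 2) =
  T * (e / 2 * tail x) / x); last by rewrite TE; field; rewrite !gt_eqF.
by rewrite ler_pdivrMr// mulrC ler_wpM2l// mulr_ge0 ?(ltW t0)// divr_ge0// ltW.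
Qed.

(** Each exponential is at most [3 / (t^2 x z)], and [t] is chosen to bring this below
    [e / 8 * tail T]; hence [24 = 3 * 8]. *)
Lemma part2_small_arith (x z T e t L : R) : x0 <= x -> 0 < z -> 0 < e -> x <= T ->
  t = 1 + 24 / (x0 * z * e * tail T) ->
  t ^+ 3 * L <= e / 4 * tail T ->
  2 * expR (1 - t ^+ 2 * (x * z)) + t ^+ 3 * L <= e / 2 * tail x.
Proof.
move=> xx z0 e0 xT tE tL.
have x1 : 0 < x by exact: lt_le_trans xx.
have T0 : 0 < T by exact: lt_le_trans xT.
have tT := tail_gt0 (ltW T0); have tTx := tail_anti xT.
have e3 : expR 1 <= 3 :> R by rewrite ltW// expR1_lt3.
have q0 : 0 < 24 / (x0 * z * e * tail T) by rewrite divr_gt0 ?mulr_gt0.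
have t1 : 1 <= t by rewrite tE lerDl ltW.
have t00 : 0 < t := lt_le_trans ltr01 t1.
have t2 : 24 / (x0 * z * e * tail T) <= t ^+ 2.
  have t3 : t <= t ^+ 2 by rewrite expr2 ler_peMl// (le_trans ler01).
  by apply: le_trans t3; rewrite tE lerDr.
have t20 : 0 < t ^+ 2 by exact: lt_le_trans t2.
have a1 : expR (1 - t ^+ 2 * (x * z)) <= e / 8 * tail T.
  rewrite expRD; apply: (@le_trans _ _ (3 * (t ^+ 2 * (x * z))^-1)).
    apply: ler_pM; rewrite ?expR_ge0//.
    by apply: expRN_le_inv; rewrite mulr_gt0// mulr_gt0.
  rewrite ler_pdivrMr ?mulr_gt0//.
  apply: (@le_trans _ _ (e / 8 * tail T * (24 / (x0 * z * e * tail T) * (x0 * z)))).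
    by rewrite le_eqVlt; apply/orP; left; apply/eqP; field; rewrite !gt_eqF.
  rewrite ler_wpM2l//; first by rewrite mulr_ge0 ?(ltW tT)// divr_ge0// ltW.
  by apply: ler_pM => //; rewrite ?(ltW q0) ?mulr_ge0 ?(ltW x00) ?(ltW z0)// ler_wpM2r// ltW.
apply: (@le_trans _ _ (e / 2 * tail T)); last by rewrite ler_wpM2l// divr_ge0// ltW.
move: a1 tL; rewrite (_ : e / 8 * tail T = (e * tail T) / 8); last by field.
rewrite (_ : e / 4 * tail T = (e * tail T) / 4); last by field.
rewrite (_ : e / 2 * tail T = (e * tail T) / 2); last by field.
set q := e * tail T; set q1 := expR _; set q2 := t ^+ 3 * L; lra.
Qed.

Lemma part1_factor (z e lam K : R) : 0 < z -> z <= 1 / 2 -> 0 < e -> lam = 1 + z ^- 2 ->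
  z * (2 * (3 * C1 + 4)) <= e -> K <= z ->
  expR K * (1 + C1 * z) / logistic (lam * z) <= 1 + e / 2.
Proof.
move=> z0 z1 e0 lamE ze Kz; have c1 := C1_gt0.
have k := expR_small Kz (ltW z0) z1.
have l : (logistic (lam * z))^-1 <= 1 + z.
  rewrite /logistic invrK lerD2l.
  apply: (@le_trans _ _ (expR (- z^-1))); last first.
    by rewrite -[leRHS]invrK; apply: expRN_le_inv; rewrite invr_gt0.
  rewrite ler_expR lerN2 lamE mulrDl mul1r (_ : z ^- 2 * z = z^-1) ?lerDr ?(ltW z0)//.
  by field; rewrite gt_eqF.
have c10 : 0 <= 1 + C1 * z by rewrite addr_ge0// mulr_ge0 ?(ltW c1) ?(ltW z0).
apply: (@le_trans _ _ ((1 + 2 * z) * (1 + C1 * z) * (1 + z))).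
  apply: ler_pM => //; first by rewrite mulr_ge0 ?expR_ge0.
    by rewrite invr_ge0 ltW// logistic_gt0.
  by rewrite ler_wpM2r.
have m1 : (1 + 2 * z) * (1 + z) <= 1 + 4 * z by nra.
have -> : (1 + 2 * z) * (1 + C1 * z) * (1 + z) = (1 + 2 * z) * (1 + z) * (1 + C1 * z) by ring.
apply: (le_trans (ler_wpM2r c10 m1)).
have cz : 0 <= C1 * z by rewrite mulr_ge0 ?(ltW c1) ?(ltW z0).
have m2 : C1 * z * z <= C1 * z / 2 by rewrite -mulrA; apply: (le_trans (ler_wpM2l cz z1)) || (rewrite mulrA; nra).
move: ze; rewrite (_ : z * (2 * (3 * C1 + 4)) = 6 * (C1 * z) + 8 * z); last by ring.
rewrite (_ : (1 + 4 * z) * (1 + C1 * z) = 1 + 4 * z + C1 * z + 4 * (C1 * z * z)); last by ring.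
move: m2; set q := C1 * z; set q2 := q * z; lra.
Qed.

End arithmetic.

(* [U] is the summand rescaled by [x], so that its variances add up to [x ^+ 2]; the
   event is scale invariant *)
Theorem self_normalized_tail (R : realType) (x0 e : R) : 0 < x0 -> 0 < e ->
  exists2 rho : R, 0 < rho & forall d (T : measurableType d) (P : probability T R) (n : nat)
    (F : 'I_n -> set (set T)) (U : 'I_n -> T -> R) (x : R),
    (forall i E, F i E -> measurable E) ->
    (forall i (B : set R), measurable B -> F i (U i @^-1` B)) ->
    independent P F ->
    (forall i, Intg P (fun w => `|U i w| ^+ 3)) ->
    x0 <= x ->
    \sum_(i < n) EX P (U i) = 0 ->
    \sum_(i < n) EX P (fun w => U i w ^+ 2) = x ^+ 2 ->
    \sum_(i < n) EX P (fun w => `|U i w| ^+ 3) <= rho ->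
    (P [set w | (x * Num.sqrt (\sum_(i < n) U i w ^+ 2) < \sum_(i < n) U i w)%R] <=
      ((1 + e) * tail x)%:E)%E.
Proof.
move=> x00 e0.
have c1 := C1_gt0 x00; have pk := @peak_gt0 R; have c0 := C0_gt0 x0.
have [z [z0 z1 zx ze zx0]] : exists z : R, [/\ 0 < z, z <= 1 / 2, 8 * z <= x0 ^+ 2,
    z * (2 * (3 * C1 x0 + 4)) <= e & z <= x0].
  have q0 : 0 < 2 * (3 * C1 x0 + 4) by rewrite mulr_gt0// addr_gt0// mulr_gt0.
  exists (Num.min (Num.min (1 / 2) (x0 ^+ 2 / 8)) (Num.min (e / (2 * (3 * C1 x0 + 4))) x0)).
  have x20 : 0 < x0 ^+ 2 by rewrite exprn_gt0.
  split.
  - by rewrite !lt_min !divr_gt0.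
  - by rewrite !ge_min lexx.
  - by rewrite mulrC -ler_pdivlMr// !ge_min lexx orbT.
  - by rewrite -ler_pdivlMr// !ge_min lexx !orbT.
  - by rewrite !ge_min lexx !orbT.
set W := @gW R; have W0 : 0 <= W := @gW_ge0 R.
pose lam := 1 + z ^- 2.
have l1 : 0 < lam by rewrite addr_gt0// invr_gt0 exprn_gt0.
(* Above [TT] the exponential gain beats the tail; below it [tail x] is at least the fixed positive
   number [tail TT]. *)
pose TT := 408 * C0 x0 / (normal_peak (1 : R) * z ^+ 2 * e).
have TT0 : 0 < TT.
  apply: divr_gt0; first by apply: mulr_gt0; [rewrite ltr0n|exact: c0].
  by apply: mulr_gt0 => //; apply: mulr_gt0 => //; exact: exprn_gt0.
have tT := tail_gt0 (ltW TT0).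
pose t := 1 + 24 / (x0 * z * e * tail TT).
have t0 : 0 < t by rewrite addr_gt0// divr_gt0// !mulr_gt0.
pose K := 2 * (expR (lam * 3) + W) * lam ^+ 3.
have K0 : 0 <= K by rewrite mulr_ge0 ?exprn_ge0 ?(ltW l1)// mulr_ge0// addr_ge0 ?expR_ge0.
(* Each smallness condition on the third moments [L] reads [q * L <= 1]; [M] adds up all the [q], so
   that the choice [M^-1] for [rho] meets them together. *)
pose M := 1 + (3 / z + K * 27 / z + (2 * (1 + W) * lam) ^+ 3 * 27 + cA + cB + 4 * t ^+ 3 +
  t ^+ 3 / (e / 4 * tail TT)).
have cA0 : 0 <= cA :> R by rewrite mulr_ge0 ?expR_ge0.
have cB0 := @cB_ge0 R.
have W3 : 0 <= (2 * (1 + W) * lam) ^+ 3 * 27.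
  by rewrite mulr_ge0// exprn_ge0// mulr_ge0 ?(ltW l1)// mulr_ge0// addr_ge0.
have z3 : 0 <= 3 / z by rewrite divr_ge0// ltW.
have zK : 0 <= K * 27 / z by apply: divr_ge0; [exact: mulr_ge0|exact: ltW].
have t3 : 0 <= 4 * t ^+ 3 by rewrite mulr_ge0// exprn_ge0// ltW.
have eT : 0 < e / 4 * tail TT by rewrite mulr_gt0// divr_gt0.
have t4 : 0 <= t ^+ 3 / (e / 4 * tail TT) by rewrite divr_ge0 ?exprn_ge0 ?(ltW t0) ?(ltW eT).
have M0 : 0 < M by rewrite /M; apply: ltr_wpDr => //; repeat (apply: addr_ge0 => //).
exists M^-1; first by rewrite invr_gt0.
move=> d T P n F U x FM FU indF I3 xx EU1 EU2.
set L := \sum_(i < n) _ => LM.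
have x1 : 0 < x by exact: lt_le_trans xx.
have L0 : 0 <= L by apply: sumr_ge0 => i _; apply: EX_ge0 => w; exact: exprn_ge0.
have ML : M * L <= 1 by rewrite -(mulfV (lt0r_neq0 M0)) ler_wpM2l// ltW.
have bound (q : R) : q <= M -> q * L <= 1 by move=> qM; apply: le_trans ML; rewrite ler_wpM2r.
have LE : L = \sum_(i < n) EX P (fun w => `|U i w| ^+ 3) by [].
have h3 : 3 * L <= z.
  have : 3 / z * L <= 1 by apply: bound; rewrite /M; lra.
  by rewrite mulrAC ler_pdivrMr// mul1r.
have hK : K * (27 * L) <= z.
  have : K * 27 / z * L <= 1 by apply: bound; rewrite /M; lra.
  by rewrite mulrAC ler_pdivrMr// mul1r mulrA.
have hW : (2 * (1 + W) * lam) ^+ 3 * (27 * L) <= 1.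
  by rewrite mulrA; apply: bound; rewrite /M; lra.
have hA : cA * L <= 1 by apply: bound; rewrite /M; lra.
have hB : cB * L <= 1 by apply: bound; rewrite /M; lra.
have ht : 4 * t ^+ 3 * L <= 1 by apply: bound; rewrite /M; lra.
have hT : t ^+ 3 * L <= e / 4 * tail TT.
  have : t ^+ 3 / (e / 4 * tail TT) * L <= 1 by apply: bound; rewrite /M; lra.
  by rewrite mulrAC ler_pdivrMr// mul1r.
pose c := x ^+ 2 - z ^+ 2 / 2 - 3 * L - z.
pose r := Num.sqrt (x ^+ 2 + 3 * L).
have [p1 p2 p3] := @part1_arith R x0 x00 x z L c r (c / r) lam xx z0 z1 L0 h3 zx erefl erefl erefl erefl.
have e1 : 0 <= z ^+ 2 / 2 by rewrite divr_ge0 ?sqr_ge0.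
have P0 := @part1 R _ _ P n F U FM FU indF I3 x x1 EU1 EU2 L LE lam z (z ^+ 2 / 2) r (c / r)
  l1 (ltW z0) e1 hW p1 p2 erefl erefl.
have tx := tail_gt0 (ltW x1).
have P0' : (P [set w | (x ^+ 2 / 2 - z ^+ 2 / 2 <= \sum_(i < n) tau3 (U i w))%R] <=
    ((1 + e / 2) * tail x)%:E)%E.
  apply: (le_trans P0); rewrite lee_fin -/c.
  have lg := logistic_gt0 (lam * z).
  apply: (@le_trans _ _ (expR (K * (27 * L)) * (tail x * (1 + C1 x0 * z)) / logistic (lam * z))).
    by apply: ler_wpM2r; [rewrite invr_ge0 ltW|apply: ler_wpM2l; rewrite ?expR_ge0].
  rewrite (_ : _ / _ = expR (K * (27 * L)) * (1 + C1 x0 * z) / logistic (lam * z) * tail x); last by ring.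
  by apply: ler_wpM2r; [exact: ltW|exact: (part1_factor x00 z0 z1 e0 erefl ze hK)].
have zlex : z <= x by exact: le_trans xx.
have [xT|Tx] := leP x TT.
  have := small_x FM FU indF I3 x1 EU1 EU2 LE z0 zlex t0 ht P0'.
  move=> /le_trans; apply; rewrite lee_fin.
  have := part2_small_arith x00 xx z0 e0 xT erefl hT.
  by set q1 := 2 * expR _ + _; set y := tail x; lra.
have := large_x FM FU indF I3 x1 EU1 EU2 LE hA hB z0 zlex P0'.
move=> /le_trans; apply; rewrite lee_fin.
have := part2_large_arith x00 xx z0 z1 e0 (ltW Tx) erefl.
by set q1 := 2 * expR _ + _; set y := tail x; lra.
Qed.

(** * Norms on finite index sets *)

Section finite_norms.
Context {R : realType}.

(** Lagrange's identity: the double sum of [(f i g j - f j g i)^2] is twice the difference of the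
    two sides. *)
Lemma sum_mul_sqr_le (I : finType) (f g : I -> R) :
  (\sum_i f i * g i) ^+ 2 <= (\sum_i f i ^+ 2) * (\sum_i g i ^+ 2).
Proof.
have : 0 <= \sum_i \sum_j (f i * g j - f j * g i) ^+ 2.
  by do 2!apply: sumr_ge0 => ? _; exact: sqr_ge0.
have -> : \sum_i \sum_j (f i * g j - f j * g i) ^+ 2 =
    (\sum_i f i ^+ 2) * (\sum_i g i ^+ 2) *+ 2 - (\sum_i f i * g i) ^+ 2 *+ 2.
  have E1 : \sum_i \sum_j f i ^+ 2 * g j ^+ 2 =
      (\sum_i f i ^+ 2) * (\sum_i g i ^+ 2).
    by rewrite mulr_suml; apply: eq_bigr => i _; rewrite mulr_sumr.
  have E2 : \sum_i \sum_j f i * g i * (f j * g j) = (\sum_i f i * g i) ^+ 2.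
    by rewrite expr2 mulr_suml; apply: eq_bigr => i _; rewrite mulr_sumr.
  have E3 : \sum_i \sum_j f j ^+ 2 * g i ^+ 2 =
      (\sum_i f i ^+ 2) * (\sum_i g i ^+ 2).
    by rewrite exchange_big.
  rewrite -E2 mulr2n -{1}E1 -E3 -!sumrMnl -big_split/= -sumrB.
  apply: eq_bigr => i _; rewrite -!sumrMnl -big_split/= -sumrB.
  by apply: eq_bigr => j _; ring.
by rewrite subr_ge0 lerMn2r.
Qed.

Definition l2 (I : finType) (f : I -> R) : R := Num.sqrt (\sum_i f i ^+ 2).

Lemma sum_sqr_ge0 (I : finType) (f : I -> R) : 0 <= \sum_i f i ^+ 2.
Proof. by apply: sumr_ge0 => i _; exact: sqr_ge0. Qed.

Lemma l2D (I : finType) (f g : I -> R) :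
  l2 (fun i => f i + g i) <= l2 f + l2 g.
Proof.
have a0 := sqrtr_ge0 (\sum_i f i ^+ 2); have b0 := sqrtr_ge0 (\sum_i g i ^+ 2).
rewrite /l2 -[leRHS]ger0_norm ?addr_ge0// -sqrtr_sqr ler_wsqrtr//.
rewrite sqrrD !sqr_sqrtr ?sum_sqr_ge0//.
rewrite (_ : \sum_i (f i + g i) ^+ 2 = \sum_i f i ^+ 2 + (\sum_i f i * g i) *+ 2
   + \sum_i g i ^+ 2); last first.
  by rewrite -sumrMnl -!big_split/=; apply: eq_bigr => i _; rewrite sqrrD.
rewrite lerD2r lerD2l lerMn2r/= -sqrtrM ?sum_sqr_ge0//.
apply: le_trans (ler_norm _) _.
by rewrite -sqrtr_sqr ler_wsqrtr// sum_mul_sqr_le.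
Qed.

Definition rms (n : nat) (f : 'I_n -> R) : R := Num.sqrt (avg (fun i => f i ^+ 2)).

Lemma rms_ge0 n (f : 'I_n -> R) : 0 <= rms f. Proof. exact: sqrtr_ge0. Qed.

Lemma rmsE n (f : 'I_n -> R) : rms f = Num.sqrt n%:R^-1 * l2 f.
Proof. by rewrite /rms /avg sqrtrM// invr_ge0. Qed.

Lemma eq_rms n (f g : 'I_n -> R) : f =1 g -> rms f = rms g.
Proof. by move=> /funext ->. Qed.

Lemma rmsD n (f g : 'I_n -> R) : rms (fun i => f i + g i) <= rms f + rms g.
Proof. by rewrite !rmsE -mulrDr ler_wpM2l ?sqrtr_ge0// l2D. Qed.

Lemma avg_le n (f g : 'I_n -> R) : (forall i, f i <= g i) -> avg f <= avg g.
Proof. by move=> fg; rewrite /avg ler_wpM2l ?invr_ge0// ler_sum. Qed.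

Lemma avg_ge0 n (f : 'I_n -> R) : (forall i, 0 <= f i) -> 0 <= avg f.
Proof. by move=> fg; rewrite /avg mulr_ge0 ?invr_ge0// sumr_ge0. Qed.

Lemma avgD n (f g : 'I_n -> R) : avg (fun i => f i + g i) = avg f + avg g.
Proof. by rewrite /avg big_split/= mulrDr. Qed.

Lemma avgZ n c (f : 'I_n -> R) : avg (fun i => c * f i) = c * avg f.
Proof. by rewrite /avg -mulr_sumr mulrCA. Qed.

Lemma avgB n (f g : 'I_n -> R) : avg (fun i => f i - g i) = avg f - avg g.
Proof. by rewrite /avg sumrB mulrBr. Qed.

Lemma avg_cst n (c : R) : (0 < n)%N -> avg (fun _ : 'I_n => c) = c.
Proof.
move=> n0; rewrite /avg sumr_const card_ord -[X in _ * X]mulr_natl mulrA mulVf ?mul1r//.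
by rewrite pnatr_eq0 -lt0n.
Qed.

Lemma avg_sum n (I : finType) (f : I -> 'I_n -> R) :
  avg (fun i => \sum_k f k i) = \sum_k avg (f k).
Proof. by rewrite /avg exchange_big/= mulr_sumr. Qed.

Lemma rms_le n (f g : 'I_n -> R) : (forall i, `|f i| <= `|g i|) -> rms f <= rms g.
Proof.
move=> fg; rewrite /rms ler_wsqrtr// avg_le// => i.
by rewrite -real_normK ?num_real// -(real_normK (num_real (g i))) lerXn2r ?nnegrE.
Qed.

Lemma rmsZ n c (f : 'I_n -> R) : rms (fun i => c * f i) = `|c| * rms f.
Proof.
rewrite /rms -sqrtr_sqr -sqrtrM ?sqr_ge0// -avgZ.
by under eq_fun do rewrite exprMn.
Qed.

Lemma rms_cst n c : (0 < n)%N -> rms (fun _ : 'I_n => c) = `|c|.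
Proof. by move=> n0; rewrite /rms avg_cst// sqrtr_sqr. Qed.

Lemma rms_dist n (f g : 'I_n -> R) : `|rms f - rms g| <= rms (fun i => f i - g i).
Proof.
have h a b : rms a - rms b <= @rms n (fun i => a i - b i).
  rewrite lerBlDr.
  rewrite (@eq_rms _ a (fun i => (a i - b i) + b i)); first exact: rmsD.
  by move=> i; rewrite subrK.
have := h f g; have := h g f; rewrite (_ : rms (fun i => g i - f i) = rms (fun i => f i - g i)).
  by rewrite ler_norml; lra.
by rewrite /rms; under eq_fun do rewrite -sqrrN opprB.
Qed.

Section matrix_norm.
Variables m n : nat.
Implicit Types A : 'M[R]_(m, n).

Lemma mx_entry_le A i j : `|A i j| <= `|A|.
Proof.
rewrite [leRHS]/Num.norm/= mx_normrE.
by apply: le_trans (le_bigmax _ _ (i, j)).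
Qed.

Lemma mx_norm_leP A (c : R) : 0 <= c -> (forall i j, `|A i j| <= c) -> `|A| <= c.
Proof.
move=> c0 h; rewrite [leLHS]/Num.norm/= mx_normrE.
by apply: bigmax_le => // -[i j] _; exact: h.
Qed.

End matrix_norm.

Section lnorm.
Variable p : nat.
Implicit Types (u v : 'cV[R]_p) (J : {set 'I_p}).

Lemma lnorm1E v : lnorm 1 v = \sum_j `|v j 0|.
Proof.
rewrite /lnorm invr1 powRr1; first by apply: eq_bigr => j _; rewrite expr1.
by apply: sumr_ge0 => j _; rewrite expr1.
Qed.

Lemma lnorm2E v : lnorm 2 v = l2 (fun j => v j 0).
Proof.
rewrite /lnorm powR12_sqrt; last by apply: sumr_ge0.
by congr Num.sqrt; apply: eq_bigr => j _; rewrite real_normK ?num_real.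
Qed.

Lemma lnorm_ge0 q v : 0 <= lnorm q v. Proof. exact: powR_ge0. Qed.

Lemma lnormZ q c v : (0 < q)%N -> lnorm q (c *: v) = `|c| * lnorm q v.
Proof.
move=> q0; rewrite /lnorm.
under eq_bigr do rewrite mxE normrM exprMn.
rewrite -mulr_sumr powRM ?exprn_ge0//; last by apply: sumr_ge0 => j _; exact: exprn_ge0.
congr (_ * _); rewrite -powR_mulrn// -powRrM mulfV ?powRr1//.
by rewrite pnatr_eq0 -lt0n.
Qed.

Lemma lnorm_le q u v : (forall j, `|u j 0| <= `|v j 0|) -> lnorm q u <= lnorm q v.
Proof.
move=> h; rewrite /lnorm ge0_ler_powR ?nnegrE ?invr_ge0//.
- by apply: sumr_ge0 => j _; exact: exprn_ge0.
- by apply: sumr_ge0 => j _; exact: exprn_ge0.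
- by apply: ler_sum => j _; rewrite lerXn2r ?nnegrE.
Qed.

Lemma lnormD q u v : (q = 1 \/ q = 2)%N -> lnorm q (u + v) <= lnorm q u + lnorm q v.
Proof.
case=> ->.
  by rewrite !lnorm1E -big_split/=; apply: ler_sum => j _; rewrite mxE ler_normD.
rewrite !lnorm2E; apply: le_trans (l2D _ _).
by rewrite /l2; under eq_bigr do rewrite mxE.
Qed.

Lemma lnorm0 q : (0 < q)%N -> @lnorm R q p 0 = 0.
Proof. by move=> q0; rewrite -(scale0r (0 : 'cV[R]_p)) lnormZ// normr0 mul0r. Qed.

Lemma entry_le_lnorm q v j : (q = 1 \/ q = 2)%N -> `|v j 0| <= lnorm q v.
Proof.
case=> ->.
  by rewrite lnorm1E (bigD1 j)//= lerDl sumr_ge0.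
rewrite lnorm2E -sqrtr_sqr ler_wsqrtr// (bigD1 j)//= lerDl sumr_ge0// => i _.
exact: sqr_ge0.
Qed.

Lemma lnorm_gt0 q v : (q = 1 \/ q = 2)%N -> v != 0 -> 0 < lnorm q v.
Proof.
move=> hq /eqP v0; rewrite lt0r lnorm_ge0 andbT; apply/eqP => h; apply: v0.
apply/colP => j; rewrite mxE; apply/eqP; rewrite -normr_le0 -h.
exact: entry_le_lnorm.
Qed.

Lemma lnorm2_le q v : (q = 1 \/ q = 2)%N -> lnorm 2 v <= lnorm q v.
Proof.
case=> -> //; rewrite lnorm2E lnorm1E.
have S0 : 0 <= \sum_j `|v j 0| by exact: sumr_ge0.
rewrite -[leRHS]ger0_norm// -sqrtr_sqr ler_wsqrtr//.
rewrite expr2 mulr_suml ler_sum// => j _.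
rewrite -(real_normK (num_real (v j 0))) expr2 ler_wpM2l// (bigD1 j)//= lerDl sumr_ge0//.
Qed.

(** One form for both exponents: trivial for [q = 1], Cauchy-Schwarz on [J] for [q = 2]. It converts
    the sensitivity bound in [lnorm q] into one on the support. *)
Lemma lnorm2_restr q s v J : (q = 1 \/ q = 2)%N -> (#|J| <= s)%N ->
  s%:R `^ q%:R^-1 * (\sum_(j in J) `|v j 0|) <= s%:R * lnorm q v.
Proof.
move=> [] -> Js.
  rewrite invr1 powRr1// ler_wpM2l// lnorm1E.
  by rewrite [leRHS](bigID (mem J))/= lerDl sumr_ge0.
rewrite powR12_sqrt// -[X in _ <= X * _]sqr_sqrtr// expr2 -mulrA ler_wpM2l ?sqrtr_ge0//.
rewrite lnorm2E /l2 -sqrtrM//.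
have S0 : 0 <= \sum_(j in J) `|v j 0| by exact: sumr_ge0.
rewrite -[leLHS]ger0_norm// -sqrtr_sqr ler_wsqrtr//.
have -> : \sum_(j in J) `|v j 0| = \sum_j ((j \in J)%:R * `|v j 0|).
  by rewrite big_mkcond; apply: eq_bigr => j _; case: ifP; rewrite ?mul1r ?mul0r.
apply: le_trans (sum_mul_sqr_le _ _) _.
have -> : \sum_j ((j \in J)%:R : R) ^+ 2 = #|J|%:R.
  rewrite -sum1_card natr_sum [RHS]big_mkcond; apply: eq_bigr => j _.
  by case: (j \in J); rewrite ?expr1n// expr0n.
apply: ler_pM => //; rewrite ?ler_nat//; first exact: sum_sqr_ge0.
by apply: ler_sum => j _; rewrite real_normK ?num_real.
Qed.

Lemma lnorm_flat q s v J m : (0 < q)%N -> (#|J| <= s)%N ->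
  (forall j, j \notin J -> v j 0 = 0) -> 0 <= m -> (forall j, `|v j 0| <= m) ->
  lnorm q v <= s%:R `^ q%:R^-1 * m.
Proof.
move=> q0 Js hv m0 hm.
have q0' : q%:R != 0 :> R by rewrite pnatr_eq0 -lt0n.
have -> : m = (m ^+ q) `^ q%:R^-1 by rewrite -powR_mulrn// -powRrM mulfV// powRr1.
rewrite -powRM ?exprn_ge0// /lnorm ge0_ler_powR ?nnegrE ?invr_ge0 ?mulr_ge0 ?exprn_ge0//.
  by apply: sumr_ge0 => j _; exact: exprn_ge0.
rewrite (bigID (mem J))/= [X in _ + X]big1 ?addr0; last first.
  by move=> j jJ; rewrite hv// normr0 expr0n; case: (q) q0.
apply: le_trans (_ : #|J|%:R * m ^+ q <= _).
  rewrite mulr_natl -sumr_const ler_sum// => j _.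
  by rewrite lerXn2r ?nnegrE.
by rewrite ler_wpM2r ?exprn_ge0// ler_nat.
Qed.

(** Markov's inequality for the counting measure; it will count the false positives. *)
Lemma lnorm_flat_ge q v J m : (0 < q)%N -> 0 <= m ->
  (forall j, j \in J -> m <= `|v j 0|) ->
  #|J|%:R * m ^+ q <= lnorm q v ^+ q.
Proof.
move=> q0 m0 hm.
have S0 : 0 <= \sum_(j < p) `|v j 0| ^+ q.
  by apply: sumr_ge0 => j _; exact: exprn_ge0.
rewrite /lnorm -powR_mulrn ?powR_ge0// -powRrM mulVf ?powRr1//; last first.
  by rewrite pnatr_eq0 -lt0n.
rewrite (bigID (mem J))/= -[leLHS]addr0 lerD//; last first.
  by apply: sumr_ge0 => j _; exact: exprn_ge0.
rewrite mulr_natl -sumr_const ler_sum// => j jJ.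
by rewrite lerXn2r ?nnegrE// hm.
Qed.

End lnorm.
End finite_norms.

(** * The conic programme on a fixed sample *)

Section conic_arithmetic.
Context {R : realFieldType}.

(** The weights are tuned to this: with [1 / (4 H)] and [1/4] each penalty can drop by at most
    [(dJ + dC) / 4], so [dC - dJ <= (dJ + dC) / 2], that is [dC <= 3 dJ]. Keeping one penalty at a
    time in the minimality inequality gives the other two bounds. *)
Lemma conic_cone (H Th T0 Uh U0 N1 N0 dJ dC : R) : 0 < H ->
  N1 + (4 * H)^-1 * Th + 4^-1 * Uh <= N0 + (4 * H)^-1 * T0 + 4^-1 * U0 ->
  N0 - dJ + dC <= N1 -> T0 - H * (dJ + dC) <= Th -> U0 - (dJ + dC) <= Uh ->
  [/\ dC <= 3 * dJ, Th <= T0 + H * (5 * dJ - 3 * dC) &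
      Uh <= U0 + (5 * dJ - 3 * dC)].
Proof.
move=> H0 hmin hN hT hU.
have e1 x : (4 * H)^-1 * x = 4^-1 * (x / H) by rewrite invfM; ring.
rewrite !e1 in hmin.
have e2 x : x = H * (x / H) by field; rewrite gt_eqF.
move: hT; rewrite {1}(e2 T0) {1}(e2 Th) -mulrBr ler_pM2l// => hT.
split; [lra| |lra].
by rewrite (e2 Th) (e2 T0) -mulrDr ler_pM2l//; move: hmin hT; clear e1 e2; lra.
Qed.

(** Inserting the bounds on [Th] and [Uh] produces [5 dJ - 3 dC]; the term [b (dJ + dC)], with
    [b <= (1 + t) b], raises it to [6 dJ - 2 dC], and [dC <= 3 dJ] handles the term in [e]. Hence
    the 6. *)
Lemma conic_gram (H Th T0 Uh U0 dJ dC t b e P : R) : 0 <= t -> 0 <= b -> 0 <= e ->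
  0 <= dJ -> 0 <= dC -> dC <= 3 * dJ ->
  Th <= T0 + H * (5 * dJ - 3 * dC) -> Uh <= U0 + (5 * dJ - 3 * dC) ->
  0 <= H ->
  P <= t * Th + (1 + t) * b * Uh + t * T0 + (1 + t) * b * U0 + (b + e) * (dJ + dC) ->
  P <= 2 * t * T0 + 2 * ((1 + t) * b) * U0 + 6 * (dJ * (t * H + (1 + t) * b + e)).
Proof.
move=> t0 b0 e0 J0 C0 C3 hT hU H0 hP; set c := (1 + t) * b in hP *.
have cb : b <= c by rewrite /c mulrDl mul1r lerDl mulr_ge0.
have h1 : t * Th <= t * (T0 + H * (5 * dJ - 3 * dC)) by rewrite ler_wpM2l.
have h2 : c * Uh <= c * (U0 + (5 * dJ - 3 * dC)) by rewrite ler_wpM2l// (le_trans b0 cb).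
have h3 : b * (dJ + dC) <= c * (dJ + dC) by rewrite ler_wpM2r ?addr_ge0.
have h4 : e * dC <= e * (3 * dJ) by rewrite ler_wpM2l.
have h5 : 0 <= t * H * dC by rewrite !mulr_ge0.
have h6 : 0 <= t * H * dJ by rewrite !mulr_ge0.
have h7 : 0 <= c * dC by rewrite mulr_ge0// (le_trans b0 cb).
have h8 : 0 <= e * dJ by rewrite !mulr_ge0.
by move: hP h1 h2 h3 h4 h5 h6 h7 h8; clearbody c; clear; lra.
Qed.

(** The 8 in the sensitivity condition exceeds the 6 of [conic_gram]: from [8 dJ K <= P] and
    [P <= A + 6 dJ K] follows [P <= A + 3/4 P]. *)
Lemma conic_kappa (s S K kap L dJ P A : R) : 0 < s -> 0 <= kap -> 0 <= dJ ->
  8 * s * K <= kap * S -> S * dJ <= s * L -> kap * L <= P -> P <= A + 6 * (dJ * K) ->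
  8 * (dJ * K) <= P /\ P <= 4 * A.
Proof.
move=> s0 k0 J0 h1 h2 h3 h4.
suff h : 8 * (dJ * K) <= P by split=> //; lra.
rewrite -(ler_pM2l s0).
have h5 : kap * (S * dJ) <= kap * (s * L) by rewrite ler_wpM2l.
have h6 : dJ * (8 * s * K) <= dJ * (kap * S) by rewrite ler_wpM2l.
have h7 : s * (kap * L) <= s * P by rewrite ler_wpM2l// ltW.
by move: h5 h6 h7; lra.
Qed.

End conic_arithmetic.

Section conic.
Context {R : realType}.

Lemma kappa_ge0 q s u n p (X : 'M[R]_(n, p)) : 0 <= kappa q s u X.
Proof.
rewrite /kappa; set A := (X in inf X).
have [->|/set0P A0] := eqVneq A set0; first by rewrite inf0.
by apply: lb_le_inf => // _ [D _ <-].
Qed.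

Lemma cone_sum p (J : {set 'I_p}) (u : R) (D : 'cV[R]_p) :
  cone J u D <-> \sum_(j in ~: J) `|D j 0| <= u * \sum_(j in J) `|D j 0|.
Proof.
have h (K : {set 'I_p}) : lnorm 1 (restr K D) = \sum_(j in K) `|D j 0|.
  rewrite lnorm1E [RHS]big_mkcond; apply: eq_bigr => j _; rewrite mxE.
  by case: ifP; rewrite ?normr0.
by rewrite /cone/= !h.
Qed.

(** Cones are invariant under scaling, so a nonzero [D] is normalized to [lnorm q D = 1]; the values
    being norms, 0 is a lower bound and the infimum applies. *)
Lemma kappa_le q s u n p (X : 'M[R]_(n, p)) (J : {set 'I_p}) (D : 'cV[R]_p) :
  (q = 1 \/ q = 2)%N -> (#|J| <= s)%N -> cone J u D ->
  kappa q s u X * lnorm q D <= `|gram X *m D|.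
Proof.
move=> hq Js cD; have q0 : (0 < q)%N by case: hq => ->.
have [->|D0] := eqVneq D 0; first by rewrite lnorm0// mulr0.
have L0 := lnorm_gt0 hq D0.
rewrite -ler_pdivlMr// mulrC -[X in X * _]ger0_norm ?invr_ge0 ?(ltW L0)//.
rewrite -normrZ scalemxAr /kappa; apply: ge_inf; first by exists 0 => _ [E _ <-].
exists ((lnorm q D)^-1 *: D) => //; split.
  by rewrite lnormZ// ger0_norm ?invr_ge0 ?(ltW L0)// mulVf ?gt_eqF.
exists J; split=> //; move/cone_sum : cD => cD; apply/cone_sum.
under eq_bigr do rewrite mxE normrM.
under [X in _ <= u * X]eq_bigr do rewrite mxE normrM.
by rewrite -!mulr_sumr mulrCA ler_wpM2l.
Qed.

Lemma row_mulE n p (Z : 'M[R]_(n, p)) (v : 'cV[R]_p) i :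
  (row i Z *m v) 0 0 = \sum_k Z i k * v k 0.
Proof. by rewrite mxE; apply: eq_bigr => k _; rewrite mxE. Qed.

Lemma gramE n p (Z : 'M[R]_(n, p)) j k : gram Z j k = avg (fun i => Z i j * Z i k).
Proof. by rewrite mxE mxE; congr (_ * _); apply: eq_bigr => i _; rewrite mxE. Qed.

Section fixed.
Variables (n p : nat) (y : 'cV[R]_n) (Z : 'M[R]_(n, p)) (Gh : 'M[R]_p).
Hypothesis n0 : (0 < n)%N.
Hypothesis Ghdiag : is_diag_mx Gh.

Notation res := (conic_residual y Z Gh).

Lemma diag_mul (v : 'cV[R]_p) j : \sum_k Gh j k * v k 0 = Gh j j * v j 0.
Proof.
rewrite (bigD1 j)//= big1 ?addr0// => k kj.
by move/is_diag_mxP : Ghdiag => -> //; [rewrite mul0r|rewrite eq_sym].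
Qed.

Lemma residual_diff (b1 b0 : 'cV[R]_p) i j :
  res b1 i j = res b0 i j - \sum_k (Z i j * Z i k - Gh j k) * (b1 - b0) k 0.
Proof.
under eq_bigr do rewrite mulrBl -mulrA.
rewrite sumrB -mulr_sumr diag_mul /conic_residual !row_mulE.
under [X in _ - (_ * X - _)]eq_bigr do rewrite !mxE mulrBr.
by rewrite sumrB !mxE; ring.
Qed.

Lemma avg_residual (b1 : 'cV[R]_p) j :
  avg (fun i => Z i j * (y i 0 - (row i Z *m b1) 0 0)) + Gh j j * b1 j 0 =
  avg (fun i => res b1 i j).
Proof. by rewrite /conic_residual avgD avg_cst. Qed.

(** The mean square is a quadratic form in [v] whose matrix has entries at most [Hstat ^+ 2], so it
    is at most that times [lnorm 1 v ^+ 2]. The residual scales are therefore Lipschitz with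
    constant [Hstat], the reason for weighting [t] by [1 / (4 H)]. *)
Lemma Hstat_bound (v : 'cV[R]_p) j :
  rms (fun i => \sum_k (Z i j * Z i k - Gh j k) * v k 0) <= Hstat Z Gh * lnorm 1 v.
Proof.
set a := fun i k => Z i j * Z i k - Gh j k.
set B := n%:R^-1 *: \sum_(i < n) ((Z i j *: row i Z - row j Gh)^T
                    *m (Z i j *: row i Z - row j Gh)).
have Bkl k l : B k l = avg (fun i => a i k * a i l).
  rewrite mxE summxE; congr (_ * _); apply: eq_bigr => i _.
  by rewrite mxE big_ord1 !mxE.
apply: (@le_trans _ _ (Num.sqrt `|B| * lnorm 1 v)); last first.
  rewrite ler_wpM2r ?lnorm_ge0// /Hstat.
  exact: (le_bigmax _ (fun j => Num.sqrt `|n%:R^-1 *: \sum_(i < n) ((Z i j *: row i Z - row j Gh)^T *m (Z i j *: row i Z - row j Gh))|) j).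
rewrite -[X in _ * X]ger0_norm ?lnorm_ge0// -sqrtr_sqr -sqrtrM// ler_wsqrtr//.
have -> : avg (fun i => (\sum_k a i k * v k 0) ^+ 2) =
    \sum_k \sum_l v k 0 * v l 0 * B k l.
  under [RHS]eq_bigr do under eq_bigr do rewrite Bkl -avgZ.
  under [RHS]eq_bigr do rewrite -avg_sum.
  rewrite -avg_sum; congr avg; apply/funext => i.
  rewrite expr2 mulr_suml; apply: eq_bigr => k _; rewrite mulr_sumr.
  by apply: eq_bigr => l _; ring.
rewrite mulrC lnorm1E expr2 mulr_suml mulr_suml; apply: ler_sum => k _.
rewrite mulr_sumr mulr_suml; apply: ler_sum => l _.
apply: le_trans (ler_norm _) _; rewrite !normrM ler_wpM2l ?mulr_ge0//.
exact: mx_entry_le.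
Qed.

Variables (b0 b1 th uh : 'cV[R]_p) (X G : 'M[R]_p) (tau b e : R).
Hypothesis tau0 : 0 <= tau.
Hypothesis b_ge0 : 0 <= b.
Hypothesis e0 : 0 <= e.
Notation H := (Hstat Z Gh).
Notation D := (b1 - b0).
Hypothesis H0 : 0 < H.
Hypothesis opt : conic_solution y Z Gh tau b (4 * H)^-1 4^-1 b1 th uh.
Hypothesis feas0 : forall j,
  `|avg (fun i => res b0 i j)| <=
    tau * rms (fun i => res b0 i j) + (1 + tau) * b * `|b0 j 0|.
Hypothesis gram_close : forall j k, `|gram Z j k - G j k - X j k| <= e.
Hypothesis Gh_close : forall j k, `|Gh j k - G j k| <= b.

Let t0 : 'cV[R]_p := \col_j rms (fun i => res b0 i j).

Lemma rms_residual_diff j :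
  `|rms (fun i => res b1 i j) - rms (fun i => res b0 i j)| <= H * lnorm 1 D.
Proof.
rewrite distrC; apply: le_trans (rms_dist _ _) _.
rewrite (@eq_rms _ _ _ (fun i => \sum_k (Z i j * Z i k - Gh j k) * D k 0)).
  exact: Hstat_bound.
by move=> i; rewrite (residual_diff b1 b0); ring.
Qed.

Lemma opt_feas j : [/\ `|avg (fun i => res b1 i j)| <= tau * `|th| + (1 + tau) * b * `|uh|,
  rms (fun i => res b1 i j) <= th j 0 & `|b1 j 0| <= uh j 0].
Proof.
case: opt => /(_ j)[h1 h2 h3] _; split=> //; rewrite -avg_residual.
apply: le_trans h1 _; apply: lerD; apply: ler_wpM2l => //.
- exact: le_trans (ler_norm _) (mx_entry_le _ _ _).
- by rewrite mulr_ge0// addr_ge0.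
- exact: le_trans (ler_norm _) (mx_entry_le _ _ _).
Qed.

(** The competitor is the true vector with the smallest admissible slacks: [t] the residual scales,
    [u] the absolute values. *)
Lemma opt_le : lnorm 1 b1 + (4 * H)^-1 * `|th| + 4^-1 * `|uh| <=
  lnorm 1 b0 + (4 * H)^-1 * `|t0| + 4^-1 * `|b0|.
Proof.
case: opt => _ /(_ b0 t0 (\col_j `|b0 j 0|)) h.
apply: le_trans (h _) _.
  move=> j; rewrite !mxE; split=> //.
  by rewrite avg_residual; exact: feas0.
rewrite /conic_objective lerD2l ler_wpM2l//.
by apply: mx_norm_leP => // i j; rewrite mxE normr_id mx_entry_le.
Qed.

Lemma th_ge : `|t0| - H * lnorm 1 D <= `|th|.
Proof.
have hh : 0 <= H * lnorm 1 D by rewrite mulr_ge0 ?lnorm_ge0// ltW.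
rewrite lerBlDr; apply: mx_norm_leP => [|j k]; first by rewrite addr_ge0.
rewrite (ord1 k) mxE ger0_norm ?rms_ge0//.
have [_ h2 _] := opt_feas j.
have := rms_residual_diff j; rewrite ler_norml => /andP[h3 _].
have h4 := le_trans (ler_norm _) (mx_entry_le th j 0).
by move: h2 h3 h4; lra.
Qed.

Lemma uh_ge : `|b0| - lnorm 1 D <= `|uh|.
Proof.
rewrite lerBlDr; apply: mx_norm_leP => [|j k]; first by rewrite addr_ge0 ?lnorm_ge0.
rewrite (ord1 k); have [_ _ h3] := opt_feas j.
have h4 := le_trans (ler_norm _) (mx_entry_le uh j 0).
have h5 := @entry_le_lnorm _ _ 1 D j (or_introl erefl).
have h6 : `|b0 j 0| <= `|b1 j 0| + `|D j 0|.
  by rewrite !mxE -lerBlDl -[in leRHS](opprB (b0 j 0)) normrN lerB_dist.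
by move: h3 h4 h5 h6; lra.
Qed.

Let J := supp b0.
Let dJ := \sum_(j in J) `|D j 0|.
Let dC := \sum_(j in ~: J) `|D j 0|.

Lemma lnorm1_split (v : 'cV[R]_p) (K : {set 'I_p}) :
  lnorm 1 v = \sum_(j in K) `|v j 0| + \sum_(j in ~: K) `|v j 0|.
Proof.
rewrite lnorm1E (bigID (mem K))/=; congr (_ + _).
by apply: eq_bigl => j; rewrite inE.
Qed.

Lemma lnorm1_opt_ge : lnorm 1 b0 - dJ + dC <= lnorm 1 b1.
Proof.
rewrite (lnorm1_split b0 J) (lnorm1_split b1 J).
have -> : \sum_(j in ~: J) `|b0 j 0| = 0.
  by apply: big1 => j; rewrite !inE negbK => /eqP ->; rewrite normr0.
have -> : dC = \sum_(j in ~: J) `|b1 j 0|.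
  apply: eq_bigr => j; rewrite !inE negbK => /eqP h.
  by rewrite !mxE h subr0.
rewrite addr0 lerD2r -sumrB; apply: ler_sum => j _; rewrite !mxE.
by rewrite lerBlDr -lerBlDl -(opprB (b0 j 0)) normrN lerB_dist.
Qed.

(** [X D] is a difference of average residuals, both small by feasibility, corrected by [Gh - G] and
    by [gram Z - G - X] acting on [D]. *)
Lemma gram_error : `|X *m D| <= tau * `|th| + (1 + tau) * b * `|uh| + tau * `|t0|
  + (1 + tau) * b * `|b0| + (b + e) * lnorm 1 D.
Proof.
apply: mx_norm_leP => [|j k].
  by rewrite !addr_ge0// ?mulr_ge0 ?lnorm_ge0// ?addr_ge0.
rewrite (ord1 k).
have -> : (X *m D) j 0 = - (avg (fun i => res b1 i j) - avg (fun i => res b0 i j))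
    + \sum_k (Gh j k - G j k) * D k 0 - \sum_k (gram Z j k - G j k - X j k) * D k 0.
  rewrite mxE -avgB.
  have -> : avg (fun i => res b1 i j - res b0 i j) =
      - \sum_k (gram Z j k - Gh j k) * D k 0.
    under [in LHS]eq_fun do rewrite (residual_diff b1 b0) addrC addKr -mulN1r.
    rewrite avgZ mulN1r; congr (- _); rewrite avg_sum; apply: eq_bigr => l _.
    under eq_fun do rewrite mulrC.
    by rewrite avgZ mulrC avgB avg_cst// gramE.
  rewrite opprK -big_split/= -sumrB; apply: eq_bigr => l _; ring.
have [h1 _ _] := opt_feas j.
have h2 := feas0 j.
have h3 : `|\sum_k (Gh j k - G j k) * D k 0| <= b * lnorm 1 D.
  apply: le_trans (ler_norm_sum _ _ _) _; rewrite lnorm1E mulr_sumr.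
  by apply: ler_sum => l _; rewrite normrM ler_wpM2r.
have h4 : `|\sum_k (gram Z j k - G j k - X j k) * D k 0| <= e * lnorm 1 D.
  apply: le_trans (ler_norm_sum _ _ _) _; rewrite lnorm1E mulr_sumr.
  by apply: ler_sum => l _; rewrite normrM ler_wpM2r.
have h5 : tau * rms (fun i => res b0 i j) <= tau * `|t0|.
  rewrite ler_wpM2l//; have := mx_entry_le t0 j 0.
  by rewrite mxE ger0_norm ?rms_ge0.
have h6 : (1 + tau) * b * `|b0 j 0| <= (1 + tau) * b * `|b0|.
  by rewrite ler_wpM2l ?mx_entry_le// mulr_ge0// addr_ge0.
apply: le_trans (ler_normB _ _) _.
apply: le_trans (lerD (ler_normD _ _) (lexx _)) _.
rewrite normrN.
apply: le_trans (lerD (lerD (ler_normB _ _) (lexx _)) (lexx _)) _.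
by move: h1 h2 h3 h4 h5 h6; rewrite mulrDl; lra.
Qed.

Variables (q s : nat) (Xd : 'M[R]_(n, p)) (c1 : R).
Hypothesis XE : X = gram Xd.
Hypothesis hq : (q = 1 \/ q = 2)%N.
Hypothesis s0 : (0 < s)%N.
Hypothesis supp_le : (#|supp b0| <= s)%N.
Hypothesis c10 : 0 < c1.
Notation S := (s%:R `^ q%:R^-1 : R).
Hypothesis kappa_large :
  8 * s%:R * (tau * H + (1 + tau) * b + e) <= kappa q s 3 Xd * S.
Hypothesis kappa_ge : c1 * s%:R `^ (- q%:R^-1) <= kappa q s 3 Xd.

(** Twice the slack granted to the true vector: the part of the Gram bound that the sensitivity
    condition does not absorb. All errors below are multiples of it. *)
Definition conic_scale : R := 2 * tau * `|t0| + 2 * ((1 + tau) * b) * `|b0|.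
Let A := conic_scale.

Lemma conic_scale_ge0 : 0 <= A.
Proof. by rewrite /A /conic_scale addr_ge0// !mulr_ge0// addr_ge0. Qed.

Lemma sparsity_scale_ge : s%:R <= S ^+ 2.
Proof.
have s1 : (1 : R) <= s%:R by rewrite ler1n.
by case: hq => ->; rewrite ?invr1 ?powRr1// ?powR12_sqrt// ?sqr_sqrtr// expr2 ler_peMr.
Qed.

(** Besides the error bounds there are two by-products. As [8 dJ K <= 4 A] and [lnorm 1 D <= 4 dJ],
    each summand of [K] times [lnorm 1 D] is at most [2 A]. So [tau * H] and [e] are controlled
    jointly with the error, although [H] has no bound by constants. *)
Lemma conic_bounds : [/\ `|X *m D| <= 4 * A, lnorm q D <= 4 * A * S / c1,
  lnorm 1 D <= 16 * s%:R * A / c1, tau * H * lnorm 1 D <= 2 * A &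
  e * lnorm 1 D <= 2 * A].
Proof.
have s0' : 0 < s%:R :> R by rewrite ltr0n.
have S0 : 0 < S by rewrite powR_gt0.
have A0 := conic_scale_ge0.
have J0 : 0 <= dJ by apply: sumr_ge0.
have C0 : 0 <= dC by apply: sumr_ge0.
have split1 : lnorm 1 D = dJ + dC by exact: lnorm1_split.
have H0' := ltW H0.
have [C3 hT hU] : [/\ dC <= 3 * dJ, `|th| <= `|t0| + H * (5 * dJ - 3 * dC) &
      `|uh| <= `|b0| + (5 * dJ - 3 * dC)].
  apply: (@conic_cone _ H `|th| `|t0| `|uh| `|b0| (lnorm 1 b1) (lnorm 1 b0)) => //.
  - exact: opt_le.
  - exact: lnorm1_opt_ge.
  - by rewrite -split1; exact: th_ge.
  - by rewrite -split1; exact: uh_ge.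
have hP := gram_error; rewrite split1 in hP.
have hP2 := conic_gram tau0 b_ge0 e0 J0 C0 C3 hT hU H0' hP.
have hk : kappa q s 3 Xd * lnorm q D <= `|X *m D|.
  by rewrite XE; apply: (@kappa_le q s 3 n p Xd J D hq supp_le); exact/cone_sum.
have hJ : S * dJ <= s%:R * lnorm q D by exact: lnorm2_restr.
have [h8 h4] : 8 * (dJ * (tau * H + (1 + tau) * b + e)) <= `|X *m D| /\ `|X *m D| <= 4 * A := conic_kappa s0' (kappa_ge0 _ _ _ _) J0 kappa_large hJ hk hP2.
have hL : lnorm q D <= 4 * A * S / c1.
  rewrite ler_pdivlMr// -ler_pdivrMr//; apply: le_trans h4; apply: le_trans hk.
  rewrite (_ : _ / S = c1 * s%:R `^ (- q%:R^-1) * lnorm q D).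
    by rewrite ler_wpM2r ?lnorm_ge0.
  by rewrite powRN; ring.
have hJ4 : dJ <= 4 * s%:R * A / c1.
  rewrite -(ler_pM2l S0); apply: le_trans hJ _.
  rewrite (_ : S * _ = s%:R * (4 * A * S / c1)); first by rewrite ler_wpM2l.
  by field; rewrite gt_eqF.
have hD : lnorm 1 D <= 4 * dJ by rewrite split1; lra.
have dK : tau * H * dJ <= dJ * (tau * H + (1 + tau) * b + e).
  by rewrite mulrC ler_wpM2l// -addrA lerDl addr_ge0// mulr_ge0// addr_ge0.
have dK2 : e * dJ <= dJ * (tau * H + (1 + tau) * b + e).
  by rewrite mulrC ler_wpM2l// lerDr addr_ge0// mulr_ge0// addr_ge0.
split=> //.
- apply: le_trans hD _.
  rewrite (_ : 16 * s%:R * A / c1 = 4 * (4 * s%:R * A / c1)); first by rewrite ler_pM2l.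
  by ring.
- have : tau * H * lnorm 1 D <= tau * H * (4 * dJ) by rewrite ler_wpM2l// mulr_ge0.
  by move: dK h8 h4; lra.
- have : e * lnorm 1 D <= e * (4 * dJ) by rewrite ler_wpM2l.
  by move: dK2 h8 h4; lra.
Qed.

Lemma threshold_upper j : tau * rms (fun i => res b1 i j) <= tau * `|t0| + 2 * A.
Proof.
have [_ _ _ h _] := conic_bounds.
apply: le_trans (lerD (lexx _) h); rewrite -mulrA -mulrDr ler_wpM2l//.
have := rms_residual_diff j; rewrite ler_norml => /andP[_ h2].
have := mx_entry_le t0 j 0; rewrite mxE ger0_norm ?rms_ge0// => h3.
by rewrite -lerBlDr; apply: le_trans h3; rewrite lerBlDr -lerBlDl.
Qed.

Variable g : R.
Hypothesis G_diag : is_diag_mx G.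
Hypothesis G_le : forall j, `|G j j| <= g.

(** Expand the quadratic form of [gram Z] at [D] along [X + G] plus an error. Duality of the [l1]
    and sup norms treats the first and last parts, giving [96 = 16 * 4 + 16 * 2]; the diagonal [G]
    only sees [lnorm 2 D], whence [16 g / c1^2]. *)
Lemma prediction_error : avg (fun i => (\sum_k Z i k * D k 0) ^+ 2) <=
  (96 / c1 + 16 * g / c1 ^+ 2) * (S * A) ^+ 2.
Proof.
have A0 := conic_scale_ge0.
have s0' : 0 < s%:R :> R by rewrite ltr0n.
have S0 : 0 < S by rewrite powR_gt0.
have [h1 h2 h3 _ h5] := conic_bounds.
(* Without coordinates [Hstat] would be an empty maximum, hence 0, against its positivity. *)
have g0 : 0 <= g.
  case: (pickP (fun j : 'I_p => true)) => [j _|h]; first exact: le_trans (G_le j).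
  have Db : D = 0 by apply/colP => j; have := h j.
  move: (H0); rewrite /Hstat big_pred0 ?ltxx// => j; exact: (h j).
have -> : avg (fun i => (\sum_k Z i k * D k 0) ^+ 2) =
    \sum_k D k 0 * ((X *m D) k 0 + G k k * D k 0 +
       \sum_l (gram Z k l - G k l - X k l) * D l 0).
  have E1 k : (X *m D) k 0 + G k k * D k 0 +
       \sum_l (gram Z k l - G k l - X k l) * D l 0 = \sum_l gram Z k l * D l 0.
    have -> : G k k * D k 0 = \sum_l G k l * D l 0.
      rewrite (bigD1 k)//= big1 ?addr0// => l kl.
      by move/is_diag_mxP : G_diag => -> //; [rewrite mul0r|rewrite eq_sym].
    by rewrite mxE -!big_split/=; apply: eq_bigr => l _; ring.
  under [RHS]eq_bigr do rewrite E1 mulr_sumr.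
  under [RHS]eq_bigr do under eq_bigr do rewrite gramE mulrCA mulrC -avgZ.
  under [RHS]eq_bigr do rewrite -avg_sum.
  rewrite -avg_sum; congr avg; apply/funext => i.
  rewrite expr2 mulr_suml; apply: eq_bigr => k _; rewrite mulr_sumr.
  by apply: eq_bigr => l _; ring.
have {}h3' : 0 <= lnorm 1 D := lnorm_ge0 _ _.
apply: (@le_trans _ _ (lnorm 1 D * (4 * A) + g * lnorm 2 D ^+ 2 +
    lnorm 1 D * (e * lnorm 1 D))).
  rewrite lnorm2E /l2 sqr_sqrtr ?sum_sqr_ge0// {1 2}lnorm1E mulr_sumr !mulr_suml -!big_split/=.
  apply: ler_sum => k _; rewrite [leLHS]mulrDr [X in X + _ <= _]mulrDr; apply: lerD; first apply: lerD.
  - apply: le_trans (ler_norm _) _; rewrite normrM ler_wpM2l//.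
    exact: le_trans (mx_entry_le _ _ _) h1.
  - rewrite (_ : D k 0 * (G k k * D k 0) = G k k * D k 0 ^+ 2); last by ring.
    by rewrite ler_wpM2r ?sqr_ge0// (le_trans (ler_norm _)).
  - apply: le_trans (ler_norm _) _; rewrite normrM ler_wpM2l//.
    apply: le_trans (ler_norm_sum _ _ _) _; rewrite lnorm1E mulr_sumr.
    by apply: ler_sum => l _; rewrite normrM ler_wpM2r.
have h6 : lnorm 2 D <= 4 * A * S / c1 by apply: le_trans h2; exact: lnorm2_le.
have h7 : lnorm 2 D ^+ 2 <= (4 * A * S / c1) ^+ 2.
  by rewrite lerXn2r ?nnegrE ?lnorm_ge0// (le_trans (lnorm_ge0 _ _) h6).
have h8 : lnorm 1 D * (4 * A) <= 16 * s%:R * A / c1 * (4 * A).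
  by rewrite ler_wpM2r// mulr_ge0.
have h9 : lnorm 1 D * (e * lnorm 1 D) <= 16 * s%:R * A / c1 * (2 * A).
  by apply: ler_pM => //; rewrite mulr_ge0.
have h10 : g * lnorm 2 D ^+ 2 <= g * (4 * A * S / c1) ^+ 2 by rewrite ler_wpM2l.
apply: le_trans (lerD (lerD h8 h10) h9) _.
rewrite [leLHS](_ : _ = 96 / c1 * (s%:R * A ^+ 2) + 16 * g / c1 ^+ 2 * (S * A) ^+ 2).
  rewrite [leRHS]mulrDl lerD2r ler_wpM2l ?divr_ge0 ?(ltW c10)// exprMn.
  by rewrite ler_wpM2r ?sqr_ge0// sparsity_scale_ge.
by field; rewrite gt_eqF.
Qed.

(** Restricting to observations with [|Z i j| <= K] bounds the product of [Z i j] and the prediction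
    error by [K] times the latter, so the mean square of [prediction_error] suffices and no higher
    moment of the error vector enters. The residual itself only decreases under the restriction. *)
Lemma threshold_lower (K : R) (nu : 'I_n -> R) j : 0 <= K ->
  (forall i, nu i = y i 0 - (row i Z *m b0) 0 0) ->
  rms (fun i => (`|Z i j| <= K)%R%:R * (Z i j * nu i + G j j * b0 j 0)) <=
  rms (fun i => res b1 i j) +
  K * Num.sqrt (96 / c1 + 16 * g / c1 ^+ 2) * (S * A) +
  ((g + b) * (4 * A * S / c1) + b * `|b0 j 0|).
Proof.
move=> K0 nuE.
have A0 := conic_scale_ge0.
have S0 : 0 < S by rewrite powR_gt0// ltr0n.
have [_ h2 _ _ _] := conic_bounds.
have hD : `|D j 0| <= 4 * A * S / c1 by apply: le_trans h2; exact: entry_le_lnorm.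
pose c := Gh j j * D j 0 + (Gh j j - G j j) * b0 j 0.
have hc : `|c| <= (g + b) * (4 * A * S / c1) + b * `|b0 j 0|.
  apply: le_trans (ler_normD _ _) _; rewrite !normrM; apply: lerD.
    apply: ler_pM => //.
    rewrite (_ : Gh j j = G j j + (Gh j j - G j j)); last by ring.
    by apply: le_trans (ler_normD _ _) _; apply: lerD.
  by rewrite ler_wpM2r.
rewrite (@eq_rms _ _ _ (fun i => ((`|Z i j| <= K)%R%:R * res b1 i j) +
   (((`|Z i j| <= K)%R%:R * (Z i j * (\sum_k Z i k * D k 0))) -
     (`|Z i j| <= K)%R%:R * c))); last first.
  move=> i; rewrite (residual_diff b1 b0).
  under eq_bigr do rewrite mulrBl -mulrA.
  rewrite sumrB -mulr_sumr diag_mul /conic_residual -nuE /c.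
  by rewrite !mxE; ring.
apply: le_trans (rmsD _ _) _; rewrite -addrA; apply: lerD.
  apply: rms_le => i; case: (`|Z i j| <= K)%R; rewrite ?mul1r// mul0r normr0//.
apply: le_trans (rmsD _ _) _; apply: lerD.
  apply: (@le_trans _ _ (rms (fun i => K * \sum_k Z i k * D k 0))).
    apply: rms_le => i; rewrite !normrM (ger0_norm K0).
    have [h|_] := boolP (`|Z i j| <= K)%R; last by rewrite normr0 mul0r mulr_ge0.
    by rewrite normr1 mul1r ler_wpM2r.
  rewrite rmsZ ger0_norm// -mulrA ler_wpM2l// -[X in _ * X]ger0_norm; last first.
    by rewrite mulr_ge0// ltW.
  rewrite -sqrtr_sqr /rms -sqrtrM; last first.
    have g0 : 0 <= g by apply: le_trans (G_le j).
    by rewrite addr_ge0// divr_ge0 ?mulr_ge0 ?exprn_ge0// ?(ltW c10).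
  by rewrite ler_wsqrtr// prediction_error.
apply: le_trans hc; rewrite -(rms_cst c n0); apply: rms_le => i.
by rewrite normrN normrM; case: (`|Z i j| <= K)%R; rewrite ?normr1 ?mul1r// normr0 mul0r.
Qed.

Variables (K1 m mu c3 bN : R).
Hypothesis tau_gt0 : 0 < tau.
Hypothesis bN0 : 0 < bN.
Hypothesis K10 : 0 < K1.
Hypothesis m0 : 0 < m.
Hypothesis c30 : 0 < c3.
Hypothesis mu0 : 0 < mu.
Hypothesis scale_le : A <= K1 * (tau * bN).
Hypothesis col_bounds : forall j, m <= avg (fun i => Z i j ^+ 2) <= mu.
Hypothesis res_lower : forall j, c3 * bN <= rms (fun i => res b1 i j).

(** [u] carries the estimation error on the selected or true coordinates, [v] the true coordinates
    that were cut. A cut entry is below its threshold, at most [3 A / m], and there are at most [s]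
    of them. *)
Lemma thresholded_error : lnorm q (thresholded y Z Gh tau b1 - b0) <=
  (4 * K1 / c1 + 3 * K1 / m) * (S * (tau * bN)).
Proof.
have A0 := conic_scale_ge0.
have S0 : 0 < S by rewrite powR_gt0// ltr0n.
have [_ h2 _ _ _] := conic_bounds.
have q0 : (0 < q)%N by case: hq => ->.
pose T := That y Z Gh tau b1.
pose u : 'cV[R]_p := \col_j (if (j \in T) || (j \in J) then D j 0 else 0).
pose v : 'cV[R]_p := \col_j (if (j \notin T) && (j \in J) then - b1 j 0 else 0).
have -> : thresholded y Z Gh tau b1 - b0 = u + v.
  apply/colP => j; rewrite !mxE -/T.
  case jT : (j \in T); case jJ : (j \in J) => /=; rewrite ?addr0//.
    by rewrite addrAC subrr.
  move: jJ; rewrite inE => /negbFE/eqP ->; by rewrite subr0.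
apply: le_trans (lnormD _ _ hq) _; rewrite mulrDl; apply: lerD.
  apply: (@le_trans _ _ (lnorm q D)).
    by apply: lnorm_le => j; rewrite mxE; case: ifP => // _; rewrite normr0.
  apply: le_trans h2 _.
  rewrite (_ : 4 * A * S / c1 = 4 * S / c1 * A); last by ring.
  rewrite [leRHS](_ : _ = 4 * S / c1 * (K1 * (tau * bN))); last by ring.
  by rewrite ler_wpM2l// divr_ge0 ?mulr_ge0 ?(ltW c10)// ltW.
have t2A : 2 * (tau * `|t0|) <= A.
  by rewrite /A /conic_scale mulrA lerDl !mulr_ge0// addr_ge0.
have M0 : 0 <= 3 * A / m by rewrite divr_ge0 ?mulr_ge0// ltW.
have hv j : `|v j 0| <= 3 * A / m.
  rewrite mxE; case: ifP => [/andP[jT _]|_]; last by rewrite normr0.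
  rewrite normrN; move: jT; rewrite inE -leNgt => jT; apply: le_trans jT _.
  have /andP[c1' _] := col_bounds j.
  have := threshold_upper j; rewrite /rms => h.
  rewrite mulrA; apply: ler_pM => //; last by rewrite lef_pV2 ?posrE// (lt_le_trans m0).
  - by rewrite mulr_ge0// sqrtr_ge0.
  - by rewrite invr_ge0 (le_trans (ltW m0)).
  - by move: h t2A A0; lra.
apply: (@le_trans _ _ (S * (3 * A / m))).
  apply: (@lnorm_flat _ _ _ _ _ J) => //.
  by move=> j; rewrite mxE => /negbTE ->; rewrite andbF.
rewrite (_ : 3 * K1 / m * _ = S * (3 * (K1 * (tau * bN)) / m)); last by ring.
by rewrite ler_pM2l// ler_pM2r ?invr_gt0// ler_pM2l.
Qed.

(** At a false positive the estimate is pure error and exceeds a threshold of order [tau * bN]; an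
    error of order [S * tau * bN] leaves room for only [O(s)] such coordinates. *)
Lemma thresholded_sparsity : (l0norm (thresholded y Z Gh tau b1))%:R <=
  (1 + (1 + 4 * K1 * mu / (c1 * c3)) ^+ 2) * s%:R.
Proof.
have A0 := conic_scale_ge0.
have S0 : 0 < S by rewrite powR_gt0// ltr0n.
have [_ h2 _ _ _] := conic_bounds.
have q0 : (0 < q)%N by case: hq => ->.
pose T := That y Z Gh tau b1.
have tb0 : 0 < tau * bN by rewrite mulr_gt0.
have th0 : 0 < c3 * (tau * bN) / mu by rewrite divr_gt0// mulr_gt0.
have hj j : j \in T :\: J -> c3 * (tau * bN) / mu <= `|D j 0|.
  rewrite !inE negbK => /andP[/eqP b0j]; rewrite !mxE b0j subr0 => jT.
  apply: le_trans (ltW jT); have /andP[cm cM] := col_bounds j.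
  rewrite [leRHS]mulrA; apply: ler_pM.
  - by rewrite ltW// mulr_gt0.
  - by rewrite invr_ge0 ltW.
  - by rewrite mulrCA ler_wpM2l// res_lower.
  - by rewrite lef_pV2 ?posrE// (lt_le_trans m0).
have := lnorm_flat_ge q0 (ltW th0) hj.
set N := #|_| => hN.
pose a := 4 * K1 * mu / (c1 * c3).
have a0 : 0 <= a by rewrite /a divr_ge0 ?mulr_ge0// ltW.
have hNs : N%:R <= (1 + a) ^+ 2 * s%:R.
  have h3 : lnorm q D <= a * S * (c3 * (tau * bN) / mu).
    apply: le_trans h2 _.
    rewrite (_ : 4 * A * S / c1 = 4 * S / c1 * A); last by ring.
    rewrite [leRHS](_ : _ = 4 * S / c1 * (K1 * (tau * bN))); last first.
      by rewrite /a; field; rewrite !gt_eqF.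
    by rewrite ler_wpM2l// divr_ge0 ?mulr_ge0 ?(ltW c10)// ltW.
  have : N%:R * (c3 * (tau * bN) / mu) ^+ q <= (a * S * (c3 * (tau * bN) / mu)) ^+ q.
    apply: le_trans hN _; rewrite lerXn2r ?nnegrE ?lnorm_ge0//.
    by rewrite mulr_ge0 ?(ltW th0)// mulr_ge0// ltW.
  rewrite [in leRHS]exprMn ler_pM2r ?exprn_gt0// => h; apply: le_trans h _.
  (* The square of [1 + a] dominates [a ^+ q] for both exponents, so that the constant does not
     depend on [q]. *)
  have a1 : a ^+ q <= (1 + a) ^+ 2.
    by case: hq => ->; rewrite ?expr1; nra.
  have Ss : S ^+ q = s%:R by case: hq => ->; rewrite ?expr1 ?invr1 ?powRr1// powR12_sqrt// sqr_sqrtr.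
  by rewrite exprMn Ss ler_wpM2r.
apply: (@le_trans _ _ (s%:R + N%:R)); last by rewrite mulrDl mul1r lerD2l.
rewrite -natrD ler_nat; apply: leq_trans (_ : #|J| + N <= _)%N; last by rewrite leq_add2r.
apply: leq_trans (_ : #|J :|: (T :\: J)| <= _)%N; last by rewrite leq_card_setU.
apply: subset_leq_card; apply/fintype.subsetP => j.
rewrite finset.in_setU finset.in_setD => h.
have {h} : thresholded y Z Gh tau b1 j 0 != 0 by move: h; rewrite inE.
rewrite mxE -/T.
by case: (j \in T); case: (j \in J); rewrite ?eqxx.
Qed.

End fixed.
End conic.

(** * Quantiles *)

Section quantile.
Context {d : measure_display} {T : measurableType d} {R : realType}.
Variables (P : probability T R) (Y : T -> R).
Hypothesis mY : measurable_fun setT Y.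

Let F x : \bar R := P [set w | Y w <= x].

Lemma cdf_meas x : measurable [set w | Y w <= x].
Proof. exact: meas_le. Qed.

Lemma cdf_mono x y : x <= y -> (F x <= F y)%E.
Proof.
move=> xy; apply: le_measure; rewrite ?inE; [exact: cdf_meas..|].
by move=> w /= h; exact: le_trans xy.
Qed.

(** Together with [cdf_exists_small] this makes the set defining the quantile nonempty and bounded
    below, so that its [inf] is not a default value. *)
Lemma cdf_exists_large (u : R) : u < 1 -> exists x, (u%:E <= F x)%E.
Proof.
move=> u1; apply: contrapT => h.
have h' x : (F x < u%:E)%E by rewrite ltNge; apply/negP => ?; apply: h; exists x.
have := @nondecreasing_cvg_mu _ _ _ P (fun k : nat => [set w | Y w <= k%:R]).
have -> : \bigcup_k [set w | Y w <= k%:R] = setT.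
  apply/seteqP; split=> // w _; exists (Num.trunc `|Y w|).+1 => //=.
  by apply: le_trans (ler_norm _) _; rewrite ltW// truncnS_gt.
move=> /(_ (fun k => cdf_meas _) measurableT) hc.
have {}hc : P [set w | Y w <= k%:R] @[k --> \oo] --> P setT.
  apply: hc => k l kl; apply/subsetPset => w /= h1; apply: le_trans h1 _.
  by rewrite ler_nat.
have : (P setT <= u%:E)%E.
  rewrite -(cvg_lim _ hc)//; apply: lime_le; first by apply/cvg_ex; exists (P setT).
  by near=> k; exact/ltW/h'.
by rewrite probability_setT lee_fin leNgt u1.
Unshelve. all: by end_near. Qed.

Lemma cdf_exists_small (u : R) : 0 < u -> exists x, (F x < u%:E)%E.
Proof.
move=> u0; apply: contrapT => h.
have h' x : (u%:E <= F x)%E by rewrite leNgt; apply/negP => ?; apply: h; exists x.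
have := @nonincreasing_cvg_mu _ _ _ P (fun k : nat => [set w | Y w <= - k%:R]).
have -> : \bigcap_k [set w | Y w <= - k%:R] = set0.
  apply/seteqP; split=> // w h0; have := h0 (Num.trunc `|Y w|).+1 I.
  rewrite /= leNgt => /negP; apply.
  by rewrite ltrNl; apply: le_lt_trans (truncnS_gt _); rewrite -normrN ler_norm.
move=> /(_ _ (fun k => cdf_meas _) measurable0) hc.
have {}hc : P [set w | Y w <= - k%:R] @[k --> \oo] --> P set0.
  apply: hc; first by rewrite (le_lt_trans (probability_le1 _ (cdf_meas _))) ?ltry.
  move=> k l kl; apply/subsetPset => w /= h1; apply: le_trans h1 _.
  by rewrite lerN2 ler_nat.
have : (u%:E <= P set0)%E.
  rewrite -(cvg_lim _ hc)//; apply: lime_ge; first by apply/cvg_ex; exists (P set0).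
  by near=> k; exact: h'.
by rewrite measure0 lee_fin leNgt u0.
Unshelve. all: by end_near. Qed.

Variable u : R.
Hypothesis u0 : 0 < u.
Hypothesis u1 : u < 1.
Let q := quantile F u.

Lemma quantile_lbound : has_lbound [set x | (u%:E <= F x)%E].
Proof.
have [y Fy] := cdf_exists_small u0; exists y => x /= ux.
rewrite leNgt; apply/negP => xy.
by have := le_lt_trans ux (le_lt_trans (cdf_mono (ltW xy)) Fy); rewrite ltxx.
Qed.

Lemma quantile_le y : (u%:E <= F y)%E -> q <= y.
Proof. by move=> uy; apply: ge_inf => //; exact: quantile_lbound. Qed.

(** Right continuity of the distribution function: the event at [q] is the decreasing intersection
    of the events at [q + 1 / (k + 1)]. For [Hn] it bounds the probability of exceeding the
    quantile. *)
Lemma quantile_attained : (u%:E <= F q)%E.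
Proof.
have inv_gt0 (k : nat) : 0 < k.+1%:R^-1 :> R by rewrite invr_gt0.
have h (k : nat) : (u%:E <= F (q + k.+1%:R^-1)%R)%E.
  have qlt : q < q + k.+1%:R^-1 by rewrite ltrDl.
  have hi : has_inf [set x | (u%:E <= F x)%E].
    by split; [exact: cdf_exists_large|exact: quantile_lbound].
  have [x ux xq] := inf_adherent (inv_gt0 k) hi.
  exact: le_trans ux (cdf_mono (ltW xq)).
have := @nonincreasing_cvg_mu _ _ _ P (fun k : nat => [set w | Y w <= q + k.+1%:R^-1]).
have -> : \bigcap_k [set w | Y w <= q + k.+1%:R^-1] = [set w | Y w <= q].
  apply/seteqP; split=> w /=; last first.
    by move=> h0 k _ /=; apply: le_trans h0 _; rewrite lerDl ltW.
  move=> h0; apply/ler_addgt0Pr => e e0.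
  have [k ke] : exists k : nat, k.+1%:R^-1 < e.
    exists (Num.trunc e^-1); rewrite -[ltRHS]invrK ltf_pV2 ?posrE ?invr_gt0//.
    exact: truncnS_gt.
  by apply: le_trans (h0 k I) _; rewrite lerD2l ltW.
move=> /(_ _ (fun k => cdf_meas _) (cdf_meas _)) hc.
have {}hc : P [set w | Y w <= q + k.+1%:R^-1] @[k --> \oo] --> F q.
  apply: hc; first by rewrite (le_lt_trans (probability_le1 _ (cdf_meas _))) ?ltry.
  move=> k l kl; apply/subsetPset => w /= h1; apply: le_trans h1 _.
  by rewrite lerD2l lef_pV2 ?posrE// ler_nat ltnS.
rewrite -(cvg_lim _ hc)//; apply: lime_ge; first by apply/cvg_ex; exists (F q).
by near=> k; exact: h.
Unshelve. all: by end_near. Qed.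

Lemma quantile_ge y : (F y < u%:E)%E -> y <= q.
Proof.
move=> Fy; rewrite leNgt; apply/negP => qy.
by have := lt_le_trans Fy (le_trans quantile_attained (cdf_mono (ltW qy))); rewrite ltxx.
Qed.

End quantile.

(** * Quantiles of the normal law *)

Section normal_quantile.
Context {R : realType}.
Notation phi := (normal_pdf (0 : R) 1).
Notation mu := (@lebesgue_measure R).

Lemma tail_half : tail (0 : R) = 2^-1.
Proof.
have h := @ge0_symfun_integralT R phi (fun x => ltW (phi_gt0 x)) (@continuous_phi R).
have {}h : (\int[mu]_x (phi x)%:E =
    2%:E * \int[mu]_(x in [set x | (0 <= x)%R]) (phi x)%:E)%E.
  by apply: h => x /=; rewrite !phiE sqrrN.
rewrite integral_normal_pdf// in h.
have h2 : (\int[mu]_(x in [set x | (0 <= x)%R]) (phi x)%:E = (tail 0)%:E)%E.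
  rewrite -tailE gammaE.
  rewrite (_ : [set x : R | (0 <= x)%R] = `[0, +oo[%classic); last first.
    by apply/seteqP; split => x/=; rewrite in_itv/= andbT.
  rewrite integral_itv_obnd_cbnd//; exact: mphiT.
move: h; rewrite h2 -EFinM => -[]; lra.
Qed.

Section fixed_level.
Variable v : R.
Hypothesis v0 : 0 < v.
Hypothesis v1 : v < 1.
Let x := Phi_inv (1 - v).

Let PhiE : (Phi : R -> \bar R) = (fun x => gamma [set w : measurableTypeR R | w <= x]).
Proof. by apply/funext => z; rewrite /Phi; congr (gamma _); apply/seteqP; split=> y /=; rewrite in_itv. Qed.

Let gPhi z : gamma [set w : measurableTypeR R | w <= z] = Phi z.
Proof. by rewrite PhiE. Qed.

Let mid : measurable_fun setT (fun y : measurableTypeR R => y : R).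
Proof. exact: measurable_id. Qed.

Let w0 : 0 < 1 - v :> R. Proof. by rewrite subr_gt0. Qed.
Let w1 : 1 - v < 1 :> R. Proof. by rewrite ltrBlDr ltrDl. Qed.

Lemma tail_Phi_inv : tail x <= v.
Proof.
have := @quantile_attained _ _ _ gamma _ mid (1 - v) w0 w1.
rewrite gPhi -PhiE Phi_tail lee_fin .
by rewrite lerD2l lerN2.
Qed.

Lemma Phi_inv_le y : tail y <= v -> x <= y.
Proof.
move=> h; have := @quantile_le _ _ _ gamma _ mid (1 - v) w0 y.
by rewrite gPhi -PhiE; apply; rewrite Phi_tail lee_fin lerD2l lerN2.
Qed.

Lemma Phi_inv_ge y : v < tail y -> y <= x.
Proof.
move=> h; have := @quantile_ge _ _ _ gamma _ mid (1 - v) w0 w1 y.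
by rewrite gPhi -PhiE; apply; rewrite Phi_tail lte_fin ltrD2l ltrN2.
Qed.

Lemma Phi_inv_le_sqrt : x <= Num.sqrt (- (2 * ln v)).
Proof.
have l0 : 0 <= - (2 * ln v) by have := ln_lt0 (introT andP (conj v0 v1)); lra.
apply: Phi_inv_le; apply: le_trans (tail_upper (sqrtr_ge0 _)) _.
rewrite sqr_sqrtr// (_ : _ / 2 = ln v); first by rewrite lnK// posrE.
by field.
Qed.

(** From [tail x >= phi (x + 1)] and [(x + 1)^2 / 2 <= x^2 + 1]. It is used in reverse: an upper
    bound on a quantile limits the logarithm of its level. *)
Lemma ln_le_Phi_inv : 0 <= x -> - ln v <= x ^+ 2 + 1 - ln (phi 0).
Proof.
move=> x0.
have h : phi (x + 1) <= v.
  by apply: le_trans tail_Phi_inv; rewrite -[leLHS]mul1r tail_lower.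
have h2 : phi 0 * expR (- (x ^+ 2 + 1)) <= v.
  apply: le_trans h; rewrite !phiE -mulrA -expRD ler_wpM2l ?normal_peak_ge0// ler_expR.
  by have := sqr_ge0 (x - 1); rewrite !expr2; lra.
have : ln (phi 0 * expR (- (x ^+ 2 + 1))) <= ln v.
  by rewrite ler_ln ?posrE ?mulr_gt0 ?phi_gt0 ?expR_gt0.
by rewrite lnM ?posrE ?phi_gt0 ?expR_gt0// expRK; lra.
Qed.

(** The tail starts at [1/2] and falls with slope at most [phi 0]. Only half of the gap is spent,
    which leaves the strict inequality that [Phi_inv_ge] asks for. *)
Lemma Phi_inv_ge_gap dl : 0 < dl -> v <= 2^-1 - dl -> dl / (2 * phi 0) <= x.
Proof.
move=> d0 vd; apply: Phi_inv_ge.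
have p0 := phi_gt0 (0 : R).
have y0 : 0 <= dl / (2 * phi 0) by rewrite divr_ge0 ?mulr_ge0 ?ltW.
have := tail_local (lexx 0) y0; rewrite tail_half subr0.
have -> : dl / (2 * phi 0) * phi 0 = dl / 2 by field; rewrite gt_eqF.
lra.
Qed.

End fixed_level.

Lemma Phi_inv_anti (v v' : R) : 0 < v -> v <= v' -> v' < 1 ->
  Phi_inv (1 - v') <= Phi_inv (1 - v).
Proof.
move=> v0 vv v1; have v'0 := lt_le_trans v0 vv; have v1' := le_lt_trans vv v1.
by apply: Phi_inv_le => //; apply: le_trans vv; exact: tail_Phi_inv.
Qed.

End normal_quantile.

(** * Concentration *)

(** No lower bound on [u] is imposed, which suits lower tails of nonnegative variables. *)
Lemma expR_quad (R : realType) (u : R) : u <= 1 -> expR u <= 1 + u + 4 * u ^+ 2.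
Proof.
move=> u1; have [um|um] := leP u (- 1).
  have h : expR u <= (1 - u)^-1.
    rewrite -[u]opprK expRN opprK lef_pV2 ?posrE ?expR_gt0//; last by lra.
    by have := expR_ge1Dx (- u); lra.
  apply: le_trans h _; rewrite -[leLHS]mul1r ler_pdivrMr; last by lra.
  have h2 : 0 <= (- u) * u ^+ 2 by rewrite mulr_ge0 ?sqr_ge0//; lra.
  have h3 := sqr_ge0 u.
  rewrite [leRHS](_ : _ = 1 + 3 * u ^+ 2 + 4 * (- u * u ^+ 2)); last by ring.
  by lra.
have hu : `|u| <= 1 by rewrite ler_norml (ltW um).
have h := expR_taylor3 u.
have e1 : expR `|u| * `|u| ^+ 3 <= 3 * `|u| ^+ 2.
  apply: ler_pM; rewrite ?expR_ge0 ?exprn_ge0//.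
    by apply: le_trans (ltW (@expR1_lt3 R)); rewrite ler_expR.
  by rewrite ler_wiXn2l.
move: h; rewrite ler_norml => /andP[_ h].
by rewrite -norm_pow2 in e1; have := sqr_ge0 u; lra.
Qed.

Section sigma_measurable.
Context {d : measure_display} {T : measurableType d} {R : realType}.

(* Measurability with respect to the sigma-algebra generated by [G]. *)
Definition Fm (G : set (set T)) (f : T -> R) : Prop :=
  @measurable_fun _ _ (g_sigma_algebraType G) R setT f.

Lemma Fm_preimage G f (B : set R) : Fm G f -> measurable B -> <<s G >> (f @^-1` B).
Proof. by move=> mf mB; have := mf measurableT B mB; rewrite setTI. Qed.

Lemma Fm_meas G f : (forall E, <<s G >> E -> measurable E) -> Fm G f ->
  measurable_fun setT f.
Proof. by move=> h mf _ B mB; rewrite setTI; apply: h; exact: Fm_preimage. Qed.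

End sigma_measurable.

Section union.
Context {d : measure_display} {T : measurableType d} {R : realType}.
Variable P : probability T R.

Lemma meas_exists (I : finType) (A : I -> set T) :
  (forall i, measurable (A i)) -> measurable [set w | exists i, A i w].
Proof.
move=> mA; rewrite (_ : [set w | exists i, A i w] = \bigcup_(i in [set: I]) A i).
  by apply: fin_bigcup_measurable => //; exact: finite_finset.
by apply/seteqP; split=> w /= [i] => [h|_ h]; exists i.
Qed.

Lemma prob_exists (I : finType) (A : I -> set T) (a : R) :
  (forall i, measurable (A i)) -> (forall i, (P (A i) <= a%:E)%E) ->
  (P [set w | exists i, A i w] <= (#|I|%:R * a)%:E)%E.
Proof.
move=> mA hA.
have h (s : seq I) : (P [set w | exists2 i, i \in s & A i w] <= ((size s)%:R * a)%:E)%E /\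
    measurable [set w | exists2 i, i \in s & A i w].
  elim: s => [|i s [IH1 IH2]].
    rewrite (_ : [set w | _] = set0) ?measure0 ?mul0r//.
    by apply/seteqP; split=> // w [].
  have E : [set w | exists2 k, k \in i :: s & A k w] =
      A i `|` [set w | exists2 k, k \in s & A k w].
    apply/seteqP; split=> w /=.
      by move=> [k]; rewrite inE => /orP[/eqP ->|ks] Ak; [left|right; exists k].
    move=> [Ai|[k ks Ak]]; first by exists i; rewrite ?inE ?eqxx.
    by exists k; rewrite ?inE ?ks ?orbT.
  rewrite E; split; last exact: measurableU.
  have m := measurableU _ _ (mA i) IH2.
  rewrite /= -[(size s).+1]add1n natrD mulrDl mul1r.
  by apply: (@prob_subU _ _ _ P _ _ _ _ _ m (mA i) IH2).
have [h1 _] := h (enum I); rewrite cardE (_ : [set w | _] = [set w | exists2 i, i \in enum I & A i w])//.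
apply/seteqP; split=> w /=; first by move=> [i Ai]; exists i => //; rewrite mem_enum.
by move=> [i _ Ai]; exists i.
Qed.

End union.

Section moments.
Context {d : measure_display} {T : measurableType d} {R : realType}.
Variable P : probability T R.
Notation EX := (EX P).
Notation Intg := (Intg P).

Lemma moment_of_mgf (Y : T -> R) (c : R) (k : nat) : measurable_fun setT Y ->
  (\int[P]_w (expR `|Y w|)%:E <= c%:E)%E ->
  Intg (fun w => `|Y w| ^+ k) /\ EX (fun w => `|Y w| ^+ k) <= k`!%:R * c.
Proof.
move=> mY hY.
have mN : measurable_fun setT (fun w => `|Y w|) by apply: measurableT_comp.
have mE : measurable_fun setT (fun w => expR `|Y w|) by apply: measurableT_comp.
have [IE EE] := Intg_ge0 mE (fun w => expR_ge0 _) hY.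
have I2 := IntgZ k`!%:R IE.
have I1 : Intg (fun w => `|Y w| ^+ k).
  apply: (Intg_dom _ _ I2); first exact: measurable_funX.
  by move=> w; rewrite ger0_norm ?exprn_ge0// pow_le_expR.
split=> //; apply: (@le_trans _ _ (EX (fun w => k`!%:R * expR `|Y w|))).
  by apply: EX_le => // w; rewrite pow_le_expR.
by rewrite EXZ// ler_wpM2l.
Qed.

Lemma expR_norm_int (Y : T -> R) (t c : R) : measurable_fun setT Y ->
  (forall s, (\int[P]_w (expR (s * Y w))%:E <= (expR (s ^+ 2 * c / 2))%:E)%E) ->
  (\int[P]_w (expR (t * `|Y w|))%:E <= (2 * expR (t ^+ 2 * c / 2))%:E)%E.
Proof.
move=> mY h.
have m s : measurable_fun setT (fun w => (expR (s * Y w))%:E : \bar R).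
  apply/measurable_EFinP; apply: measurableT_comp => //.
  by apply: measurable_funM.
apply: (@le_trans _ _ (\int[P]_w ((expR (t * Y w))%:E + (expR ((- t) * Y w))%:E))%E).
  apply: ge0_le_integral => //.
  - apply/measurable_EFinP; apply: measurableT_comp => //.
    by apply: measurable_funM => //; apply: measurableT_comp.
  - by apply: emeasurable_funD.
  - move=> w _; rewrite -EFinD lee_fin; have [y0|y0] := leP 0 (Y w).
      by rewrite ger0_norm// lerDl expR_ge0.
    by rewrite ltr0_norm// mulrN -mulNr lerDr expR_ge0.
rewrite ge0_integralD//=.
rewrite mulrDl mul1r EFinD; apply: leeD; first exact: h.
by apply: le_trans (h (- t)) _; rewrite sqrrN.
Qed.

End moments.

Section chernoff_avg.
Context {d : measure_display} {T : measurableType d} {R : realType}.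
Variables (P : probability T R) (n : nat) (G : 'I_n -> set (set T)).
Hypothesis n0 : (0 < n)%N.
Hypothesis GM : forall i E, <<s G i >> E -> measurable E.
Hypothesis indF : independent P (fun i => <<s G i >>).
Notation EX := (EX P).
Notation Intg := (Intg P).

(** A Bernstein bound at a fixed [t]; boundedness enters only from above, through
    [t * Y i w <= 1]. *)
Lemma chernoff_avg (Y : 'I_n -> T -> R) (t a m M2 : R) : (forall i, Fm (G i) (Y i)) ->
  0 <= t -> (forall i w, t * Y i w <= 1) ->
  (forall i, Intg (Y i)) -> (forall i, Intg (fun w => Y i w ^+ 2)) ->
  avg (fun i => EX (Y i)) <= m -> avg (fun i => EX (fun w => Y i w ^+ 2)) <= M2 ->
  (P [set w | (a <= avg (fun i => Y i w))%R] <=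
    (expR (n%:R * (t * m + 4 * t ^+ 2 * M2 - t * a)))%:E)%E.
Proof.
move=> fY t0 tY IY IY2 hm hM.
have n0' : 0 < n%:R :> R by rewrite ltr0n.
have fY' i (B : set R) : measurable B -> <<s G i >> ((fun w => t * Y i w) @^-1` B).
  move=> mB; apply: Fm_preimage mB.
  by apply: (@measurable_funM _ (g_sigma_algebraType (G i)) R) => //; exact: fY.
pose c i := t * EX (Y i) + 4 * t ^+ 2 * EX (fun w => Y i w ^+ 2).
have hc i : (\int[P]_w (expR (t * Y i w))%:E <= (expR (c i))%:E)%E.
  have J1 := IntgZ t (IY i); have J2 := IntgZ (4 * t ^+ 2) (IY2 i).
  have J := IntgD (IntgD (Intg_cst P 1) J1) J2.
  have mY := Fm_meas (@GM i) (fY i).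
  have Je : Intg (fun w => expR (t * Y i w)).
    apply: (@Intg_bdd _ _ _ _ _ (expR 1)).
      by apply: measurableT_comp => //; apply: measurable_funM.
    by move=> w; rewrite ger0_norm ?expR_ge0// ler_expR.
  rewrite EX_fin// lee_fin; apply: le_trans (expR_ge1Dx _).
  have -> : 1 + c i = EX (fun w => 1 + t * Y i w + 4 * t ^+ 2 * Y i w ^+ 2).
    rewrite EXD//; last exact: (IntgD (Intg_cst P 1) J1).
    by rewrite EXD// ?EX_cst; [rewrite !EXZ// /c addrA|exact: Intg_cst].
  apply: EX_le => // w; apply: le_trans (expR_quad (tY i w)) _.
  by rewrite exprMn mulrA.
have := chernoff_sum GM fY' indF (n%:R * (t * a)) hc.
have -> : [set w | n%:R * (t * a) <= \sum_(i < n) t * Y i w] =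
    [set w | t * a <= t * avg (fun i => Y i w)].
  apply/seteqP; split=> w /=; rewrite -mulr_sumr /avg;
  rewrite -(ler_pM2l n0' (t * a)) [n%:R * (t * (_ * _))]mulrCA mulVKf ?gt_eqF//.
move=> h; apply: le_trans (le_trans h _).
  apply: le_measure; rewrite ?inE.
  - apply: meas_le => //; rewrite /avg; apply: measurable_funM => //.
    by apply: meas_sum => i _; exact: Fm_meas (@GM i) (fY i).
  - apply: meas_le => //; rewrite /avg; apply: measurable_funM => //.
    apply: measurable_funM => //.
    by apply: meas_sum => i _; exact: Fm_meas (@GM i) (fY i).
  - by move=> w /= hw; rewrite ler_wpM2l.
rewrite lee_fin ler_expR mulrBr lerD2r /c big_split/= -!mulr_sumr.
have s1 : \sum_i EX (Y i) <= n%:R * m.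
  by rewrite -ler_pdivrMl.
have s2 : \sum_i EX (fun w => Y i w ^+ 2) <= n%:R * M2.
  by rewrite -ler_pdivrMl.
rewrite mulrDr; apply: lerD.
  by rewrite [leRHS]mulrCA ler_wpM2l.
by rewrite [leRHS]mulrCA ler_wpM2l// mulr_ge0// exprn_ge0.
Qed.

End chernoff_avg.

Section young.
Context {R : realType}.

Lemma mixed_pow_le (u v : R) (a b k : nat) : 0 <= u -> 0 <= v -> (a + b <= k)%N ->
  u ^+ a * v ^+ b <= 1 + u ^+ k + v ^+ k.
Proof.
move=> u0 v0 abk.
wlog uv : u v a b u0 v0 abk / u <= v.
  move=> H; have [uv|/ltW vu] := leP u v; first exact: H.
  rewrite mulrC addrAC; apply: H => //; by rewrite addnC.
apply: (@le_trans _ _ (v ^+ a * v ^+ b)).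
  by rewrite ler_wpM2r ?exprn_ge0// lerXn2r ?nnegrE.
rewrite -exprD; have [v1|v1] := leP v 1.
  apply: le_trans (exprn_ile1 _ v0 v1) _.
  by rewrite -addrA lerDl addr_ge0// exprn_ge0.
apply: (@le_trans _ _ (v ^+ k)); first by rewrite ler_weXn2l// ltW.
by rewrite lerDr addr_ge0// exprn_ge0.
Qed.

Lemma sq4 (a : R) : a ^+ 4 = (a ^+ 2) ^+ 2.
Proof. exact: exprM a 2 2. Qed.

Lemma mul_le_pow4 (a b : R) : a * b <= ((a ^+ 2) ^+ 2 + (b ^+ 2) ^+ 2) / 2 + 1.
Proof.
have h1 := sqr_ge0 (a ^+ 2 - b ^+ 2); have h2 := sqr_ge0 (a * b - 1).
have h3 := sqr_ge0 (a * b); nra.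
Qed.

Lemma mul_le_sqrD (a b : R) : 0 <= a -> 0 <= b -> a * b <= a ^+ 2 + b ^+ 2.
Proof. by move=> a0 b0; have := sqr_ge0 (a - b); have := mulr_ge0 a0 b0; nra. Qed.

Lemma one_sqr_sub_ge0 (y : R) : 0 <= 1 + y ^+ 2 - y.
Proof. by have := sqr_ge0 (y - 1); have := sqr_ge0 y; rewrite !expr2; lra. Qed.

Lemma pow4D_le (a b : R) : (a + b) ^+ 4 <= 8 * (a ^+ 4 + b ^+ 4).
Proof.
have h x y : (x + y) ^+ 2 <= 2 * (x ^+ 2 + y ^+ 2) :> R.
  by have := sqr_ge0 (x - y); rewrite !expr2; lra.
rewrite !sq4; apply: (@le_trans _ _ ((2 * (a ^+ 2 + b ^+ 2)) ^+ 2)).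
  by rewrite lerXn2r ?nnegrE ?sqr_ge0 ?h ?mulr_ge0 ?addr_ge0 ?sqr_ge0.
by rewrite exprMn; have := h (a ^+ 2) (b ^+ 2); lra.
Qed.

End young.

(** * Tail bounds for errors, their products and the scores *)

Section model_concentration.
Context {d : measure_display} {T : measurableType d} {R : realType}.
Variables (P : probability T R) (n p : nat) (G : 'I_n -> set (set T)).
Variables (W : 'I_n -> 'I_p -> T -> R) (V : 'I_n -> T -> R) (x : 'M[R]_(n, p)).
Variables (sg C0 KV : R).
Hypothesis n0 : (0 < n)%N.
Hypothesis GM : forall i E, <<s G i >> E -> measurable E.
Hypothesis indF : independent P (fun i => <<s G i >>).
Hypothesis fW : forall i j, Fm (G i) (W i j).
Hypothesis fV : forall i, Fm (G i) (V i).
Hypothesis C00 : 0 < C0.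
Hypothesis sgC : sg ^+ 2 <= C0.
Hypothesis mgfW : forall i j t,
  (\int[P]_w (expR (t * W i j w))%:E <= (expR (t ^+ 2 * sg ^+ 2 / 2))%:E)%E.
Hypothesis mgfV : forall i, (\int[P]_w (expR `|V i w|)%:E <= KV%:E)%E.
Notation EX := (EX P).
Notation Intg := (Intg P).

Let n0' : 0 < n%:R :> R. Proof. by rewrite ltr0n. Qed.

Lemma mW i j : measurable_fun setT (W i j).
Proof. exact: Fm_meas (@GM i) (@fW i j). Qed.

Lemma mV i : measurable_fun setT (V i).
Proof. exact: Fm_meas (@GM i) (@fV i). Qed.

Lemma W_mgf_abs i j t :
  (\int[P]_w (expR (t * `|W i j w|))%:E <= (2 * expR (t ^+ 2 * sg ^+ 2 / 2))%:E)%E.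
Proof. exact: expR_norm_int (mW i j) (mgfW i j). Qed.

Lemma W_moment i j k : Intg (fun w => `|W i j w| ^+ k) /\
  EX (fun w => `|W i j w| ^+ k) <= k`!%:R * (2 * expR (sg ^+ 2 / 2)).
Proof.
apply: moment_of_mgf; first exact: mW.
have := W_mgf_abs i j 1; rewrite expr1n mul1r.
by under eq_integral do rewrite mul1r.
Qed.

Lemma V_moment i k : Intg (fun w => `|V i w| ^+ k) /\
  EX (fun w => `|V i w| ^+ k) <= k`!%:R * KV.
Proof. by apply: moment_of_mgf; [exact: mV|exact: mgfV]. Qed.

(** One constant for all joint moments of an error coordinate and the normalized noise up to total
    order 8, the order that the fourth moment of a score requires. *)
Definition Kmix : R := 1 + 8`!%:R * (2 * expR (C0 / 2)) + 8`!%:R * KV.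

Lemma mixed_moment i j a b : (a + b <= 8)%N ->
  Intg (fun w => `|W i j w| ^+ a * `|V i w| ^+ b) /\
  EX (fun w => `|W i j w| ^+ a * `|V i w| ^+ b) <= Kmix.
Proof.
move=> ab; have [I1 E1] := W_moment i j 8; have [I2 E2] := V_moment i 8.
have I := IntgD (IntgD (Intg_cst P 1) I1) I2.
have pw w : `|W i j w| ^+ a * `|V i w| ^+ b <= 1 + `|W i j w| ^+ 8 + `|V i w| ^+ 8.
  exact: mixed_pow_le.
have J : Intg (fun w => `|W i j w| ^+ a * `|V i w| ^+ b).
  apply: (Intg_dom _ _ I) => [|w].
    apply: measurable_funM; apply: measurable_funX; apply: measurableT_comp => //.
      exact: mW.
    exact: mV.
  by rewrite ger0_norm// mulr_ge0// exprn_ge0.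
split=> //; apply: le_trans (EX_le J I pw) _.
rewrite EXD//; last exact: IntgD (Intg_cst P 1) I1.
rewrite EXD//; last exact: Intg_cst.
rewrite EX_cst /Kmix lerD// lerD2l; apply: le_trans E1 _.
by rewrite ler_wpM2l// ler_pM2l// ler_expR ler_pM2r.
Qed.

Lemma Kmix_ge1 : 1 <= Kmix.
Proof.
have KV0 (i : 'I_n) : 0 <= KV.
  rewrite -lee_fin; apply: le_trans (mgfV i).
  by apply: integral_ge0 => w _; rewrite lee_fin expR_ge0.
have KV0' : 0 <= KV by exact: KV0 (Ordinal n0).
by rewrite /Kmix -addrA lerDl addr_ge0// mulr_ge0// mulr_ge0// expR_ge0.
Qed.

Definition kap : R := 4`!%:R * (2 * expR (sg ^+ 2 / 2)).

Lemma kap_ge0 : 0 <= kap.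
Proof. by rewrite /kap !mulr_ge0// expR_ge0. Qed.

Lemma W4_moment i j : Intg (fun w => W i j w ^+ 4) /\ EX (fun w => W i j w ^+ 4) <= kap.
Proof.
have E : (fun w => `|W i j w| ^+ 4) = (fun w => W i j w ^+ 4).
  by apply/funext => w; rewrite !sq4 -norm_pow2.
by have := W_moment i j 4; rewrite E.
Qed.

(** With [t = sqrt (L / n) / (1 + sqrt m)] the threshold contributes [- (1 + sg^2) L] and the
    exponential moments at most [sg^2 L / 2]. The [1 +] keeps the division harmless when [m = 0]. *)
Lemma cross_tail (a : 'I_n -> R) k m L : 0 <= L -> avg (fun i => a i ^+ 2) <= m ->
  (P [set w | ((1 + sg ^+ 2) * (1 + Num.sqrt m) * Num.sqrt (L / n%:R) <=
     avg (fun i => a i * W i k w))%R] <= (expR (- L))%:E)%E.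
Proof.
move=> L0 am.
have m0 : 0 <= m by apply: le_trans am; apply: avg_ge0 => i; exact: sqr_ge0.
have sm := sqrtr_ge0 m; set q := Num.sqrt m in sm *.
have q1 : 0 < 1 + q by rewrite ltr_pwDl.
pose t := Num.sqrt (L / n%:R) / (1 + q).
have t0 : 0 <= t by rewrite divr_ge0 ?sqrtr_ge0// ltW.
have fY i (B : set R) : measurable B -> <<s G i >> ((fun w => (t * a i) * W i k w) @^-1` B).
  move=> mB; apply: Fm_preimage mB.
  by apply: (@measurable_funM _ (g_sigma_algebraType (G i)) R) => //; exact: fW.
have := chernoff_sum GM fY indF (n%:R * (t * ((1 + sg ^+ 2) * (1 + q) * Num.sqrt (L / n%:R))))
  (fun i => mgfW i k (t * a i)).
have mS (c : 'I_n -> R) : measurable_fun setT (fun w => \sum_(i < n) c i * W i k w).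
  by apply: meas_sum => i _; apply: measurable_funM => //; exact: mW.
move=> h; apply: le_trans (le_trans h _).
  apply: le_measure; rewrite ?inE.
  - apply: meas_le => //; rewrite /avg; apply: measurable_funM => //; exact: mS.
  - by apply: meas_le => //; exact: mS.
  - move=> w /= hw.
    have -> : \sum_(i < n) t * a i * W i k w = n%:R * (t * avg (fun i => a i * W i k w)).
      rewrite /avg (mulrCA t) mulVKf ?gt_eqF// mulr_sumr.
      by apply: eq_bigr => i _; rewrite mulrA.
    by rewrite ler_pM2l// ler_wpM2l.
rewrite lee_fin ler_expR.
have q2 : q ^+ 2 = m by rewrite sqr_sqrtr.
have sL : Num.sqrt (L / n%:R) ^+ 2 = L / n%:R by rewrite sqr_sqrtr// divr_ge0// ltW.
have -> : n%:R * (t * ((1 + sg ^+ 2) * (1 + q) * Num.sqrt (L / n%:R))) = (1 + sg ^+ 2) * L.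
  transitivity (n%:R * (1 + sg ^+ 2) * (Num.sqrt (L / n%:R) ^+ 2)).
    by rewrite /t; field; rewrite gt_eqF.
  by rewrite sL; field; rewrite gt_eqF.
have -> : \sum_(i < n) (t * a i) ^+ 2 * sg ^+ 2 / 2 =
    n%:R * (t ^+ 2 * sg ^+ 2 / 2 * avg (fun i => a i ^+ 2)).
  rewrite /avg (mulrCA (t ^+ 2 * _ / _)) mulVKf ?gt_eqF// mulr_sumr.
  by apply: eq_bigr => i _; ring.
have h1 : t ^+ 2 * sg ^+ 2 / 2 * avg (fun i => a i ^+ 2) <= t ^+ 2 * sg ^+ 2 / 2 * (1 + q) ^+ 2.
  apply: ler_wpM2l.
    by apply: divr_ge0 => //; apply: mulr_ge0; exact: sqr_ge0.
  apply: le_trans am _.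
  by rewrite -q2 lerXn2r ?nnegrE ?(ltW q1)// lerDr.
have h2 : t ^+ 2 * sg ^+ 2 / 2 * (1 + q) ^+ 2 = sg ^+ 2 / 2 * (L / n%:R).
  by rewrite -sL /t; field; rewrite gt_eqF.
have h3 : n%:R * (t ^+ 2 * sg ^+ 2 / 2 * avg (fun i => a i ^+ 2)) <= sg ^+ 2 / 2 * L.
  apply: (@le_trans _ _ (n%:R * (sg ^+ 2 / 2 * (L / n%:R)))).
    by rewrite ler_pM2l// -h2.
  by rewrite le_eqVlt; apply/orP; left; apply/eqP; field; rewrite gt_eqF.
have h4 : 0 <= sg ^+ 2 * L by rewrite mulr_ge0// sqr_ge0.
move: h3; set z := n%:R * _ => h3.
by rewrite mulrDl mul1r; lra.
Qed.

Lemma W_tail i j A : 0 <= A ->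
  (P [set w | (A < `|W i j w|)%R] <= (2 * expR (- (A ^+ 2 / (2 * C0))))%:E)%E.
Proof.
move=> A0; pose t := A / C0; have t0 : 0 <= t by rewrite divr_ge0// ltW.
have mN : measurable_fun setT (fun w => `|W i j w|).
  by apply: measurableT_comp => //; exact: mW.
have mE : measurable_fun setT (fun w => expR (t * `|W i j w|)).
  by apply: measurableT_comp => //; apply: measurable_funM.
have [I E] := Intg_ge0 mE (fun w => expR_ge0 _) (W_mgf_abs i j t).
have J := IntgZ (expR (- (t * A))) I.
apply: le_trans (prob_le_EX _ J _ _) _.
- exact: meas_lt.
- by move=> w; rewrite mulr_ge0 ?expR_ge0.
- move=> w /= Aw; rewrite -expRD -expR0 ler_expR addrC subr_ge0.
  by rewrite ler_wpM2l// ltW.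
rewrite lee_fin EXZ//; apply: (@le_trans _ _ (expR (- (t * A)) * (2 * expR (t ^+ 2 * sg ^+ 2 / 2)))).
  by rewrite ler_wpM2l ?expR_ge0.
rewrite mulrCA ler_pM2l// -expRD ler_expR.
have h : t ^+ 2 * sg ^+ 2 <= t ^+ 2 * C0 by rewrite ler_wpM2l ?sqr_ge0.
have e1 : t ^+ 2 * C0 = A ^+ 2 / C0 by rewrite /t; field; rewrite gt_eqF.
have e2 : t * A = A ^+ 2 / C0 by rewrite /t; field; rewrite gt_eqF.
have e3 : A ^+ 2 / (2 * C0) = A ^+ 2 / C0 / 2 by field; rewrite gt_eqF.
by rewrite e1 in h; rewrite e2 e3; lra.
Qed.

Lemma max_W_tail A : 0 <= A ->
  (P [set w | exists ij : 'I_n * 'I_p, (A < `|W ij.1 ij.2 w|)%R] <=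
    ((n * p)%:R * (2 * expR (- (A ^+ 2 / (2 * C0)))))%:E)%E.
Proof.
move=> A0; have := @prob_exists _ _ _ P ('I_n * 'I_p)%type
  (fun ij => [set w | A < `|W ij.1 ij.2 w|]) (2 * expR (- (A ^+ 2 / (2 * C0)))).
rewrite card_prod !card_ord; apply=> ij; last exact: W_tail.
by apply: meas_lt => //; apply: measurableT_comp => //; exact: mW.
Qed.

Section truncation.
Variable A : R.
Hypothesis A0 : 0 < A.

(** A product of two subgaussian errors is only subexponential. Cutting both factors at [A] allows
    the Chernoff bound at [t = sqrt (L / n)] as soon as [t A^2 <= 1], with second moments bounded
    independently of [A]. *)
Definition trprod i j k w : R :=
  if (`|W i j w| <= A) && (`|W i k w| <= A) then W i j w * W i k w else 0.

Lemma trprod_Fm i j k : Fm (G i) (trprod i j k).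
Proof.
rewrite /Fm; set T' := g_sigma_algebraType (G i).
have fj : @measurable_fun _ _ T' R setT (W i j) := @fW i j.
have fk : @measurable_fun _ _ T' R setT (W i k) := @fW i k.
have mn (f : T' -> R) : measurable_fun setT f -> measurable_fun setT (fun w => `|f w| <= A).
  move=> mf; apply: (measurable_fun_bool true).
  rewrite setTI (_ : _ @^-1` _ = [set w | `|f w| <= A]); last first.
    by apply/seteqP; split=> w.
  by apply: meas_le => //; apply: measurableT_comp.
apply: measurable_fun_ifT => //; last exact: measurable_funM.
by apply: measurable_and; exact: mn.
Qed.

Lemma trprod_abs i j k w : `|trprod i j k w| <= A ^+ 2.
Proof.
rewrite /trprod; case: ifP => [/andP[h1 h2]|_]; last by rewrite normr0 sqr_ge0.
by rewrite normrM expr2 ler_pM.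
Qed.

Lemma trprod_sqr i j k w : trprod i j k w ^+ 2 <= (W i j w ^+ 4 + W i k w ^+ 4) / 2.
Proof.
apply: (@le_trans _ _ ((W i j w * W i k w) ^+ 2)).
  by rewrite /trprod; case: ifP => _//; rewrite expr0n sqr_ge0.
have := sqr_ge0 (W i j w ^+ 2 - W i k w ^+ 2).
rewrite !sq4 exprMn; set a := W i j w ^+ 2; set b := W i k w ^+ 2.
by rewrite !expr2; lra.
Qed.

Lemma trprod_Intg i j k : Intg (trprod i j k).
Proof.
apply: (@Intg_bdd _ _ _ _ _ (A ^+ 2)); last exact: trprod_abs.
exact: Fm_meas (@GM i) (@trprod_Fm i j k).
Qed.

Lemma trprod_moment2 i j k : Intg (fun w => trprod i j k w ^+ 2) /\
  EX (fun w => trprod i j k w ^+ 2) <= kap.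
Proof.
have [I1 E1] := W4_moment i j; have [I2 E2] := W4_moment i k.
have I := IntgZr (2^-1) (IntgD I1 I2).
have J : Intg (fun w => trprod i j k w ^+ 2).
  apply: (Intg_dom _ _ I).
    by apply: measurable_funX; exact: Fm_meas (@GM i) (@trprod_Fm i j k).
  by move=> w; rewrite ger0_norm ?sqr_ge0// trprod_sqr.
split=> //; apply: le_trans (EX_le J I (trprod_sqr i j k)) _.
rewrite EXZr; last exact: IntgD.
rewrite EXD//; move: E1 E2; set a := EX _; set b := EX _.
by clearbody a b; lra.
Qed.

Lemma trprod_tail j k L (s : bool) : 0 <= L -> Num.sqrt (L / n%:R) * A ^+ 2 <= 1 ->
  (P [set w | (avg (fun i => (-1) ^+ s * EX (trprod i j k)) + (1 + 4 * kap) * Num.sqrt (L / n%:R) <=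
       avg (fun i => (-1) ^+ s * trprod i j k w))%R] <= (expR (- L))%:E)%E.
Proof.
move=> L0 LA; set t := Num.sqrt (L / n%:R) in LA *.
have t0 : 0 <= t by exact: sqrtr_ge0.
have t2 : t ^+ 2 = L / n%:R by rewrite sqr_sqrtr// divr_ge0// ltW.
set m := avg _.
have := @chernoff_avg _ _ _ P n G n0 GM indF (fun i w => (-1) ^+ s * trprod i j k w)
  t (m + (1 + 4 * kap) * t) m kap _ t0.
move=> h; apply: le_trans (h _ _ _ _ _ _) _.
- move=> i; apply: (@measurable_funM _ (g_sigma_algebraType (G i)) R) => //.
  exact: trprod_Fm.
- move=> i w; apply: le_trans (ler_norm _) _; rewrite !normrM normrX normrN1 expr1n mul1r.
  by rewrite ger0_norm//; apply: le_trans LA; rewrite ler_wpM2l// trprod_abs.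
- by move=> i; apply: IntgZ; exact: trprod_Intg.
- move=> i; apply: (eq_Intg _ (proj1 (trprod_moment2 i j k))) => w.
  by rewrite exprMn sqrr_sign mul1r.
- apply: avg_le => i; rewrite EXZ//; exact: trprod_Intg.
- rewrite -(avg_cst kap n0); apply: avg_le => i.
  rewrite (@eq_EX _ _ _ P _ (fun w => trprod i j k w ^+ 2)).
    exact: (proj2 (trprod_moment2 i j k)).
  by move=> w; rewrite exprMn sqrr_sign mul1r.
rewrite lee_fin ler_expR (_ : _ - _ = - t ^+ 2); last by ring.
by rewrite t2 mulrN mulrCA mulfV ?mulr1// gt_eqF.
Qed.

(** With [r = sqrt n], the discarded product satisfies [|a b| <= (a b)^2 / (2 r) + r / 2] and lives
    on two events of probability at most [r^-2]; both contributions are of order [1 / r]. *)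
Lemma trprod_bias i j k : (forall l, (P [set w | (A < `|W i l w|)%R] <= (n%:R^-1)%:E)%E) ->
  Intg (fun w => W i j w * W i k w) /\
  `|EX (trprod i j k) - EX (fun w => W i j w * W i k w)| <= (kap + 1) / Num.sqrt n%:R.
Proof.
move=> hA.
have sn0 : 0 < Num.sqrt n%:R :> R by rewrite sqrtr_gt0.
have sn2 : Num.sqrt n%:R ^+ 2 = n%:R :> R by rewrite sqr_sqrtr// ltW.
set r := Num.sqrt n%:R in sn0 sn2 *.
have [I1 E1] := W4_moment i j; have [I2 E2] := W4_moment i k.
pose B l := [set w | A < `|W i l w|].
have mB l : measurable (B l).
  by apply: meas_lt => //; apply: measurableT_comp => //; exact: mW.
have PB l : EX (\1_(B l) : T -> R) <= r^-1 ^+ 2.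
  by rewrite exprVn sn2 -lee_fin -EX_ind//; exact: hA.
have prod_le w : `|W i j w * W i k w| <= (W i j w ^+ 4 + W i k w ^+ 4) / 2 + 1.
  rewrite normrM -[W i j w ^+ 4]ger0_norm ?sq4 ?sqr_ge0// -[(W i k w ^+ 2) ^+ 2]ger0_norm ?sqr_ge0//.
  by rewrite !normrX; exact: mul_le_pow4.
have IP : Intg (fun w => W i j w * W i k w).
  apply: (Intg_dom _ prod_le (IntgD (IntgZr 2^-1 (IntgD I1 I2)) (Intg_cst P 1))).
  by apply: measurable_funM; exact: mW.
split=> //; rewrite -EXB//; last exact: trprod_Intg.
have pw w : `|trprod i j k w - W i j w * W i k w| <=
   (W i j w ^+ 4 + W i k w ^+ 4) * (r^-1 / 2) + r / 2 * (\1_(B j) w + \1_(B k) w).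
  have q4 l : 0 <= W i l w ^+ 4 by rewrite sq4 sqr_ge0.
  have r1 : 0 <= r^-1 / 2 by rewrite divr_ge0// invr_ge0 ltW.
  have r2 : 0 <= r / 2 by rewrite divr_ge0// ltW.
  have i0 l : 0 <= (\1_(B l) w : R) by rewrite indicE.
  rewrite /trprod; case: ifPn => [_|].
    by rewrite subrr normr0 addr_ge0// mulr_ge0// addr_ge0.
  rewrite negb_and -!ltNge sub0r normrN => h.
  have i1 : (1 : R) <= \1_(B j) w + \1_(B k) w.
    case/orP: h => h.
      by rewrite [X in X + _]indicE mem_set// lerDl.
    by rewrite [X in _ + X]indicE mem_set// lerDr.
  apply: (@le_trans _ _ ((W i j w ^+ 4 + W i k w ^+ 4) * (r^-1 / 2) + r / 2)); last first.
    by rewrite lerD2l -[leLHS]mulr1 ler_wpM2l.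
  rewrite normrM; set a := `|W i j w|; set b := `|W i k w|.
  have e4 l : W i l w ^+ 4 = (`|W i l w| ^+ 2) ^+ 2 by rewrite sq4 (norm_pow2 (W i l w)).
  rewrite !e4 -/a -/b.
  have h1 : a * b <= (a * b) ^+ 2 / (2 * r) + r / 2.
    have := sqr_ge0 (a * b - r); rewrite sqrrB => h1.
    have -> : (a * b) ^+ 2 / (2 * r) + r / 2 = ((a * b) ^+ 2 + r ^+ 2) / (2 * r).
      by field; rewrite gt_eqF.
    by rewrite ler_pdivlMr ?mulr_gt0//; move: h1; rewrite mulr2n; lra.
  apply: le_trans h1 _; rewrite lerD2r.
  have -> : (a * b) ^+ 2 / (2 * r) = (a ^+ 2 * b ^+ 2) * (r^-1 / 2).
    by field; rewrite gt_eqF.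
  by apply: ler_wpM2r => //; apply: mul_le_sqrD; exact: sqr_ge0.
have ID := IntgB (trprod_Intg i j k) IP.
have IR1 := IntgZr (r^-1 / 2) (IntgD I1 I2).
have IB : Intg (fun w => (\1_(B j) w + \1_(B k) w : R)) by apply: IntgD; exact: Intg_ind.
have IR2 := IntgZ (r / 2) IB.
apply: le_trans (EX_norm ID) _.
apply: le_trans (EX_le (Intg_norm ID) (IntgD IR1 IR2) pw) _.
rewrite EXD// EXZr; last exact: IntgD.
rewrite EXZ// EXD// EXD; [|exact: Intg_ind|exact: Intg_ind].
move: E1 E2 (PB j) (PB k); set a := EX _; set b := EX _; set c := EX _; set e := EX _.
move=> E1 E2 Pc Pe.
have r1 : 0 <= r^-1 / 2 by rewrite divr_ge0// invr_ge0 ltW.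
have r2 : 0 <= r / 2 by rewrite divr_ge0// ltW.
apply: (@le_trans _ _ ((kap + kap) * (r^-1 / 2) + r / 2 * (r^-1 ^+ 2 + r^-1 ^+ 2))).
  by apply: lerD; [rewrite ler_wpM2r// lerD|rewrite ler_wpM2l// lerD].
by rewrite le_eqVlt; apply/orP; left; apply/eqP; field; rewrite gt_eqF.
Qed.

Definition tr4 i j w : R := if `|W i j w| <= A then W i j w ^+ 4 else 0.

(** The scale is [t = A^-4], the largest at which [t * tr4 <= 1]; [8 Kmix <= A^4] makes the
    second-order term [4 t^2 Kmix] at most [t / 2], half of the gain. *)
Lemma tr4_tail j : 8 * Kmix <= A ^+ 4 ->
  (P [set w | (Kmix + 1 <= avg (fun i => tr4 i j w))%R] <=
    (expR (- (n%:R / (2 * A ^+ 4))))%:E)%E.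
Proof.
move=> hA; have K1 := Kmix_ge1; have A4 : 0 < A ^+ 4 by rewrite exprn_gt0.
pose t := (A ^+ 4)^-1; have t0 : 0 < t by rewrite invr_gt0.
have e4 i w : W i j w ^+ 4 = `|W i j w| ^+ 4 by rewrite !sq4 (norm_pow2 (W i j w)).
have f4 i : Fm (G i) (tr4 i j).
  rewrite /Fm; set T' := g_sigma_algebraType (G i).
  have fj : @measurable_fun _ _ T' R setT (W i j) := @fW i j.
  apply: measurable_fun_ifT => //; last exact: measurable_funX.
  apply: (measurable_fun_bool true).
  rewrite setTI (_ : _ @^-1` _ = [set w : T' | `|W i j w| <= A]); last first.
    by apply/seteqP; split=> w.
  by apply: meas_le => //; apply: measurableT_comp.
have b4 i w : 0 <= tr4 i j w <= A ^+ 4.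
  rewrite /tr4; case: ifP => h; last by rewrite lexx ltW.
  by rewrite e4 exprn_ge0// lerXn2r ?nnegrE// ltW.
have mom i k : (k <= 2)%N -> Intg (fun w => tr4 i j w ^+ k) /\ EX (fun w => tr4 i j w ^+ k) <= Kmix.
  move=> k2; have [I E] := @mixed_moment i j (4 * k) 0 (ltac:(by rewrite addn0; move: k2; case: k => [|[|[|]]])).
  have pw w : tr4 i j w ^+ k <= `|W i j w| ^+ (4 * k) * `|V i w| ^+ 0.
    rewrite expr0 mulr1 exprM /tr4 e4; case: ifP => // _.
    by case: k {k2 I E} => // k; rewrite expr0n/= exprn_ge0// exprn_ge0.
  have J : Intg (fun w => tr4 i j w ^+ k).
    apply: (Intg_dom _ _ I).
      by apply: measurable_funX; exact: Fm_meas (@GM i) (@f4 i).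
    by move=> w; rewrite ger0_norm// exprn_ge0//; have /andP[] := b4 i w.
  by split=> //; apply: le_trans E; exact: EX_le.
have := @chernoff_avg _ _ _ P n G n0 GM indF (fun i w => tr4 i j w)
  t (Kmix + 1) Kmix Kmix f4 (ltW t0).
move=> h; apply: le_trans (h _ _ _ _ _) _.
- move=> i w; have /andP[_ h2] := b4 i w.
  by rewrite /t mulrC ler_pdivrMr// mul1r.
- by move=> i; have [] := mom i 1 isT.
- by move=> i; have [] := mom i 2 isT.
- rewrite -[leRHS](avg_cst Kmix n0); apply: avg_le => i; have [_] := mom i 1 isT.
  by under eq_EX do rewrite expr1.
- by rewrite -[leRHS](avg_cst Kmix n0); apply: avg_le => i; have [_] := mom i 2 isT.
rewrite lee_fin ler_expR.
have h3 : 4 * t ^+ 2 * Kmix <= t / 2.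
  rewrite (_ : 4 * t ^+ 2 * Kmix = t * (8 * Kmix / A ^+ 4) / 2); last first.
    by rewrite /t; field; rewrite gt_eqF.
  rewrite ler_pM2r// -[leRHS]mulr1 ler_pM2l// ler_pdivrMr// mul1r//.
have -> : n%:R / (2 * A ^+ 4) = n%:R * (t / 2) by rewrite /t; field; rewrite gt_eqF.
by rewrite -[leRHS]mulrN ler_pM2l//; move: h3; set u := 4 * t ^+ 2 * Kmix => h3; lra.
Qed.

End truncation.

(** The noise does not depend on a coordinate, so there is no union to pay for and Markov's
    inequality is enough. The price is the factor [1 / e], through which [eps] enters the final
    constants. *)
Lemma V4_tail e : 0 < e ->
  (P [set w | (Kmix / e <= avg (fun i => `|V i w| ^+ 4))%R] <= e%:E)%E.
Proof.
move=> e0; have K0 : 0 < Kmix by apply: lt_le_trans Kmix_ge1.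
pose f i w := `|V i w| ^+ 4.
have [I E] : (forall i, Intg (f i)) /\ (forall i, EX (f i) <= Kmix).
  case: (pickP (fun j : 'I_p => true)) => [j _|h].
    have h i : Intg (f i) /\ EX (f i) <= Kmix.
      have := @mixed_moment i j 0 4 isT.
      rewrite (_ : (fun w => `|W i j w| ^+ 0 * `|V i w| ^+ 4) = f i)//.
      by apply/funext => w; rewrite expr0 mul1r.
    by split=> i; have [] := h i.
  split=> i; have [I E] := V_moment i 4; rewrite /f //.
  apply: le_trans E _; have KV0 : 0 <= KV.
    rewrite -lee_fin; apply: le_trans (mgfV i).
    by apply: integral_ge0 => w _; rewrite lee_fin expR_ge0.
  apply: (@le_trans _ _ (8`!%:R * KV)).
    by rewrite ler_wpM2r// ler_nat.
  by rewrite /Kmix lerDr addr_ge0// mulr_ge0// mulr_ge0// expR_ge0.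
have IA : Intg (fun w => avg (fun i => f i w)).
  by apply: IntgZ; apply: Intg_sum => i _; exact: I.
have J := IntgZ (e / Kmix) IA.
apply: le_trans (prob_le_EX _ J _ _) _.
- by apply: meas_le => //; exact: Intg_meas IA.
- move=> w; rewrite mulr_ge0//; first by rewrite divr_ge0// ltW.
  by apply: avg_ge0 => i; exact: exprn_ge0.
- move=> w /= h; rewrite -(mulVf (lt0r_neq0 (divr_gt0 K0 e0))) invf_div.
  by rewrite ler_wpM2l// divr_ge0// ltW.
rewrite lee_fin EXZ// mulrAC ler_pdivrMr// ler_wpM2l//; first exact: ltW.
rewrite /avg EXZ; last by apply: Intg_sum => i _; exact: I.
rewrite EX_sum; last by move=> i _; exact: I.
by rewrite -/(avg _) -[leRHS](avg_cst Kmix n0); apply: avg_le.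
Qed.

(** * The score of one coordinate *)

Section score.
Variables (j : 'I_p) (gm C1 : R).
Hypothesis x4 : avg (fun i => x i j ^+ 4) <= C1.
Hypothesis gmK : `|gm| <= Kmix.

Definition zc i w : R := x i j + W i j w.
(** Used with [V] the noise and [gm] the diagonal correction, both divided by [1 + |beta0|_2]: it is
    the summand of the constraint at [beta0], for known [Gamma], scaled to have moments bounded
    uniformly in [beta0]. *)
Definition score i w : R := zc i w * V i w + gm.

Let C10 : 0 <= C1.
Proof.
apply: le_trans x4; apply: avg_ge0 => i.
by rewrite sq4 sqr_ge0.
Qed.

Lemma zc_Fm i : Fm (G i) (zc i).
Proof.
apply: (@measurable_funD _ (g_sigma_algebraType (G i)) R) => //.
exact: fW.
Qed.

Lemma score_Fm i : Fm (G i) (score i).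
Proof.
apply: (@measurable_funD _ (g_sigma_algebraType (G i)) R) => //.
by apply: (@measurable_funM _ (g_sigma_algebraType (G i)) R); [exact: zc_Fm|exact: fV].
Qed.

Definition zVbound (a : R) (k : nat) i w : R :=
  8 * (a * (`|W i j w| ^+ 0 * `|V i w| ^+ k) + `|W i j w| ^+ 4 * `|V i w| ^+ k).

Lemma zVbound_Intg a k i : (k <= 4)%N -> Intg (zVbound a k i) /\
  (0 <= a -> EX (zVbound a k i) <= 8 * (a * Kmix + Kmix)).
Proof.
move=> k4; have [I1 E1] := @mixed_moment i j 0 k (leq_trans k4 (isT : (4 <= 8)%N)).
have [I2 E2] := @mixed_moment i j 4 k (leq_add (leqnn 4) k4 : (4 + k <= 8)%N).
have J1 := IntgZ a I1; have J := IntgZ 8 (IntgD J1 I2).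
split=> // a0; rewrite /zVbound EXZ; last exact: IntgD.
by rewrite EXD// EXZ// ler_wpM2l// lerD// ler_wpM2l.
Qed.

Lemma zc4_le i w : zc i w ^+ 4 <= 8 * (x i j ^+ 4 + `|W i j w| ^+ 4).
Proof.
apply: le_trans (pow4D_le _ _) _.
by rewrite [in leRHS](_ : `|W i j w| ^+ 4 = W i j w ^+ 4)// !sq4 -norm_pow2.
Qed.

Lemma zVbound_le i w k : zc i w ^+ 4 * `|V i w| ^+ k <= zVbound (x i j ^+ 4) k i w.
Proof.
rewrite /zVbound expr0 mul1r -mulrDl mulrA ler_wpM2r ?exprn_ge0//.
exact: zc4_le.
Qed.

Let x40 i : 0 <= x i j ^+ 4. Proof. by rewrite sq4 sqr_ge0. Qed.

Definition M4 : R := 64 * ((C1 + 1) * Kmix) + 8 * Kmix ^+ 4.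

Lemma score4 : (forall i, Intg (fun w => score i w ^+ 4)) /\
  avg (fun i => EX (fun w => score i w ^+ 4)) <= M4.
Proof.
have pw i w : score i w ^+ 4 <= 8 * (zVbound (x i j ^+ 4) 4 i w + gm ^+ 4).
  apply: le_trans (pow4D_le _ _) _; rewrite ler_pM2l// lerD2r.
  rewrite exprMn; apply: le_trans (zVbound_le i w 4).
  by rewrite ler_wpM2l ?(sq4 (zc i w)) ?sqr_ge0// !sq4 -norm_pow2.
have h i : Intg (fun w => score i w ^+ 4) /\
    EX (fun w => score i w ^+ 4) <= 8 * (8 * (x i j ^+ 4 * Kmix + Kmix) + Kmix ^+ 4).
  have [I E] := zVbound_Intg (x i j ^+ 4) i (leqnn 4).
  have J := IntgZ 8 (IntgD I (Intg_cst P (gm ^+ 4))).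
  have J4 : Intg (fun w => score i w ^+ 4).
    apply: (Intg_dom _ _ J).
      by apply: measurable_funX; exact: Fm_meas (@GM i) (@score_Fm i).
    by move=> w; rewrite ger0_norm// sq4 sqr_ge0.
  split=> //; apply: le_trans (EX_le J4 J (pw i)) _.
  rewrite EXZ; last exact: IntgD I (Intg_cst P _).
  rewrite EXD//; last exact: Intg_cst.
  rewrite EX_cst ler_pM2l// lerD ?E//.
  rewrite (_ : gm ^+ 4 = `|gm| ^+ 4); last by rewrite !sq4 -norm_pow2.
  by rewrite lerXn2r ?nnegrE// (le_trans _ Kmix_ge1).
split=> [i|]; first by have [] := h i.
apply: le_trans (avg_le (fun i => proj2 (h i))) _.
have -> : avg (fun i => 8 * (8 * (x i j ^+ 4 * Kmix + Kmix) + Kmix ^+ 4)) =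
    64 * ((avg (fun i => x i j ^+ 4) + 1) * Kmix) + 8 * Kmix ^+ 4.
  rewrite (_ : (fun i => _) = (fun i => 64 * Kmix * x i j ^+ 4 + (64 * Kmix + 8 * Kmix ^+ 4))); last first.
    by apply/funext => i; ring.
  by rewrite avgD avgZ avg_cst//; ring.
by rewrite lerD2r ler_pM2l// ler_wpM2r ?lerD2r// (le_trans _ Kmix_ge1).
Qed.

Lemma score_pow i k : (k <= 4)%N -> Intg (fun w => `|score i w| ^+ k) /\
  EX (fun w => `|score i w| ^+ k) <= 1 + EX (fun w => score i w ^+ 4).
Proof.
move=> k4; have I := proj1 score4 i; have J := IntgD (Intg_cst P 1) I.
have pw w : `|score i w| ^+ k <= 1 + score i w ^+ 4.
  have := @mixed_pow_le _ `|score i w| 0 k 0 4 (normr_ge0 _) (lexx _).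
  rewrite addn0 expr0 mulr1 expr0n addr0 => /(_ k4) h; apply: le_trans h _.
  by rewrite !sq4 -norm_pow2.
have J2 : Intg (fun w => `|score i w| ^+ k).
  apply: (Intg_dom _ _ J).
    apply: measurable_funX; apply: measurableT_comp => //.
    exact: Fm_meas (@GM i) (@score_Fm i).
  by move=> w; rewrite ger0_norm ?exprn_ge0.
split=> //; apply: le_trans (EX_le J2 J pw) _.
by rewrite EXD// ?EX_cst//; exact: Intg_cst.
Qed.

Definition M1 : R := 16 * ((C1 + 1) * Kmix) + 2 * Kmix ^+ 2 * (1 + 8 * (C1 + Kmix)).

Lemma score2_z2 : (forall i, Intg (fun w => score i w ^+ 2 * zc i w ^+ 2)) /\
  avg (fun i => EX (fun w => score i w ^+ 2 * zc i w ^+ 2)) <= M1.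
Proof.
have pw i w : score i w ^+ 2 * zc i w ^+ 2 <=
    2 * zVbound (x i j ^+ 4) 2 i w + 2 * gm ^+ 2 * (1 + zVbound (x i j ^+ 4) 0 i w).
  apply: (@le_trans _ _ (2 * (zc i w ^+ 4 * `|V i w| ^+ 2) + 2 * gm ^+ 2 * (1 + zc i w ^+ 4 * `|V i w| ^+ 0))).
    rewrite expr0 mulr1 -norm_pow2 /score sq4; set z := zc i w; set v := V i w.
    have -> : 2 * ((z ^+ 2) ^+ 2 * v ^+ 2) + 2 * gm ^+ 2 * (1 + (z ^+ 2) ^+ 2) =
      (z * v + gm) ^+ 2 * z ^+ 2 + ((z * v - gm) ^+ 2 * z ^+ 2 +
        2 * gm ^+ 2 * (1 + (z ^+ 2) ^+ 2 - z ^+ 2)) by ring.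
    rewrite lerDl; apply: addr_ge0; apply: mulr_ge0; rewrite ?sqr_ge0//.
      by rewrite mulr_ge0// sqr_ge0.
    exact: one_sqr_sub_ge0.
  apply: lerD; first by rewrite ler_pM2l// zVbound_le.
  by apply: ler_wpM2l; [apply: mulr_ge0 => //; exact: sqr_ge0|rewrite lerD2l zVbound_le].
have h i : Intg (fun w => score i w ^+ 2 * zc i w ^+ 2) /\
    EX (fun w => score i w ^+ 2 * zc i w ^+ 2) <= 2 * (8 * (x i j ^+ 4 * Kmix + Kmix))
      + 2 * Kmix ^+ 2 * (1 + 8 * (x i j ^+ 4 + Kmix)).
  have [I2 E2] := @zVbound_Intg (x i j ^+ 4) 2 i isT.
  have I0 : Intg (zVbound (x i j ^+ 4) 0 i) := proj1 (@zVbound_Intg (x i j ^+ 4) 0 i isT).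
  have E0 : EX (zVbound (x i j ^+ 4) 0 i) <= 8 * (x i j ^+ 4 + Kmix).
    have [J1 F1] := @mixed_moment i j 4 0 isT.
    rewrite (@eq_EX _ _ _ P _ (fun w => 8 * (x i j ^+ 4 + `|W i j w| ^+ 4 * `|V i w| ^+ 0))); last first.
      by move=> w; rewrite /zVbound !expr0 !mulr1.
    rewrite EXZ; last exact: IntgD (Intg_cst P _) J1.
    by rewrite EXD//; [rewrite EX_cst ler_pM2l// lerD2l|exact: Intg_cst].
  have J2 := IntgZ 2 I2; have J0 := IntgZ (2 * gm ^+ 2) (IntgD (Intg_cst P 1) I0).
  have J := IntgD J2 J0.
  have I : Intg (fun w => score i w ^+ 2 * zc i w ^+ 2).
    apply: (Intg_dom _ _ J).
      apply: measurable_funM; apply: measurable_funX.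
        exact: Fm_meas (@GM i) (@score_Fm i).
      exact: Fm_meas (@GM i) (@zc_Fm i).
    by move=> w; rewrite ger0_norm ?pw//; apply: mulr_ge0; exact: sqr_ge0.
  split=> //; apply: le_trans (EX_le I J (pw i)) _.
  rewrite EXD// EXZ// EXZ; last exact: IntgD (Intg_cst P 1) I0.
  rewrite EXD//; last exact: Intg_cst.
  rewrite EX_cst; apply: lerD; first by rewrite ler_pM2l// E2.
  have K0 : 0 <= Kmix by rewrite (le_trans _ Kmix_ge1).
  apply: ler_pM.
  - by apply: mulr_ge0 => //; exact: sqr_ge0.
  - apply: addr_ge0 => //; apply: EX_ge0 => w.
    apply: mulr_ge0 => //; apply: addr_ge0; last by apply: mulr_ge0; exact: exprn_ge0.
    by apply: mulr_ge0 => //; apply: mulr_ge0; exact: exprn_ge0.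
  - by rewrite ler_pM2l// norm_pow2 lerXn2r ?nnegrE.
  - by rewrite lerD2l.
split=> [i|]; first by have [] := h i.
apply: le_trans (avg_le (fun i => proj2 (h i))) _.
rewrite (_ : (fun i => _) = (fun i => (16 * Kmix + 16 * Kmix ^+ 2) * x i j ^+ 4 +
  (16 * Kmix + 2 * Kmix ^+ 2 * (1 + 8 * Kmix)))); last by apply/funext => i; ring.
rewrite avgD avgZ avg_cst// /M1.
have K0 : 0 <= Kmix by rewrite (le_trans _ Kmix_ge1).
have h1 : (16 * Kmix + 16 * Kmix ^+ 2) * avg (fun i => x i j ^+ 4) <= (16 * Kmix + 16 * Kmix ^+ 2) * C1.
  by rewrite ler_wpM2l// addr_ge0// mulr_ge0// sqr_ge0.
apply: le_trans (lerD h1 (lexx _)) _.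
by rewrite le_eqVlt; apply/orP; left; apply/eqP; ring.
Qed.

Variable c2 : R.
Hypothesis c20 : 0 < c2.
Hypothesis var_ge : c2 <= avg (fun i => EX (fun w => score i w ^+ 2)).

Let K0 : 0 < Kmix. Proof. exact: lt_le_trans Kmix_ge1. Qed.

Let CK0 : 0 < (C1 + 1) * Kmix. Proof. by rewrite mulr_gt0// ltr_wpDl. Qed.

Lemma M1_gt0 : 0 < M1.
Proof.
rewrite /M1 ltr_pwDl//; first by rewrite mulr_gt0.
apply: mulr_ge0; first by apply: mulr_ge0 => //; exact: sqr_ge0.
by apply: addr_ge0 => //; apply: mulr_ge0 => //; apply: addr_ge0 => //; exact: ltW.
Qed.

Lemma M4_gt0 : 0 < M4.
Proof.
rewrite /M4 ltr_pwDl//; first by rewrite mulr_gt0.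
by apply: mulr_ge0 => //; apply: exprn_ge0; exact: ltW.
Qed.

(** Chebyshev's level: the average second moment of the scores over [|z| > Kz] is at most
    [M1 / Kz^2 = c2 / 2]. *)
Definition Kz : R := Num.sqrt (2 * M1 / c2).

Definition score_tr i w : R := (`|zc i w| <= Kz)%R%:R * score i w.

(** Truncation leaves a mean of at least [c2 / 2], and for nonnegative summands a lower deviation
    needs only their second moments, bounded by [M4]. The choice [t = c2 / (32 M4)] minimizes
    [- t c2 / 4 + 4 t^2 M4]. *)
Lemma score_lower_tail :
  (P [set w | (avg (fun i => score_tr i w ^+ 2) <= c2 / 4)%R] <=
    (expR (- (n%:R * (c2 ^+ 2 / (256 * M4)))))%:E)%E.
Proof.
have m1 := M1_gt0; have m4 := M4_gt0.
have Kz0 : 0 < Kz by rewrite sqrtr_gt0 divr_gt0// mulr_gt0.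
have Kz2 : Kz ^+ 2 = 2 * M1 / c2 by rewrite sqr_sqrtr// ltW// divr_gt0// mulr_gt0.
have b01 i w : 0 <= ((`|zc i w| <= Kz)%R%:R : R) <= 1.
  by case: (`|zc i w| <= Kz)%R; rewrite ?lexx ler01.
have le2 i w : score_tr i w ^+ 2 <= score i w ^+ 2.
  rewrite /score_tr exprMn ler_piMl ?sqr_ge0//.
  have /andP[h1 h2] := b01 i w; exact: exprn_ile1.
have le4 i w : (score_tr i w ^+ 2) ^+ 2 <= score i w ^+ 4.
  by rewrite sq4 lerXn2r ?nnegrE ?sqr_ge0.
have ftr i : Fm (G i) (fun w => - score_tr i w ^+ 2).
  rewrite /Fm; set T' := g_sigma_algebraType (G i).
  have fz : @measurable_fun _ _ T' R setT (zc i) := @zc_Fm i.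
  have fs : @measurable_fun _ _ T' R setT (score i) := @score_Fm i.
  apply: measurableT_comp => //; apply: measurable_funX; apply: measurable_funM => //.
  rewrite (_ : (fun w => _) = (fun w : T' => if (`|zc i w| <= Kz)%R then 1 else 0)); last first.
    by apply/funext => w; case: (`|zc i w| <= Kz)%R.
  apply: measurable_fun_ifT => //; apply: (measurable_fun_bool true).
  rewrite setTI (_ : _ @^-1` _ = [set w : T' | `|zc i w| <= Kz]); last first.
    by apply/seteqP; split=> w.
  by apply: meas_le => //; apply: measurableT_comp.
have I2 i : Intg (fun w => score i w ^+ 2).
  apply: (eq_Intg _ (proj1 (@score_pow i 2 isT))) => w.
  by rewrite -norm_pow2.
have Itr i : Intg (fun w => - score_tr i w ^+ 2).
  apply: (Intg_dom _ _ (I2 i)); first exact: Fm_meas (@GM i) (@ftr i).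
  by move=> w; rewrite normrN ger0_norm ?sqr_ge0.
have Itr2 i : Intg (fun w => (- score_tr i w ^+ 2) ^+ 2).
  apply: (Intg_dom _ _ (proj1 score4 i)).
    by apply: measurable_funX; exact: Fm_meas (@GM i) (@ftr i).
  by move=> w; rewrite sqrrN ger0_norm ?sqr_ge0.
pose t := c2 / (32 * M4); have t0 : 0 < t by rewrite divr_gt0// mulr_gt0.
have := @chernoff_avg _ _ _ P n G n0 GM indF (fun i w => - score_tr i w ^+ 2)
  t (- (c2 / 4)) (- (c2 / 2)) M4 ftr (ltW t0).
move=> h; have -> : [set w | avg (fun i => score_tr i w ^+ 2) <= c2 / 4] =
    [set w | - (c2 / 4) <= avg (fun i => - score_tr i w ^+ 2)].
  apply/seteqP; split=> w /=; rewrite [in X in _ -> X]/= (_ : avg (fun i => - _) = - avg (fun i => score_tr i w ^+ 2)) ?lerN2//;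
  by rewrite /avg sumrN mulrN.
apply: le_trans (h _ _ _ _ _) _ => //.
- move=> i w; rewrite mulrN; apply: (@le_trans _ _ 0) => //.
  by rewrite oppr_le0 mulr_ge0 ?sqr_ge0// ltW.
- have pw i w : - score_tr i w ^+ 2 <= - score i w ^+ 2 + (Kz ^+ 2)^-1 * (score i w ^+ 2 * zc i w ^+ 2).
    rewrite /score_tr; have [_|hz] := leP `|zc i w| Kz.
      rewrite mul1r lerDl; apply: mulr_ge0; first by rewrite invr_ge0 sqr_ge0.
      by apply: mulr_ge0; exact: sqr_ge0.
    rewrite mul0r expr0n oppr0 addrC subr_ge0 mulrCA.
    rewrite ler_peMr ?sqr_ge0// ler_pdivlMl ?exprn_gt0// mulr1 norm_pow2 [leRHS]norm_pow2.
    by rewrite lerXn2r ?nnegrE// (ger0_norm (ltW Kz0)) ltW.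
  have [J2 E2] := score2_z2.
  have J i := IntgD (IntgN (I2 i)) (IntgZ (Kz ^+ 2)^-1 (J2 i)).
  apply: le_trans (avg_le (fun i => EX_le (Itr i) (J i) (pw i))) _.
  rewrite (_ : (fun i => _) = fun i => (-1) * EX (fun w => score i w ^+ 2) +
     (Kz ^+ 2)^-1 * EX (fun w => score i w ^+ 2 * zc i w ^+ 2)); last first.
    apply/funext => i; rewrite EXD; [|exact: IntgN|exact: IntgZ].
    by rewrite EXN// EXZ// mulN1r.
  rewrite avgD !avgZ mulN1r.
  have h3 : (Kz ^+ 2)^-1 * avg (fun i => EX (fun w => score i w ^+ 2 * zc i w ^+ 2)) <= c2 / 2.
    apply: (@le_trans _ _ ((Kz ^+ 2)^-1 * M1)).
      by rewrite ler_wpM2l// invr_ge0 sqr_ge0.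
    by rewrite Kz2 le_eqVlt; apply/orP; left; apply/eqP; field; rewrite !gt_eqF.
  move: var_ge h3; set a := avg _; set b := _ * avg _; lra.
- apply: le_trans (proj2 score4); apply: avg_le => i.
  apply: EX_le => //; first exact: (proj1 score4 i).
  by move=> w; rewrite sqrrN.
rewrite lee_fin ler_expR le_eqVlt; apply/orP; left; apply/eqP.
by rewrite /t; field; rewrite gt_eqF.
Qed.

(** The scores are rescaled by [y / B], with [B^2 >= n c2] their total variance. The third moments
    then add up to at most [y^3 (1 + M4) / (c2 sqrt c2 sqrt n)], which the last hypothesis puts
    below [rho]. The sign gives both sides of the constraint. *)
Lemma self_normalized_score (x0 e rho y : R) (s : bool) :
  (forall (U : 'I_n -> T -> R) (y : R),
    (forall i (B : set R), measurable B -> <<s G i >> (U i @^-1` B)) ->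
    (forall i, Intg (fun w => `|U i w| ^+ 3)) -> x0 <= y ->
    \sum_i EX (U i) = 0 -> \sum_i EX (fun w => U i w ^+ 2) = y ^+ 2 ->
    \sum_i EX (fun w => `|U i w| ^+ 3) <= rho ->
    (P [set w | (y * Num.sqrt (\sum_i U i w ^+ 2) < \sum_i U i w)%R] <=
       ((1 + e) * tail y)%:E)%E) ->
  0 < x0 -> x0 <= y -> \sum_i EX (score i) = 0 ->
  y ^+ 3 * (1 + M4) <= rho * (c2 * Num.sqrt c2) * Num.sqrt n%:R ->
  (P [set w | ((Num.sqrt n%:R)^-1 * y * rms (fun i => score i w) <
     avg (fun i => (-1) ^+ s * score i w))%R] <= ((1 + e) * tail y)%:E)%E.
Proof.
move=> hSN x00 xy s0 hy.
have y0 : 0 < y by exact: lt_le_trans xy.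
have I1 i : Intg (score i).
  apply: (Intg_dom _ _ (proj1 (@score_pow i 1 isT))); first exact: Fm_meas (@GM i) (@score_Fm i).
  by move=> w; rewrite expr1.
have I2 i : Intg (fun w => score i w ^+ 2).
  apply: (eq_Intg _ (proj1 (@score_pow i 2 isT))) => w.
  by rewrite -norm_pow2.
have I3 i := proj1 (@score_pow i 3 isT).
pose S := \sum_i EX (fun w => score i w ^+ 2).
have Sge : n%:R * c2 <= S.
  by rewrite -ler_pdivlMl.
have S0 : 0 < S by apply: lt_le_trans Sge; rewrite mulr_gt0.
have B0 : 0 < Num.sqrt S by rewrite sqrtr_gt0.
have B2 : Num.sqrt S ^+ 2 = S by rewrite sqr_sqrtr// ltW.
set B := Num.sqrt S in B0 B2.
pose k := y / B; have k0 : 0 < k by rewrite divr_gt0.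
pose U i w := (-1) ^+ s * k * score i w.
have absU i w : `|U i w| = k * `|score i w|.
  by rewrite /U -mulrA normrMsign normrM gtr0_norm.
have key w : (y * Num.sqrt (\sum_i U i w ^+ 2) < \sum_i U i w) =
  ((Num.sqrt n%:R)^-1 * y * rms (fun i => score i w) <
     avg (fun i => (-1) ^+ s * score i w)).
  have -> : \sum_i U i w ^+ 2 = k ^+ 2 * \sum_i score i w ^+ 2.
    by rewrite mulr_sumr; apply: eq_bigr => i _; rewrite /U !exprMn sqrr_sign mul1r.
  have -> : \sum_i U i w = k * \sum_i ((-1) ^+ s * score i w).
    by rewrite mulr_sumr; apply: eq_bigr => i _; rewrite /U mulrAC mulrC.
  rewrite sqrtrM ?sqr_ge0// sqrtr_sqr (gtr0_norm k0) mulrCA ltr_pM2l// rmsE /l2 /avg.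
  rewrite sqrtrV ?ler0n// [in RHS]mulrACA.
  have -> : (Num.sqrt n%:R)^-1 * (Num.sqrt n%:R)^-1 = n%:R^-1 :> R.
    by rewrite -invfM -expr2 sqr_sqrtr// ltW.
  by rewrite ltr_pM2l ?invr_gt0.
have := hSN U y.
have -> : [set w | y * Num.sqrt (\sum_i U i w ^+ 2) < \sum_i U i w] =
  [set w | (Num.sqrt n%:R)^-1 * y * rms (fun i => score i w) <
     avg (fun i => (-1) ^+ s * score i w)].
  by apply/seteqP; split=> w /=; rewrite key.
apply=> //.
- move=> i A mA; apply: Fm_preimage mA.
  apply: (@measurable_funM _ (g_sigma_algebraType (G i)) R) => //; exact: score_Fm.
- move=> i; apply: (eq_Intg _ (IntgZ (k ^+ 3) (I3 i))) => w.
  by rewrite absU [RHS]exprMn.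
- rewrite /U; under eq_bigr do rewrite EXZ//.
  by rewrite -mulr_sumr s0 mulr0.
- rewrite (eq_bigr (fun i => k ^+ 2 * EX (fun w => score i w ^+ 2))) => [|i _]; last first.
    by rewrite -EXZ//; apply: eq_EX => w; rewrite /U !exprMn sqrr_sign mul1r.
  by rewrite -mulr_sumr -/S -B2 -exprMn /k divfK// gt_eqF.
- rewrite (eq_bigr (fun i => k ^+ 3 * EX (fun w => `|score i w| ^+ 3))) => [|i _]; last first.
    by rewrite -EXZ//; apply: eq_EX => w; rewrite absU [LHS]exprMn.
  rewrite -mulr_sumr.
  have h3 : \sum_i EX (fun w => `|score i w| ^+ 3) <= n%:R * (1 + M4).
    rewrite -ler_pdivrMl//.
    apply: le_trans (avg_le (fun i => proj2 (@score_pow i 3 isT))) _.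
    by rewrite avgD avg_cst// lerD2l; exact: (proj2 score4).
  apply: (@le_trans _ _ (k ^+ 3 * (n%:R * (1 + M4)))).
    by rewrite ler_wpM2l// exprn_ge0// ltW.
  have sn0 : 0 < Num.sqrt n%:R :> R by rewrite sqrtr_gt0.
  have sn2 : Num.sqrt n%:R ^+ 2 = n%:R :> R by rewrite sqr_sqrtr// ltW.
  have sc0 : 0 < Num.sqrt c2 by rewrite sqrtr_gt0.
  have sc2 : Num.sqrt c2 ^+ 2 = c2 by rewrite sqr_sqrtr// ltW.
  have Bge : Num.sqrt n%:R * Num.sqrt c2 <= B.
    by rewrite -sqrtrM ?ler0n// ler_wsqrtr.
  have B3 : (Num.sqrt n%:R * Num.sqrt c2) ^+ 3 <= B ^+ 3.
    by rewrite lerXn2r ?nnegrE ?mulr_ge0// ltW.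
  have rho0 : 0 <= rho * (c2 * Num.sqrt c2) * Num.sqrt n%:R.
    apply: le_trans hy; rewrite mulr_ge0 ?exprn_ge0 ?(ltW y0)//.
    by rewrite addr_ge0// ltW// M4_gt0.
  have rho0' : 0 <= rho.
    by move: rho0; rewrite pmulr_lge0// pmulr_lge0// mulr_gt0.
  rewrite /k expr_div_n mulrAC ler_pdivrMr ?exprn_gt0// mulrCA.
  apply: (@le_trans _ _ (n%:R * (rho * (c2 * Num.sqrt c2) * Num.sqrt n%:R))).
    by rewrite ler_pM2l.
  apply: (@le_trans _ _ (rho * (Num.sqrt n%:R * Num.sqrt c2) ^+ 3)); last by rewrite ler_wpM2l.
  have e1 : Num.sqrt n%:R ^+ 3 = n%:R * Num.sqrt n%:R :> R by rewrite exprSr sn2.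
  have e2 : Num.sqrt c2 ^+ 3 = c2 * Num.sqrt c2 by rewrite exprSr sc2.
  rewrite exprMn e1 e2.
  by rewrite le_eqVlt; apply/orP; left; apply/eqP; ring.
Qed.

End score.

End model_concentration.

(** * The errors-in-variables model *)

Section model_measurability.
Context {d : measure_display} {T : measurableType d} {R : realType}.

Lemma meas_bigmax (I : finType) (Q : pred I) (f : I -> T -> R) :
  (forall i, measurable_fun setT (f i)) ->
  measurable_fun setT (fun w => \big[Num.max/0]_(i | Q i) f i w).
Proof.
move=> mf; have h (s : seq I) :
    measurable_fun setT (fun w => \big[Num.max/0]_(i <- s | Q i) f i w).
  elim: s => [|i s IH].
    rewrite (_ : (fun w => _) = fun=> 0)//.
    by apply/funext => w; rewrite big_nil.
  rewrite (_ : (fun w => _) = (fun w => if Q i then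
      Num.max (f i w) (\big[Num.max/0]_(i <- s | Q i) f i w)
      else \big[Num.max/0]_(i <- s | Q i) f i w)); last first.
    by apply/funext => w; rewrite big_cons.
  by case: (Q i) => //; exact: measurable_maxr.
exact: h.
Qed.

Lemma meas_mx_norm m n (A : T -> 'M[R]_(m, n)) :
  (forall i j, measurable_fun setT (fun w => A w i j)) ->
  measurable_fun setT (fun w => `|A w|).
Proof.
move=> mA; rewrite (_ : (fun w => `|A w|) =
    fun w => \big[Num.max/0]_(ij : 'I_m * 'I_n) `|A w ij.1 ij.2|).
  by apply: meas_bigmax => ij; apply: measurableT_comp.
by apply/funext => w; rewrite [LHS]/Num.norm/= mx_normrE.
Qed.

(** Inversion on nonnegative reals is the power [-1], also at 0, where both conventions give 0. *)
Lemma meas_div (f g : T -> R) : measurable_fun setT f -> measurable_fun setT g ->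
  (forall w, 0 <= g w) -> measurable_fun setT (fun w => f w / g w).
Proof.
move=> mf mg g0; rewrite (_ : (fun w => _) = fun w => f w * g w `^ (-1)).
  apply: measurable_funM => //.
  by apply: (measurableT_comp (measurable_powR (-1))).
by apply/funext => w; rewrite powR_inv1.
Qed.

Lemma meas_sqrt (f : T -> R) : measurable_fun setT f ->
  measurable_fun setT (fun w => Num.sqrt (f w)).
Proof. exact: (measurableT_comp (cont_meas (@sqrt_continuous R))). Qed.

Lemma meas_avg n (f : 'I_n -> T -> R) : (forall i, measurable_fun setT (f i)) ->
  measurable_fun setT (fun w => avg (fun i => f i w)).
Proof.
by move=> mf; apply: measurable_funM => //; apply: meas_sum => i _; exact: mf.
Qed.

End model_measurability.

Section model.
Context {R : realType} {n p : nat} (M : eiv_model R n p).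
Notation P := (Pr M).
Notation W i j := (w M i j : sample M -> R).
Notation T := (sample M).

Lemma meas_rv (X : {RV P >-> R}) : measurable_fun setT (X : T -> R).
Proof. exact: measurable_funPT. Qed.

Lemma z_meas i j : measurable_fun setT (fun om : T => z_at om i j).
Proof.
rewrite (_ : (fun om => _) = fun om : T => design M i j + w M i j om).
  by apply: measurable_funD => //; exact: meas_rv.
by apply/funext => om; rewrite mxE.
Qed.

Lemma y_meas i : measurable_fun setT (fun om : T => y_at om i 0).
Proof.
rewrite (_ : (fun om => _) = fun om : T => (row i (design M) *m beta0 M) 0 0 + xi M i om).
  by apply: measurable_funD => //; exact: meas_rv.
by apply/funext => om; rewrite mxE.
Qed.

Lemma Gh_meas j k : measurable_fun setT (fun om : T => Gh_at om j k).
Proof.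
rewrite (_ : (fun om => _) = (Gammahat M j k : T -> R)); first exact: meas_rv.
by apply/funext => om; rewrite mxE.
Qed.

Lemma Gh_err_meas : measurable_fun setT (fun om : T => `|Gh_at om - Gamma M|).
Proof.
apply: meas_mx_norm => j k; rewrite (_ : (fun om => _) = fun om => Gh_at om j k - Gamma M j k).
  by apply: measurable_funB => //; exact: Gh_meas.
by apply/funext => om; rewrite !mxE.
Qed.

Lemma Hn_meas : measurable_fun setT (@Hn R n p M).
Proof.
apply: meas_bigmax => j; apply: meas_sqrt; apply: meas_mx_norm => k l.
rewrite (_ : (fun om => _) = fun om => n%:R^-1 * \sum_(i < n)
   ((z_at om i j * z_at om i k - Gh_at om j k) * (z_at om i j * z_at om i l - Gh_at om j l))).
  apply: measurable_funM => //; apply: meas_sum => i _.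
  by apply: measurable_funM; apply: measurable_funB; rewrite ?Gh_meas//;
    try exact: Gh_meas; apply: measurable_funM; exact: z_meas.
apply/funext => om; rewrite mxE summxE; congr (_ * _); apply: eq_bigr => i _.
by rewrite mxE big_ord1 !mxE.
Qed.

Section estimator.
Variables (bh : 'I_p -> {RV P >-> R}) (alpha : R).

Lemma residual_meas i j : measurable_fun setT
  (fun om : T => conic_residual (y_at om) (z_at om) (Gh_at om) (vec_at bh om) i j).
Proof.
rewrite (_ : (fun om => _) = fun om => z_at om i j * (y_at om i 0 -
    \sum_k z_at om i k * bh k om) + Gh_at om j j * bh j om).
  apply: measurable_funD; apply: measurable_funM.
  - exact: z_meas.
  - apply: measurable_funB; first exact: y_meas.
    apply: meas_sum => k _; apply: measurable_funM; [exact: z_meas|exact: meas_rv].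
  - exact: Gh_meas.
  - exact: meas_rv.
apply/funext => om; rewrite /conic_residual [(_ *m _) 0 0]mxE !mxE.
by congr (_ * (_ - _) + _); apply: eq_bigr => k _; rewrite !mxE.
Qed.

Lemma beta_thr_meas j : measurable_fun setT (fun om : T => beta_thr alpha bh om j 0).
Proof.
pose th (om : T) := tau n p alpha * (rms (fun i => conic_residual (y_at om) (z_at om) (Gh_at om) (vec_at bh om) i j)
  / avg (fun i => z_at om i j ^+ 2)).
rewrite (_ : (fun om => _) = fun om => if th om < `|bh j om| then bh j om else 0).
  apply: measurable_fun_ifT => //.
  apply: (measurable_fun_bool true).
  rewrite setTI (_ : _ @^-1` _ = [set om | th om < `|bh j om|]); last first.
    by apply/seteqP; split=> om.
  apply: meas_lt; last by apply: measurableT_comp => //; exact: meas_rv.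
  apply: measurable_funM => //; apply: meas_div.
  - apply: meas_sqrt; apply: meas_avg => i; apply: measurable_funX.
    exact: residual_meas.
  - by apply: meas_avg => i; apply: measurable_funX; exact: z_meas.
  - by move=> om; apply: avg_ge0 => i; exact: sqr_ge0.
by apply/funext => om; rewrite mxE inE mxE.
Qed.

Lemma final_event_meas (q : nat) (c e : R) :
  measurable [set om : T | (l0norm (beta_thr alpha bh om))%:R <= c /\
    lnorm q (beta_thr alpha bh om - beta0 M) <= e].
Proof.
rewrite (_ : [set om : T | _] =
  [set om : T | (l0norm (beta_thr alpha bh om))%:R <= c] `&`
  [set om : T | lnorm q (beta_thr alpha bh om - beta0 M) <= e])//.
apply: measurableI; apply: meas_le => //.
  rewrite (_ : (fun om => _) = fun om =>
     \sum_j (if beta_thr alpha bh om j 0 == 0 then 0 else 1 : R)).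
    apply: meas_sum => j _; apply: measurable_fun_ifT => //.
    apply: (measurable_fun_bool true).
    rewrite setTI (_ : _ @^-1` _ = (fun om => beta_thr alpha bh om j 0) @^-1` [set 0]).
      by apply: meas_preimage => //; exact: beta_thr_meas.
    by apply/seteqP; split=> om /=; [move/eqP|move=> ->; rewrite eqxx].
  apply/funext => om; rewrite /l0norm -sum1_card natr_sum [LHS]big_mkcond.
  by apply: eq_bigr => j _; rewrite inE; case: eqP.
apply: (measurableT_comp (measurable_powR q%:R^-1)).
apply: meas_sum => j _; apply: measurable_funX; apply: measurableT_comp => //.
rewrite (_ : (fun om => _) = fun om => beta_thr alpha bh om j 0 - beta0 M j 0).
  by apply: measurable_funB => //; exact: beta_thr_meas.
by apply/funext => om; rewrite [LHS]mxE [X in _ + X]mxE.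
Qed.

End estimator.

Lemma ExE (f : T -> R) : Ex f = EX P f.
Proof. by rewrite /Ex unlock. Qed.

(** Independence across [i] of the pair of error and noise is taken from that of the observations:
    [W_Fm] and [V_Fm] recover both, [design] and [beta0] being deterministic. *)
Definition obs_gen (i : 'I_n) : set (set T) :=
  \bigcup_k preimage_set_system setT (@obs R n p M i k) measurable.

Lemma obs_meas i k : measurable_fun setT (@obs R n p M i k).
Proof. by case: k => [k|]; [exact: z_meas|exact: y_meas]. Qed.

Lemma obs_gen_meas i E : <<s obs_gen i >> E -> measurable E.
Proof.
apply: smallest_sub; first exact: sigma_algebra_measurable.
by move=> _ [k _ [B mB <-]]; exact: obs_meas.
Qed.

Lemma obs_Fm i k : Fm (obs_gen i) (@obs R n p M i k).
Proof.
move=> _ B mB; apply: sub_sigma_algebra; exists k => //.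
by exists B.
Qed.

Lemma W_Fm i j : Fm (obs_gen i) (W i j).
Proof.
rewrite (_ : (W i j) = fun om => @obs R n p M i (Some j) om - design M i j).
  apply: (@measurable_funB _ (g_sigma_algebraType (obs_gen i)) R) => //.
  exact: obs_Fm.
by apply/funext => om; rewrite /obs mxE addrAC subrr add0r.
Qed.

Definition bN : R := 1 + lnorm 2 (beta0 M).

Lemma bN_ge1 : 1 <= bN. Proof. by rewrite lerDl lnorm_ge0. Qed.
Lemma bN_gt0 : 0 < bN. Proof. exact: lt_le_trans bN_ge1. Qed.

(** This normalization gives exponential moments bounded uniformly in [beta0], and is the origin of
    the factor [1 + |beta0|_2] in the rate. *)
Definition V (i : 'I_n) (om : T) : R := noise i om / bN.

Lemma V_Fm i : Fm (obs_gen i) (V i).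
Proof.
rewrite (_ : V i = fun om => (@obs R n p M i None om - (row i (design M) *m beta0 M) 0 0 -
   \sum_j (@obs R n p M i (Some j) om - design M i j) * beta0 M j 0) * bN^-1).
  set T' := g_sigma_algebraType (obs_gen i).
  apply: (@measurable_funM _ T' R) => //; apply: (@measurable_funB _ T' R).
    by apply: (@measurable_funB _ T' R) => //; exact: obs_Fm.
  apply: (@meas_sum _ T' R) => j _; apply: (@measurable_funM _ T' R) => //.
  by apply: (@measurable_funB _ T' R) => //; exact: obs_Fm.
apply/funext => om; rewrite /V /noise; congr (_ / _).
have -> : @obs R n p M i None om = (row i (design M) *m beta0 M) 0 0 + xi M i om.
  by rewrite /obs [LHS]mxE.
rewrite [_ + xi M i om]addrC addrK; congr (_ - _); apply: eq_bigr => j _.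
by rewrite /obs [z_at om i j]mxE addrAC subrr add0r.
Qed.

Variables (s : nat) (C0 sx sw : R).
Hypothesis C00 : 0 < C0.
Hypothesis hA : conditionA M s C0 sx sw.

Let sxC : sx ^+ 2 <= C0. Proof. by case: hA => _ [_ _ []]. Qed.
Let swC : sw ^+ 2 <= C0. Proof. by case: hA => _ _ [_ _ []]. Qed.

Lemma subgaussian_mgf (sg : R) (Y : T -> R) t : subgaussian P sg Y ->
  (\int[P]_om (expR (t * Y om))%:E <= (expR (t ^+ 2 * sg ^+ 2 / 2))%:E)%E.
Proof.
case=> _ /(_ t); rewrite /mmt_gen_fun unlock; congr (_ <= _)%E.
by apply: eq_integral => om _ /=; rewrite mulrC.
Qed.

(** Subgaussianity is given for unit vectors; homogeneity moves the norm of [v] into [t]. *)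
Lemma lincomb_mgf (v : 'cV[R]_p) i t :
  (\int[P]_om (expR (t * \sum_j v j 0 * W i j om))%:E <=
    (expR (t ^+ 2 * (lnorm 2 v ^+ 2 * sw ^+ 2) / 2))%:E)%E.
Proof.
have [->|v0] := eqVneq v 0.
  under eq_integral => om _.
    rewrite big1 ?mulr0; last by move=> j _; rewrite mxE mul0r.
    over.
  rewrite (EX_fin (Intg_cst P (expR 0))) EX_cst lee_fin ler_expR lnorm0//.
  by rewrite expr0n mul0r mulr0 mul0r.
have l0 := @lnorm_gt0 _ _ 2 v (or_intror erefl) v0.
have hv : lnorm 2 ((lnorm 2 v)^-1 *: v) = 1.
  by rewrite lnormZ// ger0_norm ?invr_ge0 ?(ltW l0)// mulVf ?gt_eqF.
case: hA => _ _ [_ /(_ i)/(_ _ hv) sub _ _] _.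
have := subgaussian_mgf (t * lnorm 2 v) sub.
rewrite exprMn mulrA; congr (_ <= _)%E; apply: eq_integral => om _.
congr (expR _)%:E; rewrite -mulrA; congr (_ * _); rewrite mulr_sumr.
by apply: eq_bigr => j _; rewrite mxE -mulrA mulVKf ?gt_eqF.
Qed.

Lemma W_mgf i j t :
  (\int[P]_om (expR (t * W i j om))%:E <= (expR (t ^+ 2 * sw ^+ 2 / 2))%:E)%E.
Proof.
have := lincomb_mgf (delta_mx j 0) i t.
have -> : lnorm 2 (delta_mx j 0 : 'cV[R]_p) = 1.
  rewrite lnorm2E /l2 (bigD1 j)//= mxE !eqxx big1 ?addr0 ?expr1n ?sqrtr1// => k kj.
  by rewrite mxE (negbTE kj) expr0n.
rewrite expr1n mul1r; congr (_ <= _)%E; apply: eq_integral => om _.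
congr (expR (_ * _))%:E; rewrite (bigD1 j)//= mxE !eqxx mul1r big1 ?addr0// => k kj.
by rewrite mxE (negbTE kj) mul0r.
Qed.

Definition KV : R := 2 * expR (2 * C0).

(** Convexity of the exponential separates the two parts of the noise at the price of doubling their
    arguments; at [t = 2] each part contributes [2 expR (2 C0)], which is [KV]. *)
Lemma V_mgf i : (\int[P]_om (expR `|V i om|)%:E <= KV%:E)%E.
Proof.
pose u om := \sum_j beta0 M j 0 * W i j om.
have mu : measurable_fun setT u.
  by apply: meas_sum => j _; apply: measurable_funM => //; exact: meas_rv.
have mx := meas_rv (xi M i).
have hx : (\int[P]_om (expR (2 * `|xi M i om|))%:E <= KV%:E)%E.
  have subx : subgaussian P sx (xi M i) by case: hA => _ [_ h _].
  apply: le_trans (@expR_norm_int _ _ _ P _ 2 (sx ^+ 2) mx (fun t => subgaussian_mgf t subx)) _.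
  by rewrite lee_fin ler_pM2l// ler_expR; move: sxC; rewrite expr2; lra.
have b1 := bN_ge1; have b0 := bN_gt0.
have hu : (\int[P]_om (expR (2 * `|u om / bN|))%:E <= KV%:E)%E.
  have mu' : measurable_fun setT (fun om => u om / bN) by apply: measurable_funM.
  apply: le_trans (@expR_norm_int _ _ _ P _ 2 (sw ^+ 2) mu' _) _.
    move=> t; have h := lincomb_mgf (beta0 M) i (t / bN).
    rewrite (_ : (fun om => (expR (t * (u om / bN)))%:E) =
      (fun om => (expR (t / bN * u om))%:E)); last by apply/funext => om; rewrite mulrA mulrAC.
    apply: le_trans h _; rewrite lee_fin ler_expR ler_pM2r//.
    have -> : (t / bN) ^+ 2 * (lnorm 2 (beta0 M) ^+ 2 * sw ^+ 2) =
      t ^+ 2 * sw ^+ 2 * (lnorm 2 (beta0 M) / bN) ^+ 2 by field; rewrite gt_eqF.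
    rewrite ler_piMr//; first by apply: mulr_ge0; exact: sqr_ge0.
    apply: exprn_ile1; first by rewrite divr_ge0 ?lnorm_ge0 ?(ltW b0).
    by rewrite ler_pdivrMr// mul1r lerDr.
  by rewrite lee_fin ler_pM2l// ler_expR; move: swC; rewrite expr2; lra.
have m1 : measurable_fun setT (fun om => expR (2 * `|xi M i om|)).
  by apply: measurableT_comp => //; apply: measurable_funM => //; apply: measurableT_comp.
have m2 : measurable_fun setT (fun om => expR (2 * `|u om / bN|)).
  apply: measurableT_comp => //; apply: measurable_funM => //; apply: measurableT_comp => //.
  by apply: measurable_funM.
have mVi : measurable_fun setT (V i) := Fm_meas (@obs_gen_meas i) (@V_Fm i).
have m3 : measurable_fun setT (fun om => expR `|V i om|).
  by apply: measurableT_comp => //; apply: measurableT_comp.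
have [I1 E1] := Intg_ge0 m1 (fun=> expR_ge0 _) hx.
have [I2 E2] := Intg_ge0 m2 (fun=> expR_ge0 _) hu.
have I := IntgZ 2^-1 (IntgD I1 I2).
have pw om : expR `|V i om| <= 2^-1 * (expR (2 * `|xi M i om|) + expR (2 * `|u om / bN|)).
  have -> : V i om = xi M i om / bN - u om / bN.
    rewrite /V /noise -mulrBl; congr ((_ - _) / _); apply: eq_bigr => j _.
    by rewrite mulrC.
  have h1 : `|xi M i om / bN| <= `|xi M i om|.
    by rewrite normrM ler_piMr// ger0_norm ?invr_ge0 ?(ltW b0)// invf_le1.
  have h2 := le_trans (ler_normB (xi M i om / bN) (u om / bN)) (lerD h1 (lexx _)).
  rewrite -ler_expR in h2; apply: le_trans h2 _; rewrite expRD.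
  set a := `|xi M i om|; set c := `|u om / bN|.
  have e2 (z : R) : expR (2 * z) = expR z * expR z by rewrite -expRD; congr expR; ring.
  rewrite !e2; have := sqr_ge0 (expR a - expR c).
  by set x := expR a; set y := expR c; rewrite expr2; lra.
have J : Intg P (fun om => expR `|V i om|).
  by apply: (Intg_dom m3 _ I) => om; rewrite ger0_norm ?expR_ge0.
rewrite EX_fin// lee_fin; apply: le_trans (EX_le J I pw) _.
rewrite EXZ; last exact: IntgD.
rewrite EXD//; move: E1 E2; set a := EX _ _; set c := EX _ _; lra.
Qed.

End model.

(** * Means and variances of the scores *)

Section model.
Context {R : realType} {n p : nat} (M : eiv_model R n p).
Notation P := (Pr M).
Notation W i j := (w M i j : sample M -> R).
Notation T := (sample M).
Variables (s : nat) (C0 sx sw : R).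
Hypothesis C00 : 0 < C0.
Hypothesis hA : conditionA M s C0 sx sw.

Lemma EX_subgaussian (sg : R) (Y : T -> R) : subgaussian P sg Y -> EX P Y = 0.
Proof. by case; rewrite unlock /EX => ->. Qed.

Lemma W_mean i j : EX P (W i j) = 0.
Proof.
have hv : lnorm 2 (delta_mx j 0 : 'cV[R]_p) = 1.
  rewrite lnorm2E /l2 (bigD1 j)//= mxE !eqxx big1 ?addr0 ?expr1n ?sqrtr1// => k kj.
  by rewrite mxE (negbTE kj) expr0n.
case: hA => _ _ [_ /(_ i)/(_ _ hv) sub _ _] _.
rewrite -(EX_subgaussian sub); apply: eq_EX => om.
rewrite (bigD1 j)//= mxE !eqxx mul1r big1 ?addr0// => k kj.
by rewrite mxE (negbTE kj) mul0r.
Qed.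

Lemma xi_mean i : EX P (xi M i) = 0.
Proof. by case: hA => _ [_ /(_ i) h _] _ _; exact: EX_subgaussian h. Qed.

Lemma W_moments i j k : Intg P (fun om => `|W i j om| ^+ k).
Proof.
have := @expR_norm_int _ _ _ P (W i j) 1 (sw ^+ 2) (meas_rv _) (W_mgf hA i j).
under eq_integral do rewrite mul1r.
by move=> h; exact: (proj1 (moment_of_mgf k (meas_rv _) h)).
Qed.

Lemma xi_moments i k : Intg P (fun om => `|xi M i om| ^+ k).
Proof.
have subx : subgaussian P sx (xi M i) by case: hA => _ [_ h _].
have := @expR_norm_int _ _ _ P (xi M i) 1 (sx ^+ 2) (meas_rv _) (fun t => @subgaussian_mgf _ _ _ M sx _ t subx).
under eq_integral do rewrite mul1r.
move=> h; exact: (proj1 (moment_of_mgf k (meas_rv _) h)).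
Qed.

Lemma Intg_prod (f g : T -> R) : measurable_fun setT f -> measurable_fun setT g ->
  Intg P (fun om => `|f om| ^+ 2) -> Intg P (fun om => `|g om| ^+ 2) ->
  Intg P (fun om => f om * g om).
Proof.
move=> mf mg If Ig; apply: (Intg_dom (measurable_funM mf mg) _ (IntgD If Ig)) => om.
by rewrite normrM mul_le_sqrD.
Qed.

(** [decouple] applies to nonnegative integrands, so the product is reached by polarization: the
    expectation of [(W + xi)^2] is computed jointly and iteratedly, and the two results differ by
    twice the wanted mean. *)
Lemma W_xi_mean i j : EX P (fun om => W i j om * xi M i om) = 0.
Proof.
have mW := meas_rv (w M i j); have mx := meas_rv (xi M i).
have IW := W_moments i j 2; have Ix := xi_moments i 2.
have IW2 : Intg P (fun om => W i j om ^+ 2).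
  by apply: (eq_Intg _ IW) => om; rewrite real_normK ?num_real.
have Ix2 : Intg P (fun om => xi M i om ^+ 2).
  by apply: (eq_Intg _ Ix) => om; rewrite real_normK ?num_real.
have IW1 : Intg P (W i j).
  by apply: (Intg_dom mW _ (W_moments i j 1)) => om; rewrite expr1.
have Ix1 : Intg P (xi M i).
  by apply: (Intg_dom mx _ (xi_moments i 1)) => om; rewrite expr1.
have IP := Intg_prod mW mx IW Ix.
have ind : indep2 P (W i j) (xi M i).
  move=> A B mA mB; case: hA => _ _ _ h.
  pose E (b : bool) := if b then W i j @^-1` A else (xi M i : T -> R) @^-1` B.
  have := h [set: bool]%SET E; under eq_bigl do rewrite finset.in_setT; rewrite big_bool/=.
  rewrite (_ : \bigcap_(b in _) E b = W i j @^-1` A `&` (xi M i : T -> R) @^-1` B); last first.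
    apply/seteqP; split=> om /=.
      by move=> hb; split; [have := hb true|have := hb false]; apply; rewrite /= finset.in_setT.
    by move=> [h1 h2] [].
  move=> -> //.
    rewrite EFinM !fineK //; [apply: fin_num_measure; exact: meas_preimage..].
  case=> _; apply: sub_sigma_algebra.
    by exists (i, j) => //; exists A => //; rewrite setTI.
  by exists i => //; exists B => //; rewrite setTI.
have := @decouple _ _ _ P (W i j) (xi M i) (fun z => ((z.1 + z.2) ^+ 2)%:E) mW mx ind.
have mh : measurable_fun setT (fun z : R * R => ((z.1 + z.2) ^+ 2)%:E).
  by apply/measurable_EFinP; apply: measurable_funX; apply: measurable_funD.
move=> /(_ mh (fun z => _)) /=; rewrite /= => H.
have {}H : (\int[P]_om ((W i j om + xi M i om) ^+ 2)%:E =
    \int[P]_v \int[P]_om ((W i j v + xi M i om) ^+ 2)%:E)%E.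
  by apply: H => z; rewrite lee_fin sqr_ge0.
have E1 : (\int[P]_om ((W i j om + xi M i om) ^+ 2)%:E =
   (EX P (fun om => W i j om ^+ 2) + 2 * EX P (fun om => W i j om * xi M i om)
     + EX P (fun om => xi M i om ^+ 2))%:E)%E.
  have I2 := IntgZ 2 IP.
  under eq_integral do rewrite sqrrD -mulr_natl.
  rewrite (EX_fin (IntgD (IntgD IW2 I2) Ix2)) EXD//; last exact: IntgD.
  by rewrite EXD// EXZ.
have E2 v : (\int[P]_om ((W i j v + xi M i om) ^+ 2)%:E =
   (W i j v ^+ 2 + EX P (fun om => xi M i om ^+ 2))%:E)%E.
  have I2 := IntgZ (2 * W i j v) Ix1.
  under eq_integral do rewrite sqrrD -mulr_natl mulrA.
  have Ic := Intg_cst P (W i j v ^+ 2).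
  rewrite (EX_fin (IntgD (IntgD Ic I2) Ix2)) EXD//; last exact: IntgD.
  by rewrite EXD// EXZ// xi_mean mulr0 addr0 EX_cst.
rewrite (_ : (fun v => \int[P]_om ((W i j v + xi M i om) ^+ 2)%:E)%E =
  (fun v => (W i j v ^+ 2 + EX P (fun om => xi M i om ^+ 2))%:E)) in H; last first.
  by apply/funext => v; exact: E2.
have Ic := Intg_cst P (EX P (fun om => xi M i om ^+ 2)).
move: H; rewrite E1 (EX_fin (IntgD IW2 Ic)) EXD// EX_cst => -[].
set a := EX P _; set b := EX P _; set c := EX P _; clearbody a b c => h; lra.
Qed.

Lemma W_cov i j k : j != k -> EX P (fun om => W i j om * W i k om) = 0.
Proof.
case: hA => _ _ [_ _ _ h] _ jk.
have : (j < k)%N || (k < j)%N by rewrite -neq_ltn.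
case/orP => lt; have := h i _ _ lt; rewrite unlock /EX; first by move=> ->.
move=> e; rewrite (_ : (fun om => (W i j om * W i k om)%:E) =
  (EFin \o (fun om => W i k om * W i j om))); last by apply/funext => om /=; rewrite mulrC.
by rewrite -[RHS]/(fine 0%E) -[in RHS]e.
Qed.

Hypothesis n0 : (0 < n)%N.

Lemma GammaE j k : Gamma M j k = avg (fun i => EX P (fun om => W i j om * W i k om)).
Proof. by rewrite mxE; congr avg; apply/funext => i; rewrite ExE. Qed.

Definition gm j : R := Gamma M j j * beta0 M j 0 / bN M.

Lemma V_Intg i k : Intg P (fun om => `|(V (M:=M)) i om| ^+ k).
Proof.
have mVi : measurable_fun setT ((V (M:=M)) i) := Fm_meas (@obs_gen_meas _ _ _ M i) (@V_Fm _ _ _ M i).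
exact: (proj1 (moment_of_mgf k mVi (V_mgf hA i))).
Qed.

(** Of the linear combination inside the noise only the coordinate [j] correlates with [W i j], by
    [W_cov] and [W_xi_mean]. *)
Lemma WV_mean i j : Intg P (fun om => W i j om * (V (M:=M)) i om) /\
  EX P (fun om => W i j om * (V (M:=M)) i om) =
  - (EX P (fun om => W i j om * W i j om) * beta0 M j 0 / bN M).
Proof.
have mVi : measurable_fun setT ((V (M:=M)) i) := Fm_meas (@obs_gen_meas _ _ _ M i) (@V_Fm _ _ _ M i).
have mW k := meas_rv (w M i k); have mx := meas_rv (xi M i).
have I := Intg_prod (mW j) mVi (W_moments i j 2) (V_Intg i 2).
split=> //.
have IP := Intg_prod (mW j) mx (W_moments i j 2) (xi_moments i 2).
have IW k := Intg_prod (mW j) (mW k) (W_moments i j 2) (W_moments i k 2).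
have IS : Intg P (fun om => \sum_k beta0 M k 0 * (W i j om * W i k om)).
  by apply: Intg_sum => k _; apply: IntgZ.
rewrite (@eq_EX _ _ _ P _ (fun om => (W i j om * xi M i om -
    \sum_k beta0 M k 0 * (W i j om * W i k om)) * (bN M)^-1)); last first.
  move=> om; rewrite /V /noise mulrA; congr (_ * _); rewrite mulrBr mulr_sumr.
  by apply: congr1; apply: congr1; apply: eq_bigr => k _; ring.
rewrite EXZr; last exact: IntgB.
rewrite EXB// W_xi_mean sub0r EX_sum; last by move=> k _; exact: IntgZ.
rewrite (bigD1 j)//= EXZ// big1 ?addr0; last by move=> k kj; rewrite EXZ// W_cov ?mulr0// eq_sym.
by rewrite mulNr [_ * beta0 M j 0]mulrC.
Qed.

Lemma V_mean i : EX P ((V (M:=M)) i) = 0.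
Proof.
have mx := meas_rv (xi M i).
have Ix1 : Intg P (xi M i).
  by apply: (Intg_dom mx _ (xi_moments i 1)) => om; rewrite expr1.
have IW1 k : Intg P (W i k).
  by apply: (Intg_dom (meas_rv _) _ (W_moments i k 1)) => om; rewrite expr1.
have IS : Intg P (fun om => \sum_k W i k om * beta0 M k 0).
  by apply: Intg_sum => k _; apply: IntgZr.
rewrite (@eq_EX _ _ _ P _ (fun om => (xi M i om - \sum_k W i k om * beta0 M k 0) * (bN M)^-1))//.
rewrite EXZr ?EXB//; last exact: IntgB.
rewrite xi_mean EX_sum; last by move=> k _; exact: IntgZr.
by rewrite big1 ?subr0 ?mul0r// => k _; rewrite EXZr// W_mean mul0r.
Qed.

(** A single mean is proportional to [Gamma j j] minus the variance of [W i j] and need not vanish.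
    The sum does, since [Gamma] is the average of these variances. *)
Lemma score_mean j : \sum_i EX P (score (fun i j => W i j) (V (M:=M)) (design M) j (gm j) i) = 0.
Proof.
have IV1 i : Intg P ((V (M:=M)) i).
  have mVi : measurable_fun setT ((V (M:=M)) i) := Fm_meas (@obs_gen_meas _ _ _ M i) (@V_Fm _ _ _ M i).
  by apply: (Intg_dom mVi _ (V_Intg i 1)) => om; rewrite expr1.
rewrite (eq_bigr (fun i => - (EX P (fun om => W i j om * W i j om)) * (beta0 M j 0 / bN M) + gm j)).
  rewrite big_split/= -mulr_suml sumrN sumr_const card_ord /gm GammaE /avg.
  rewrite -mulr_natl; have n1 : n%:R != 0 :> R by rewrite pnatr_eq0 -lt0n.
  set S := \sum_(i < n) _; have b1 := lt0r_neq0 (bN_gt0 M).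
  by field; rewrite n1 b1.
move=> i _; have [I E] := WV_mean i j.
have I1 := IntgZ (design M i j) (IV1 i).
rewrite (@eq_EX _ _ _ P _ (fun om => design M i j * (V (M:=M)) i om + W i j om * (V (M:=M)) i om + gm j)); last first.
  by move=> om; rewrite /score /zc mulrDl.
rewrite EXD; [|exact: IntgD|exact: Intg_cst].
by rewrite EXD// EXZ// V_mean mulr0 add0r E EX_cst mulNr mulrA.
Qed.

Lemma score2_Intg i j : Intg P (fun om => score (fun i j => W i j) (V (M:=M)) (design M) j (gm j) i om ^+ 2).
Proof.
have mVi : measurable_fun setT ((V (M:=M)) i) := Fm_meas (@obs_gen_meas _ _ _ M i) (@V_Fm _ _ _ M i).
have mz : measurable_fun setT (fun om => design M i j + W i j om).
  by apply: measurable_funD => //; exact: meas_rv.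
have Ic := Intg_cst P.
have J := IntgZ 2 (IntgD (IntgD (IntgZ 8 (IntgD (Ic (design M i j ^+ 4)) (W_moments i j 4))) (V_Intg i 4)) (Ic (gm j ^+ 2))).
apply: (Intg_dom _ _ J).
  by apply: measurable_funX; apply: measurable_funD => //; exact: measurable_funM.
move=> om; rewrite ger0_norm ?sqr_ge0// /score /zc.
set z := design M i j + _; set v := (V (M:=M)) i om; set g := gm j.
have h1 : z ^+ 4 <= 8 * (design M i j ^+ 4 + `|W i j om| ^+ 4).
  by apply: le_trans (pow4D_le _ _) _; rewrite !sq4 -norm_pow2.
have h2 := mul_le_sqrD (sqr_ge0 z) (sqr_ge0 v); rewrite -!sq4 in h2.
rewrite (_ : `|v| ^+ 4 = v ^+ 4); last by rewrite !sq4 -norm_pow2.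
apply: (@le_trans _ _ (2 * (z ^+ 2 * v ^+ 2 + g ^+ 2))).
  by have := sqr_ge0 (z * v - g); rewrite !expr2; lra.
by rewrite ler_pM2l// lerD2r; apply: le_trans h2 _; rewrite lerD2r.
Qed.

Lemma score_var c2 C2 j : moment_condition M c2 C2 ->
  c2 <= avg (fun i => EX P (fun om => score (fun i j => W i j) (V (M:=M)) (design M) j (gm j) i om ^+ 2)).
Proof.
move=> /(_ j) /andP[h _]; have b0 := (bN_gt0 M).
rewrite -(ler_pM2r (exprn_gt0 2 b0)); apply: le_trans h _.
rewrite [leRHS]mulrC -avgZ le_eqVlt; apply/orP; left; apply/eqP; congr avg; apply/funext => i.
rewrite ExE -EXZ; last exact: score2_Intg.
apply: eq_EX => om; rewrite -exprMn /score /zc /gm /V; congr (_ ^+ 2).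
rewrite [z_at om i j]mxE; have b1 := lt0r_neq0 b0; move: b1; set B := bN M; set g := Gamma M j j * _; set v := noise i om; move=> b1; field; exact: b1.
Qed.

End model.

(** * The good event *)

Section cover.
Context {d : measure_display} {T : measurableType d} {R : realType}.
Variable P : probability T R.

Fixpoint bad_union (B : seq (set T * R)) : set T :=
  if B is b :: B' then b.1 `|` bad_union B' else set0.

Fixpoint bad_ok (B : seq (set T * R)) : Prop :=
  if B is b :: B' then [/\ measurable b.1, (P b.1 <= b.2%:E)%E & bad_ok B'] else True.

Lemma prob_bad_union B : bad_ok B ->
  measurable (bad_union B) /\ (P (bad_union B) <= (\sum_(b <- B) b.2)%:E)%E.
Proof.
elim: B => [_|b B IH [m1 p1 /IH[m2 p2]]] /=; first by rewrite big_nil measure0.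
split; first exact: measurableU.
by rewrite big_cons; apply: (prob_subU _ m1 m2) => //; exact: measurableU.
Qed.

Lemma prob_cover B (E : set T) : bad_ok B -> measurable E ->
  ~` (bad_union B) `<=` E -> ((1 - \sum_(b <- B) b.2)%:E <= P E)%E.
Proof.
move=> /prob_bad_union[m p] mE BE.
apply: (@le_trans _ _ (P (~` bad_union B))); last first.
  by apply: le_measure; rewrite ?inE//; exact: measurableC.
by rewrite probability_setC// EFinB leeB.
Qed.

End cover.

Section good_event.
Context {R : realType} {n p : nat} (M : eiv_model R n p).
Notation P := (Pr M).
Notation T := (sample M).
Let W i j : T -> R := w M i j.
Let V : 'I_n -> T -> R := @V R n p M.
Let G := @obs_gen R n p M.
Variables (s : nat) (C0 sx sw : R).
Hypothesis C00 : 0 < C0.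
Hypothesis hA : conditionA M s C0 sx sw.
Hypothesis hE : eiv_assumptions M.
Hypothesis n0 : (0 < n)%N.
Hypothesis p0 : (0 < p)%N.
Variables (eps alpha b C1 c2 C2 x0 rho : R).
Hypothesis eps0 : 0 < eps.
Hypothesis eps1 : eps < 1.
Hypothesis al0 : 0 < alpha.
Hypothesis al1 : alpha < 1.
Hypothesis hGh : (P [set om | (b < `|Gh_at om - Gamma M|)%R] <= eps%:E)%E.
Hypothesis hx4 : forall j, avg (fun i => design M i j ^+ 4) <= C1.
Hypothesis hmom : moment_condition M c2 C2.
Hypothesis c20 : 0 < c2.
Hypothesis hH : {ae P, forall om, 0 < Hn om}.

(** The logarithmic costs of the union bounds: [Lp] for the [2 p^2] signed pairs of coordinates,
    [Lnp] for the [n p] entries of the error matrix. With probability [1 - eps] no entry exceeds the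
    truncation level [Atr]. *)
Definition Lp : R := ln (2 * p%:R ^+ 2 / eps).
Definition Lnp : R := ln (2 * n%:R * p%:R / eps).
Definition Atr : R := Num.sqrt (2 * C0 * Lnp).
Let K : R := Kmix C0 (KV C0).
Let y : R := Phi_inv (1 - alpha / (2 * p%:R)).
Let sc := score W V (design M).

Let GM i E : <<s G i >> E -> measurable E. Proof. exact: obs_gen_meas. Qed.
Let fW i j : Fm (G i) (W i j). Proof. exact: W_Fm. Qed.
Let fV i : Fm (G i) (V i). Proof. exact: V_Fm. Qed.
Let mgfW i j t := W_mgf hA i j t.
Let mgfV i := V_mgf hA i.
Let swC : sw ^+ 2 <= C0. Proof. by case: hA => _ _ [_ _ []]. Qed.
Let indF : independent P (fun i => <<s G i >>). Proof. exact: (proj1 hE). Qed.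
Let nR : 1 <= n%:R :> R. Proof. by rewrite ler1n. Qed.
Let pR : 1 <= p%:R :> R. Proof. by rewrite ler1n. Qed.
Let nR0 : 0 < n%:R :> R. Proof. exact: lt_le_trans nR. Qed.
Let pR0 : 0 < p%:R :> R. Proof. exact: lt_le_trans pR. Qed.
Let mWT i j : measurable_fun setT (W i j). Proof. exact: meas_rv. Qed.
Let mVT i : measurable_fun setT (V i).
Proof. exact: Fm_meas (@GM i) (@fV i). Qed.

Lemma ratio_ge2 (a : R) : 1 <= a -> 2 <= 2 * a / eps.
Proof. by move=> a1; rewrite ler_pdivlMr//; move: eps0 eps1 => e0 e1; nra. Qed.

Lemma expR_Lp : expR (- Lp) = eps / (2 * p%:R ^+ 2).
Proof.
rewrite expRN /Lp lnK ?posrE ?invf_div//.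
by rewrite divr_gt0// mulr_gt0// exprn_gt0.
Qed.

Lemma expR_Lnp : expR (- Lnp) = eps / (2 * n%:R * p%:R).
Proof.
by rewrite expRN /Lnp lnK ?posrE ?invf_div// divr_gt0// !mulr_gt0.
Qed.

Lemma ln2_half : 2^-1 <= ln (2 : R).
Proof.
rewrite -ler_expR lnK ?posrE//.
have h : (2 : R)^-1 <= expR (- 2^-1).
  by apply: le_trans (expR_ge1Dx _); lra.
by rewrite -[expR _]invrK -expRN -[leRHS]invrK lef_pV2 ?posrE ?invr_gt0 ?expR_gt0.
Qed.

Lemma Lp_ge : 2^-1 <= Lp.
Proof.
apply: le_trans ln2_half _; rewrite /Lp ler_ln ?posrE ?divr_gt0 ?mulr_gt0 ?exprn_gt0//.
by apply: ratio_ge2; rewrite exprn_ege1.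
Qed.

Lemma Lnp_ge : 2^-1 <= Lnp.
Proof.
apply: le_trans ln2_half _; rewrite /Lnp ler_ln ?posrE ?divr_gt0 ?mulr_gt0//.
by rewrite -(mulrA 2); apply: ratio_ge2; rewrite mulr_ege1.
Qed.

Lemma Atr_sqr : Atr ^+ 2 = 2 * C0 * Lnp.
Proof.
rewrite sqr_sqrtr// mulr_ge0 ?mulr_ge0 ?(ltW C00)//.
by apply: le_trans Lnp_ge; rewrite invr_ge0.
Qed.

Lemma Atr_gt0 : 0 < Atr.
Proof.
rewrite sqrtr_gt0 !mulr_gt0//; apply: lt_le_trans Lnp_ge.
by rewrite invr_gt0.
Qed.

Lemma bad3 : measurable [set om : T | h_quantile M eps < Hn om] /\
  (P [set om : T | (h_quantile M eps < Hn om)%R] <= eps%:E)%E.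
Proof.
have m := meas_lt (@measurable_cst _ _ T R setT (h_quantile M eps)) (@Hn_meas R n p M).
split=> //.
have m2 := cdf_meas (@Hn_meas R n p M) (h_quantile M eps).
have e0 : 0 < 1 - eps by rewrite subr_gt0.
have e1 : 1 - eps < 1 by rewrite ltrBlDr ltrDl.
have := quantile_attained P (@Hn_meas R n p M) e0 e1; rewrite -/(h_quantile M eps) => h.
rewrite (_ : [set om : T | _] = ~` [set om : T | Hn om <= h_quantile M eps]); last first.
  by apply/seteqP; split=> om /=; [rewrite ltNge => /negP|move/negP; rewrite -ltNge].
rewrite probability_setC//.
rewrite -(fineK (fin_num_measure P _ m2)) in h *; rewrite -EFinB lee_fin.
by rewrite lee_fin in h; lra.
Qed.

Lemma bad4 : measurable [set om : T | Hn om <= 0] /\ (P [set om : T | (Hn om <= 0)%R] <= 0%:E)%E.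
Proof.
have m := meas_le (@Hn_meas R n p M) (@measurable_cst _ _ T R setT 0).
split=> //; rewrite (measure_negligible m)//.
by apply: negligibleS hH => om /= h1 h2; move: (lt_le_trans h2 h1); rewrite ltxx.
Qed.

Lemma bad5 : measurable [set om : T | exists ij : 'I_n * 'I_p, Atr < `|W ij.1 ij.2 om|] /\
  (P [set om : T | exists ij : 'I_n * 'I_p, (Atr < `|W ij.1 ij.2 om|)%R] <= eps%:E)%E.
Proof.
split.
  apply: (meas_exists (A := fun ij om => Atr < `|W ij.1 ij.2 om|)) => ij.
  by apply: meas_lt => //; apply: measurableT_comp.
have := max_W_tail GM fW C00 swC mgfW (ltW Atr_gt0).
rewrite Atr_sqr.
have -> : 2 * C0 * Lnp / (2 * C0) = Lnp by field; rewrite gt_eqF.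
rewrite expR_Lnp => h; apply: le_trans h _; rewrite lee_fin natrM.
by rewrite le_eqVlt; apply/orP; left; apply/eqP; field; rewrite !gt_eqF.
Qed.

(** The level that serves all [n p] entries leaves a single one a probability of at most [1 / n], as
    the bias of the truncated products requires. *)
Lemma W_tail_n i l : (P [set om : T | (Atr < `|W i l om|)%R] <= (n%:R^-1)%:E)%E.
Proof.
have := W_tail GM fW C00 swC mgfW i l (ltW Atr_gt0).
rewrite Atr_sqr.
have -> : 2 * C0 * Lnp / (2 * C0) = Lnp by field; rewrite gt_eqF.
rewrite expR_Lnp => h; apply: le_trans h _; rewrite lee_fin.
have -> : 2 * (eps / (2 * n%:R * p%:R)) = n%:R^-1 * (eps / p%:R) by field; rewrite !gt_eqF.
rewrite ler_piMr ?invr_ge0 ?(ltW nR0)// ler_pdivrMr// mul1r.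
by apply: le_trans (ltW eps1) pR.
Qed.

Definition E6 (jk : 'I_p * 'I_p * bool) (om : T) : Prop :=
  (1 + sw ^+ 2) * (1 + Num.sqrt (m2 M)) * Num.sqrt (Lp / n%:R) <=
    avg (fun i => (-1) ^+ jk.2 * design M i jk.1.1 * W i jk.1.2 om).

Lemma card_pairs : #|{: 'I_p * 'I_p * bool}|%:R * (eps / (2 * p%:R ^+ 2)) = eps :> R.
Proof.
rewrite !card_prod !card_ord card_bool !natrM.
by field; rewrite gt_eqF.
Qed.

Lemma bad6 : measurable [set om : T | exists jk, E6 jk om] /\
  (P [set om : T | exists jk, E6 jk om] <= eps%:E)%E.
Proof.
have m jk : measurable (E6 jk).
  by apply: meas_le => //; apply: meas_avg => i; apply: measurable_funM.
split; first exact: meas_exists.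
have cp := card_pairs; rewrite -expR_Lp in cp.
rewrite -[X in (_ <= X%:E)%E]cp; apply: prob_exists => // -[[j k] sg] /=.
have L0 : 0 <= Lp by apply: le_trans Lp_ge; rewrite invr_ge0.
apply: (cross_tail n0 GM indF fW mgfW (a := fun i => (-1) ^+ sg * design M i j) k L0).
apply: (@le_trans _ _ (avg (fun i => design M i j ^+ 2))).
  by apply: avg_le => i; rewrite exprMn sqrr_sign mul1r.
exact: (le_bigmax _ (fun j => avg (fun i => design M i j ^+ 2)) j).
Qed.

Hypothesis N1 : Num.sqrt (Lp / n%:R) * Atr ^+ 2 <= 1.

Definition E7 (jk : 'I_p * 'I_p * bool) (om : T) : Prop :=
  avg (fun i => (-1) ^+ jk.2 * EX P (trprod W Atr i jk.1.1 jk.1.2)) +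
    (1 + 4 * kap sw) * Num.sqrt (Lp / n%:R) <=
  avg (fun i => (-1) ^+ jk.2 * trprod W Atr i jk.1.1 jk.1.2 om).

Lemma bad7 : measurable [set om : T | exists jk, E7 jk om] /\
  (P [set om : T | exists jk, E7 jk om] <= eps%:E)%E.
Proof.
have m jk : measurable (E7 jk).
  apply: meas_le => //; apply: meas_avg => i; apply: measurable_funM => //.
  exact: Fm_meas (@GM i) (@trprod_Fm _ _ _ _ _ _ _ fW Atr i _ _).
split; first exact: meas_exists.
have cp := card_pairs; rewrite -expR_Lp in cp.
rewrite -[X in (_ <= X%:E)%E]cp; apply: prob_exists => // -[[j k] sg] /=.
have L0 : 0 <= Lp by apply: le_trans Lp_ge; rewrite invr_ge0.
exact: (trprod_tail n0 GM indF fW mgfW j k sg L0 N1).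
Qed.

Hypothesis N2 : 8 * K <= Atr ^+ 4.
Hypothesis N3 : p%:R * expR (- (n%:R / (2 * Atr ^+ 4))) <= eps.

Definition E8 j (om : T) : Prop := K + 1 <= avg (fun i => tr4 W Atr i j om).

Lemma tr4_meas i j : measurable_fun setT (tr4 W Atr i j).
Proof.
apply: measurable_fun_ifT => //; last exact: measurable_funX.
apply: (measurable_fun_bool true).
rewrite setTI (_ : _ @^-1` _ = [set om : T | `|W i j om| <= Atr]); last first.
  by apply/seteqP; split=> om.
by apply: meas_le => //; apply: measurableT_comp.
Qed.

Lemma bad8 : measurable [set om : T | exists j, E8 j om] /\
  (P [set om : T | exists j, E8 j om] <= eps%:E)%E.
Proof.
have m j : measurable (E8 j).
  by apply: meas_le => //; apply: meas_avg => i; exact: tr4_meas.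
split; first exact: meas_exists.
apply: le_trans (prob_exists m (a := expR (- (n%:R / (2 * Atr ^+ 4)))) _) _.
  by move=> j; exact: (tr4_tail n0 GM indF fW fV swC mgfW mgfV Atr_gt0 j N2).
by rewrite card_ord lee_fin.
Qed.

Lemma bad9 : measurable [set om : T | K / eps <= avg (fun i => `|V i om| ^+ 4)] /\
  (P [set om : T | (K / eps <= avg (fun i => `|V i om| ^+ 4))%R] <= eps%:E)%E.
Proof.
split; last exact: (V4_tail n0 GM fW fV swC mgfW mgfV eps0).
apply: meas_le => //; apply: meas_avg => i; apply: measurable_funX.
exact: measurableT_comp.
Qed.

Lemma Gamma_bounds j : 0 <= Gamma M j j <= K.
Proof.
rewrite GammaE; apply/andP; split.
  by apply: avg_ge0 => i; apply: EX_ge0 => om; rewrite -expr2 sqr_ge0.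
rewrite -[leRHS](avg_cst K n0); apply: avg_le => i.
have [_] := mixed_moment GM fW fV swC mgfW mgfV i j (isT : (2 + 0 <= 8)%N).
congr (_ <= _); apply: eq_EX => om; rewrite expr0 mulr1.
by rewrite real_normK ?num_real// expr2.
Qed.

Lemma gm_le j : `|gm M j| <= K.
Proof.
have /andP[g0 gK] := Gamma_bounds j.
rewrite /gm -mulrA normrM (ger0_norm g0) -[leRHS]mulr1 ler_pM//.
rewrite normrM normfV (gtr0_norm (bN_gt0 M)) ler_pdivrMr ?bN_gt0// mul1r.
apply: le_trans (entry_le_lnorm (q := 2) _ _ (or_intror erefl)) _.
by rewrite lerDr.
Qed.

Hypothesis N4 : p%:R * expR (- (n%:R * (c2 ^+ 2 / (256 * M4 C0 (KV C0) C1)))) <= eps.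

Definition E10 j (om : T) : Prop :=
  avg (fun i => score_tr W V (design M) C0 (KV C0) j (gm M j) C1 c2 i om ^+ 2) <= c2 / 4.

Lemma sc_meas i j : measurable_fun setT (sc j (gm M j) i).
Proof. exact: Fm_meas (@GM i) (@score_Fm _ _ _ _ _ _ _ _ (design M) fW fV j (gm M j) i). Qed.

Lemma bad10 : measurable [set om : T | exists j, E10 j om] /\
  (P [set om : T | exists j, E10 j om] <= eps%:E)%E.
Proof.
have m j : measurable (E10 j).
  apply: meas_le => //; apply: meas_avg => i; apply: measurable_funX; apply: measurable_funM.
    rewrite (_ : (fun om => _) = (fun om : T => if (`|zc W (design M) j i om| <= Kz C0 (KV C0) C1 c2)%R then 1 else 0)); last first.
      by apply/funext => om; case: (_ <= Kz _ _ _ _)%R.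
    apply: measurable_fun_ifT => //; apply: (measurable_fun_bool true).
    rewrite setTI (_ : _ @^-1` _ = [set om : T | `|zc W (design M) j i om| <= Kz C0 (KV C0) C1 c2]); last first.
      by apply/seteqP; split=> om.
    apply: meas_le => //; apply: measurableT_comp => //.
    by apply: measurable_funD.
  exact: sc_meas.
split; first exact: meas_exists.
apply: le_trans (prob_exists m (a := expR (- (n%:R * (c2 ^+ 2 / (256 * M4 C0 (KV C0) C1))))) _) _.
  move=> j; exact: (score_lower_tail n0 GM indF fW fV swC mgfW mgfV (hx4 j) (gm_le j) c20 (score_var hA j hmom)).
by rewrite card_ord lee_fin.
Qed.

Hypothesis hSN : forall (U : 'I_n -> T -> R) (y : R),
    (forall i (B : set R), measurable B -> <<s G i >> (U i @^-1` B)) ->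
    (forall i, Intg P (fun w => `|U i w| ^+ 3)) -> x0 <= y ->
    \sum_i EX P (U i) = 0 -> \sum_i EX P (fun w => U i w ^+ 2) = y ^+ 2 ->
    \sum_i EX P (fun w => `|U i w| ^+ 3) <= rho ->
    (P [set w | (y * Num.sqrt (\sum_i U i w ^+ 2) < \sum_i U i w)%R] <=
       ((1 + eps) * tail y)%:E)%E.
Hypothesis x00 : 0 < x0.
Hypothesis xy : x0 <= y.
Hypothesis N5 : y ^+ 3 * (1 + M4 C0 (KV C0) C1) <= rho * (c2 * Num.sqrt c2) * Num.sqrt n%:R.

Definition E2 (js : 'I_p * bool) (om : T) : Prop :=
  (Num.sqrt n%:R)^-1 * y * rms (fun i => sc js.1 (gm M js.1) i om) <
     avg (fun i => (-1) ^+ js.2 * sc js.1 (gm M js.1) i om).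

(** There are [2 p] events, one per coordinate and sign, each of probability at most
    [(1 + eps) alpha / (2 p)]. The relative error of the tail bound thus adds up to
    [eps alpha <= eps]. *)
Lemma bad2 : measurable [set om : T | exists js, E2 js om] /\
  (P [set om : T | exists js, E2 js om] <= (alpha + eps)%:E)%E.
Proof.
have m js : measurable (E2 js).
  apply: meas_lt.
    apply: measurable_funM => //; apply: meas_sqrt; apply: meas_avg => i.
    by apply: measurable_funX; exact: sc_meas.
  by apply: meas_avg => i; apply: measurable_funM => //; exact: sc_meas.
split; first exact: meas_exists.
apply: le_trans (prob_exists m (a := (1 + eps) * tail y) _) _.
  move=> [j sg]; apply: (self_normalized_score n0 GM fW fV swC mgfW mgfV (hx4 j) (gm_le j) c20 (score_var hA j hmom) sg hSN x00 xy _ N5).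
  exact: (score_mean hA n0 j).
have v0 : 0 < alpha / (2 * p%:R) by rewrite divr_gt0// mulr_gt0.
have v1 : alpha / (2 * p%:R) < 1.
  rewrite ltr_pdivrMr ?mulr_gt0// mul1r; apply: lt_le_trans al1 _.
  by move: pR; lra.
have ht := tail_Phi_inv v0 v1; rewrite -/y in ht.
rewrite card_prod card_ord card_bool lee_fin natrM.
apply: (@le_trans _ _ (p%:R * 2 * ((1 + eps) * (alpha / (2 * p%:R))))).
  by rewrite ler_pM2l ?mulr_gt0// ler_pM2l// ltr_wpDl// ltW.
rewrite (_ : _ * _ = alpha + eps * alpha); last by field; rewrite gt_eqF.
by rewrite lerD2l ler_piMr// ltW.
Qed.

Record good (om : T) : Prop := Good {
  good1 : `|Gh_at om - Gamma M| <= b;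
  good2 : forall j sg, avg (fun i => (-1) ^+ (sg : bool) * sc j (gm M j) i om) <=
    (Num.sqrt n%:R)^-1 * y * rms (fun i => sc j (gm M j) i om);
  good3 : Hn om <= h_quantile M eps;
  good4 : 0 < Hn om;
  good5 : forall i j, `|W i j om| <= Atr;
  good6 : forall j k sg, avg (fun i => (-1) ^+ (sg : bool) * design M i j * W i k om) <=
    (1 + sw ^+ 2) * (1 + Num.sqrt (m2 M)) * Num.sqrt (Lp / n%:R);
  good7 : forall j k sg, avg (fun i => (-1) ^+ (sg : bool) * trprod W Atr i j k om) <=
    avg (fun i => (-1) ^+ sg * EX P (trprod W Atr i j k)) + (1 + 4 * kap sw) * Num.sqrt (Lp / n%:R);
  good8 : forall j, avg (fun i => tr4 W Atr i j om) <= K + 1;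
  good9 : avg (fun i => `|V i om| ^+ 4) <= K / eps;
  good10 : forall j, c2 / 4 <=
    avg (fun i => score_tr W V (design M) C0 (KV C0) j (gm M j) C1 c2 i om ^+ 2) }.

Lemma prob_good (E : set T) : measurable E -> (forall om, good om -> E om) ->
  ((1 - alpha - 11 * eps)%:E <= P E)%E.
Proof.
move=> mE gE.
have m1 : measurable [set om : T | b < `|Gh_at om - Gamma M|].
  by apply: meas_lt => //; exact: Gh_err_meas.
have [m2 h2] := bad2. have [m3 h3] := bad3. have [m4 h4] := bad4.
have [m5 h5] := bad5. have [m6 h6] := bad6. have [m7 h7] := bad7.
have [m8 h8] := bad8. have [m9 h9] := bad9. have [m10 h10] := bad10.
pose B : seq (set T * R) := [:: ([set om : T | b < `|Gh_at om - Gamma M|], eps);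
  ([set om : T | exists js, E2 js om], alpha + eps);
  ([set om : T | h_quantile M eps < Hn om], eps); ([set om : T | Hn om <= 0], 0);
  ([set om : T | exists ij : 'I_n * 'I_p, Atr < `|W ij.1 ij.2 om|], eps);
  ([set om : T | exists jk, E6 jk om], eps); ([set om : T | exists jk, E7 jk om], eps);
  ([set om : T | exists j, E8 j om], eps);
  ([set om : T | K / eps <= avg (fun i => `|V i om| ^+ 4)], eps);
  ([set om : T | exists j, E10 j om], eps)].
have Bok : bad_ok P B by do 10 (split=> //).
have := prob_cover Bok mE _.
rewrite !big_cons big_nil /= => h; apply: le_trans (h _).
  by rewrite lee_fin; move: eps0; lra.
move=> om /= hB; apply: gE.
have nn (A : Prop) : ~ A -> A -> False by [].
split.
- by rewrite leNgt; apply/negP => h'; apply: hB; left.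
- by move=> j sg; rewrite leNgt; apply/negP => h'; apply: hB; right; left; exists (j, sg).
- by rewrite leNgt; apply/negP => h'; apply: hB; do 2 right; left.
- by rewrite ltNge; apply/negP => h'; apply: hB; do 3 right; left.
- by move=> i j; rewrite leNgt; apply/negP => h'; apply: hB; do 4 right; left; exists (i, j).
- by move=> j k sg; rewrite leNgt; apply/negP => h'; apply: hB; do 5 right; left; exists ((j, k), sg); exact: ltW.
- by move=> j k sg; rewrite leNgt; apply/negP => h'; apply: hB; do 6 right; left; exists ((j, k), sg); exact: ltW.
- by move=> j; rewrite leNgt; apply/negP => h'; apply: hB; do 7 right; left; exists j; exact: ltW.
- by rewrite leNgt; apply/negP => h'; apply: hB; do 8 right; left; exact: ltW.
- by move=> j; rewrite leNgt; apply/negP => h'; apply: hB; do 9 right; left; exists j; exact: ltW.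
Qed.

End good_event.

(** * The estimator on the good event *)

Section constants.
Context {R : realType}.
Variables (C0 c1 C1 c2 eps : R).

(** The three summands stand for the two cross terms of design and error, the deviation of the
    truncated products, and the truncation bias. Depending on [sw] alone, it can serve as [C']. *)
Definition design_const (sw : R) : R := 2 * (1 + sw ^+ 2) + (1 + 4 * kap sw) + 2 * (kap sw + 1).
Definition mom_const : R := Kmix C0 (KV C0).
Definition z4_const : R := 8 * (C1 + mom_const + 1).
Definition score_const : R := Num.sqrt (z4_const + mom_const / eps) + mom_const.
Definition z_level : R := Kz C0 (KV C0) C1 c2.
(** The Young weight that makes the contribution of the fourth moments of the noise in [col_good]
    equal to [c2 / 16]. *)
Definition col_weight : R := 32 * z_level ^+ 2 * mom_const / (eps * c2).
Definition col_const : R := c2 / 8 / (2 * col_weight + 2 * mom_const).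
Definition scale_const (K2 : R) : R := 2 * score_const + 2 + 4 * K2.
Definition pred_const (K2 : R) : R := z_level * Num.sqrt (96 / c1 + 16 * mom_const / c1 ^+ 2) * scale_const K2 +
  4 * (mom_const + 1) * scale_const K2 / c1.

End constants.

Section deterministic.
Context {R : realType} {n p : nat} (M : eiv_model R n p).
Notation P := (Pr M).
Notation T := (sample M).
Let W i j : T -> R := w M i j.
Let V : 'I_n -> T -> R := @V R n p M.
Variables (s : nat) (C0 sx sw : R).
Hypothesis C00 : 0 < C0.
Hypothesis hA : conditionA M s C0 sx sw.
Hypothesis hE : eiv_assumptions M.
Hypothesis n0 : (0 < n)%N.
Hypothesis p0 : (0 < p)%N.
Variables (eps alpha b c1 C1 c2 : R).
Hypothesis eps0 : 0 < eps.
Hypothesis eps1 : eps < 1.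
Hypothesis c20 : 0 < c2.
Hypothesis C10 : 0 < C1.
Hypothesis hx4 : forall j, avg (fun i => design M i j ^+ 4) <= C1.
Variable om : T.
Hypothesis gd : good C0 sw eps alpha b C1 c2 om.
Let K : R := mom_const C0.
Let tu : R := tau n p alpha.
Let L : R := Lp (R := R) (p := p) eps.
Let Z := z_at om.
Let sc j i : R := score W V (design M) j (gm M j) i om.
Let B := bN M.
Let e : R := design_const sw * (1 + Num.sqrt (m2 M)) * Num.sqrt (L / n%:R).
Notation be := (beta0 M).
Hypothesis tu0 : 0 < tu.
Hypothesis tu1 : tu <= 1.
Hypothesis b1 : b <= 1.
Notation res := (conic_residual (y_at om) Z (Gh_at om)).

Let K1 : 1 <= K. Proof. exact: (Kmix_ge1 C0 n0 (V_mgf hA)). Qed.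
Let K0 : 0 < K. Proof. exact: lt_le_trans K1. Qed.
Let B0 : 0 < B. Proof. exact: bN_gt0. Qed.
Let B1 : 1 <= B. Proof. exact: bN_ge1. Qed.
Let b0 : 0 <= b. Proof. exact: le_trans (good1 gd). Qed.
Let be_le j : `|be j 0| <= B.
Proof.
apply: le_trans (entry_le_lnorm (q := 2) _ _ (or_intror erefl)) _.
by rewrite /B /bN lerDr.
Qed.
Let be_norm : `|be| <= B.
Proof. by apply: mx_norm_leP => [|j k]; [exact: ltW|rewrite (ord1 k)]. Qed.

Let Gh_close j k : `|Gh_at om j k - Gamma M j k| <= b.
Proof.
apply: le_trans (good1 gd); have := mx_entry_le (Gh_at om - Gamma M) j k.
by rewrite !mxE.
Qed.

Let ZE i j : Z i j = design M i j + W i j om. Proof. by rewrite mxE. Qed.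

Let Gam j : 0 <= Gamma M j j <= K. Proof. exact: (Gamma_bounds hA n0). Qed.

Lemma gram_close_good j k : `|gram Z j k - Gamma M j k - gram (design M) j k| <= e.
Proof.
have tr i : trprod W (Atr (n := n) (p := p) C0 eps) i j k om = W i j om * W i k om.
  by rewrite /trprod !(good5 gd).
set t := Num.sqrt (L / n%:R); have t0 : 0 <= t by exact: sqrtr_ge0.
set a := 1 + Num.sqrt (m2 M); have a1 : 1 <= a by rewrite lerDl sqrtr_ge0.
have h1 l m : `|avg (fun i => design M i l * W i m om)| <= (1 + sw ^+ 2) * a * t.
  have := good6 gd l m false; have := good6 gd l m true.
  under eq_fun do rewrite expr1 mulN1r mulNr -mulN1r.
  rewrite avgZ; under [in X in _ -> X -> _]eq_fun do rewrite expr0 mul1r.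
  by rewrite -/t -/a ler_norml; set u := avg _; lra.
have h2 : `|avg (fun i => W i j om * W i k om) -
    avg (fun i => EX P (trprod W (Atr (n := n) (p := p) C0 eps) i j k))| <= (1 + 4 * kap sw) * t.
  have := good7 gd j k false; have := good7 gd j k true.
  rewrite !avgZ expr0 expr1 !mulN1r !mul1r -/t.
  have -> : avg (fun i => trprod W (Atr (n := n) (p := p) C0 eps) i j k om) = avg (fun i => W i j om * W i k om).
    by rewrite /avg; congr (_ * _); apply: eq_bigr => i _; exact: tr.
  by rewrite ler_norml; set u := avg _; set v := avg _; lra.
have k0 := @kap_ge0 R sw.
have h3 : `|avg (fun i => EX P (trprod W (Atr (n := n) (p := p) C0 eps) i j k)) - Gamma M j k| <=
    2 * (kap sw + 1) * t.
  rewrite GammaE -avgB; apply: le_trans (_ : avg (fun i : 'I_n => (kap sw + 1) / Num.sqrt n%:R) <= _).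
    rewrite /avg normrM ger0_norm ?invr_ge0// ler_wpM2l ?invr_ge0//.
    apply: le_trans (ler_norm_sum _ _ _) _; apply: ler_sum => i _.
    exact: (proj2 (trprod_bias n0 (@obs_gen_meas R n p M) (@W_Fm R n p M) (W_mgf hA) j k
      (W_tail_n C00 hA n0 p0 eps0 eps1 i))).
  rewrite avg_cst// [2 * _]mulrC -mulrA ler_wpM2l ?addr_ge0//.
  rewrite /t sqrtrM; last by apply: le_trans (Lp_ge p0 eps0 eps1); rewrite invr_ge0.
  rewrite sqrtrV ?ler0n// mulrA -[leLHS]mul1r ler_wpM2r ?invr_ge0 ?sqrtr_ge0//.
  (* [Lp >= 1/4] turns the bias of order [1 / sqrt n] into a multiple of [sqrt (Lp / n)]; the factor
     2 in the last summand of [design_const] is spent here. *)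
  have : Num.sqrt (4^-1) <= Num.sqrt L.
    by rewrite ler_wsqrtr//; apply: le_trans (Lp_ge p0 eps0 eps1); rewrite lef_pV2 ?posrE// ler_nat.
  have -> : (4^-1 : R) = 2^-1 ^+ 2 by field.
  by rewrite sqrtr_sqr ger0_norm ?invr_ge0//; lra.
have h4 : (1 + 4 * kap sw) * t <= (1 + 4 * kap sw) * a * t.
  by rewrite ler_wpM2r// ler_peMr// addr_ge0// mulr_ge0.
have h5 : 2 * (kap sw + 1) * t <= 2 * (kap sw + 1) * a * t.
  by rewrite ler_wpM2r// ler_peMr// mulr_ge0// addr_ge0.
have -> : gram Z j k - Gamma M j k - gram (design M) j k =
   avg (fun i => design M i j * W i k om) + avg (fun i => design M i k * W i j om) +
   (avg (fun i => W i j om * W i k om) -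
    avg (fun i => EX P (trprod W (Atr (n := n) (p := p) C0 eps) i j k))) +
   (avg (fun i => EX P (trprod W (Atr (n := n) (p := p) C0 eps) i j k)) - Gamma M j k).
  have -> : gram Z j k = gram (design M) j k + avg (fun i => design M i j * W i k om) +
     avg (fun i => design M i k * W i j om) + avg (fun i => W i j om * W i k om).
    rewrite !gramE -!avgD; congr avg; apply/funext => i; rewrite !ZE; ring.
  ring.
apply: le_trans (ler_normD _ _) _; apply: le_trans (lerD (ler_normD _ _) (lexx _)) _.
apply: le_trans (lerD (lerD (ler_normD _ _) (lexx _)) (lexx _)) _.
apply: le_trans (lerD (lerD (lerD (h1 j k) (h1 k j)) (le_trans h2 h4)) (le_trans h3 h5)) _.
by rewrite le_eqVlt; apply/orP; left; apply/eqP; rewrite /e /design_const -/a -/t; ring.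
Qed.

Lemma noiseE i : noise i om = y_at om i 0 - (row i Z *m be) 0 0.
Proof.
rewrite /noise row_mulE [y_at om i 0]mxE row_mulE.
have -> : \sum_k Z i k * be k 0 = \sum_k design M i k * be k 0 + \sum_k W i k om * be k 0.
  by rewrite -big_split/=; apply: eq_bigr => k _; rewrite ZE mulrDl.
by rewrite /W; ring.
Qed.

Lemma scE i j : B * sc j i = Z i j * noise i om + Gamma M j j * be j 0.
Proof.
have key (z v g D : R) : D != 0 -> D * (z * (v / D) + g / D) = z * v + g.
  by move=> D0; field.
rewrite ZE; apply: key; exact: lt0r_neq0.
Qed.

Lemma resE i j : res be i j = B * sc j i + (Gh_at om j j - Gamma M j j) * be j 0.
Proof. by rewrite scE /conic_residual -noiseE; ring. Qed.

(** Replacing [Gamma] by its estimate changes the average residual by at most [b |beta_j|] and,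
    inside the self-normalizing scale, costs [tau b |beta_j|]: together these are the [(1 + tau) b]
    of the programme. *)
Lemma feas_good j : `|avg (fun i => res be i j)| <=
    tu * rms (fun i => res be i j) + (1 + tu) * b * `|be j 0|.
Proof.
set dl := (Gh_at om j j - Gamma M j j) * be j 0.
have hd : `|dl| <= b * `|be j 0| by rewrite normrM ler_wpM2r.
have hs : `|avg (sc j)| <= tu * rms (sc j).
  have := good2 gd j false; have := good2 gd j true.
  rewrite !avgZ expr0 expr1 mulN1r mul1r -/(tau n p alpha) -/tu ler_norml.
  by rewrite /sc; set u := avg _; set v := tu * _; lra.
have hr : B * rms (sc j) <= rms (fun i => res be i j) + b * `|be j 0|.
  rewrite -(gtr0_norm B0) -rmsZ (@eq_rms _ _ _ (fun i => res be i j + (- dl))).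
    apply: le_trans (rmsD _ _) _; rewrite lerD2l rms_cst// normrN//.
  by move=> i; rewrite resE /dl; ring.
rewrite (_ : avg _ = B * avg (sc j) + dl); last first.
  rewrite -avgZ -[dl](avg_cst dl n0) -avgD; congr avg; apply/funext => i.
  by rewrite resE.
apply: le_trans (ler_normD _ _) _; rewrite normrM (gtr0_norm B0).
have h1 : B * `|avg (sc j)| <= tu * (rms (fun i => res be i j) + b * `|be j 0|).
  by apply: le_trans (ler_wpM2l (ltW B0) hs) _; rewrite mulrCA ler_wpM2l// ltW.
apply: le_trans (lerD h1 hd) _.
by rewrite le_eqVlt; apply/orP; left; apply/eqP; ring.
Qed.

Lemma z4_good j : avg (fun i => Z i j ^+ 4) <= z4_const C0 C1.
Proof.
have h8 := good8 gd j.
apply: (@le_trans _ _ (avg (fun i => 8 * (design M i j ^+ 4 + tr4 W (Atr (n := n) (p := p) C0 eps) i j om)))).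
  apply: avg_le => i; rewrite /tr4 (good5 gd) ZE; exact: pow4D_le.
by rewrite avgZ avgD /z4_const ler_pM2l// -addrA lerD//.
Qed.

Lemma z4_const_ge0 : 0 <= z4_const C0 C1.
Proof. by rewrite /z4_const -/K mulr_ge0// addr_ge0// addr_ge0 ?(ltW C10) ?(ltW K0). Qed.

Lemma sc_rms j : rms (sc j) <= score_const C0 C1 eps.
Proof.
rewrite (@eq_rms _ _ _ (fun i => Z i j * V i om + gm M j)); last by move=> i; rewrite ZE.
apply: le_trans (rmsD _ _) _.
apply: lerD; last by rewrite rms_cst// (gm_le hA n0).
rewrite /rms ler_wsqrtr//.
apply: (@le_trans _ _ (avg (fun i => Z i j ^+ 4 + `|V i om| ^+ 4))).
  apply: avg_le => i; rewrite exprMn.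
  apply: le_trans (mul_le_sqrD (sqr_ge0 _) (sqr_ge0 _)) _.
  by rewrite -!sq4 lerD2l !sq4 -norm_pow2.
by rewrite avgD lerD ?z4_good// (good9 gd).
Qed.

Lemma res_rms j : rms (fun i => res be i j) <= B * (score_const C0 C1 eps + 1).
Proof.
rewrite (@eq_rms _ _ _ (fun i => B * sc j i + (Gh_at om j j - Gamma M j j) * be j 0)); last first.
  by move=> i; exact: resE.
apply: le_trans (rmsD _ _) _; rewrite mulrDr mulr1; apply: lerD.
  by rewrite rmsZ gtr0_norm// ler_pM2l// sc_rms.
rewrite rms_cst// normrM -[leRHS]mul1r ler_pM//.
exact: le_trans (Gh_close j j) b1.
Qed.

Lemma z_level_gt0 : 0 < z_level C0 C1 c2.
Proof.
rewrite /z_level /Kz sqrtr_gt0 divr_gt0// mulr_gt0//.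
rewrite /M1 -/(mom_const C0) -/K; apply: addr_gt0; apply: mulr_gt0 => //.
  by rewrite mulr_gt0// addr_gt0.
  by rewrite mulr_gt0// exprn_gt0.
by rewrite addr_gt0// mulr_gt0// addr_gt0.
Qed.

Lemma col_const_gt0 : 0 < col_const C0 C1 c2 eps.
Proof.
have k0 := z_level_gt0; rewrite /col_const /col_weight -/K.
rewrite !divr_gt0// addr_gt0// mulr_gt0// divr_gt0// !mulr_gt0//; exact: exprn_gt0.
Qed.

Hypothesis e_small : e <= c2 / (32 * K).

Lemma tr_sqr_le (u z v g lam kz : R) : 0 < lam -> `|z| <= kz -> u = z * v + g ->
  u ^+ 2 <= 2 * lam * z ^+ 2 + 2 * kz ^+ 2 / lam * `|v| ^+ 4 + 2 * g ^+ 2.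
Proof.
move=> l0 zk ->.
have h1 : (z * v + g) ^+ 2 <= 2 * (z ^+ 2 * v ^+ 2) + 2 * g ^+ 2.
  by have := sqr_ge0 (z * v - g); rewrite !expr2; lra.
apply: le_trans h1 _.
have z2 : z ^+ 2 <= kz ^+ 2 by rewrite norm_pow2 lerXn2r ?nnegrE// (le_trans _ zk).
have -> : `|v| ^+ 4 = v ^+ 4 by rewrite !sq4 -norm_pow2.
have h2 : v ^+ 2 <= lam + v ^+ 4 / lam.
  rewrite -(ler_pM2r l0) mulrDl divfK ?gt_eqF// sq4 addrC -expr2.
  exact: mul_le_sqrD (sqr_ge0 v) (ltW l0).
have h3 : z ^+ 2 * v ^+ 2 <= lam * z ^+ 2 + kz ^+ 2 / lam * v ^+ 4.
  apply: le_trans (ler_wpM2l (sqr_ge0 z) h2) _; rewrite mulrDr [z ^+ 2 * lam]mulrC lerD2l.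
  rewrite mulrCA mulrC; apply: ler_wpM2r; first by rewrite sq4 sqr_ge0.
  by apply: ler_wpM2r => //; rewrite invr_ge0 ltW.
have -> : 2 * lam * z ^+ 2 + 2 * kz ^+ 2 / lam * v ^+ 4 + 2 * g ^+ 2 =
  2 * (lam * z ^+ 2 + kz ^+ 2 / lam * v ^+ 4) + 2 * g ^+ 2 by ring.
by rewrite lerD2r ler_pM2l.
Qed.

(** The lower bound comes from the scores: a column with small [avg Z^2] would have small truncated
    scores. Young's inequality bounds their mean square by [2 lam avg Z^2], a noise term of at most
    [c2 / 16] and [2 gm^2]. Moreover [gm^2 <= K Gamma_jj], and [Gamma_jj <= avg Z^2 + e] since the
    design contributes a nonnegative part. Of [c2 / 4] there remains [c2 / 8]. *)
Lemma col_good j : col_const C0 C1 c2 eps <= avg (fun i => Z i j ^+ 2) <= 1 + z4_const C0 C1.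
Proof.
have kz0 := z_level_gt0; have [g0 gK] := andP (Gam j).
have l0 : 0 < col_weight C0 C1 c2 eps by rewrite /col_weight -/K divr_gt0// !mulr_gt0// exprn_gt0.
apply/andP; split; last first.
  apply: (@le_trans _ _ (avg (fun i => 1 + Z i j ^+ 4))).
    apply: avg_le => i; rewrite -subr_ge0 sq4; have := one_sqr_sub_ge0 (Z i j ^+ 2); lra.
  by rewrite avgD avg_cst// lerD2l z4_good.
set lam := col_weight C0 C1 c2 eps in l0; set kz := z_level C0 C1 c2 in kz0.
have gm2 : gm M j ^+ 2 <= K * Gamma M j j.
  have : `|gm M j| <= Gamma M j j.
    rewrite /gm -mulrA normrM (ger0_norm g0) ler_piMr// normrM normfV (gtr0_norm B0).
    by rewrite ler_pdivrMr// mul1r be_le.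
  move=> h; rewrite norm_pow2 expr2; apply: ler_pM => //; exact: le_trans gK.
have h10 := good10 gd j.
have h9 := good9 gd.
have h11 : c2 / 4 <= 2 * lam * avg (fun i => Z i j ^+ 2) + 2 * kz ^+ 2 / lam * avg (fun i => `|V i om| ^+ 4)
    + 2 * gm M j ^+ 2.
  apply: le_trans h10 _; rewrite -!avgZ -[2 * gm M j ^+ 2](avg_cst _ n0) -!avgD.
  apply: avg_le => i; rewrite /score_tr.
  have [h|h] := leP `|zc W (design M) j i om| (Kz C0 (KV C0) C1 c2).
    by rewrite mul1r; apply: tr_sqr_le => //; rewrite ZE.
  rewrite mul0r expr0n/=; apply: addr_ge0; last by rewrite mulr_ge0// sqr_ge0.
  apply: addr_ge0; apply: mulr_ge0; rewrite ?sqr_ge0 ?exprn_ge0//.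
    by rewrite mulr_ge0// ltW.
  by rewrite divr_ge0 ?(ltW l0)// mulr_ge0// sqr_ge0.
have h12 : 2 * kz ^+ 2 / lam * avg (fun i => `|V i om| ^+ 4) <= c2 / 16.
  apply: (@le_trans _ _ (2 * kz ^+ 2 / lam * (K / eps))).
    by rewrite ler_wpM2l// divr_ge0 ?(ltW l0)// mulr_ge0// sqr_ge0.
  rewrite /lam /col_weight -/kz -/K le_eqVlt; apply/orP; left; apply/eqP; field.
  by rewrite !gt_eqF.
have h13 : Gamma M j j <= avg (fun i => Z i j ^+ 2) + e.
  have := gram_close_good j j; rewrite ler_norml => /andP[h _].
  rewrite !gramE in h; have h' : 0 <= avg (fun i => design M i j * design M i j).
    by apply: avg_ge0 => i; rewrite -expr2 sqr_ge0.
  have -> : avg (fun i => Z i j ^+ 2) = avg (fun i => Z i j * Z i j) by [].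
  by move: h h'; set u := avg _; set v := avg _; lra.
have h14 : K * e <= c2 / 32.
  apply: le_trans (ler_wpM2l (ltW K0) e_small) _.
  by rewrite le_eqVlt; apply/orP; left; apply/eqP; field; rewrite gt_eqF.
have h15 : K * Gamma M j j <= K * avg (fun i => Z i j ^+ 2) + K * e.
  by rewrite -mulrDr ler_pM2l.
rewrite /col_const -/lam -/K ler_pdivrMr; last by rewrite addr_gt0// mulr_gt0.
move: h11 h12 h14 h15 gm2; set u := avg _; set v := _ * avg _; set gg := gm M j ^+ 2.
by set q := K * e; set r := K * Gamma M j j; move=> *; lra.
Qed.

Variables (q : nat) (hq : (q = 1 \/ q = 2)%N).
Hypothesis s0 : (0 < s)%N.
Hypothesis c10 : 0 < c1.
Hypothesis GhD : is_diag_mx (Gh_at om).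
Variables (b1' th uh : 'cV[R]_p).
Hypothesis opt : conic_solution (y_at om) Z (Gh_at om) tu b (4 * Hn om)^-1 4^-1 b1' th uh.
Hypothesis kappa_large :
  8 * s%:R * ((1 + tu) * b + tu * h_quantile M eps + e) <=
  kappa q s 3 (design M) * s%:R `^ q%:R^-1.
Hypothesis kappa_ge : c1 * s%:R `^ (- q%:R^-1) <= kappa q s 3 (design M).
Variable K2 : R.
Hypothesis bK2 : b <= K2 * tu.
Hypothesis small : pred_const C0 c1 C1 c2 eps K2 * (s%:R `^ q%:R^-1 * tu) + b <= Num.sqrt c2 / 4.
Notation S := (s%:R `^ q%:R^-1 : R).
Let k1 := scale_const C0 C1 eps K2.

Lemma e_ge0 : 0 <= e.
Proof.
rewrite /e /design_const !mulr_ge0 ?sqrtr_ge0 ?addr_ge0 ?sqrtr_ge0 ?sqr_ge0 ?mulr_ge0 ?addr_ge0 ?sqr_ge0 ?kap_ge0 ?mulr_ge0 ?kap_ge0//.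
Qed.

Lemma score_const_ge0 : 0 <= score_const C0 C1 eps.
Proof. by rewrite /score_const addr_ge0 ?sqrtr_ge0// -/K ltW. Qed.

Lemma K2_ge0 : 0 <= K2.
Proof. by rewrite -(pmulr_lge0 _ tu0) (le_trans b0). Qed.

Lemma k1_gt0 : 0 < k1.
Proof. by rewrite /k1 /scale_const; have := score_const_ge0; have := K2_ge0; lra. Qed.

Lemma kappa_good : 8 * s%:R * (tu * Hstat Z (Gh_at om) + (1 + tu) * b + e) <=
  kappa q s 3 (design M) * S.
Proof.
apply: le_trans kappa_large; rewrite ler_pM2l ?mulr_gt0 ?ltr0n// lerD2r addrC lerD2l.
by rewrite ler_pM2l//; exact: (good3 gd).
Qed.

Let suppB : (#|supp be| <= s)%N. Proof. by case: hA. Qed.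
Let GD : is_diag_mx (Gamma M). Proof. exact: (proj2 hE). Qed.
Let Hpos : 0 < Hstat Z (Gh_at om). Proof. exact: (good4 gd). Qed.

Let scale := conic_scale (y_at om) Z (Gh_at om) be tu b.

(** Both parts of the slack are of order [tau * bN]: the residual scales by [res_rms], the part in
    [b] by [b <= K2 * tu]. *)
Lemma scale_good : scale <= k1 * (tu * B).
Proof.
have h1 : `|(\col_j rms (fun i => res be i j) : 'cV[R]_p)| <= B * (score_const C0 C1 eps + 1).
  apply: mx_norm_leP => [|j k]; first by rewrite mulr_ge0 ?(ltW B0)// addr_ge0// score_const_ge0.
  by rewrite mxE ger0_norm ?rms_ge0// res_rms.
rewrite /scale /conic_scale /k1 /scale_const.
apply: (@le_trans _ _ (2 * tu * (B * (score_const C0 C1 eps + 1)) + 2 * (2 * (K2 * tu)) * B)).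
  apply: lerD; first by rewrite ler_wpM2l// mulr_ge0// ltW.
  apply: ler_pM => //; first by rewrite mulr_ge0// mulr_ge0// addr_ge0// ltW.
  rewrite ler_pM2l//; apply: ler_pM => //; first by rewrite addr_ge0// ltW.
  by move: tu1; lra.
by rewrite le_eqVlt; apply/orP; left; apply/eqP; ring.
Qed.

(** The truncated scores at the true vector have root mean square at least [sqrt c2 / 2], times
    [bN]. By [small] the estimation error removes at most half of it. *)
Lemma res_lower_good j : Num.sqrt c2 / 4 * B <= rms (fun i => res b1' i j).
Proof.
have kz0 := z_level_gt0.
have S0 : 0 < S by rewrite powR_gt0// ltr0n.
have gle l : `|Gamma M l l| <= K by have /andP[g0 gK] := Gam l; rewrite ger0_norm.
have h := threshold_lower n0 GhD (ltW tu0) b0 e_ge0 Hpos opt feas_good gram_close_good Gh_close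
  erefl hq s0 suppB c10 kappa_good kappa_ge GD gle j (ltW kz0) (fun i => noiseE i).
have hs : Num.sqrt c2 / 2 * B <= rms (fun i => (`|Z i j| <= z_level C0 C1 c2)%R%:R *
    (Z i j * noise i om + Gamma M j j * be j 0)).
  rewrite (@eq_rms _ _ _ (fun i => B * score_tr W V (design M) C0 (KV C0) j (gm M j) C1 c2 i om)).
    rewrite rmsZ gtr0_norm// mulrC ler_pM2l//.
    have -> : Num.sqrt c2 / 2 = Num.sqrt (c2 / 4).
      rewrite sqrtrM ?(ltW c20)// sqrtrV// (_ : (4 : R) = 2 ^+ 2); last by ring.
      by rewrite sqrtr_sqr ger0_norm.
    by rewrite ler_wsqrtr//; exact: (good10 gd).
  by move=> i; rewrite -scE /sc /score_tr /zc ZE mulrCA.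
have sA0 := conic_scale_ge0 (y_at om) Z (Gh_at om) be (ltW tu0) b0.
have sA := scale_good; rewrite -/scale in sA0 h.
have hSA : S * scale <= S * (k1 * (tu * B)) by rewrite ler_pM2l.
set D1 := Num.sqrt (96 / c1 + 16 * K / c1 ^+ 2) in h.
have d1 : 0 <= D1 by exact: sqrtr_ge0.
have h1 : z_level C0 C1 c2 * D1 * (S * scale) <= z_level C0 C1 c2 * D1 * (S * (k1 * (tu * B))).
  by rewrite ler_wpM2l// mulr_ge0// ltW.
have h2 : (K + b) * (4 * scale * S / c1) <= (K + 1) * (4 * (k1 * (tu * B)) * S / c1).
  apply: ler_pM.
  - by apply: addr_ge0 => //; exact: ltW.
  - apply: divr_ge0; last exact: ltW.
    by apply: mulr_ge0; [apply: mulr_ge0 => //; exact: sA0|exact: ltW].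
  - by rewrite lerD2l.
  - by rewrite ler_pM2r ?invr_gt0// ler_pM2r// ler_pM2l.
have h3 : b * `|be j 0| <= b * B by rewrite ler_wpM2l.
have h4 := ler_wpM2r (ltW B0) small.
have h5 : pred_const C0 c1 C1 c2 eps K2 * (S * tu) * B = z_level C0 C1 c2 * D1 * (S * (k1 * (tu * B))) +
   (K + 1) * (4 * (k1 * (tu * B)) * S / c1).
  by rewrite /pred_const -/K -/D1 -/k1; field; rewrite gt_eqF.
rewrite mulrDl h5 in h4.
have {}h := le_trans hs h.
move: h h1 h2 h3 h4; set a1 := z_level C0 C1 c2 * D1 * (S * scale); set a2 := (K + b) * _.
set a3 := b * `|be j 0|; set a4 := z_level C0 C1 c2 * D1 * _; set a5 := (K + 1) * _; set a6 := rms _.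
by set a7 := b * B; set a8 := Num.sqrt c2; move=> *; nra.
Qed.

Lemma final_good (Cs Ce : R) :
  Cs = 1 + (1 + 4 * k1 * (1 + z4_const C0 C1) / (c1 * (Num.sqrt c2 / 4))) ^+ 2 ->
  Ce = 4 * k1 / c1 + 3 * k1 / col_const C0 C1 c2 eps ->
  (l0norm (thresholded (y_at om) Z (Gh_at om) tu b1'))%:R <= Cs * s%:R /\
  lnorm q (thresholded (y_at om) Z (Gh_at om) tu b1' - be) <= Ce * (S * (tu * B)).
Proof.
move=> -> ->.
have gle l : `|Gamma M l l| <= K by have /andP[g0 gK] := Gam l; rewrite ger0_norm.
have mu0 : 0 < 1 + z4_const C0 C1 by rewrite ltr_pwDl// z4_const_ge0.
have c30 : 0 < Num.sqrt c2 / 4 by rewrite divr_gt0// sqrtr_gt0.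
split.
  exact: (thresholded_sparsity n0 GhD (ltW tu0) b0 e_ge0 Hpos opt feas_good gram_close_good Gh_close
  erefl hq s0 suppB c10 kappa_good kappa_ge tu0 B0 k1_gt0 col_const_gt0 c30 mu0 scale_good col_good res_lower_good).
exact: (thresholded_error n0 GhD (ltW tu0) b0 e_ge0 Hpos opt feas_good gram_close_good Gh_close
  erefl hq s0 suppB c10 kappa_good kappa_ge col_const_gt0 scale_good col_good).
Qed.

End deterministic.

(** * Asymptotics of the levels *)

Section umom.
Context {R : realType} {n p : nat} (M : eiv_model R n p).
Notation P := (Pr M).
Notation T := (sample M).
Let W i j : T -> R := w M i j.
Let V : 'I_n -> T -> R := @V R n p M.
Variables (s : nat) (C0 C1 sx sw : R).
Hypothesis C00 : 0 < C0.
Hypothesis hA : conditionA M s C0 sx sw.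
Hypothesis n0 : (0 < n)%N.
Hypothesis hx4 : forall j, avg (fun i => design M i j ^+ 4) <= C1.
Let K := Kmix C0 (KV C0).
Let swC : sw ^+ 2 <= C0. Proof. by case: hA => _ _ [_ _ []]. Qed.

(** [U_] has the individual variance where the score has [Gamma j j]; it is again [bN] times a
    score, for another constant [g] bounded by [K]. *)
Lemma U_Intg i j k : (k <= 4)%N -> Intg P (fun om => `|U_ i j om| ^+ k).
Proof.
move=> k4.
pose g := Ex (fun o : T => w M i j o ^+ 2) * beta0 M j 0 / bN M.
have B0 := bN_gt0 M.
have Eb : 0 <= Ex (fun o : T => w M i j o ^+ 2) <= K.
  rewrite ExE; apply/andP; split; first by apply: EX_ge0 => om; exact: sqr_ge0.
  have [_] := mixed_moment (@obs_gen_meas R n p M) (@W_Fm R n p M) (@V_Fm R n p M) swC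
    (W_mgf hA) (V_mgf hA) i j (isT : (2 + 0 <= 8)%N).
  congr (_ <= _); apply: eq_EX => om; rewrite expr0 mulr1.
  by rewrite real_normK ?num_real.
have gK : `|g| <= K.
  have /andP[E0 EK] := Eb.
  rewrite /g -mulrA normrM (ger0_norm E0) -[leRHS]mulr1 ler_pM//.
  rewrite normrM normfV (gtr0_norm B0) ler_pdivrMr// mul1r.
  apply: le_trans (entry_le_lnorm (q := 2) _ _ (or_intror erefl)) _.
  by rewrite lerDr.
have [I _] := score_pow n0 (@obs_gen_meas R n p M) (@W_Fm R n p M) (@V_Fm R n p M) swC
    (W_mgf hA) (V_mgf hA) (hx4 j) gK i k4.
apply: (eq_Intg _ (IntgZ (bN M ^+ k) I)) => om.
transitivity (`|bN M * score W V (design M) j g i om| ^+ k).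
  by rewrite normrM exprMn (gtr0_norm B0).
congr (`|_| ^+ _).
have key (z v gg D : R) : D != 0 -> D * (z * (v / D) + gg / D) = z * v + gg.
  by move=> D0; field.
rewrite /U_ [z_at om i j]mxE; apply: key; exact: lt0r_neq0.
Qed.

(** Lyapunov's inequality for the averaged law, by integrating [3 c u^2 <= 2 u^3 + c^3] at
    [c = Umom j 2]. The ratios in Condition B are thus at least 1. *)
Lemma umom_mono j : Umom M j 2 <= Umom M j 3.
Proof.
pose a2 := avg (fun i : 'I_n => Ex (fun om : T => `|U_ i j om| ^+ 2)).
pose a3 := avg (fun i : 'I_n => Ex (fun om : T => `|U_ i j om| ^+ 3)).
have a20 : 0 <= a2.
  by apply: avg_ge0 => i; rewrite ExE; apply: EX_ge0 => om; exact: exprn_ge0.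
pose c := a2 `^ 2^-1; have c0 : 0 <= c by exact: powR_ge0.
have c2 : c ^+ 2 = a2 by rewrite /c powR12_sqrt// sqr_sqrtr.
have h : 3 * c * a2 <= 2 * a3 + c ^+ 3.
  rewrite /a2 /a3 -!avgZ -[c ^+ 3](avg_cst _ n0) -avgD; apply: avg_le => i.
  rewrite !ExE; have I2 := @U_Intg i j 2 isT; have I3 := @U_Intg i j 3 isT.
  have J2 := IntgZ (3 * c) I2; have J3 := IntgZ 2 I3.
  have J := IntgD J3 (Intg_cst P (c ^+ 3)).
  rewrite -EXZ// -(EXZ 2 I3) -[c ^+ 3](EX_cst P) -EXD//; last exact: Intg_cst.
  apply: EX_le => // om; have u0 := normr_ge0 (U_ i j om); set u := `|_| in u0 *.
  have h : 0 <= (u - c) ^+ 2 * (2 * u + c) by rewrite mulr_ge0 ?sqr_ge0// addr_ge0// mulr_ge0.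
  rewrite -subr_ge0; apply: le_trans h _; rewrite le_eqVlt; apply/orP; left; apply/eqP; ring.
have h3 : c ^+ 3 <= a3.
  by move: h; rewrite -c2 (_ : 3 * c * c ^+ 2 = 3 * c ^+ 3); [lra|ring].
have : (c ^+ 3) `^ 3^-1 <= a3 `^ 3^-1.
  by rewrite ge0_ler_powR ?nnegrE ?invr_ge0 ?exprn_ge0// (le_trans _ h3)// exprn_ge0.
by rewrite -[c ^+ 3]powR_mulrn// -powRrM mulfV// powRr1.
Qed.

(** A single coordinate suffices, its moment ratio being at least 1; [0 < p] provides one. *)
Lemma r_bound (alpha eps b ell : R) : (0 < p)%N ->
  conditionB M alpha eps b ell -> 0 <= Phi_inv (1 - alpha / (2 * p%:R * n%:R)) ->
  Phi_inv (1 - alpha / (2 * p%:R * n%:R)) <= n%:R `^ (6^-1) / ell.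
Proof.
move=> p0 [_ [U0 _] h _ _] r0; apply: le_trans h.
rewrite -[leLHS]mul1r ler_wpM2r//.
apply: le_trans (le_bigmax _ (fun j => Umom M j 3 / Umom M j 2) (Ordinal p0)).
by rewrite ler_pdivlMr// mul1r umom_mono.
Qed.

End umom.

(** * Logarithms against normal quantiles *)

Section level_arithmetic.
Context {R : realType}.
Notation phi0 := (normal_pdf (0 : R) 1 0).

Definition log_const (eps : R) : R := 1 + `|ln phi0| + `|ln eps|.

(** The quantile at level [alpha / (2 p n)] controls [ln (2 p n)], since [- ln alpha >= 0]. The
    doubled bound for [Lp] comes from [2 p^2 <= (2 p n)^2]. *)
Lemma log_bounds (eps alpha : R) (n p : nat) : 0 < eps -> eps < 1 -> 0 < alpha -> alpha < 1 ->
  (0 < n)%N -> (0 < p)%N ->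
  let r := Phi_inv (1 - alpha / (2 * p%:R * n%:R)) in 0 <= r ->
  [/\ Lnp (n := n) (p := p) eps <= r ^+ 2 + log_const eps & Lp (p := p) eps <= 2 * (r ^+ 2 + log_const eps)].
Proof.
move=> e0 e1 a0 a1 n0 p0 r r0.
have nR : 1 <= n%:R :> R by rewrite ler1n.
have pR : 1 <= p%:R :> R by rewrite ler1n.
have nR0 : 0 < n%:R :> R by exact: lt_le_trans nR.
have pR0 : 0 < p%:R :> R by exact: lt_le_trans pR.
have v0 : 0 < alpha / (2 * p%:R * n%:R) by rewrite divr_gt0// !mulr_gt0.
have pn1 : 1 <= p%:R * n%:R :> R by rewrite mulr_ege1.
have v1 : alpha / (2 * p%:R * n%:R) < 1.
  by rewrite ltr_pdivrMr ?mulr_gt0// mul1r -mulrA; move: a1 pn1; lra.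
have hQ := ln_le_Phi_inv v0 v1 r0; rewrite -/r in hQ.
have lnv : - ln (alpha / (2 * p%:R * n%:R)) = ln (2 * p%:R * n%:R) - ln alpha.
  by rewrite ln_div ?posrE// ?mulr_gt0// opprB.
have la : ln alpha <= 0 by rewrite ln_le0// ltW.
have h2 : ln (2 * p%:R * n%:R) <= r ^+ 2 + 1 - ln phi0.
  by rewrite lnv in hQ; lra.
have le0 : - ln eps <= `|ln eps| by rewrite -normrN ler_norm.
have lp0 : - ln phi0 <= `|ln phi0| by rewrite -normrN ler_norm.
have leps0 : 0 <= - ln eps by rewrite oppr_ge0 ln_le0// ltW.
split.
  rewrite /Lnp (mulrAC 2) ln_div ?posrE ?mulr_gt0// /log_const; lra.
have -> : Lp (p := p) eps = ln (2 * p%:R ^+ 2) - ln eps.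
  by rewrite /Lp ln_div ?posrE// mulr_gt0// exprn_gt0.
have h3 : ln (2 * p%:R ^+ 2) <= ln ((2 * p%:R * n%:R) ^+ 2 : R).
  rewrite ler_ln ?posrE ?mulr_gt0 ?exprn_gt0 ?mulr_gt0//.
  rewrite !exprMn -mulrA; apply: ler_pM; rewrite ?exprn_ge0 ?ler0n//.
    by rewrite expr2; lra.
  by rewrite ler_peMr ?exprn_ge0// exprn_ege1.
rewrite lnXn ?mulr_gt0// mulr2n in h3.
have := normr_ge0 (ln eps); rewrite /log_const; lra.
Qed.

(** The level is at most [alpha / 2], below [1/2] by at least [5 eps]. This is the origin of the
    constant [x0]. *)
Lemma Phi_level (eps alpha : R) (p : nat) : 0 < eps -> 0 < alpha -> alpha < 1 - 11 * eps ->
  (0 < p)%N -> 5 * eps / (2 * phi0) <= Phi_inv (1 - alpha / (2 * p%:R)).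
Proof.
move=> e0 a0 a1 p0; have pR : 1 <= p%:R :> R by rewrite ler1n.
have pR0 : 0 < p%:R :> R by exact: lt_le_trans pR.
have v0 : 0 < alpha / (2 * p%:R) by rewrite divr_gt0// mulr_gt0.
have va : alpha / (2 * p%:R) <= alpha / 2.
  by rewrite ler_pM2l// lef_pV2 ?posrE ?mulr_gt0//; lra.
apply: Phi_inv_ge_gap => //; [lra|lra|lra].
Qed.

(** The logarithm is at most [y^2 + log_const eps]; as [y >= x0] the constant is absorbed by
    [log_const eps / x0^2 * y^2]. Hence [b] is at most a fixed multiple of [tau]. *)
Lemma b_tau (eps alpha C1 x0 : R) (n p : nat) : 0 < eps -> eps < 1 -> 0 < alpha -> alpha < 1 ->
  (0 < n)%N -> (0 < p)%N -> 0 <= C1 -> 0 < x0 -> x0 <= Phi_inv (1 - alpha / (2 * p%:R)) ->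
  C1 * Num.sqrt (ln (2 * p%:R / eps) / n%:R) <=
    C1 * Num.sqrt (1 + log_const eps / x0 ^+ 2) * tau n p alpha.
Proof.
move=> e0 e1 a0 a1 n0 p0 C10 x00; set y := Phi_inv _ => xy.
have pR : 1 <= p%:R :> R by rewrite ler1n.
have pR0 : 0 < p%:R :> R by exact: lt_le_trans pR.
have y0 : 0 < y by exact: lt_le_trans xy.
have v0 : 0 < alpha / (2 * p%:R) by rewrite divr_gt0// mulr_gt0.
have v1 : alpha / (2 * p%:R) < 1 by rewrite ltr_pdivrMr ?mulr_gt0// mul1r; lra.
have hQ := ln_le_Phi_inv v0 v1 (ltW y0); rewrite -/y in hQ.
rewrite ln_div ?posrE ?mulr_gt0// opprB in hQ.
have la : ln alpha <= 0 by rewrite ln_le0// ltW.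
have le0 : - ln eps <= `|ln eps| by rewrite -normrN ler_norm.
have lp0 : - ln phi0 <= `|ln phi0| by rewrite -normrN ler_norm.
have cc0 : 0 <= log_const eps by rewrite /log_const !addr_ge0.
have h : ln (2 * p%:R / eps) <= (1 + log_const eps / x0 ^+ 2) * y ^+ 2.
  have -> : (1 + log_const eps / x0 ^+ 2) * y ^+ 2 = y ^+ 2 + log_const eps / x0 ^+ 2 * y ^+ 2.
    by set q := _ / _; ring.
  rewrite ln_div ?posrE ?mulr_gt0//.
  have : log_const eps <= log_const eps / x0 ^+ 2 * y ^+ 2.
    rewrite mulrAC ler_pdivlMr ?exprn_gt0// ler_wpM2l// lerXn2r ?nnegrE// ltW//.
  have hc : 1 - ln phi0 - ln eps <= log_const eps by rewrite /log_const; lra.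
  move=> h1; apply: (@le_trans _ _ (y ^+ 2 + log_const eps)); last by rewrite lerD2l.
  move: hQ la hc; set A1 := ln (2 * _); set A2 := ln alpha; set A3 := ln phi0; set A4 := ln eps.
  set A6 := log_const eps; set A7 := y ^+ 2.
  by clearbody A1 A2 A3 A4 A6 A7 => h2 h3 h4; lra.
rewrite -[leRHS]mulrA; apply: ler_wpM2l => //.
have q0 : 0 <= 1 + log_const eps / x0 ^+ 2 by rewrite addr_ge0// divr_ge0// exprn_ge0// ltW.
have -> : Num.sqrt (1 + log_const eps / x0 ^+ 2) * tau n p alpha =
    Num.sqrt ((1 + log_const eps / x0 ^+ 2) * y ^+ 2) * (Num.sqrt n%:R)^-1.
  by rewrite sqrtrM// sqrtr_sqr ger0_norm ?(ltW y0)// /tau -/y mulrA mulrAC.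
rewrite sqrtrM; last by apply: ln_ge0; rewrite ler_pdivlMr// mul1r; lra.
rewrite sqrtrV ?ler0n//; apply: ler_wpM2r; first by rewrite invr_ge0 sqrtr_ge0.
exact: ler_wsqrtr.
Qed.

Lemma tau_upper (alpha : R) (n p : nat) : 0 < alpha -> alpha < 1 -> (0 < n)%N -> (0 < p)%N ->
  tau n p alpha <= 2 * Num.sqrt (ln (2 * p%:R / alpha) / n%:R).
Proof.
move=> a0 a1 n0 p0.
have pR : 1 <= p%:R :> R by rewrite ler1n.
have pR0 : 0 < p%:R :> R by exact: lt_le_trans pR.
have v0 : 0 < alpha / (2 * p%:R) by rewrite divr_gt0// mulr_gt0.
have v1 : alpha / (2 * p%:R) < 1 by rewrite ltr_pdivrMr ?mulr_gt0// mul1r; lra.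
have h := Phi_inv_le_sqrt v0 v1.
have e1 : - (2 * ln (alpha / (2 * p%:R))) = 2 * ln (2 * p%:R / alpha).
  rewrite -[alpha / _]invf_div lnV ?posrE ?divr_gt0 ?mulr_gt0//; ring.
have l0 : 0 <= ln (2 * p%:R / alpha).
  apply: ln_ge0; rewrite ler_pdivlMr// mul1r; lra.
rewrite e1 sqrtrM// in h.
rewrite /tau sqrtrM// sqrtrV ?ler0n// mulrA mulrC ler_wpM2r ?invr_ge0 ?sqrtr_ge0//.
apply: le_trans h _; rewrite ler_wpM2r ?sqrtr_ge0//.
have -> : (2 : R) = Num.sqrt (2 ^+ 2) by rewrite sqrtr_sqr ger0_norm.
by rewrite ler_wsqrtr// sqrtr_sqr ger0_norm// expr2; lra.
Qed.

End level_arithmetic.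

(** * The conclusion at one sample size, from explicit numerical conditions *)

Section per_sample_size.
Context {R : realType}.
Notation phi0 := (normal_pdf (0 : R) 1 0).
Variables (eps : R) (q : nat) (C0 c1 C1 c2 C2 rho : R).
Hypothesis eps0 : 0 < eps.
Hypothesis eps1 : eps < 1.
Hypothesis hq : (q = 1 \/ q = 2)%N.
Hypothesis C00 : 0 < C0.
Hypothesis c10 : 0 < c1.
Hypothesis C10 : 0 < C1.
Hypothesis c20 : 0 < c2.
Let x0 : R := 5 * eps / (2 * phi0).
Hypothesis rho0 : 0 < rho.
Let K : R := mom_const C0.
Definition b_over_tau : R := C1 * Num.sqrt (1 + log_const eps / x0 ^+ 2).
Definition sparsity_const : R := 1 + (1 + 4 * scale_const C0 C1 eps b_over_tau * (1 + z4_const C0 C1) / (c1 * (Num.sqrt c2 / 4))) ^+ 2.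
Definition error_const : R := 4 * scale_const C0 C1 eps b_over_tau / c1 + 3 * scale_const C0 C1 eps b_over_tau / col_const C0 C1 c2 eps.
Definition gram_const : R := 2 * (1 + C0) + (1 + 4 * (4`!%:R * (2 * expR (C0 / 2)))) +
  2 * (4`!%:R * (2 * expR (C0 / 2)) + 1).
Definition final_const : R := `|sparsity_const| + 2 * `|error_const| + 1.

Variables (n p s : nat) (alpha b sx sw ell eta t : R) (M : eiv_model R n p).
Variables (bh th uh : 'I_p -> {RV (Pr M) >-> R}).
Hypothesis hSN : forall (d : measure_display) (T : measurableType d) (P : probability T R) (n : nat)
    (F : 'I_n -> set (set T)) (U : 'I_n -> T -> R) (x : R),
    (forall i E, F i E -> measurable E) ->
    (forall i (B : set R), measurable B -> F i (U i @^-1` B)) -> independent P F ->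
    (forall i, Intg P (fun w => `|U i w| ^+ 3)) -> x0 <= x ->
    \sum_i EX P (U i) = 0 -> \sum_i EX P (fun w => U i w ^+ 2) = x ^+ 2 ->
    \sum_i EX P (fun w => `|U i w| ^+ 3) <= rho ->
    (P [set w | (x * Num.sqrt (\sum_i U i w ^+ 2) < \sum_i U i w)%R] <=
       ((1 + eps) * tail x)%:E)%E.
Hypothesis n0 : (0 < n)%N.
Hypothesis p0 : (0 < p)%N.
Hypothesis s0 : (0 < s)%N.
Hypothesis al0 : 0 < alpha.
Hypothesis al1 : alpha < 1.
Hypothesis hE : eiv_assumptions M.
Hypothesis hA : conditionA M s C0 sx sw.
Hypothesis hB : conditionB M alpha eps b ell.
Hypothesis hest : is_conic_estimator alpha b bh th uh.
Hypothesis hkappa : 8 * s%:R * ((1 + tau n p alpha) * b + tau n p alpha * h_quantile M eps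
            + design_const sw * (1 + Num.sqrt (m2 M))
              * Num.sqrt (ln (2 * p%:R ^+ 2 / eps) / n%:R))
       <= kappa q s 3 (design M) * s%:R `^ (q%:R^-1).
Hypothesis hOm : Omega_X q s c1 C1 (design M).
Hypothesis hb : b <= C1 * Num.sqrt (ln (2 * p%:R / eps) / n%:R).
Hypothesis hmom : moment_condition M c2 C2.
Let Zn : R := s%:R `^ (q%:R^-1) * Num.sqrt (ln (2 * p%:R * n%:R / alpha) / n%:R).
Hypothesis tE : t = n%:R `^ (6^-1).
Hypothesis T1 : 1 <= t.
Hypothesis eta0 : 0 < eta.
Hypothesis etaC : 2 * C0 * eta <= 1.
Hypothesis eta2 : 2 * eta <= 1.
Hypothesis eta3 : eta <= c2 ^+ 2 / (256 * M4 C0 (KV C0) C1).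
Hypothesis T2 : 2 * log_const eps <= eta * t ^+ 2.
Hypothesis T3 : 2 <= eta * ell ^+ 2.
Hypothesis T4 : Num.sqrt (8 * K) / (2 * C0) <= ln n%:R.
Hypothesis T5 : gram_const * (1 + Num.sqrt (1 + C1)) <= c2 / (32 * K) * t ^+ 2.
Hypothesis T6 : 1 + M4 C0 (KV C0) C1 <= rho * (c2 * Num.sqrt c2) * ell ^+ 3.
Hypothesis T7 : (2 * pred_const C0 c1 C1 c2 eps b_over_tau + 2 * b_over_tau) * Zn <= Num.sqrt c2 / 4.
Hypothesis T8 : 2 * b_over_tau * Zn <= 1.

Let y : R := Phi_inv (1 - alpha / (2 * p%:R)).
Let r : R := Phi_inv (1 - alpha / (2 * p%:R * n%:R)).
Let tu : R := tau n p alpha.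
Let phi0_gt0 : 0 < phi0. Proof. exact: phi_gt0. Qed.
Let x00 : 0 < x0. Proof. by rewrite divr_gt0// mulr_gt0. Qed.
Let nR : 1 <= n%:R :> R. Proof. by rewrite ler1n. Qed.
Let pR : 1 <= p%:R :> R. Proof. by rewrite ler1n. Qed.
Let nR0 : 0 < n%:R :> R. Proof. exact: lt_le_trans nR. Qed.
Let pR0 : 0 < p%:R :> R. Proof. exact: lt_le_trans pR. Qed.
Let t0 : 0 < t. Proof. exact: lt_le_trans T1. Qed.
Let t6 : t ^+ 6 = n%:R.
Proof. by rewrite tE -powR_mulrn ?powR_ge0// -powRrM mulVf ?powRr1. Qed.
Let t3 : Num.sqrt n%:R = t ^+ 3.
Proof.
rewrite -t6 (_ : t ^+ 6 = (t ^+ 3) ^+ 2); last by rewrite -exprM.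
by rewrite sqrtr_sqr ger0_norm// exprn_ge0// ltW.
Qed.
Let ell2 : 2 <= ell. Proof. by case: hB => _ []. Qed.
Let ell0 : 0 < ell. Proof. exact: lt_le_trans ell2. Qed.
Let hx4 j : avg (fun i => design M i j ^+ 4) <= C1.
Proof.
case: hOm => _ /=; apply: le_trans.
exact: (le_bigmax _ (fun j => avg (fun i => design M i j ^+ 4)) j).
Qed.
Let kge : c1 * s%:R `^ (- q%:R^-1) <= kappa q s 3 (design M). Proof. by case: hOm. Qed.
Let S1 : 1 <= s%:R `^ q%:R^-1 :> R.
Proof.
have s1 : (1 : R) <= s%:R by rewrite ler1n.
case: hq => ->; first by rewrite invr1 powRr1.
by rewrite powR12_sqrt ?ler0n// -[leLHS]sqrtr1 ler_wsqrtr.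
Qed.
Let K1 : 1 <= K. Proof. exact: (Kmix_ge1 C0 n0 (V_mgf hA)). Qed.
Let K0 : 0 < K. Proof. exact: lt_le_trans K1. Qed.

Hypothesis nontriv : alpha < 1 - 11 * eps.

Lemma y_ge : x0 <= y. Proof. exact: Phi_level. Qed.

Lemma y_le_r : y <= r.
Proof.
apply: Phi_inv_anti.
- by rewrite divr_gt0// !mulr_gt0.
- rewrite ler_pM2l// lef_pV2 ?posrE ?mulr_gt0//.
  by rewrite ler_peMr// mulr_ge0// ltW.
- by rewrite ltr_pdivrMr ?mulr_gt0// mul1r; move: al1 pR; lra.
Qed.

Lemma y_gt0 : 0 < y. Proof. exact: lt_le_trans y_ge. Qed.

Lemma r_le : r <= t / ell.
Proof.
rewrite tE; apply: (r_bound hA n0 hx4 p0 hB).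
by apply: le_trans (ltW y_gt0) y_le_r.
Qed.

Let D : R := r ^+ 2 + log_const eps.

(** Half of the budget is for [r <= t / ell], with [ell] large enough for [eta]; the other half is
    for the constant, negligible against [t^2]. *)
Lemma D_le : D <= eta * t ^+ 2.
Proof.
have r0 : 0 <= r by apply: le_trans (ltW y_gt0) y_le_r.
have h : r ^+ 2 <= (t / ell) ^+ 2 by rewrite lerXn2r ?nnegrE ?r_le// divr_ge0// ltW.
have h2 : 2 * (t / ell) ^+ 2 <= eta * t ^+ 2.
  rewrite expr_div_n mulrA ler_pdivrMr ?exprn_gt0// mulrAC ler_wpM2r ?sqr_ge0//.
by rewrite /D; move: T2; lra.
Qed.

Lemma logs : Lnp (n := n) (p := p) eps <= D /\ Lp (p := p) eps <= 2 * D.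
Proof.
have r0 : 0 <= r by apply: le_trans (ltW y_gt0) y_le_r.
by have [] := log_bounds eps0 eps1 al0 al1 n0 p0 r0.
Qed.

Lemma Lp_small : Num.sqrt (Lp (p := p) eps / n%:R) <= (t ^+ 2)^-1.
Proof.
have [_ h] := logs; have d := D_le.
have h2 : Lp (p := p) eps / n%:R <= ((t ^+ 2)^-1) ^+ 2.
  have -> : ((t ^+ 2)^-1) ^+ 2 = t ^+ 2 / n%:R by rewrite -t6; field; rewrite gt_eqF.
  rewrite ler_pM2r ?invr_gt0//; apply: le_trans h _.
  have : eta * 2 * t ^+ 2 <= 1 * t ^+ 2 by rewrite ler_wpM2r ?sqr_ge0// mulrC.
  by move: d; lra.
apply: le_trans (ler_wsqrtr h2) _.
by rewrite sqrtr_sqr ger0_norm// invr_ge0 sqr_ge0.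
Qed.

Let A := Atr (n := n) (p := p) C0 eps.
Let A2 : A ^+ 2 = 2 * C0 * Lnp (n := n) (p := p) eps.
Proof. exact: Atr_sqr. Qed.

Lemma A2_le : A ^+ 2 <= t ^+ 2.
Proof.
rewrite A2; have [h _] := logs; have d := D_le.
apply: (@le_trans _ _ (2 * C0 * (eta * t ^+ 2))).
  by rewrite ler_wpM2l ?mulr_ge0 ?(ltW C00)//; exact: le_trans d.
by rewrite mulrA -[leRHS]mul1r ler_wpM2r ?sqr_ge0.
Qed.

(** Here [n = t^6]: logarithms of order [t^2] give [sqrt (Lp / n) <= t^-2] and a squared truncation
    level of at most [t^2], which just balance. *)
Lemma num1 : Num.sqrt (Lp (p := p) eps / n%:R) * A ^+ 2 <= 1.
Proof.
apply: (@le_trans _ _ ((t ^+ 2)^-1 * t ^+ 2)); last by rewrite mulVf// gt_eqF// exprn_gt0.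
by apply: ler_pM; rewrite ?sqrtr_ge0 ?sqr_ge0 ?Lp_small ?A2_le.
Qed.

Lemma Lnp_ge_ln : ln n%:R <= Lnp (n := n) (p := p) eps.
Proof.
rewrite /Lnp ler_ln ?posrE ?divr_gt0 ?mulr_gt0//.
rewrite ler_pdivlMr//; apply: (@le_trans _ _ (n%:R * 1)).
  by rewrite ler_pM2l// ltW.
rewrite mulr1 mulrAC mulrC; apply: ler_peMr; first exact: ltW.
by move: pR; lra.
Qed.

(** The truncation level must also be large; it grows because [Lnp >= ln n]. *)
Lemma num2 : 8 * K <= A ^+ 4.
Proof.
have h := le_trans T4 Lnp_ge_ln; rewrite ler_pdivrMr ?mulr_gt0// in h.
rewrite sq4 A2 -[leLHS]sqr_sqrtr; last by rewrite mulr_ge0// ltW.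
have h' : Num.sqrt (8 * K) <= 2 * C0 * Lnp (n := n) (p := p) eps by rewrite [leRHS]mulrC.
by rewrite lerXn2r ?nnegrE ?sqrtr_ge0// (le_trans _ h')// sqrtr_ge0.
Qed.

Lemma exp_union (c : R) : Lnp (n := n) (p := p) eps <= c -> p%:R * expR (- c) <= eps.
Proof.
move=> h; apply: (@le_trans _ _ (p%:R * expR (- Lnp (n := n) (p := p) eps))).
  by rewrite ler_pM2l// ler_expR lerN2.
rewrite expR_Lnp// mulrA ler_pdivrMr ?mulr_gt0// mulrC ler_pM2l//.
by rewrite ler_peMl ?(ltW pR0)//; move: nR; lra.
Qed.

(** As [A^4 <= t^4], the exponent is at least [t^2 / 2], which dominates [Lnp] and so pays for the
    union over coordinates. *)
Lemma num3 : p%:R * expR (- (n%:R / (2 * A ^+ 4))) <= eps.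
Proof.
have A0 : 0 < A by exact: Atr_gt0.
apply: exp_union; rewrite ler_pdivlMr ?mulr_gt0 ?exprn_gt0//.
have [h _] := logs; have d := D_le; have l0 : 0 <= Lnp (n := n) (p := p) eps.
  by apply: le_trans (Lnp_ge n0 p0 eps0 eps1); rewrite invr_ge0.
apply: (@le_trans _ _ (eta * t ^+ 2 * (2 * (t ^+ 2) ^+ 2))).
  apply: ler_pM => //; first by rewrite mulr_ge0// sq4 sqr_ge0.
    exact: le_trans d.
  by rewrite ler_pM2l// sq4 lerXn2r ?nnegrE ?sqr_ge0// A2_le.
rewrite (_ : _ * _ = 2 * eta * t ^+ 6); last by ring.
by rewrite t6 -[leRHS]mul1r ler_wpM2r// ltW.
Qed.

Lemma num4 : p%:R * expR (- (n%:R * (c2 ^+ 2 / (256 * M4 C0 (KV C0) C1)))) <= eps.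
Proof.
apply: exp_union; have [h _] := logs; apply: le_trans (le_trans h D_le) _.
rewrite mulrC; apply: ler_pM => //; rewrite ?sqr_ge0 ?(ltW eta0)//.
by rewrite -t6 ler_weXn2l.
Qed.

(** The moderate deviation range [y = o (n^(1/6))]: here [y^3 <= sqrt n / ell^3]. *)
Lemma num5 : y ^+ 3 * (1 + M4 C0 (KV C0) C1) <= rho * (c2 * Num.sqrt c2) * Num.sqrt n%:R.
Proof.
have y3 : y ^+ 3 <= t ^+ 3 / ell ^+ 3.
  rewrite -expr_div_n lerXn2r ?nnegrE ?(ltW y_gt0)//; first by rewrite divr_ge0// ltW.
  exact: le_trans y_le_r r_le.
have y30 : 0 <= y ^+ 3 by rewrite exprn_ge0// ltW// y_gt0.
apply: le_trans (ler_wpM2l y30 T6) _.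
have c0 : 0 <= rho * (c2 * Num.sqrt c2) by rewrite mulr_ge0 ?mulr_ge0 ?sqrtr_ge0 ?ltW.
rewrite t3 mulrCA; apply: ler_wpM2l => //.
by rewrite -ler_pdivlMr ?exprn_gt0.
Qed.

Lemma tu_gt0 : 0 < tu.
Proof. by rewrite mulr_gt0 ?y_gt0// invr_gt0 sqrtr_gt0. Qed.

Lemma tu_le1 : tu <= 1.
Proof.
rewrite /tu /tau -/y t3 mulrC ler_pdivrMr ?exprn_gt0// mul1r.
apply: le_trans (le_trans y_le_r r_le) _.
apply: (@le_trans _ _ t); last by rewrite ler_eXnr.
by rewrite ler_pdivrMr// ler_peMr ?(ltW t0)//; move: ell2; lra.
Qed.

Lemma Q_ge : ln (2 * p%:R / alpha) <= ln (2 * p%:R * n%:R / alpha).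
Proof.
rewrite ler_ln ?posrE ?divr_gt0 ?mulr_gt0// ler_pM2r ?invr_gt0//.
by rewrite ler_peMr// mulr_ge0// ltW.
Qed.

Lemma Stu_le : s%:R `^ q%:R^-1 * tu <= 2 * Zn.
Proof.
rewrite /Zn [leRHS]mulrCA ler_pM2l; last exact: lt_le_trans S1.
apply: le_trans (tau_upper al0 al1 n0 p0) _; rewrite ler_pM2l// ler_wsqrtr//.
by rewrite ler_pM2r ?invr_gt0// Q_ge.
Qed.

Lemma tu_le : tu <= 2 * Zn.
Proof.
apply: le_trans Stu_le; apply: ler_peMl; [exact: ltW tu_gt0|exact: S1].
Qed.

Lemma b_over_tau_ge0 : 0 <= b_over_tau. Proof. by rewrite mulr_ge0 ?sqrtr_ge0// ltW. Qed.

Lemma b_le : b <= b_over_tau * tu.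
Proof.
by apply: le_trans hb _; apply: (b_tau eps0 eps1 al0 al1 n0 p0 (ltW C10) x00); exact: y_ge.
Qed.

Lemma b_le1 : b <= 1.
Proof.
apply: le_trans b_le _; apply: le_trans (ler_wpM2l b_over_tau_ge0 tu_le) _.
by rewrite mulrCA mulrA; exact: T8.
Qed.

Lemma pred_const_ge0 : 0 <= pred_const C0 c1 C1 c2 eps b_over_tau.
Proof.
have k1 : 0 <= scale_const C0 C1 eps b_over_tau.
  rewrite /scale_const /score_const -/K; have := sqrtr_ge0 (z4_const C0 C1 + K / eps); have := b_over_tau_ge0; move: K0; lra.
rewrite /pred_const -/K; apply: addr_ge0.
  by apply: mulr_ge0 => //; apply: mulr_ge0; [exact: sqrtr_ge0|exact: sqrtr_ge0].
apply: divr_ge0; last exact: ltW.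
by apply: mulr_ge0 => //; apply: mulr_ge0 => //; apply: addr_ge0 => //; exact: ltW.
Qed.

Lemma small_ok : pred_const C0 c1 C1 c2 eps b_over_tau * (s%:R `^ q%:R^-1 * tu) + b <= Num.sqrt c2 / 4.
Proof.
apply: le_trans T7.
have h1 := ler_wpM2l pred_const_ge0 Stu_le; have h2 := ler_wpM2l b_over_tau_ge0 tu_le; have h3 := b_le.
apply: le_trans (lerD h1 (le_trans h3 h2)) _.
by rewrite le_eqVlt; apply/orP; left; apply/eqP; ring.
Qed.

Lemma e_ok : design_const sw * (1 + Num.sqrt (m2 M)) * Num.sqrt (Lp (p := p) eps / n%:R) <= c2 / (32 * K).
Proof.
have swC : sw ^+ 2 <= C0 by case: hA => _ _ [_ _ []].
have kk : kap sw <= 4`!%:R * (2 * expR (C0 / 2)).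
  by rewrite /kap ler_pM2l ?ltr0n// ler_pM2l// ler_expR ler_pM2r.
have k0 := @kap_ge0 R sw; have s20 := sqr_ge0 sw.
have h1 : 0 <= design_const sw by rewrite /design_const; move: k0 s20; set a := kap sw; set bb := sw ^+ 2; lra.
have h2 : design_const sw <= gram_const.
  by rewrite /design_const /gram_const; move: kk swC; set a := kap sw; set bb := sw ^+ 2; set d := 4`!%:R * _; lra.
have h3 : m2 M <= 1 + C1.
  apply: bigmax_le => [|j _]; first by rewrite addr_ge0// ltW.
  apply: (@le_trans _ _ (avg (fun i => 1 + design M i j ^+ 4))).
    apply: avg_le => i; rewrite -subr_ge0 sq4.
    by have := one_sqr_sub_ge0 (design M i j ^+ 2); lra.
  by rewrite avgD avg_cst// lerD2l.
have t20 : 0 < t ^+ 2 by rewrite exprn_gt0.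
apply: (@le_trans _ _ (gram_const * (1 + Num.sqrt (1 + C1)) * (t ^+ 2)^-1)).
  apply: ler_pM; rewrite ?sqrtr_ge0 ?Lp_small//.
    by rewrite mulr_ge0// addr_ge0// sqrtr_ge0.
  apply: ler_pM; [exact: h1|by rewrite addr_ge0 ?sqrtr_ge0|exact: h2|].
  by rewrite lerD2l ler_wsqrtr.
by rewrite ler_pdivrMr.
Qed.

Lemma per_n : ((1 - alpha - 11 * eps)%:E <=
  Pr M [set om : sample M | ((l0norm (beta_thr alpha bh om))%:R <= final_const * s%:R /\
    lnorm q (beta_thr alpha bh om - beta0 M) <=
      final_const * (1 + lnorm 2 (beta0 M)) * s%:R `^ (q%:R^-1)
      * Num.sqrt (ln (2 * p%:R / alpha) / n%:R))%R])%E.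
Proof.
have [[GD hGh] _ _ _ _] := hB; have [hH hsol] := hest.
have hSN' := fun U y fU I3 xy s1 s2 s3 => @hSN _ _ (Pr M) n (fun i => <<s @obs_gen R n p M i >>) U y
  (@obs_gen_meas R n p M) fU (proj1 hE) I3 xy s1 s2 s3.
apply: (prob_good C00 hA hE n0 p0 eps0 eps1 al0 al1 hGh hx4 hmom c20 hH num1 num2 num3 num4 hSN' x00 y_ge num5).
  exact: final_event_meas.
move=> om gd; have H0 := good4 gd.
have [f1 f2] := final_good C00 hA hE n0 p0 eps0 eps1 c20 C10 hx4 gd tu_gt0 tu_le1 b_le1 e_ok hq s0 c10
  (GD om) (hsol om H0) hkappa kge b_le small_ok (erefl sparsity_const) (erefl error_const).
have sR : 0 < s%:R :> R by rewrite ltr0n.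
split.
  apply: le_trans f1 _; rewrite ler_pM2r//; apply: le_trans (ler_norm _) _.
  by rewrite /final_const -addrA lerDl addr_ge0// mulr_ge0.
apply: le_trans f2 _.
have S0 : 0 < s%:R `^ q%:R^-1 :> R by exact: lt_le_trans S1.
have B0 := bN_gt0 M; have h := tau_upper al0 al1 n0 p0.
set Lq := Num.sqrt _ in h *; have L0 : 0 <= Lq by exact: sqrtr_ge0.
have h0 : 0 <= s%:R `^ q%:R^-1 * (tu * bN M).
  by rewrite mulr_ge0 ?(ltW S0)// mulr_ge0 ?(ltW tu_gt0) ?(ltW B0).
apply: le_trans (ler_wpM2r h0 (ler_norm error_const)) _.
have h1 : s%:R `^ q%:R^-1 * (tu * bN M) <= s%:R `^ q%:R^-1 * (2 * Lq * bN M).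
  by rewrite ler_pM2l// ler_pM2r.
apply: le_trans (ler_wpM2l (normr_ge0 _) h1) _.
rewrite -/(bN M) (_ : `|error_const| * _ = 2 * `|error_const| * (bN M * s%:R `^ q%:R^-1 * Lq)); last by ring.
rewrite -[leRHS]mulrA -mulrA [leRHS](_ : _ = final_const * (bN M * s%:R `^ q%:R^-1 * Lq)); last by ring.
rewrite [leLHS](_ : _ = 2 * `|error_const| * (bN M * s%:R `^ q%:R^-1 * Lq)); last by ring.
apply: ler_wpM2r; first by rewrite !mulr_ge0// ltW.
by rewrite /final_const addrAC lerDr addr_ge0.
Qed.

End per_sample_size.

(** * Eventual bounds and the theorem *)

Section eventually.
Context {R : realType}.

Lemma near_ge_cvg (u : nat -> R) (c : R) : u n @[n --> \oo] --> +oo ->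
  \forall n \near \oo, c <= u n.
Proof. by move=> /cvgryPge; exact. Qed.

Lemma near_nat_ge (c : R) : \forall n \near \oo, c <= n%:R :> R.
Proof. exact: near_ge_cvg (@cvgr_idn R). Qed.

Lemma near_root6_ge (c : R) : \forall n \near \oo, c <= n%:R `^ 6^-1 :> R.
Proof.
near=> n; apply: (@le_trans _ _ `|c|); first exact: ler_norm.
have h : `|c| ^+ 6 <= n%:R by near: n; exact: near_nat_ge.
have : (`|c| ^+ 6) `^ 6^-1 <= n%:R `^ 6^-1.
  by rewrite ge0_ler_powR ?nnegrE ?invr_ge0 ?exprn_ge0.
by rewrite -powR_mulrn// -powRrM mulfV// powRr1.
Unshelve. all: by end_near. Qed.

Lemma near_ln_ge (c : R) : \forall n \near \oo, c <= ln n%:R :> R.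
Proof.
near=> n; rewrite -[c]expRK ler_ln ?posrE ?expR_gt0//.
  by near: n; exact: near_nat_ge.
apply: lt_le_trans (expR_gt0 c) _; near: n; exact: near_nat_ge.
Unshelve. all: by end_near. Qed.

Lemma near_le_cvg0 (u : nat -> R) (k c : R) : u n @[n --> \oo] --> (0 : R) -> 0 < c ->
  \forall n \near \oo, k * u n <= c.
Proof.
move=> u0 c0.
have h : k * u n @[n --> \oo] --> (0 : R).
  by rewrite -(mulr0 k); apply: cvgM => //; exact: cvg_cst.
move/cvgrPdist_le : h => /(_ _ c0); apply: filterS => n.
by rewrite sub0r normrN; exact: le_trans (ler_norm _).
Qed.

Lemma near_scaled_sqr (a b : R) (u : nat -> R) : 0 < a ->
  (\forall n \near \oo, 1 + `|b| / a <= u n) -> \forall n \near \oo, b <= a * u n ^+ 2.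
Proof.
move=> a0; apply: filterS => n h.
have q0 : 0 <= `|b| / a by rewrite divr_ge0// ltW.
have u1 : 1 <= u n by apply: le_trans h; rewrite lerDl.
apply: le_trans (ler_norm b) _; rewrite mulrC -ler_pdivrMr//.
apply: (@le_trans _ _ (u n)); first by apply: le_trans h; rewrite lerDr.
by rewrite expr2 ler_peMr// (le_trans _ u1).
Qed.

End eventually.

Theorem theorem2 (R : realType) :
  exists C' : R -> R -> R, (forall sw sx, 0 < C' sw sx) /\
  forall (eps : R) (q : nat) (C0 c1 C1 c2 C2 : R),
    0 < eps < 1 -> (q = 1 \/ q = 2)%N ->
    0 < C0 -> 0 < c1 -> 0 < C1 -> 0 < c2 < C2 ->
  exists C c' : R, [/\ 0 < C, 1 <= c' &
  forall (p s : nat -> nat) (alpha b sigma_xi sigma_w ell : nat -> R)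
      (M : forall n, eiv_model R n (p n))
      (betahat that uhat : forall n, 'I_(p n) -> {RV (Pr (M n)) >-> R}),
    (forall n, (1 <= p n)%N /\ (1 <= s n)%N) ->
    (forall n, 0 < alpha n < 1) ->
    ell n @[n --> \oo] --> +oo ->
    (\forall n \near \oo,
       eiv_assumptions (M n) /\
       conditionA (M n) (s n) C0 (sigma_xi n) (sigma_w n) /\
       conditionB (M n) (alpha n) eps (b n) (ell n)) ->
    (\forall n \near \oo,
       is_conic_estimator (alpha n) (b n) (betahat n) (that n) (uhat n)) ->
    (\forall n \near \oo,
       8 * (s n)%:R * ((1 + tau n (p n) (alpha n)) * b n
          + tau n (p n) (alpha n) * h_quantile (M n) eps
          + C' (sigma_w n) (sigma_xi n) * (1 + Num.sqrt (m2 (M n)))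
            * Num.sqrt (ln (2 * (p n)%:R ^+ 2 / eps) / n%:R))
       <= kappa q (s n) 3 (design (M n)) * (s n)%:R `^ (q%:R^-1)) ->
    (\forall n \near \oo, Omega_X q (s n) c1 C1 (design (M n))) ->
    (\forall n \near \oo,
       b n <= C1 * Num.sqrt (ln (2 * (p n)%:R / eps) / n%:R)) ->
    ((s n)%:R `^ (q%:R^-1)
       * Num.sqrt (ln (2 * (p n)%:R * n%:R / alpha n) / n%:R)
       @[n --> \oo] --> (0 : R)) ->
    (\forall n \near \oo, moment_condition (M n) c2 C2) ->
    exists delta : nat -> R, delta n @[n --> \oo] --> (0 : R) /\
      \forall n \near \oo,
        ((1 - alpha n - 11 * eps - delta n)%:E <=
          Pr (M n) [set om : sample (M n) | (
            (l0norm (beta_thr (alpha n) (betahat n) om))%:R <= C * (s n)%:R /\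
            lnorm q (beta_thr (alpha n) (betahat n) om - beta0 (M n)) <=
              C * (1 + lnorm 2 (beta0 (M n))) * (s n)%:R `^ (q%:R^-1)
              * Num.sqrt (ln (c' * (p n)%:R / alpha n) / n%:R))%R])%E].
Proof.
exists (fun sw _ => design_const sw); split.
  move=> sw _; rewrite /design_const; have := @kap_ge0 R sw; have := sqr_ge0 sw.
  by set a := kap sw; set c := sw ^+ 2; lra.
move=> eps q C0 c1 C1 c2 C2 /andP[eps0 eps1] hq C00 c10 C10 /andP[c20 _].
(* The lower bound on the quantile provided by [Phi_level]; depending only on [eps], it fixes [rho]
   before any sample size. *)
have x00 : 0 < 5 * eps / (2 * normal_pdf (0 : R) 1 0).
  by rewrite divr_gt0 ?mulr_gt0 ?phi_gt0.
have [rho rho0 hSN] := self_normalized_tail x00 eps0.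
(* The value [c' = 2] is the one in [tau_upper], which bounds [tau] by the rate. *)
exists (final_const eps C0 c1 C1 c2), 2; split => [||p s alpha b sx sw ell M bh th uh ps al ellinf hyps est hk hO hb hZ hm].
- by rewrite /final_const ltr_pwDr// addr_ge0// mulr_ge0.
- by rewrite ler1n.
exists (fun=> 0); split; first exact: cvg_cst.
have KV0 : 0 < KV C0 :> R by rewrite /KV mulr_gt0// expR_gt0.
have K0 : 0 < mom_const C0 :> R.
  rewrite /mom_const /Kmix; have : 0 <= 8`!%:R * (2 * expR (C0 / 2)) :> R by rewrite mulr_ge0// mulr_ge0// expR_ge0.
  have : 0 <= 8`!%:R * KV C0 :> R by rewrite mulr_ge0// ltW.
  by set a := _ * KV C0; set c := 8`!%:R * _; lra.
have M40 : 0 < M4 C0 (KV C0) C1 :> R.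
  rewrite /M4 -/(mom_const C0); apply: addr_gt0; apply: mulr_gt0 => //; last exact: exprn_gt0.
  by rewrite mulr_gt0// addr_gt0.
(* The three bounds serve, in this order, the truncation level ([A2_le]), the exponents in
   [Lp_small] and [num3], and the lower tail of the scores ([num4]). *)
pose eta : R := Num.min (2 * C0)^-1 (Num.min 2^-1 (c2 ^+ 2 / (256 * M4 C0 (KV C0) C1))).
have c3 : 0 < c2 ^+ 2 / (256 * M4 C0 (KV C0) C1) by rewrite divr_gt0 ?exprn_gt0 ?mulr_gt0.
have eta0 : 0 < eta by rewrite /eta !lt_min c3 andbT !invr_gt0 mulr_gt0 ?ltr0n.
have eta1 : 2 * C0 * eta <= 1.
  rewrite -[leRHS](@mulfV _ (2 * C0)) ?gt_eqF ?mulr_gt0// ler_pM2l ?mulr_gt0//.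
  by rewrite /eta ge_min lexx.
have eta2 : 2 * eta <= 1.
  rewrite -[leRHS](@mulfV _ (2 : R))// ler_pM2l//.
  by rewrite /eta !ge_min lexx orbT.
have eta3 : eta <= c2 ^+ 2 / (256 * M4 C0 (KV C0) C1).
  by rewrite /eta !ge_min lexx !orbT.
have rc0 : 0 < rho * (c2 * Num.sqrt c2) by rewrite !mulr_gt0// sqrtr_gt0.
have w0 : 0 < c2 / (32 * mom_const C0) by rewrite divr_gt0// mulr_gt0.
near=> n.
have [p0 s0] := ps n; have /andP[a0 a1] := al n.
have [hE [hA hB]] : eiv_assumptions (M n) /\ conditionA (M n) (s n) C0 (sx n) (sw n) /\
   conditionB (M n) (alpha n) eps (b n) (ell n) by near: n.
(* When [alpha >= 1 - 11 eps] the asserted lower bound is at most 0. Otherwise the normal quantile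
   is bounded away from 0. *)
rewrite subr0; have [nontriv|triv] := ltP (alpha n) (1 - 11 * eps); last first.
  apply: (@le_trans _ _ 0%E) => //; rewrite lee_fin; lra.
have n1 : (1 : R) <= n%:R by near: n; exact: near_nat_ge.
have n0 : (0 < n)%N by rewrite -(ltr_nat R) (lt_le_trans ltr01).
have T6 : 1 + M4 C0 (KV C0) C1 <= rho * (c2 * Num.sqrt c2) * ell n ^+ 3.
  have e1 : 1 <= ell n by near: n; exact: near_ge_cvg.
  apply: (@le_trans _ _ (rho * (c2 * Num.sqrt c2) * ell n ^+ 2)).
    near: n; apply: near_scaled_sqr => //; exact: near_ge_cvg.
  by rewrite ler_pM2l// ler_weXn2l.
have T3 : 2 <= eta * ell n ^+ 2.
  by near: n; apply: near_scaled_sqr => //; exact: near_ge_cvg.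
have T1 : 1 <= n%:R `^ 6^-1 :> R by near: n; exact: near_root6_ge.
have T2 : 2 * log_const eps <= eta * (n%:R `^ 6^-1) ^+ 2.
  by near: n; apply: near_scaled_sqr => //; exact: near_root6_ge.
have T5 : gram_const C0 * (1 + Num.sqrt (1 + C1)) <= c2 / (32 * mom_const C0) * (n%:R `^ 6^-1) ^+ 2.
  by near: n; apply: near_scaled_sqr => //; exact: near_root6_ge.
have T4 : Num.sqrt (8 * mom_const C0) / (2 * C0) <= ln n%:R by near: n; exact: near_ln_ge.
have T7 : (2 * pred_const C0 c1 C1 c2 eps (b_over_tau eps C1) + 2 * b_over_tau eps C1) *
   ((s n)%:R `^ (q%:R^-1) * Num.sqrt (ln (2 * (p n)%:R * n%:R / alpha n) / n%:R)) <= Num.sqrt c2 / 4.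
  by near: n; apply: near_le_cvg0 => //; rewrite divr_gt0// sqrtr_gt0.
have T8 : 2 * b_over_tau eps C1 *
   ((s n)%:R `^ (q%:R^-1) * Num.sqrt (ln (2 * (p n)%:R * n%:R / alpha n) / n%:R)) <= 1.
  by near: n; exact: near_le_cvg0.
have g1 : is_conic_estimator (alpha n) (b n) (bh n) (th n) (uh n) by near: n; exact: est.
have g2 : 8 * (s n)%:R * ((1 + tau n (p n) (alpha n)) * b n
          + tau n (p n) (alpha n) * h_quantile (M n) eps
          + design_const (sw n) * (1 + Num.sqrt (m2 (M n)))
            * Num.sqrt (ln (2 * (p n)%:R ^+ 2 / eps) / n%:R))
       <= kappa q (s n) 3 (design (M n)) * (s n)%:R `^ (q%:R^-1) by near: n; exact: hk.
have g3 : Omega_X q (s n) c1 C1 (design (M n)) by near: n; exact: hO.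
have g4 : b n <= C1 * Num.sqrt (ln (2 * (p n)%:R / eps) / n%:R) by near: n; exact: hb.
have g5 : moment_condition (M n) c2 C2 by near: n; exact: hm.
exact: (per_n eps0 eps1 hq C00 c10 C10 c20 rho0 hSN n0 p0 s0 a0 a1 hE hA hB g1 g2 g3 g4 g5 erefl T1 eta0 eta1 eta2 eta3 T2 T3 T4 T5 T6 T7 T8 nontriv).
Unshelve. all: by end_near. Qed.
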